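(* Let $T$ be an $\omega$-Calderón–Zygmund operator on $\mathbb{R}^n$ with $\omega$ satisfying the Dini condition, let $p(\cdot)\in\mathcal{P}(\mathbb{R}^n)$ and let $m$ be a nonnegative integer. Let $0<\alpha<n$ and let $r(\cdot)\in\mathcal{P}^{\log}(\mathbb{R}^n)$ be such that $n/\alpha<r^-$ and $r_\infty\le r(\cdot)$. Let $\delta(\cdot)$ be defined by $\frac{\delta(\cdot)}{n}=\frac{\alpha}{n}-\frac1{r(\cdot)}$ and let $b\in\mathbb{L}(\delta(\cdot))$. Assume that $(\mathsf{A},\mathsf{B},\mathsf{D})$ and $(\mathsf{E},\mathsf{H},\mathsf{J})$ are 3-tuples of generalized $\Phi$-functions satisfying condition $\mathcal{F}$, that the maximal operator $M_{\mathsf{B}(\cdot,L)}$ is bounded from $L^{p(\cdot)}(\mathbb{R}^n)$ to $L^{p(\cdot)}(\mathbb{R}^n)$, and that the maximal operator $M_{\mathsf{H}(\cdot,L)}$ is bounded from $L^{p'(\cdot)}(\mathbb{R}^n)$ to $L^{p'(\cdot)}(\mathbb{R}^n)$. Suppose that $(v,w)$ is any couple of weights such that $v\in L^{p(\cdot)}_{\rm loc}(\mathbb{R}^n)$ and $$\sup_Q\ \|\chi_Q\|_{n/\delta(\cdot)}^m\,\frac{\|\chi_Q w\|_{\mathsf{E}(\cdot,L)}}{\|\chi_Q\|_{\mathsf{E}(\cdot,L)}}\,\frac{\|\chi_Q v^{-1}\|_{\mathsf{A}(\cdot,L)}}{\|\chi_Q\|_{\mathsf{A}(\cdot,L)}}<\infty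 ,$$ where the supremum is taken over all cubes $Q\subset\mathbb{R}^n$. Then the commutator of order $m$, $T_b^m$, is bounded from $L^{p(\cdot)}_v(\mathbb{R}^n)$ to $L^{p(\cdot)}_w(\mathbb{R}^n)$; that is, there is a constant $C>0$ such that $\|(T_b^mf)w\|_{p(\cdot)}\le C\|fv\|_{p(\cdot)}$ for every $f\in L^{p(\cdot)}_v(\mathbb{R}^n)$.
   Context: Cubes in $\mathbb{R}^n$ have sides parallel to the coordinate axes; $\chi_Q$ is the characteristic function of $Q$ and $f_Q=\frac1{|Q|}\int_Q f$. A weight is a locally integrable function on $\mathbb{R}^n$ that is positive almost everywhere. $A\lesssim B$ means $A\le CB$ for a constant $C>0$ independent of the relevant variables (cube $Q$, point $x$, number $t$). Variable exponents. $\mathcal{P}(\mathbb{R}^n)$ is the set of measurable $p(\cdot):\mathbb{R}^n\to[1,\infty]$; $p^-$ and $p^+$ denote the essential infimum and supremum; $p'(\cdot)$ is the conjugate exponent, $1/p(x)+1/p'(x)=1$. $\mathcal{P}^{\log}(\mathbb{R}^n)$ is the set of $p(\cdot)\in\mathcal{P}(\mathbb{R}^n)$ for which there are positive constants $C,p_\infty$ with $|1/p(x)-1/p(y)|\le C/\log(e+1/|x-y|)$ and $|1/p(x)-1/p_\infty|\le C/\log(e+|x|)$ for all $x,y\in\mathbb{R}^n$ (so $r_\infty$ is this constant for the exponent $r(\cdot)$). The norm is $\|f\|_{p(\cdot)}=\inf\{\lambda>0:\int_{\mathbb{R}^n}\varphi_{p(\cdot)}(x,|f(x)|/\lambda)\,dx\le1\}$,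 where $\varphi_{p(\cdot)}(x,t)=t^{p(x)}$ if $p(x)<\infty$ and $\varphi_{p(\cdot)}(x,t)=\infty\cdot\chi_{(1,\infty)}(t)$ if $p(x)=\infty$ (with $\infty\cdot 0=0$); $L^{p(\cdot)}(\mathbb{R}^n)$ is the space of measurable $f$ with $\|f\|_{p(\cdot)}<\infty$, $L^{p(\cdot)}_{\rm loc}(\mathbb{R}^n)$ is the space of $f$ belonging to $L^{p(\cdot)}(U)$ for every compact $U\subset\mathbb{R}^n$, and $L^{p(\cdot)}_w(\mathbb{R}^n)=\{f: fw\in L^{p(\cdot)}(\mathbb{R}^n)\}$ with norm $\|fw\|_{p(\cdot)}$. Operators. Let $\omega:[0,1]\to[0,\infty)$ be continuous, increasing and subadditive with $\omega(0)=0$. A linear operator $T$ is an $\omega$-Calderón–Zygmund operator if it is bounded on $L^2(\mathbb{R}^n)$ and can be represented as $Tf(x)=\int_{\mathbb{R}^n}K(x,y)f(y)\,dy$ for $x\notin\operatorname{supp}f$, where $|K(x,y)|\le C_K|x-y|^{-n}$ for $x\ne y$ and $|K(x,y)-K(x',y)|+|K(y,x)-K(y,x')|\le\omega\left(\frac{|x-x'|}{|x-y|}\right)\frac1{|x-y|^n}$ whenever $|x-y|>2|x-x'|$. The Dini condition is $\int_0^1\omega(t)\frac{dt}{t}<\infty$. For $b\in L^1_{\rm loc}(\mathbb{R}^n)$ the commutator is formally defined by $[b,T]f(x)=b(x)\,Tf(x)-T(bf)(x)$, and $T_b^0=T$, $T_b^m=[b,T_b^{m-1}]$. Symbols. $\mathbb{L}(\delta(\cdot))$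 is the set of $b\in L^1_{\rm loc}(\mathbb{R}^n)$ such that $\sup_Q\frac{1}{\|\chi_Q\|_{n/\delta(\cdot)}|Q|}\int_Q|b(x)-b_Q|\,dx<\infty$. Generalized $\Phi$-functions. A $\Phi$-function is a convex $\psi:[0,\infty)\to[0,\infty)$ with $\psi(0)=0$, $\lim_{t\to0^+}\psi(t)=0$ and $\lim_{t\to\infty}\psi(t)=\infty$. A generalized $\Phi$-function is a function $\Psi:\mathbb{R}^n\times[0,\infty)\to[0,\infty)$ such that $\Psi(\cdot,t)$ is Lebesgue measurable for every $t\ge0$ and $\Psi(x,\cdot)$ is a $\Phi$-function for every $x$. Its norm is $\|f\|_{\Psi(\cdot,L)}=\inf\{\lambda>0:\int_{\mathbb{R}^n}\Psi(x,|f(x)|/\lambda)\,dx\le1\}$, its conjugate is $\Psi^*(x,u)=\sup_{t\ge0}(tu-\Psi(x,t))$, and its generalized inverse is $\Psi^{-1}(x,t)=\inf\{u\ge0:\Psi(x,u)\ge t\}$. The associated maximal operator is $M_{\Psi(\cdot,L)}f(x)=\sup_{Q\ni x}\|\chi_Qf\|_{\Psi(\cdot,L)}/\|\chi_Q\|_{\Psi(\cdot,L)}$. Condition $\mathcal{F}$. A 3-tuple $(\mathsf{A},\mathsf{B},\mathsf{D})$ of generalized $\Phi$-functions satisfies condition $\mathcal{F}$ if: (1) $\|\chi_Q\|_{\mathsf{A}(\cdot,L)}\|\chi_Q\|_{\mathsf{B}(\cdot,L)}\lesssim\|\chi_Q\|_{\mathsf{D}(\cdot,L)}$ for all cubes $Q$;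 (2) $\mathsf{A}^{-1}(x,t)\mathsf{B}^{-1}(x,t)\lesssim\mathsf{D}^{-1}(x,t)$ for all $x\in\mathbb{R}^n$, $t\ge0$; (3) $\|\chi_Q\|_{\mathsf{D}(\cdot,L)}\|\chi_Q\|_{\mathsf{D}^*(\cdot,L)}\lesssim|Q|$ for all cubes $Q$. *)

(* Defs.v *)
From HB Require Import structures.
From mathcomp Require Import all_boot all_order all_algebra.
From mathcomp Require Import all_classical all_reals all_analysis.
From mathcomp Require Import measurable_realfun ess_sup_inf.

Set Implicit Arguments.
Unset Strict Implicit.
Unset Printing Implicit Defensive.

Import Order.TTheory GRing.Theory Num.Theory.
Import numFieldNormedType.Exports.

Local Open Scope classical_set_scope.
Local Open Scope ring_scope.

(* Lebesgue measure on R^n: the library only provides it for n = 1.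
   The outer measure is the infimum of the total volumes of the countable
   families of boxes that cover a set, and the measurable sets are the
   Caratheodory-measurable ones, i.e. the (completed) Lebesgue sigma-algebra. *)
Section lebesgue_outer_measure.
Context (R : realType) (n : nat).
Implicit Types (A : set 'rV[R]_n) (D : set ('rV[R]_n * 'rV[R]_n)).

Definition box (ab : 'rV[R]_n * 'rV[R]_n) : set 'rV[R]_n :=
  [set x | forall i, ab.1 ord0 i <= x ord0 i <= ab.2 ord0 i].

Definition box_volume (ab : 'rV[R]_n * 'rV[R]_n) : R :=
  \prod_(i < n) Num.max 0 (ab.2 ord0 i - ab.1 ord0 i).

Definition box_cover A : set (set ('rV[R]_n * 'rV[R]_n)) :=
  [set D | countable D /\ A `<=` \bigcup_(ab in D) box ab].

Definition lebesgue_outer A : \bar R :=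
  ereal_inf [set (\esum_(ab in D) (box_volume ab)%:E)%E | D in box_cover A].

Local Open Scope ereal_scope.

Let volume_ge0 ab : 0 <= (box_volume ab)%:E.
Proof.
by rewrite lee_fin; apply: prodr_ge0 => i _; rewrite le_max lexx.
Qed.

Let lebesgue_outer_ge0 A : 0 <= lebesgue_outer A.
Proof.
apply: le_ereal_inf_tmp => _ [D _ <-]; apply: esum_ge0 => ab _.
exact: volume_ge0.
Qed.

Let lebesgue_outer0 : lebesgue_outer set0 = 0.
Proof.
apply/eqP; rewrite eq_le lebesgue_outer_ge0 andbT.
apply: ereal_inf_lbound; exists set0; last by rewrite esum_set0.
by split => //; exact: countable0.
Qed.

Let le_lebesgue_outer : {homo lebesgue_outer : A B / A `<=` B >-> A <= B}.
Proof.
move=> A B AB; apply/ereal_inf_le_tmp => _ [D [cD BD] <-].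
by exists D => //; split => //; exact: subset_trans AB BD.
Qed.

Let lebesgue_outer_sigma_subadditive : sigma_subadditive lebesgue_outer.
Proof.
move=> A; have [[i Aioo]|] := pselect (exists i, lebesgue_outer (A i) = +oo).
  by rewrite (eseries_pinfty _ _ Aioo) ?leey// => k _; rewrite -ltNye
    (lt_le_trans _ (lebesgue_outer_ge0 _)).
rewrite -forallNE => Aoo; apply/lee_addgt0Pr => e e0.
apply: le_trans (epsilon_trick _ _ (ltW e0)) => //.
have /choice[G PG] : forall k, exists D, box_cover (A k) D /\
    \esum_(ab in D) (box_volume ab)%:E <=
      lebesgue_outer (A k) + (e / (2 ^ k.+1)%:R)%:E.
  move=> k; have Afin : lebesgue_outer (A k) \is a fin_num.
    by rewrite ge0_fin_numE// lt_neqAle leey andbT; exact/eqP.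
  have ek : (0 < e / (2 ^ k.+1)%:R)%R by rewrite divr_gt0// ltr0n expn_gt0.
  have [_ [D AD <-] /ltW lD] := lb_ereal_inf_adherent ek Afin.
  by exists D.
apply: (@le_trans _ _ (\esum_(ab in \bigcup_k G k) (box_volume ab)%:E)).
  apply: ereal_inf_lbound; exists (\bigcup_k G k) => //; split.
    by apply: bigcup_countable => // k _; exact: (PG k).1.1.
  move=> x [k _ Akx]; have [ab Gab xab] := (PG k).1.2 x Akx.
  by exists ab => //; exists k.
rewrite seqDU_bigcup_eq (nneseries_sum_bigcup (@trivIset_seqDU _ G))//.
apply: lee_nneseries => [k _ _|k _]; first exact: esum_ge0.
apply: le_trans (PG k).2; rewrite esum_mkcond [leRHS]esum_mkcond.
apply: le_esum => ab _; case: ifPn => [|_]; last by case: ifPn.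
by rewrite inE => /(@subset_seqDU _ G k) Gab; rewrite mem_set.
Qed.

HB.instance Definition _ := isOuterMeasure.Build R 'rV[R]_n lebesgue_outer
  lebesgue_outer0 lebesgue_outer_ge0 le_lebesgue_outer
  lebesgue_outer_sigma_subadditive.

End lebesgue_outer_measure.

Definition lebesgue_outer_measure (R : realType) (n : nat) :
  {outer_measure set 'rV[R]_n -> \bar R} := @lebesgue_outer R n.

(* Row vectors, with their topology and with the Lebesgue sigma-algebra. *)
Definition Rn (R : realType) (n : nat) : Type := 'rV[R]_n.

HB.instance Definition _ (R : realType) (n : nat) :=
  NormedModule.copy (Rn R n) 'rV[R]_n.
HB.instance Definition _ (R : realType) (n : nat) :=
  Measurable.copy (Rn R n) (caratheodory_type (lebesgue_outer_measure R n)).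

Definition lebesgue_Rn (R : realType) (n : nat) : set (Rn R n) -> \bar R :=
  lebesgue_outer_measure R n.

HB.instance Definition _ (R : realType) (n : nat) :=
  Measure.copy (@lebesgue_Rn R n)
    (lebesgue_outer_measure R n :
      set (caratheodory_type (lebesgue_outer_measure R n)) -> \bar R).

Section euclidean_space.
Context {R : realType} {n : nat}.
Local Notation Rn := (Rn R n).
Local Notation leb := (@lebesgue_Rn R n).
Implicit Types (f g b v w : Rn -> R) (p r : Rn -> \bar R) (Q : set Rn).

(* The library's norm on row vectors is the maximum norm; the norm below is
   the Euclidean one. *)
Definition enorm (x : Rn) : R := Num.sqrt (\sum_(i < n) (x ord0 i) ^+ 2).

Definition cube (a : Rn) (l : R) : set Rn :=
  [set x | forall i, a ord0 i <= x ord0 i <= a ord0 i + l].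

Definition cubes : set (set Rn) :=
  [set Q | exists a l, 0 < l /\ Q = cube a l].

Definition average f Q : R := (fine (leb Q))^-1 * \int[leb]_(x in Q) f x.

Definition locally_integrable_Rn f : Prop :=
  forall K : set Rn, compact K -> leb.-integrable K (EFin \o f).

Definition weight w : Prop :=
  locally_integrable_Rn w /\ \forall x \ae leb, 0 < w x.

(* Phi : R^n x [0,oo] -> [0,oo]; functions are allowed to be infinite because
   maximal operators are. *)
Definition luxemburg (Phi : Rn -> \bar R -> \bar R) (f : Rn -> \bar R)
  : \bar R :=
  ereal_inf [set l%:E | l in [set l : R |
    0 < l /\ (\int[leb]_x Phi x (`|f x| * l^-1%:E) <= 1)%E]].

Definition exponent p : Prop :=
  measurable_fun setT p /\ forall x, (1 <= p x)%E.

Definition log_exponent p (pinf : R) : Prop :=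
  [/\ exponent p, 0 < pinf & exists2 C : R, 0 < C &
    (forall x y, `|fine (p x)^-1%E - fine (p y)^-1%E|
                   <= C / ln (expR 1 + (enorm (x - y))^-1)) /\
    (forall x, `|fine (p x)^-1%E - pinf^-1| <= C / ln (expR 1 + enorm x))].

Definition phi_exponent (q t : \bar R) : \bar R :=
  match q with
  | r%:E => poweR t r
  | +oo%E => if (1 < t)%E then +oo%E else 0%E
  | -oo%E => 0%E
  end.

Definition pnorm p (f : Rn -> \bar R) : \bar R :=
  luxemburg (fun x => phi_exponent (p x)) f.

Definition Lp p : set (Rn -> \bar R) :=
  [set f | measurable_fun setT f /\ (pnorm p f < +oo)%E].

Definition Lp_weighted p w : set (Rn -> R) :=
  [set f | Lp p (EFin \o (f \* w))].

Definition Lp_loc p : set (Rn -> R) :=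
  [set f | forall U : set Rn, compact U -> Lp p (EFin \o (f \* \1_U))].

Definition L2 : set (Rn -> R) :=
  [set f | measurable_fun setT f /\ finite_norm leb 2%:E f].

Definition modulus_of_continuity (omega : R -> R) : Prop :=
  [/\ {within `[0, 1], continuous omega},
      {in `[0, 1], forall t, 0 <= omega t},
      {in `[0, 1] &, {homo omega : s t / s <= t}},
      (forall s t, 0 <= s -> 0 <= t -> s + t <= 1 ->
         omega (s + t) <= omega s + omega t)
    & omega 0 = 0].

Definition dini (omega : R -> R) : Prop :=
  (\int[lebesgue_measure]_(t in `]0%R, 1%R]) (omega t / t)%:E < +oo)%E.

Definition CZ_kernel (omega : R -> R) (K : Rn -> Rn -> R) : Prop :=
  (exists2 CK : R, 0 < CK &
     forall x y, x != y -> `|K x y| <= CK * enorm (x - y) ^- n) /\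
  (forall x x' y, 2 * enorm (x - x') < enorm (x - y) ->
     `|K x y - K x' y| + `|K y x - K y x'|
       <= omega (enorm (x - x') / enorm (x - y)) * enorm (x - y) ^- n).

(* T is an operator on L^2, whose elements are functions up to equality almost
   everywhere; its values outside L^2 are irrelevant. *)
Definition CZ_operator (omega : R -> R) (T : (Rn -> R) -> Rn -> R) : Prop :=
  [/\ forall (a : R) f g, L2 f -> L2 g ->
        T (fun x => a * f x + g x) = (fun x => a * T f x + T g x) %[ae leb],
      exists2 C : R, 0 < C & forall f, L2 f -> L2 (T f) /\
        ('N[leb]_2%:E[EFin \o T f] <= C%:E * 'N[leb]_2%:E[EFin \o f])%E
    & exists2 K, CZ_kernel omega K & forall f, L2 f ->
        \forall x \ae leb, ~ closure [set y | f y != 0] x ->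
          T f x = \int[leb]_y (K x y * f y)].

Definition commutator b (T : (Rn -> R) -> Rn -> R) : (Rn -> R) -> Rn -> R :=
  fun f x => b x * T f x - T (b \* f) x.

Definition iter_commutator (m : nat) b (T : (Rn -> R) -> Rn -> R)
  : (Rn -> R) -> Rn -> R := iter m (commutator b) T.

(* The recursion defining the m-th commutator of an operator on L^2 applies T
   to the functions b^k f, k <= m, and to no others. *)
Definition commutator_domain (m : nat) b : set (Rn -> R) :=
  [set f | forall k, (k <= m)%N -> L2 (fun x => b x ^+ k * f x)].

(* q is the variable exponent n / delta of the symbol class. *)
Definition symbol_class (q : Rn -> \bar R) : set (Rn -> R) :=
  [set b | locally_integrable_Rn b /\
    (ereal_sup [set (pnorm q (EFin \o \1_Q) * leb Q)^-1 *
       \int[leb]_(x in Q) `|b x - average b Q|%:E | Q in cubes] < +oo)%E].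

Definition Phi_function (psi : R -> R) : Prop :=
  [/\ forall t, 0 <= t -> 0 <= psi t,
      convex_function (`[0, +oo[%classic : set R) psi,
      psi 0 = 0,
      psi t @[t --> 0^'+] --> 0
    & psi t @[t --> +oo] --> +oo].

(* Only the values Psi x t with 0 <= t are relevant. *)
Definition generalized_Phi (Psi : Rn -> R -> R) : Prop :=
  (forall t, 0 <= t -> measurable_fun setT (Psi ^~ t)) /\
  (forall x, Phi_function (Psi x)).

Definition Phi_norm (Psi : Rn -> R -> R) f : \bar R :=
  luxemburg (fun x => er_map (Psi x)) (EFin \o f).

(* The conjugate can take the value +oo even though Psi is finite. *)
Definition Phi_conjugate (Psi : Rn -> R -> R) (x : Rn) (u : \bar R) : \bar R :=
  ereal_sup [set t%:E * u - (Psi x t)%:E | t in [set t : R | (0 <= t)%R]]%E.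

Definition Phi_inverse (Psi : Rn -> R -> R) (x : Rn) (t : R) : R :=
  inf [set u | 0 <= u /\ t <= Psi x u].

Definition Phi_maximal (Psi : Rn -> R -> R) f (x : Rn) : \bar R :=
  ereal_sup [set Phi_norm Psi (\1_Q \* f)%R / Phi_norm Psi \1_Q
            | Q in [set Q | cubes Q /\ Q x]]%E.

Definition Phi_maximal_bounded (Psi : Rn -> R -> R) p : Prop :=
  exists2 C : R, 0 < C & forall f, Lp p (EFin \o f) ->
    Lp p (Phi_maximal Psi f) /\
    (pnorm p (Phi_maximal Psi f) <= C%:E * pnorm p (EFin \o f))%E.

Definition condition_F (A B D : Rn -> R -> R) : Prop :=
  [/\ exists2 C : R, 0 < C & forall Q, cubes Q ->
        (Phi_norm A \1_Q * Phi_norm B \1_Q <= C%:E * Phi_norm D \1_Q)%E,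
      exists2 C : R, 0 < C & forall x t, 0 <= t ->
        Phi_inverse A x t * Phi_inverse B x t <= C * Phi_inverse D x t
    & exists2 C : R, 0 < C & forall Q, cubes Q ->
        (Phi_norm D \1_Q * luxemburg (Phi_conjugate D) (EFin \o \1_Q)
           <= C%:E * leb Q)%E].

(* U, given on a set of functions dom, is bounded from L^p_v to L^p_w: dom is
   dense in L^p_v, and U extends to a linear operator on L^p_v that satisfies
   the norm inequality. By density S f is the value of U at f, up to equality
   almost everywhere, for every f in L^p_v. *)
Definition bounded_weighted p v w (dom : set (Rn -> R))
    (U : (Rn -> R) -> Rn -> R) : Prop :=
  (forall f, Lp_weighted p v f -> exists u : nat -> Rn -> R,
     (forall k, dom (u k) /\ Lp_weighted p v (u k)) /\
     (pnorm p (EFin \o ((u k \- f) \* v)%R) @[k --> \oo] --> 0%E)) /\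
  exists2 S : (Rn -> R) -> Rn -> R,
    (forall (a : R) f g, Lp_weighted p v f -> Lp_weighted p v g ->
       S (fun x => a * f x + g x) = (fun x => a * S f x + S g x) %[ae leb]) /\
    (forall f, dom f -> Lp_weighted p v f -> S f = U f %[ae leb]) &
    exists2 C : R, 0 < C & forall f, Lp_weighted p v f ->
      Lp_weighted p w (S f) /\
      (pnorm p (EFin \o (S f \* w)%R) <= C%:E * pnorm p (EFin \o (f \* v)%R))%E.

End euclidean_space.

(* Main.v *)
(* The local forms I(Q) = int_Q |T_b^m (f 1_(dil Q))| G, with dil Q a dilate of Q, satisfy

     I(Q) <= C phi(dil Q)^m <|f|>_(dil Q) int_Q G + sum_j I(P_j),

   where phi(Q) is the norm of the indicator of Q in L^(n/delta), <.> denotes averages, and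
   the P_j are disjoint dyadic subcubes that cover at most half of Q: b differs from its
   average over Q by at most C phi(Q) almost everywhere on Q, because the averages of b
   telescope and phi decays geometrically along shrinking cubes; the weak (1,1) inequality
   bounds T off the P_j, and the Dini condition bounds the oscillation of the far part of T
   on each P_j. Iteration bounds int |T_b^m f| G by the integral of any function that on
   every Q exceeds phi(dil Q)^m <|f|>_(dil Q) <G>_Q. For G = g w, the condition on (v, w)
   and the Hoelder inequality that condition F provides make M_B (f v) M_H g such a
   function, and its integral is at most C ||f v||_p ||g||_p'.

   The boundedness of M_H on L^p' forces p to be essentially bounded. Hence truncations
   are dense in L^p_v, norms in L^p can be computed by duality with explicit functions, and
   the bound, proved for bounded f supported where b is bounded, extends to L^p_v by almost
   everywhere convergence along fast approximations. *)
Require Import Defs.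
From mathcomp Require Import all_boot all_order all_algebra.
From mathcomp Require Import all_classical all_reals all_analysis.
From mathcomp Require Import measurable_realfun ess_sup_inf.
From mathcomp Require Import ring lra zify.
Set Implicit Arguments.
Unset Strict Implicit.
Unset Printing Implicit Defensive.
Import Order.TTheory GRing.Theory Num.Theory.
Import numFieldNormedType.Exports.
Local Open Scope classical_set_scope.
Local Open Scope ring_scope.

(** * Lebesgue measure and cubes *)

(** Around a constant beta, T_b^m u is a combination of the products (b - beta)^(m-k) T((b - beta)^k
    u). The bound |b - beta| <= psi, almost everywhere on a dilated cube, turns each of them into
    psi^m times a quantity that involves T alone, so the order m costs only a constant. This
    requires a pointwise bound where the hypothesis bounds mean oscillations, and the passage rests
    on the decay of phi. Put s = delta / n. From n / alpha < r^- and r_inf <= r, the limit si of s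
    at infinity is positive and bounds s from below; with log-Hoelder continuity, phi decreases like
    a power of the side, on small and on large scales. The forms contain absolute values and G >= 0,
    so that they add up over disjoint subcubes. The exponent p is bounded because the Hoelder
    inequality with the constant function 1 makes M_H dominate ordinary averages, and such an
    operator cannot be bounded on a space whose exponent p' comes arbitrarily close to 1 on sets of
    positive measure. *)

Section LebesgueRn.
Context {R : realType}.

Lemma nneseries_ge_term (f : nat -> \bar R) k :
  (forall i, 0 <= f i)%E -> (f k <= \sum_(0 <= i <oo) f i)%E.
Proof.
move=> f0; rewrite (nneseriesD1 (n := k))// leeDl//.
by apply: nneseries_ge0 => i _ _.
Qed.

Lemma integral_indic_setT (B : set R) (l : R) : measurable B ->
  lebesgue_measure B = l%:E ->
  (\int[lebesgue_measure]_t (\1_B t)%:E)%E = l%:E.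
Proof. by move=> mB <-; rewrite integral_indic// setIT. Qed.

(* Integrating out one coordinate at a time replaces the product measure, which is
   not available: it yields the lower bound for the outer measure of a box. *)
Lemma prod_volume_le_series (n : nat) (B : nat -> set R) (l : nat -> R)
    (F : nat -> nat -> set R) (d : nat -> nat -> R) (c : nat -> \bar R) :
  (forall i, measurable (B i) /\ lebesgue_measure (B i) = (l i)%:E) ->
  (forall k i, measurable (F k i) /\ lebesgue_measure (F k i) = (d k i)%:E) ->
  (forall k, 0 <= c k)%E ->
  (forall x : nat -> R, (\prod_(i < n) \1_(B i) (x i))%:E <=
     \sum_(0 <= k <oo) (c k * (\prod_(i < n) \1_(F k i) (x i))%:E))%E ->
  ((\prod_(i < n) l i)%:E <=
     \sum_(0 <= k <oo) (c k * (\prod_(i < n) d k i)%:E))%E.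
Proof.
move=> hB hF; elim: n c => [|n IH] c c0 H.
  have := H (fun=> 0); rewrite !big_ord0 => /le_trans; apply.
  by apply: lee_nneseries => k _; rewrite !big_ord0// mule1.
have l0 i : 0 <= l i by rewrite -lee_fin -(hB i).2 measure_ge0.
have d0 k i : 0 <= d k i by rewrite -lee_fin -(hF k i).2 measure_ge0.
have pd0 k : (0 <= (\prod_(i < n) d k i)%:E)%E.
  by rewrite lee_fin prodr_ge0.
have key (t : R) : ((\prod_(i < n) l i)%:E * (\1_(B n) t)%:E <=
   \sum_(0 <= k <oo) (c k * (\prod_(i < n) d k i)%:E * (\1_(F k n) t)%:E))%E.
  have [tB|tB] := boolP (t \in B n); last first.
    rewrite indicE (negbTE tB) mule0; apply: nneseries_ge0 => k _ _.
    by rewrite !mule_ge0// lee_fin indicE.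
  rewrite indicE tB mule1.
  (* The weights [c] are arbitrary so that the indicators of the last coordinate, frozen at [t], can
     be absorbed into them. *)
  apply: le_trans (IH (fun k => c k * (\1_(F k n) t)%:E)%E _ _) _.
  - by move=> k; rewrite mule_ge0// lee_fin indicE.
  - move=> x; have := H (fun i => if (i == n)%N then t else x i).
    rewrite big_ord_recr/= eqxx indicE tB mulr1.
    rewrite (eq_bigr (fun i : 'I_n => \1_(B i) (x i))); last first.
      by move=> i _; rewrite ltn_eqF.
    move/le_trans; apply; apply: lee_nneseries => k _.
      by rewrite mule_ge0// lee_fin prodr_ge0// => i _; rewrite indicE.
    rewrite big_ord_recr/= eqxx (eq_bigr (fun i : 'I_n => \1_(F k i) (x i))).
      by rewrite mulrC EFinM muleA.
    by move=> i _; rewrite ltn_eqF.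
  - apply: lee_nneseries => k _; first by rewrite !mule_ge0// lee_fin indicE.
    by rewrite muleAC.
have mk k : measurable_fun setT (fun t : R =>
    (c k * (\prod_(i < n) d k i)%:E * (\1_(F k n) t)%:E)%E).
  apply: measurable_funeM; apply/measurable_EFinP.
  by apply: measurable_indic; exact: (hF k n).1.
have k0 k (t : R) :
    (0 <= c k * (\prod_(i < n) d k i)%:E * (\1_(F k n) t)%:E)%E.
  by rewrite !mule_ge0// lee_fin indicE.
have := @ge0_le_integral _ _ _ (@lebesgue_measure R) setT measurableT
  (fun t => ((\prod_(i < n) l i)%:E * (\1_(B n) t)%:E)%E)
  (fun t => \sum_(0 <= k <oo)
     (c k * (\prod_(i < n) d k i)%:E * (\1_(F k n) t)%:E))%E.
have mB : measurable_fun setT (fun t : R => (\1_(B n) t : R)%:E).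
  by apply/measurable_EFinP; apply: measurable_indic; exact: (hB n).1.
rewrite ge0_integralZl; [|exact: measurableT|exact: mB
  |by move=> t _; rewrite lee_fin indicE|by rewrite lee_fin prodr_ge0].
rewrite (integral_indic_setT (hB n).1 (hB n).2) integral_nneseries; [|exact: measurableT|exact: mk
  |by move=> k t _; exact: k0].
rewrite big_ord_recr/= EFinM => le; apply: le_trans (le _ _ _ _) _.
- by move=> t _; rewrite mule_ge0// lee_fin ?prodr_ge0// indicE.
- exact: measurable_funeM.
- by apply: ge0_emeasurable_sum => [k t _ _|k _]; [exact: k0|exact: mk].
- by move=> t _; exact: key.
apply: lee_nneseries => [k _ _|k _].
  by apply: integral_ge0 => t _; exact: k0.
rewrite ge0_integralZl; [|exact: measurableT
  |by apply/measurable_EFinP; apply: measurable_indic; exact: (hF k n).1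
  |by move=> t _; rewrite lee_fin indicE|by rewrite mule_ge0].
rewrite (integral_indic_setT (hF k n).1 (hF k n).2).
by rewrite -muleA big_ord_recr/= EFinM.
Qed.

Context {n : nat}.
Local Notation V := 'rV[R]_n.+1.

Lemma box_volume_ge0 m (ab : 'rV[R]_m * 'rV[R]_m) : (0 <= (box_volume ab)%:E)%E.
Proof. by rewrite lee_fin; apply: prodr_ge0 => i _; rewrite le_max lexx. Qed.

Lemma lebesgue_outer_box (ab : V * V) :
  (lebesgue_outer (box ab) <= (box_volume ab)%:E)%E.
Proof.
apply: ereal_inf_lbound; exists [set ab].
  by split; [exact: countable1|move=> x; exists ab].
by rewrite esum_set1// box_volume_ge0.
Qed.

Lemma lebesgue_outer_le_series (A : set V) (F : nat -> V * V) :
  A `<=` \bigcup_k box (F k) ->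
  (lebesgue_outer A <= \sum_(0 <= k <oo) (box_volume (F k))%:E)%E.
Proof.
move=> AF; have := @le_outer_measure _ _ (lebesgue_outer_measure R n.+1) _ _ AF.
move=> /le_trans; apply.
apply: le_trans (outer_measure_sigma_subadditive (lebesgue_outer_measure R n.+1) _) _.
by apply: lee_nneseries => k _ //; exact: lebesgue_outer_box.
Qed.

Lemma box_cover_seq (A : set V) D : box_cover A D -> exists F : nat -> V * V,
  A `<=` \bigcup_k box (F k) /\
  (\sum_(0 <= k <oo) (box_volume (F k))%:E <=
     \esum_(ab in D) (box_volume ab)%:E)%E.
Proof.
case=> /countable_injP[f fi] AD.
pose F k := xget (0, 0) [set ab | D ab /\ f ab = k].
have Ff ab : D ab -> F (f ab) = ab.
  move=> Dab; rewrite /F; case: xgetP => [_ -> [Dx fx]|/(_ ab)]; last by case.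
  by apply: fi => //; rewrite inE.
exists F; split.
  by move=> x /AD[ab Dab xab]; exists (f ab) => //; rewrite Ff.
pose G k := [set ab | D ab /\ f ab = k].
have -> : D = \bigcup_k G k.
  by apply/seteqP; split=> [ab Dab|ab [k _ []//]]; exists (f ab).
rewrite nneseries_sum_bigcup; last 2 first.
- by apply/trivIsetP => i j _ _ /eqP ij; apply/seteqP; split=> // ab/=
    [[_ fabi] [_ fabj]]; apply: ij; rewrite -fabi -fabj.
- by move=> ab; exact: box_volume_ge0.
apply: lee_nneseries => [k _ _|k _]; first exact: box_volume_ge0.
have [[ab [Dab fab]]|nG] := pselect (G k !=set0).
  have -> : G k = [set ab].
    apply/seteqP; split=> [cd [Dcd fcd]|cd ->]//=.
    by apply: fi; rewrite ?inE//; congruence.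
  by rewrite esum_set1 ?box_volume_ge0// -fab Ff.
(* Indices without a box carry a degenerate one, of volume 0 because there is at least one
   coordinate. *)
have -> : F k = (0, 0) by rewrite /F; case: xgetP => // x _ Gx; case: nG; exists x.
rewrite /box_volume big_ord_recl/= !mxE subrr maxxx mul0r.
by apply: esum_ge0 => ab _; exact: box_volume_ge0.
Qed.

(** When the hyperplane misses the box, one of the halves is a reversed box, whose volume is 0 by
    the [Num.max] in [box_volume]; additivity thus holds for every [c]. *)
Lemma box_split (ab : V * V) (i : 'I_n.+1) (c : R) :
  let l := (ab.1, \row_j if j == i then Num.min (ab.2 ord0 j) c else ab.2 ord0 j) in
  let r := (\row_j if j == i then Num.max (ab.1 ord0 j) c else ab.1 ord0 j, ab.2) in
  [/\ box ab `&` [set x | x ord0 i <= c] `<=` box l,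
      box ab `&` ~` [set x | x ord0 i <= c] `<=` box r &
      box_volume l + box_volume r = box_volume ab].
Proof.
move=> l r; split.
- move=> x [xab /= xc] j; rewrite !mxE; have /andP[-> ] := xab j.
  by case: eqP => [->|//]; rewrite le_min xc => ->.
- move=> x [xab /= /negP xc] j; rewrite !mxE; have /andP[+ ->] := xab j.
  rewrite andbT; case: eqP => [->|//]; rewrite ge_max => ->/=.
  by rewrite ltW// ltNge.
- rewrite /box_volume (bigD1 i)//= [in X in _ + X](bigD1 i)//= [RHS](bigD1 i)//=.
  rewrite !mxE eqxx.
  rewrite (eq_bigr (fun j => Num.max 0 (ab.2 ord0 j - ab.1 ord0 j))); last first.
    by move=> j /negbTE ji; rewrite mxE ji.
  rewrite [in X in _ + X](eq_bigr (fun j => Num.max 0 (ab.2 ord0 j - ab.1 ord0 j))).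
    rewrite -mulrDl; congr (_ * _).
    set a := ab.1 _ _; set b := ab.2 _ _; rewrite /Num.max /Num.min.
    by repeat case: ifPn; rewrite -?leNgt; lra.
  by move=> j /negbTE ji; rewrite mxE ji.
Qed.

(** Every box of a cover is cut by the hyperplane without loss of volume. All later measurability of
    coordinates, boxes and cubes comes from this. *)
Lemma caratheodory_halfspace (i : 'I_n.+1) (c : R) :
  (lebesgue_outer_measure R n.+1).-caratheodory [set x : V | x ord0 i <= c].
Proof.
apply: le_caratheodory_measurable => X.
apply: le_ereal_inf_tmp => _ [D XD <-].
have [F [XF]] := box_cover_seq XD; apply: le_trans.
pose Fl k := ((F k).1, \row_j if j == i then Num.min ((F k).2 ord0 j) c
   else (F k).2 ord0 j) : V * V.
pose Fr k := (\row_j if j == i then Num.max ((F k).1 ord0 j) c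
   else (F k).1 ord0 j, (F k).2) : V * V.
rewrite (eq_eseriesr (g := fun k => (box_volume (Fl k))%:E + (box_volume (Fr k))%:E)%E);
  last by move=> k _; have [_ _ <-] := box_split (F k) i c.
rewrite nneseriesD; last 2 first.
- by move=> k _ _; exact: box_volume_ge0.
- by move=> k _ _; exact: box_volume_ge0.
apply: leeD; apply: lebesgue_outer_le_series => x [/XF[k _ xk] xc]; exists k => //.
- by have [+ _ _] := box_split (F k) i c; apply.
- by have [_ + _] := box_split (F k) i c; apply.
Qed.

Local Notation Rn := (Rn R n.+1).
Local Notation leb := (@lebesgue_Rn R n.+1).

Lemma measurable_halfspace (i : 'I_n.+1) (c : R) :
  measurable [set x : Rn | x ord0 i <= c].
Proof. exact: caratheodory_halfspace. Qed.

Lemma measurable_coord (i : 'I_n.+1) :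
  measurable_fun setT (fun x : Rn => x ord0 i).
Proof.
apply: (measurability _ (RGenOInfty.measurableE R)).
move=> _ [_ [r ->] <-]; rewrite setTI.
rewrite (_ : _ @^-1` _ = ~` [set x : Rn | x ord0 i <= r]).
  by apply: measurableC; exact: measurable_halfspace.
by apply/seteqP; split=> x /=; rewrite in_itv/= andbT ltNge => /negP.
Qed.

Lemma measurable_coordwise (B : 'I_n.+1 -> set R) :
  (forall i, measurable (B i)) ->
  measurable [set x : Rn | forall i, B i (x ord0 i)].
Proof.
move=> mB.
have -> : [set x : Rn | forall i, B i (x ord0 i)] =
    \bigcap_(i in [set: 'I_n.+1]) [set x : Rn | B i (x ord0 i)].
  by apply/seteqP; split=> [x xB i _|x xB i]; apply: xB.
apply: fin_bigcap_measurable => [|i _]; first exact: finite_finset.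
by have := measurable_coord i measurableT (mB i); rewrite setTI.
Qed.

(** A cover by boxes is a pointwise inequality between products of indicators of one variable, which
    [prod_volume_le_series] integrates. *)
Lemma le_lebesgue_coordwise (B : 'I_n.+1 -> set R) (l : 'I_n.+1 -> R) :
  (forall i, measurable (B i) /\ lebesgue_measure (B i) = (l i)%:E) ->
  ((\prod_i l i)%:E <= leb [set x : Rn | forall i, B i (x ord0 i)])%E.
Proof.
move=> hB; apply: le_ereal_inf_tmp => _ [D XD <-].
have [F [XF]] := box_cover_seq XD; apply: le_trans.
pose Bn i := B (inord i); pose ln i := l (inord i).
pose Fn k i := `[(F k).1 ord0 (inord i), (F k).2 ord0 (inord i)]%classic : set R.
pose dn k i := Num.max 0 ((F k).2 ord0 (inord i) - (F k).1 ord0 (inord i)).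
have := @prod_volume_le_series n.+1 Bn ln Fn dn (fun=> 1%E).
rewrite (_ : \prod_(i < n.+1) ln i = \prod_i l i); last first.
  by apply: eq_bigr => i _; rewrite /ln inord_val.
move=> /(_ _ _ _ _)/le_trans; apply => //.
- by move=> i; exact: hB.
- move=> k i; split; first exact: measurable_itv.
  rewrite /Fn /dn lebesgue_measure_itv/= lte_fin -EFinB.
  set a := _ ord0 _; set b := _ ord0 _; rewrite /Num.max subr_gt0.
  by case: ifPn => //; rewrite -leNgt.
- move=> x.
  have [xB|xB] := boolP [forall i : 'I_n.+1, x i \in B i]; last first.
    move: xB => /forallPn[i xi]; rewrite (bigD1 i)//= indicE /Bn inord_val.
    rewrite (negbTE xi) mul0r; apply: nneseries_ge0 => k _ _.
    by rewrite mul1e lee_fin prodr_ge0// => j _; rewrite indicE.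
  have /XF[k _ xk] : [set x : Rn | forall i, B i (x ord0 i)] (\row_i x i).
    by move=> i; rewrite mxE; apply/set_mem; exact: (forallP xB i).
  apply: (@le_trans _ _ (1 * (\prod_(i < n.+1) \1_(Fn k i) (x i))%:E))%E.
    rewrite mul1e lee_fin; apply: ler_prod => i _.
    rewrite !indicE ler0n/= [in leRHS]mem_set ?lern1 ?leq_b1//.
    rewrite /Fn inord_val/= in_itv/=.
    by have := xk i; rewrite mxE.
  apply: (@nneseries_ge_term (fun k => (1 * (\prod_(i < n.+1) \1_(Fn k i) (x i))%:E)%E)).
  by move=> j; rewrite mul1e lee_fin prodr_ge0// => i _; rewrite indicE.
- apply: lee_nneseries => [k _ _|k _].
    by rewrite mul1e lee_fin; apply: prodr_ge0 => i _; rewrite le_max lexx.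
  by rewrite mul1e; rewrite lee_fin le_eqVlt; apply/orP; left; apply/eqP;
    apply: eq_bigr => i _; rewrite /dn inord_val.
Qed.

(** Half-open, so that the dyadic subcubes of one generation partition the cube; closed cubes differ
    from these by null sets. *)
Definition hcube (a : Rn) (l : R) : set Rn :=
  [set x | forall i, a ord0 i <= x ord0 i < a ord0 i + l].

Lemma measurable_hcube a l : measurable (hcube a l).
Proof.
have := @measurable_coordwise (fun i => `[a ord0 i, a ord0 i + l[%classic).
rewrite (_ : [set x | _] = hcube a l); first by apply=> i; exact: measurable_itv.
by apply/seteqP; split=> x /= H i; have := H i; rewrite in_itv.
Qed.

Lemma measurable_cube a l : measurable (cube a l : set Rn).
Proof.
have := @measurable_coordwise (fun i => `[a ord0 i, a ord0 i + l]%classic).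
rewrite (_ : [set x | _] = cube a l); first by apply=> i; exact: measurable_itv.
by apply/seteqP; split=> x /= H i; have := H i; rewrite in_itv.
Qed.

Lemma hcube_cube a l : hcube a l `<=` cube a l.
Proof. by move=> x H i; have /andP[-> /ltW] := H i. Qed.

Lemma lebesgue_cube_le (a : Rn) (l : R) : 0 <= l -> (leb (cube a l) <= (l ^+ n.+1)%:E)%E.
Proof.
move=> l0.
have := lebesgue_outer_box (a, a + const_mx l).
rewrite /box_volume (eq_bigr (fun=> l)); last first.
  by move=> i _; rewrite /= !mxE addrAC subrr add0r; apply/max_idPr.
rewrite prodr_const card_ord; apply: le_trans.
apply: (le_outer_measure (lebesgue_outer_measure R n.+1)).
by move=> x H i; have := H i; rewrite /= !mxE.
Qed.

Lemma lebesgue_hcube (a : Rn) (l : R) : 0 <= l -> leb (hcube a l) = (l ^+ n.+1)%:E.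
Proof.
move=> l0; apply/eqP; rewrite eq_le; apply/andP; split.
  apply: le_trans (lebesgue_cube_le a l0).
  exact: (le_outer_measure (lebesgue_outer_measure R n.+1) _ _ (@hcube_cube a l)).
have := @le_lebesgue_coordwise (fun i => `[a ord0 i, a ord0 i + l[%classic) (fun=> l).
rewrite (_ : [set x | _] = hcube a l); last first.
  by apply/seteqP; split=> x /= H i; have := H i; rewrite in_itv.
rewrite prodr_const card_ord; apply => i; split; first exact: measurable_itv.
rewrite lebesgue_measure_itv/= lte_fin ltrDl -EFinB addrC addKr.
by case: ifPn => //; rewrite -leNgt => l1; congr _%:E; apply/le_anti; rewrite l0 l1.
Qed.

Lemma lebesgue_cube (a : Rn) (l : R) : 0 <= l -> leb (cube a l) = (l ^+ n.+1)%:E.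
Proof.
move=> l0; apply/eqP; rewrite eq_le lebesgue_cube_le//= -(lebesgue_hcube a l0).
exact: (le_outer_measure (lebesgue_outer_measure R n.+1) _ _ (@hcube_cube a l)).
Qed.

(** The left-hand product is a polynomial in [h], hence continuous at 0. *)
Lemma prod_add_le (I : finType) (f : I -> R) (e : R) : 0 < e ->
  exists2 h, 0 < h & \prod_i (f i + h) <= \prod_i f i + e.
Proof.
move=> e0; pose p := \prod_i ((f i)%:P + 'X) : {poly R}.
have /(_ 0)/cvgrPdist_le/(_ _ e0) := @continuous_horner R p.
move=> /nbhs_ballP[r/= r0 H].
exists (r / 2); first by rewrite divr_gt0.
have := H (r / 2); rewrite /ball/= sub0r normrN gtr0_norm ?divr_gt0//.
have pE x : p.[x] = \prod_i (f i + x).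
  by rewrite /p horner_prod; apply: eq_bigr => i _; rewrite !hornerE.
rewrite !pE => /(_ _)/ler_distlCDr.
move=> H1; have {}H1 := H1 (_ : r / 2 < r).
have hr : r / 2 < r by lra.
by have := H1 hr; under [X in _ <= X + _ -> _]eq_bigr do rewrite addr0.
Qed.

(** Outer regularity: half of [e] pays for a nearly optimal cover, the other half, in geometric
    shares, for enlarging its boxes to open ones. Openness is expressed by cubes, the form in which
    the dyadic arguments use it. *)
Lemma lebesgue_outer_open (A : set Rn) (e : R) : 0 < e -> (leb A < +oo)%E ->
  exists O : set Rn, [/\ A `<=` O, measurable O,
    forall x, O x -> exists2 h, 0 < h & cube (x - const_mx h) (2 * h) `<=` O &
    (leb O <= leb A + e%:E)%E].
Proof.
move=> e0 Aoo.
have Afin : leb A \is a fin_num by rewrite ge0_fin_numE.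
have e20 : 0 < e / 2 by rewrite divr_gt0.
have [_ [D XD <-] /ltW lD] := lb_ereal_inf_adherent e20 Afin.
have [F [XF FD]] := box_cover_seq XD.
have /choice[h H] : forall k, exists h : R, 0 < h /\
   \prod_(i < n.+1) (Num.max 0 ((F k).2 ord0 i - (F k).1 ord0 i) + h) <=
     box_volume (F k) + e / 2 / (2 ^ k.+1)%:R.
  move=> k; have [|h h0 hP] := @prod_add_le _ (fun i : 'I_n.+1 =>
      Num.max 0 ((F k).2 ord0 i - (F k).1 ord0 i)) (e / 2 / (2 ^ k.+1)%:R).
    by rewrite divr_gt0// ltr0n expn_gt0.
  by exists h.
pose O k := [set x : Rn | forall i, x ord0 i \in
   `](F k).1 ord0 i - h k / 2, (F k).2 ord0 i + h k / 2[].
exists (\bigcup_k O k); split.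
- move=> x /XF[k _ xk]; exists k => // i; have /andP[x1 x2] := xk i.
  have [h0 _] := H k; rewrite in_itv/=; apply/andP; split; lra.
- apply: bigcup_measurable => k _.
  by apply: (@measurable_coordwise (fun i => `](F k).1 ord0 i - h k / 2,
      (F k).2 ord0 i + h k / 2[%classic)) => i; exact: measurable_itv.
- move=> x [k _ xk].
  pose d i := Num.min (x ord0 i - ((F k).1 ord0 i - h k / 2))
                ((F k).2 ord0 i + h k / 2 - x ord0 i).
  have d0 i : 0 < d i by have := xk i; rewrite in_itv/= /d lt_min !subr_gt0.
  have [i0 _ dmin] := @arg_minP _ _ _ (ord0 : 'I_n.+1) xpredT d erefl.
  exists (d i0 / 2); first by rewrite divr_gt0.
  move=> y yx; exists k => // i.
  have := yx i; rewrite !mxE => /andP[y1 y2].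
  have := dmin i erefl; rewrite {2}/d le_min => /andP[d1 d2].
  have := d0 i0.
  rewrite in_itv/=; move: (d i0) y1 y2 d1 d2 => dd *; apply/andP; split; lra.
- apply: (@le_trans _ _ (\sum_(0 <= k <oo) ((box_volume (F k))%:E +
       (e / 2 / (2 ^ k.+1)%:R)%:E)))%E.
    apply: le_trans (outer_measure_sigma_subadditive (lebesgue_outer_measure R n.+1) _) _.
    apply: lee_nneseries => k _ //.
    rewrite -EFinD; have [h0 hk] := H k; apply: le_trans (_ : _ <= (\prod_(i < n.+1) (Num.max 0
       ((F k).2 ord0 i - (F k).1 ord0 i) + h k))%:E)%E _; last by rewrite lee_fin.
    pose ab := ((F k).1 - const_mx (h k / 2), (F k).2 + const_mx (h k / 2)).
    apply: (@le_trans _ _ (box_volume ab)%:E).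
      apply: le_trans (lebesgue_outer_box ab).
      apply: (le_outer_measure (lebesgue_outer_measure R n.+1)) => x xO i.
      by have := xO i; rewrite in_itv/= !mxE => /andP[/ltW -> /ltW ->].
    rewrite lee_fin /box_volume; apply: ler_prod => i _; rewrite !mxE.
    set d := (F k).2 ord0 i - (F k).1 ord0 i.
    have d0 : 0 <= Num.max 0 d by rewrite le_max lexx.
    have dd : d <= Num.max 0 d by rewrite le_max lexx orbT.
    rewrite le_max lexx/= ge_max; apply/andP; split; first lra.
    apply: le_trans (lerD dd (lexx (h k))).
    by rewrite /d opprB addrAC addrA; lra.
  have := @epsilon_trick R (fun k => (box_volume (F k))%:E) (e / 2) xpredT.
  move=> /(_ _ _)/le_trans; apply; [|exact: ltW|].
    by move=> k; exact: box_volume_ge0.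
  by rewrite [in leRHS](splitr e) EFinD addeA leeD2r//; exact: le_trans lD.
Qed.

End LebesgueRn.

(** * Dyadic cubes *)

Section Dyadic.
Context {R : realType} {n : nat}.
Local Notation Rn := (Rn R n.+1).
Local Notation leb := (@lebesgue_Rn R n.+1).
Implicit Types (a c x : Rn) (l s : R).

(** The integer coordinates [z] make all the generations together countable, which [stopping_cubes]
    exploits to index families by natural numbers. *)
Definition dyadic a l (k : nat) c := exists z : {ffun 'I_n.+1 -> nat},
  forall i, (z i < 2 ^ k)%N /\ c ord0 i = a ord0 i + (z i)%:R * (l / 2 ^+ k).

Lemma hcubeS a l a' l' : (forall i, a ord0 i <= a' ord0 i) ->
  (forall i, a' ord0 i + l' <= a ord0 i + l) -> hcube a' l' `<=` hcube a l.
Proof.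
move=> h1 h2 x h i; have /andP[x1 x2] := h i.
by rewrite (le_trans (h1 i) x1) (lt_le_trans x2 (h2 i)).
Qed.

Lemma pow2_gt0 k : 0 < 2 ^+ k :> R. Proof. by rewrite exprn_gt0. Qed.

Lemma dyadicS a l k c : 0 < l -> dyadic a l k c ->
  hcube c (l / 2 ^+ k) `<=` hcube a l.
Proof.
move=> l0 [z hz]; have p0 := pow2_gt0 k; apply: hcubeS => i; rewrite (hz i).2.
  by rewrite lerDl mulr_ge0// divr_ge0// ltW.
rewrite -addrA lerD2l -{2}[l / 2 ^+ k]mul1r -mulrDl natr1 mulrA ler_pdivrMr//.
rewrite mulrC ler_pM2l// -natrX ler_nat.
by have [] := hz i.
Qed.

Lemma dyadic_exists a l k x : 0 < l -> hcube a l x ->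
  exists c, dyadic a l k c /\ hcube c (l / 2 ^+ k) x.
Proof.
move=> l0 xQ; have p0 := pow2_gt0 k; have s0 : 0 < l / 2 ^+ k by rewrite divr_gt0.
pose t i := (x ord0 i - a ord0 i) / (l / 2 ^+ k).
have t0 i : 0 <= t i.
  by rewrite divr_ge0 ?(ltW s0)// subr_ge0; have /andP[] := xQ i.
have tP i : (Num.trunc (t i))%:R <= t i < (Num.trunc (t i)).+1%:R by rewrite trunc_itv.
exists (\row_i (a ord0 i + (Num.trunc (t i))%:R * (l / 2 ^+ k))); split.
  exists [ffun i => Num.trunc (t i)] => i; rewrite ffunE mxE; split => //.
  rewrite -(ltr_nat R) natrX; have /andP[tt _] := tP i; apply: le_lt_trans tt _.
  rewrite ltr_pdivrMr// mulrC divfK ?gt_eqF//.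
  by have /andP[_] := xQ i; rewrite ltrBlDl.
move=> i; rewrite mxE; have /andP[t1 t2] := tP i; apply/andP; split.
  by rewrite -lerBrDl -ler_pdivlMr.
rewrite -addrA -{2}[l / 2 ^+ k]mul1r -mulrDl natr1 -ltrBlDl -ltr_pdivrMr//.
Qed.

Lemma dyadic_uniq a l k c c' x : 0 < l -> dyadic a l k c -> dyadic a l k c' ->
  hcube c (l / 2 ^+ k) x -> hcube c' (l / 2 ^+ k) x -> c = c'.
Proof.
move=> l0 [z hz] [z' hz'] xc xc'; apply/rowP => i.
have s0 : 0 < l / 2 ^+ k by rewrite divr_gt0 ?pow2_gt0.
have := xc i; have := xc' i; rewrite (hz i).2 (hz' i).2.
move=> /andP[x1 x2] /andP[x3 x4].
rewrite -addrA -{2}[l / 2 ^+ k]mul1r -mulrDl natr1 in x2.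
rewrite -addrA -{2}[l / 2 ^+ k]mul1r -mulrDl natr1 in x4.
have := le_lt_trans x1 x4; have := le_lt_trans x3 x2.
rewrite !ltrD2l !ltr_pM2r// !ltr_nat !ltnS => h1 h2.
by congr (_ + _%:R * _); apply/eqP; rewrite eqn_leq h1 h2.
Qed.

Lemma dyadic_parent a l k c : 0 < l -> dyadic a l k.+1 c ->
  exists2 c', dyadic a l k c' & hcube c (l / 2 ^+ k.+1) `<=` hcube c' (l / 2 ^+ k).
Proof.
move=> l0 [z hz]; have p0 := pow2_gt0 k.
have s0 : 0 < l / 2 ^+ k by rewrite divr_gt0.
have sE : l / 2 ^+ k.+1 = (l / 2 ^+ k) / 2 by rewrite exprSr invfM mulrA.
have zE i : (z i)%:R = 2 * (z i)./2%:R + (odd (z i))%:R :> R.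
  by rewrite -{1}(odd_double_half (z i)) natrD -mul2n natrM addrC.
have o1 i : 0 <= ((odd (z i))%:R : R) <= 1 by rewrite ler0n lern1 leq_b1.
exists (\row_i (a ord0 i + (z i)./2%:R * (l / 2 ^+ k))).
  exists [ffun i => (z i)./2] => i; rewrite ffunE mxE; split => //.
  by have [+ _] := hz i; rewrite expnS; lia.
apply: hcubeS => i; rewrite mxE (hz i).2 sE zE; move: (o1 i) s0.
  by move: (_ / _) ((odd _)%:R : R) (((z i)./2)%:R : R) => u v w *; nra.
by move: (_ / _) ((odd _)%:R : R) (((z i)./2)%:R : R) => u v w *; nra.
Qed.

Lemma dyadic_ancestor a l k c j : 0 < l -> (j <= k)%N -> dyadic a l k c ->
  exists2 c', dyadic a l j c' & hcube c (l / 2 ^+ k) `<=` hcube c' (l / 2 ^+ j).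
Proof.
move=> l0; elim: k c => [|k IH] c; first by rewrite leqn0 => /eqP -> h; exists c.
rewrite leq_eqVlt => /predU1P[-> h|]; first by exists c.
rewrite ltnS => jk /(dyadic_parent l0)[c1 h1 s1]; have [c2 h2 s2] := IH c1 jk h1.
by exists c2 => //; exact: subset_trans s1 s2.
Qed.

Lemma hcube_corner c s : 0 < s -> hcube c s c.
Proof. by move=> s0 i; rewrite lexx ltrDl. Qed.

Lemma dyadic_nested a l j k c c' x : 0 < l -> (j <= k)%N ->
  dyadic a l j c -> dyadic a l k c' ->
  hcube c (l / 2 ^+ j) x -> hcube c' (l / 2 ^+ k) x ->
  hcube c' (l / 2 ^+ k) `<=` hcube c (l / 2 ^+ j).
Proof.
move=> l0 jk hc hc' xc xc'; have [c2 h2 s2] := dyadic_ancestor l0 jk hc'.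
by rewrite (dyadic_uniq l0 hc h2 xc (s2 _ xc')).
Qed.

(** The maximal dyadic cubes with property [S]: those that have it while no proper ancestor does.
    Two of them that meet are nested, and then the smaller would have an ancestor with [S]; this
    makes the family disjoint. *)
Lemma stopping_cubes a l (S : Rn -> R -> Prop) : 0 < l ->
  exists (J : set nat) (c : nat -> Rn) (k : nat -> nat), [/\
    forall i, J i -> dyadic a l (k i) (c i) /\ S (c i) (l / 2 ^+ k i),
    trivIset J (fun i => hcube (c i) (l / 2 ^+ k i)),
    forall i j c', J i -> (j < k i)%N -> dyadic a l j c' ->
      hcube (c i) (l / 2 ^+ k i) `<=` hcube c' (l / 2 ^+ j) -> ~ S c' (l / 2 ^+ j) &
    forall x j c', hcube a l x ->
      ~ (\bigcup_(i in J) hcube (c i) (l / 2 ^+ k i)) x ->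
      dyadic a l j c' -> hcube c' (l / 2 ^+ j) x -> ~ S c' (l / 2 ^+ j)].
Proof.
move=> l0.
pose cor (t : nat * {ffun 'I_n.+1 -> nat}) : Rn :=
  \row_i (a ord0 i + (t.2 i)%:R * (l / 2 ^+ t.1)).
pose good (t : nat * {ffun 'I_n.+1 -> nat}) := [/\ (forall i, t.2 i < 2 ^ t.1)%N,
   S (cor t) (l / 2 ^+ t.1) &
   forall j c', (j < t.1)%N -> dyadic a l j c' ->
      hcube (cor t) (l / 2 ^+ t.1) `<=` hcube c' (l / 2 ^+ j) -> ~ S c' (l / 2 ^+ j)].
pose t0 : nat * {ffun 'I_n.+1 -> nat} := (0%N, [ffun=> 0%N]).
pose u i := odflt t0 (unpickle i).
have dcor t : good t -> dyadic a l t.1 (cor t).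
  by case=> zt _ _; exists t.2 => i; rewrite mxE.
have dyad_cor j c : dyadic a l j c ->
    exists2 z : {ffun 'I_n.+1 -> nat}, (forall i, z i < 2 ^ j)%N & c = cor (j, z).
  case=> z hz; exists z; first by move=> i; have [] := hz i.
  by apply/rowP => i; rewrite mxE (hz i).2.
pose J := [set i | exists t, i = pickle t /\ good t].
have uJ t : u (pickle t) = t by rewrite /u pickleK.
exists J, (cor \o u), (fst \o u); split => /=.
- by move=> _ [t [-> gt]]; rewrite uJ; split; [exact: dcor|case: gt].
- apply/trivIsetP => _ _ [t [-> gt]] [t' [-> gt']]; rewrite !uJ => tt'.
  apply/eqP/negPn/negP => /set0P[x [xt xt']].
  wlog le_tt' : t t' gt gt' tt' xt xt' / (t.1 <= t'.1)%N.
    move=> H; have [le|/ltnW le] := leqP t.1 t'.1; first exact: H le.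
    by apply: (H t' t) => //; rewrite eq_sym.
  have dt := dcor _ gt; have dt' := dcor _ gt'.
  have sub := dyadic_nested l0 le_tt' dt dt' xt xt'.
  move: le_tt'; rewrite leq_eqVlt => /predU1P[e|lt].
    move: tt'; rewrite (_ : t = t') ?eqxx//.
    have := dyadic_uniq l0 dt; rewrite e => /(_ _ _ dt'); rewrite -e => /(_ _ xt).
    rewrite {1}e => /(_ xt') /rowP cc.
    case: t t' e cc {gt gt' dt dt' sub xt xt'} => [k z] [k' z'] /= <- cc.
    congr (_, _); apply/ffunP => i; have := cc i; rewrite !mxE/= => /addrI.
    move=> /mulIf => /(_ _)/eqP; rewrite eqr_nat => H; apply/eqP/H.
    by rewrite mulf_neq0 ?invr_neq0 ?expf_neq0 ?gt_eqF.
  by case: gt' => _ _ /(_ _ _ lt dt sub); case: gt.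
- by move=> _ j c' [t [-> gt]]; rewrite uJ => jk dc' sub; case: gt => _ _; apply.
(* Induction on the level: the first cube around [x] with property [S] would belong to the
   family. *)
- move=> x j c' xQ xN; elim/ltn_ind: j c' => j IH c' dc' xc' Sc'.
  apply: xN; have [z zj cE] := dyad_cor _ _ dc'.
  exists (pickle (j, z)); last by rewrite uJ/= -cE.
  exists (j, z); split=> //; split=> //=; first by rewrite -cE.
  by move=> i c'' ij dc'' sub; apply: IH => //; apply: sub; rewrite -cE.
Qed.

Lemma ge0_integral_bigcup_cond (J : set nat) (F : nat -> set Rn) (f : Rn -> \bar R) :
  (forall i, J i -> measurable (F i)) -> trivIset J F ->
  measurable_fun (\bigcup_(i in J) F i) f ->
  (forall x, (\bigcup_(i in J) F i) x -> 0 <= f x)%E ->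
  (\int[leb]_(x in \bigcup_(i in J) F i) f x =
    \sum_(0 <= i <oo | i \in J) \int[leb]_(x in F i) f x)%E.
Proof.
move=> mF tF mf f0.
rewrite bigcup_mkcond in mf f0 *.
rewrite ge0_integral_bigcup//; last 2 first.
- by move=> i; case: ifPn => // /set_mem; exact: mF.
- by rewrite -trivIset_mkcond.
rewrite [RHS]eseries_mkcond; apply: eq_eseriesr => i _.
by case: ifPn => // _; rewrite integral_set0.
Qed.

Lemma measurable_dyadic_bigcup (J : set nat) (c : nat -> Rn) (s : nat -> R) :
  measurable (\bigcup_(i in J) hcube (c i) (s i) : set Rn).
Proof. by apply: bigcup_measurable => i _; exact: measurable_hcube. Qed.

Lemma dyadic_small a l x e : 0 < l -> 0 < e -> hcube a l x ->
  exists k c, [/\ dyadic a l k c, hcube c (l / 2 ^+ k) x &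
    hcube c (l / 2 ^+ k) `<=` cube (x - const_mx e) (2 * e)].
Proof.
move=> l0 e0 xQ.
have [k hk] : exists k, l / 2 ^+ k <= e.
  exists (Num.trunc (l / e)).+1; set k := (Num.trunc (l / e)).+1.
  have : l / e < k%:R by have := trunc_itv (ltW (divr_gt0 l0 e0)) => /andP[].
  rewrite ltr_pdivrMr// ler_pdivrMr ?pow2_gt0// => /ltW/le_trans; apply.
  rewrite mulrC ler_pM2l// -natrX ler_nat.
  exact/ltnW/ltn_expl.
have [c [dc xc]] := dyadic_exists k l0 xQ; exists k, c; split => // y yc i.
have := xc i; have := yc i; rewrite !mxE => /andP[y1 y2] /andP[x1 x2].
by apply/andP; split; move: hk y1 y2 x1 x2; move: (l / _) => u *; lra.
Qed.

(** The maximal dyadic cubes inside an open superset of nearly the same measure. They are required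
    to meet [F], so that hypotheses on cubes around points of [F] apply to each of them. *)
Lemma dyadic_cover a l (F : set Rn) e : 0 < l -> 0 < e -> F `<=` hcube a l ->
  exists (J : set nat) (c : nat -> Rn) (k : nat -> nat), [/\
    forall i, J i -> dyadic a l (k i) (c i) /\ (hcube (c i) (l / 2 ^+ k i) `&` F !=set0),
    trivIset J (fun i => hcube (c i) (l / 2 ^+ k i)),
    F `<=` \bigcup_(i in J) hcube (c i) (l / 2 ^+ k i) &
    (leb (\bigcup_(i in J) hcube (c i) (l / 2 ^+ k i)) <= leb F + e%:E)%E].
Proof.
move=> l0 e0 FQ.
have Foo : (leb F < +oo)%E.
  apply: (@le_lt_trans _ _ (leb (hcube a l))).
    exact: (le_outer_measure (lebesgue_outer_measure R n.+1)).
  by rewrite lebesgue_hcube ?ltW// ltry.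
have [U0 [FO mO Oop Ole]] := lebesgue_outer_open e0 Foo.
have [J [c [k [JS tJ Jmax Jout]]]] := @stopping_cubes a l
  (fun c s => hcube c s `<=` U0 /\ hcube c s `&` F !=set0) l0.
exists J, c, k; split => //.
- by move=> i /JS[? [? ?]].
- move=> x Fx; apply: contrapT => xN.
  have [h h0 hO] := Oop x (FO x Fx).
  have [j [c' [dc' xc' sub]]] := dyadic_small l0 h0 (FQ x Fx).
  apply: (Jout x j c' (FQ x Fx) xN dc' xc'); split; last by exists x.
  exact: subset_trans sub hO.
- apply: le_trans Ole; apply: (le_outer_measure (lebesgue_outer_measure R n.+1)).
  by move=> x [i /JS[_ [iO _]] xi]; exact: iO.
Qed.

(* A dyadic Lebesgue differentiation theorem, one-sided, which is all that is needed. *)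
Lemma dyadic_density a l (f : Rn -> \bar R) (lam : R) (G : set Rn) : 0 < l -> 0 <= lam ->
  measurable_fun (hcube a l) f -> (forall x, 0 <= f x)%E ->
  measurable G -> G `<=` hcube a l ->
  (forall x k c, G x -> dyadic a l k c -> hcube c (l / 2 ^+ k) x ->
    (\int[leb]_(y in hcube c (l / 2 ^+ k)) f y <=
       lam%:E * leb (hcube c (l / 2 ^+ k)))%E) ->
  {ae leb, forall x, G x -> (f x <= lam%:E)%E}.
Proof.
move=> l0 lam0 mf f0 mG GQ H.
pose F j := G `&` [set x | ((lam + j.+1%:R^-1)%:E <= f x)%E].
have mF j : measurable (F j).
  have := emeasurable_fun_c_infty mG (measurable_funS (measurable_hcube a l) GQ mf).
  exact.
have FG j : F j `<=` G by move=> x [].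
have F0 j : leb (F j) = 0.
  set d : R := j.+1%:R^-1.
  have d0 : 0 < d by rewrite invr_gt0.
  have Ffin : leb (F j) \is a fin_num.
    rewrite ge0_fin_numE//; apply: (@le_lt_trans _ _ (leb (hcube a l))).
      apply: (le_outer_measure (lebesgue_outer_measure R n.+1)).
      exact: subset_trans (FG j) GQ.
    by rewrite lebesgue_hcube ?ltW// ltry.
  (* The cover exceeds [F j] by at most [e] in measure and its cubes meet [G]: the integral of [f]
     over it is at least (lam + d) |F j| and at most lam (|F j| + e). *)
  have key e : 0 < e -> (d%:E * leb (F j) <= (lam * e)%:E)%E.
    move=> e0.
    have [J [c [k [JS tJ Jcov Jle]]]] := dyadic_cover l0 e0 (subset_trans (FG j) GQ).
    set U := \bigcup_(i in J) _ in Jcov Jle.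
    have mU : measurable U by exact: measurable_dyadic_bigcup.
    have UQ : U `<=` hcube a l by move=> x [i /JS[di _]]; exact: (dyadicS l0 di).
    have mfU := measurable_funS (measurable_hcube a l) UQ mf.
    have h1 : ((lam + d)%:E * leb (F j) <= \int[leb]_(x in F j) f x)%E.
      rewrite -integral_cst//; apply: ge0_le_integral => //.
      - by move=> x _; rewrite lee_fin addr_ge0// ltW.
      - exact: measurable_funS (measurable_hcube a l) (subset_trans (FG j) GQ) mf.
      - by move=> x [].
    have h2 : (\int[leb]_(x in F j) f x <= \int[leb]_(x in U) f x)%E.
      by apply: ge0_subset_integral.
    have h3 : (\int[leb]_(x in U) f x <= lam%:E * leb U)%E.
      rewrite /U ge0_integral_bigcup_cond//; last by move=> i _; exact: measurable_hcube.
      rewrite measure_bigcup//; last by move=> i _; exact: measurable_hcube.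
      rewrite -nneseriesZl; last by move=> i _; exact: measure_ge0.
      apply: lee_nneseries => [i _ _|i /set_mem Ji]; first exact: integral_ge0.
      have [di [x [xi [Gx _]]]] := JS i Ji.
      exact: (H x).
    have h4 : (lam%:E * leb U <= lam%:E * (leb (F j) + e%:E))%E.
      by apply: lee_wpmul2l; rewrite ?lee_fin.
    have := le_trans h1 (le_trans h2 (le_trans h3 h4)).
    rewrite -(fineK Ffin) -EFinD -!EFinM !lee_fin; lra.
  apply/eqP; rewrite eq_le measure_ge0 andbT -(fineK Ffin) lee_fin leNgt.
  apply/negP => F0; have lam1 : 0 < lam + 1 by lra.
  (* This [e] makes lam e smaller than d |F j|, against [key]. *)
  have := key (d * fine (leb (F j)) / (2 * (lam + 1))) _.
  rewrite -(fineK Ffin) -EFinM lee_fin => /(_ _)/wrap[].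
    by rewrite divr_gt0 ?mulr_gt0.
  apply/negP; rewrite -ltNge mulrA ltr_pdivrMr; last by rewrite mulr_gt0.
  have : 0 < d * fine (leb (F j)) by rewrite mulr_gt0.
  by move: (d * _) => u u0; nra.
exists (\bigcup_j F j); split.
- exact: bigcup_measurable.
- apply/eqP; rewrite eq_le measure_ge0 andbT.
  apply: le_trans (outer_measure_sigma_subadditive (lebesgue_outer_measure R n.+1) _) _.
  by rewrite eseries0// => i _ _; exact: F0.
- move=> x /= /not_implyP[Gx /negP]; rewrite -ltNge => lf.
  have [j hj] : exists j : nat, ((lam + j.+1%:R^-1)%:E <= f x)%E.
    move: lf; case: (f x) => [r| |]//; last by exists 0%N; rewrite leey.
    rewrite lte_fin -subr_gt0 => r0.
    exists (Num.trunc (r - lam)^-1); rewrite lee_fin -lerBrDl.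
    rewrite -[leRHS]invrK lef_pV2 ?posrE ?invr_gt0//.
    have r1 : 0 <= (r - lam)^-1 by rewrite invr_ge0 ltW.
    by have /andP[_ /ltW] := trunc_itv r1.
  by exists j.
Qed.

End Dyadic.

(** * Integration and L2 *)

Section monotone_integral.
Import HBNNSimple.
Context d (T : measurableType d) (R : realType) (mu : {measure set T -> \bar R}).

(* The integral of a nonnegative function is a supremum over simple functions below it,
   so measurability is not required here. *)
Lemma leintT (f g : T -> \bar R) : (forall x, 0 <= f x)%E ->
  (forall x, f x <= g x)%E -> (\int[mu]_x f x <= \int[mu]_x g x)%E.
Proof.
move=> f0 fg; rewrite !ge0_integralTE//; last first.
  by move=> x; exact: le_trans (fg x).
apply: ge_ereal_sup => _ [h hf <-]; apply: ereal_sup_ubound; exists h => // x.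
exact: le_trans (hf x) (fg x).
Qed.

(** Again through simple functions below [f], each of which may be set to 0 on the exceptional null
    set. It serves for modulars and products whose measurability is not established. *)
Lemma ae_le_int (f g : T -> \bar R) : (forall x, 0 <= f x)%E -> (forall x, 0 <= g x)%E ->
  {ae mu, forall x, (f x <= g x)%E} -> (\int[mu]_x f x <= \int[mu]_x g x)%E.
Proof.
move=> f0 g0 [N [mN N0 HN]].
rewrite [leLHS]ge0_integralTE//; apply: ge_ereal_sup => _ [h hf <-].
pose hh : T -> R := HBNNSimple.NonNegSimpleFun.sort h.
have mh : measurable_fun [set: T] (EFin \o hh).
  by apply/measurable_EFinP; exact: (measurable_funPT h).
have -> : sintegral mu hh = (\int[mu]_x (hh x)%:E)%E by rewrite integralT_nnsfun.
rewrite (ge0_negligible_integral mN measurableT mh _ N0); last first.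
  by move=> x _; rewrite lee_fin.
rewrite setTD integral_mkcond; apply: leintT => x; rewrite patchE; case: ifPn => //.
  by move=> _; rewrite lee_fin.
move=> /set_mem xN; apply: le_trans (hf x) _; apply: contrapT => fg.
by apply: xN; apply: HN.
Qed.

Lemma leint (D : set T) (f g : T -> \bar R) : (forall x, D x -> 0 <= f x)%E ->
  (forall x, D x -> f x <= g x)%E ->
  (\int[mu]_(x in D) f x <= \int[mu]_(x in D) g x)%E.
Proof.
move=> f0 fg; rewrite integral_mkcond [leRHS]integral_mkcond; apply: leintT => x;
  rewrite !patchE; case: ifPn => // /set_mem; [exact: f0|exact: fg].
Qed.

Lemma leintS (D E : set T) (f : T -> \bar R) : D `<=` E ->
  (forall x, E x -> 0 <= f x)%E ->
  (\int[mu]_(x in D) f x <= \int[mu]_(x in E) f x)%E.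
Proof.
move=> DE f0; rewrite integral_mkcond [leRHS]integral_mkcond; apply: leintT => x;
  rewrite !patchE; case: ifPn => //.
- by move=> /set_mem /DE; exact: f0.
- by move=> /set_mem /DE /mem_set ->.
- by move=> _; case: ifPn => // /set_mem; exact: f0.
Qed.

Lemma ae_eq_int (f g : T -> \bar R) : (forall x, 0 <= f x)%E -> (forall x, 0 <= g x)%E ->
  {ae mu, forall x, f x = g x} -> (\int[mu]_x f x = \int[mu]_x g x)%E.
Proof.
move=> f0 g0 fg; apply/eqP; rewrite eq_le; apply/andP; split; apply: ae_le_int => //.
  by move: fg; apply: filterS => x ->.
by move: fg; apply: filterS => x ->.
Qed.

End monotone_integral.

Section mfun.
Context {R : realType} {n : nat}.
Local Notation Rn := (Rn R n.+1).
Local Notation leb := (@lebesgue_Rn R n.+1).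
Definition mfun (f : Rn -> R) := measurable_fun [set: Rn] f.
Implicit Types f g : Rn -> R.

Lemma mfunD f g : mfun f -> mfun g -> mfun (fun x => f x + g x).
Proof. by move=> mf mg; apply: measurable_funD. Qed.

Lemma mfunB f g : mfun f -> mfun g -> mfun (fun x => f x - g x).
Proof. by move=> mf mg; apply: measurable_funB. Qed.

Lemma mfunM f g : mfun f -> mfun g -> mfun (fun x => f x * g x).
Proof. by move=> mf mg; apply: measurable_funM. Qed.

Lemma mfun_cst (a : R) : mfun (fun=> a).
Proof. exact: measurable_cst. Qed.

Lemma mfunZ (a : R) f : mfun f -> mfun (fun x => a * f x).
Proof. by move=> mf; apply: mfunM => //; exact: mfun_cst. Qed.

Lemma mfunX f k : mfun f -> mfun (fun x => f x ^+ k).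
Proof. by move=> mf; exact: measurable_funX. Qed.

Lemma mfun_norm f : mfun f -> mfun (fun x => `|f x|).
Proof. by move=> mf; exact: measurableT_comp. Qed.

Lemma mfun1 (D : set Rn) : measurable D -> mfun (\1_D).
Proof. by move=> mD; exact: measurable_indic. Qed.

Lemma mfun_sum (I : Type) (r : seq I) (f : I -> Rn -> R) :
  (forall i, mfun (f i)) -> mfun (fun x => \sum_(i <- r) f i x).
Proof. by move=> mf; apply: measurable_sum. Qed.

Lemma mfunE f : mfun f -> measurable_fun [set: Rn] (fun x => (f x)%:E).
Proof. by move=> mf; apply/measurable_EFinP. Qed.

Lemma mfunED f (D : set Rn) : mfun f -> measurable_fun D (fun x => (f x)%:E).
Proof. by move=> /mfunE; exact: measurable_funTS. Qed.

Lemma mfun_gt f (a : R) : mfun f -> measurable [set x : Rn | a < f x].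
Proof.
move=> mf; have := mf measurableT _ (measurable_itv `]a, +oo[).
by rewrite setTI; congr (measurable _); apply/seteqP; split=> x /=; rewrite in_itv/= andbT.
Qed.

Lemma mfun_ge f (a : R) : mfun f -> measurable [set x : Rn | a <= f x].
Proof.
move=> mf; have := mf measurableT _ (measurable_itv `[a, +oo[).
by rewrite setTI; congr (measurable _); apply/seteqP; split=> x /=; rewrite in_itv/= andbT.
Qed.

Lemma integral_leb_cst (D : set Rn) (r : R) : measurable D ->
  (\int[leb]_(x in D) r%:E = r%:E * leb D)%E.
Proof. by move=> mD; exact: integral_cst. Qed.

Lemma integral_leb_indic (D : set Rn) : measurable D ->
  (\int[leb]_x (\1_D x)%:E = leb D)%E.
Proof. by move=> mD; rewrite integral_indic// setIT. Qed.

Lemma intD (f g : Rn -> \bar R) :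
  measurable_fun [set: Rn] f -> measurable_fun [set: Rn] g ->
  (forall x, 0 <= f x)%E -> (forall x, 0 <= g x)%E ->
  (\int[leb]_x (f x + g x) = \int[leb]_x f x + \int[leb]_x g x)%E.
Proof.
move=> mf mg f0 g0.
exact: (@ge0_integralD _ _ _ leb setT measurableT f g (fun x _ => f0 x) mf
  (fun x _ => g0 x) mg).
Qed.

Lemma intZ (k : R) (f : Rn -> \bar R) : measurable_fun [set: Rn] f -> 0 <= k ->
  (forall x, 0 <= f x)%E -> (\int[leb]_x (k%:E * f x) = k%:E * \int[leb]_x f x)%E.
Proof.
move=> mf k0 f0.
exact: (@ge0_integralZl _ _ _ leb setT measurableT f mf k%:E (fun x _ => f0 x)).
Qed.

Lemma ae_mono (P Q : Rn -> Prop) : {ae leb, forall x, P x} ->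
  (forall x, P x -> Q x) -> {ae leb, forall x, Q x}.
Proof. by move=> aeP PQ; move: aeP; apply: filterS. Qed.

Lemma ae_mono2 (P1 P2 Q : Rn -> Prop) : {ae leb, forall x, P1 x} ->
  {ae leb, forall x, P2 x} ->
  (forall x, P1 x -> P2 x -> Q x) -> {ae leb, forall x, Q x}.
Proof. by move=> aeP1 aeP2 PQ; move: aeP1 aeP2; apply: filterS2. Qed.

Lemma leb_le (A B : set Rn) : A `<=` B -> (leb A <= leb B)%E.
Proof. exact: (le_outer_measure (lebesgue_outer_measure R n.+1)). Qed.

Lemma leb_ge0 (A : set Rn) : (0 <= leb A)%E.
Proof. exact: (@outer_measure_ge0 _ _ (lebesgue_outer_measure R n.+1)). Qed.

Lemma leb_bigcup (F : nat -> set Rn) :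
  (leb (\bigcup_k F k) <= \sum_(0 <= k <oo) leb (F k))%E.
Proof. exact: (outer_measure_sigma_subadditive (lebesgue_outer_measure R n.+1)). Qed.

Lemma leb_setU (A B : set Rn) : (leb (A `|` B) <= leb A + leb B)%E.
Proof. exact: (outer_measureU2 (lebesgue_outer_measure R n.+1)). Qed.

Lemma leb_hcube_lty (c : Rn) (s : R) : (leb (hcube c s) < +oo)%E.
Proof.
apply: (@le_lt_trans _ _ (leb (hcube c `|s|))); last by rewrite lebesgue_hcube// ltry.
by apply: leb_le; apply: hcubeS => i //; rewrite lerD2l ler_norm.
Qed.

End mfun.

Section L2.
Context {R : realType} {n : nat}.
Local Notation Rn := (Rn R n.+1).
Local Notation leb := (@lebesgue_Rn R n.+1).

Definition sqint (f : Rn -> R) : \bar R := (\int[leb]_x ((f x) ^+ 2)%:E)%E.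

Lemma sqint_ge0 f : (0 <= sqint f)%E.
Proof. by apply: integral_ge0 => x _; rewrite lee_fin sqr_ge0. Qed.

Lemma powR_Lnorm2 (f : Rn -> R) : ('N[leb]_2%:E[EFin \o f] `^ 2 = sqint f)%E.
Proof.
rewrite powR_Lnorm ?pnatr_eq0//; apply: eq_integral => x _ /=.
by rewrite powR_mulrn// real_normK// num_real.
Qed.

Lemma L2P (f : Rn -> R) : L2 f <-> measurable_fun setT f /\ (sqint f < +oo)%E.
Proof.
rewrite /L2/= /finite_norm -powR_Lnorm2; split=> -[mf]; split => //; move: b.
  by move=> H; rewrite poweR_lty.
have := Lnorm_ge0 leb 2%:E (EFin \o f).
move: (Lnorm leb 2%:E (EFin \o f)) => [z| |]//= _.
  by move=> _; rewrite ltry.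
by rewrite pnatr_eq0.
Qed.

(** Inside each of a sequence of growing cubes, an open set is the countable union of its maximal
    dyadic subcubes. This links the topology to the Caratheodory sigma-algebra. *)
Lemma measurable_open_cubes (U : set Rn) :
  (forall x, U x -> exists2 h, 0 < h & cube (x - const_mx h) (2 * h) `<=` U) ->
  measurable U.
Proof.
move=> Uop.
pose c0 N : Rn := const_mx (- N%:R).
have -> : U = \bigcup_(N in [set N : nat | (0 < N)%N]) (U `&` hcube (c0 N) (2 * N%:R)).
  apply/seteqP; split=> [x Ux|x [N _ []]//].
  exists (Num.trunc (\sum_i `|x ord0 i|)).+1 => //; split => // i.
  have s0 : 0 <= \sum_i `|x ord0 i| by apply: sumr_ge0.
  have /andP[_ sN] := truncn_itv s0.
  have xi : `|x ord0 i| <= \sum_i `|x ord0 i|.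
    by rewrite (bigD1 i)//= lerDl sumr_ge0.
  have := le_lt_trans xi sN; rewrite ltr_norml mxE; move: (_.+1%:R) => u /andP[u1 u2].
  by apply/andP; split; lra.
apply: bigcup_measurable => N N0.
have l0 : 0 < 2 * N%:R :> R by rewrite mulr_gt0// ltr0n.
have [J [c [k [JS _ _ Jout]]]] := @stopping_cubes R n (c0 N) _
  (fun c s => hcube c s `<=` U) l0.
have -> : U `&` hcube (c0 N) (2 * N%:R) = \bigcup_(i in J) hcube (c i) (2 * N%:R / 2 ^+ k i).
  apply/seteqP; split=> [x [Ux xQ]|x [i /JS[di iU] xi]].
    apply: contrapT => xN; have [h h0 hU] := Uop x Ux.
    have [j [c' [dc' xc' sub]]] := dyadic_small l0 h0 xQ.
    exact: (Jout x j c' xQ xN dc' xc' (subset_trans sub hU)).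
  by split; [exact: iU|exact: (dyadicS l0 di)].
exact: measurable_dyadic_bigcup.
Qed.

Lemma L2_integrable (f : Rn -> R) (c : Rn) (s : R) : L2 f ->
  (forall x, ~ hcube c s x -> f x = 0) ->
  leb.-integrable setT (EFin \o f).
Proof.
move=> /L2P[mf f2] fs; apply/integrableP; split; first exact: mfunE.
have mQ := measurable_hcube c s.
apply: (@le_lt_trans _ _ (\int[leb]_x ((\1_(hcube c s) x)%:E + ((f x) ^+ 2)%:E))%E).
  apply: leintT => [x|x]; first exact: abse_ge0.
  rewrite /= lee_fin indicE.
  have [xQ|xQ] := boolP (x \in _).
    by rewrite -[f x ^+ 2]real_normK ?num_real//=; have := sqr_ge0 (`|f x| - 1); nra.
  by rewrite fs ?normr0 ?add0r ?expr0n// => /mem_set; apply/negP.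
rewrite intD; [|exact: mfunE (mfun1 mQ)|exact: mfunE (mfunX 2 mf)
  |by move=> x; rewrite lee_fin indicE|by move=> x; rewrite lee_fin sqr_ge0].
by rewrite lte_add_pinfty// integral_leb_indic// leb_hcube_lty.
Qed.

Lemma sqint_lin (a : R) (f g : Rn -> R) : mfun f -> mfun g ->
  (sqint (fun x => a * f x + g x)%R <= (2 * a ^+ 2)%:E * sqint f + 2%:E * sqint g)%E.
Proof.
move=> mf mg.
have p0 (h : Rn -> R) x : (0 <= ((h x)^+2)%:E)%E by rewrite lee_fin sqr_ge0.
have a0 : (0 <= (2 * a ^+ 2)%:E)%E by rewrite lee_fin mulr_ge0// sqr_ge0.
have mf2 := mfunE (mfunX 2 mf); have mg2 := mfunE (mfunX 2 mg).
have -> : ((2 * a ^+ 2)%:E * sqint f = \int[leb]_x ((2 * a ^+ 2)%:E * ((f x) ^+ 2)%:E))%E.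
  by rewrite (intZ mf2 _ (p0 f))// mulr_ge0// sqr_ge0.
have -> : (2%:E * sqint g = \int[leb]_x (2%:E * ((g x) ^+ 2)%:E))%E.
  by rewrite (intZ mg2 _ (p0 g)).
rewrite -intD; [|exact: measurable_funeM mf2|exact: measurable_funeM mg2
  |by move=> x; exact: mule_ge0 a0 (p0 f x)|by move=> x; exact: mule_ge0 _ (p0 g x)].
apply: leintT => x; first exact: (p0 (fun x => a * f x + g x)).
rewrite -!EFinM -EFinD lee_fin.
by have := sqr_ge0 (a * f x - g x); nra.
Qed.

Lemma L2_lin (a : R) (f g : Rn -> R) : L2 f -> L2 g -> L2 (fun x => a * f x + g x).
Proof.
move=> /L2P[mf f2] /L2P[mg g2]; apply/L2P; split; first exact: (mfunD (mfunZ a mf) mg).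
apply: le_lt_trans (sqint_lin a mf mg) _.
by apply: lte_add_pinfty; apply: lte_mul_pinfty => //; rewrite lee_fin mulr_ge0// sqr_ge0.
Qed.

Lemma L2_0 : L2 (fun _ : Rn => 0 : R).
Proof.
apply/L2P; split; first exact: mfun_cst.
by rewrite /sqint; under eq_integral do rewrite expr0n/=; rewrite integral0.
Qed.

Lemma L2D (f g : Rn -> R) : L2 f -> L2 g -> L2 (fun x => f x + g x).
Proof.
by move=> hf hg; have := L2_lin 1 hf hg; congr L2; apply/funext => x; rewrite mul1r.
Qed.

Lemma L2B (f g : Rn -> R) : L2 f -> L2 g -> L2 (fun x => f x - g x).
Proof.
move=> hf hg; have := L2_lin (-1) hg hf; congr L2; apply/funext => x.
by rewrite mulN1r addrC.
Qed.

Lemma L2_sum (I : Type) (r : seq I) (f : I -> Rn -> R) :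
  (forall i, L2 (f i)) -> L2 (fun x => \sum_(i <- r) f i x).
Proof.
move=> hf; elim: r => [|i r IH].
  by have := L2_0; congr L2; apply/funext => x; rewrite big_nil.
by have := L2D (hf i) IH; congr L2; apply/funext => x; rewrite big_cons.
Qed.

Lemma L2_dom (f g : Rn -> R) : mfun f -> L2 g ->
  (forall x, `|f x| <= `|g x|) -> L2 f.
Proof.
move=> mf /L2P[mg g2] fg; apply/L2P; split => //; apply: le_lt_trans g2.
apply: leintT => x; first by rewrite lee_fin sqr_ge0.
by rewrite lee_fin -real_normK ?num_real// -[leRHS]real_normK ?num_real// lerXn2r ?nnegrE.
Qed.

Lemma L2_mfun (f : Rn -> R) : L2 f -> mfun f. Proof. by case. Qed.

Lemma L2_restrict (f : Rn -> R) (D : set Rn) : measurable D -> L2 f ->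
  L2 (fun x => \1_D x * f x).
Proof.
move=> mD hf; apply: (L2_dom (mfunM (mfun1 mD) (L2_mfun hf)) hf).
by move=> x; rewrite normrM indicE; case: (_ \in _); rewrite ?normr1 ?mul1r ?normr0 ?mul0r.
Qed.

Lemma sqint_bounded (f : Rn -> R) (c : Rn) (s M : R) :
  (forall x, `|f x| <= M) -> (forall x, ~ hcube c s x -> f x = 0) ->
  (sqint f <= (M ^+ 2)%:E * leb (hcube c s))%E.
Proof.
move=> fM fs; have M0 : 0 <= M by exact: le_trans (fM 0).
rewrite -integral_leb_cst; last exact: measurable_hcube.
rewrite [leRHS]integral_mkcond; apply: leintT => x; first by rewrite lee_fin sqr_ge0.
rewrite patchE; case: ifPn => [_|/negP xs].
  by rewrite lee_fin -real_normK ?num_real// lerXn2r ?nnegrE.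
by rewrite fs ?expr0n// => /mem_set.
Qed.

Lemma L2_bounded (f : Rn -> R) (c : Rn) (s M : R) : mfun f ->
  (forall x, `|f x| <= M) -> (forall x, ~ hcube c s x -> f x = 0) -> L2 f.
Proof.
move=> mf fM fs; apply/L2P; split => //.
apply: le_lt_trans (sqint_bounded fM fs) _.
by apply: lte_mul_pinfty; rewrite ?leb_hcube_lty// lee_fin sqr_ge0.
Qed.

Lemma markov (f : Rn -> R) (lam : R) : 0 < lam -> mfun f ->
  (lam%:E * leb [set x : Rn | (lam < `|f x|)%R] <= \int[leb]_x `|f x|%:E)%E.
Proof.
move=> l0 mf; rewrite -integral_leb_cst; last exact: mfun_gt (mfun_norm mf).
rewrite integral_mkcond; apply: leintT => x; rewrite patchE; case: ifPn => //.
- by move=> _; rewrite lee_fin ltW.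
- by move=> /set_mem/= /ltW; rewrite lee_fin.
- by move=> _; rewrite lee_fin.
Qed.

Lemma markov_sq (f : Rn -> R) (lam : R) : 0 < lam -> mfun f ->
  ((lam ^+ 2)%:E * leb [set x : Rn | (lam < `|f x|)%R] <= sqint f)%E.
Proof.
move=> l0 mf; rewrite -integral_leb_cst; last exact: mfun_gt (mfun_norm mf).
rewrite integral_mkcond; apply: leintT => x; rewrite patchE; case: ifPn => //.
- by move=> _; rewrite lee_fin sqr_ge0.
- move=> /set_mem/= /ltW h; rewrite lee_fin -[leRHS]real_normK ?num_real//.
  by rewrite lerXn2r ?nnegrE// ltW.
- by move=> _; rewrite lee_fin sqr_ge0.
Qed.

End L2.

(** * The Calderon-Zygmund operator *)

Section enorm.
Context {R : realType} {n : nat}.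
Local Notation Rn := (Rn R n.+1).
Implicit Types x y : Rn.

Lemma enorm_ge0 x : 0 <= enorm x. Proof. exact: sqrtr_ge0. Qed.

Lemma enorm_ge x i : `|x ord0 i| <= enorm x.
Proof.
rewrite -sqrtr_sqr ler_wsqrtr// (bigD1 i)//= lerDl sumr_ge0// => j _.
exact: sqr_ge0.
Qed.

Lemma enorm_le x (M : R) : 0 <= M -> (forall i, `|x ord0 i| <= M) ->
  enorm x <= n.+1%:R * M.
Proof.
move=> M0 xM; rewrite -[leRHS]ger0_norm ?mulr_ge0// -sqrtr_sqr ler_wsqrtr//.
apply: (@le_trans _ _ (\sum_(i < n.+1) M ^+ 2)).
  by apply: ler_sum => i _; rewrite -real_normK ?num_real// lerXn2r ?nnegrE.
rewrite sumr_const card_ord -[leLHS]mulr_natl exprMn ler_wpM2r ?sqr_ge0//.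
by rewrite -natrX ler_nat expnS expn1 leq_pmulr.
Qed.

Lemma enorm_lt x (M : R) : (forall i, `|x ord0 i| < M) -> enorm x < n.+1%:R * M.
Proof.
move=> xM.
have [i0 _ imax] := @arg_maxP _ _ _ (ord0 : 'I_n.+1) xpredT (fun i => `|x ord0 i|) erefl.
have : enorm x <= n.+1%:R * `|x ord0 i0| by apply: enorm_le => // i; exact: imax.
by move/le_lt_trans; apply; rewrite ltr_pM2l.
Qed.

End enorm.

(** * The Dini condition as a sum over dyadic scales *)

Section dini.
Context {R : realType} (omega : R -> R).
Hypotheses (homega : modulus_of_continuity omega) (hdini : dini omega).

Lemma omega_ge0 (t : R) : 0 <= t <= 1 -> 0 <= omega t.
Proof. by move=> t01; have [_ + _ _ _] := homega; apply; rewrite in_itv. Qed.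

Lemma omega_le (s t : R) : 0 <= s -> s <= t -> t <= 1 -> omega s <= omega t.
Proof.
move=> s0 st t1; have [_ _ + _ _] := homega; apply => //; rewrite in_itv/=.
  by rewrite s0 (le_trans st t1).
by rewrite t1 (le_trans s0 st).
Qed.

Lemma exp2V_itv (j : nat) : 0 < (2 ^- j : R) <= 1.
Proof. by rewrite invr_gt0 exprn_gt0//= invf_le1 ?exprn_gt0// exprn_ege1// ler1n. Qed.

(** The block [I j] has length 2^-(j+1), and on it omega t / t is at least omega (2^-(j+1)) 2^j, so
    it contributes at least omega (2^-(j+1)) / 2 to the integral. The step functions [g N] collect
    the first N blocks. *)
Lemma dini_sum : exists2 W : R, 0 < W &
  forall N, \sum_(1 <= j < N) omega (2 ^- j) <= W.
Proof.
have w0 j : 0 <= omega (2 ^- j).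
  by have /andP[p0 p1] := exp2V_itv j; rewrite omega_ge0// p1 ltW.
pose I j := `](2 ^- j.+1 : R), 2 ^- j]%classic.
pose c j := omega (2 ^- j.+1) * 2 ^+ j.
have c0 j : 0 <= c j by rewrite mulr_ge0// exprn_ge0.
pose g N t := \sum_(0 <= j < N) c j * \1_(I j) t.
have gP N t : (t <= 2 ^- N -> g N t = 0) /\
    (2 ^- N < t -> t <= 1 -> g N t <= omega t / t).
  elim: N => [|N [IH0 IH1]].
    rewrite /g big_nil; split=> //; rewrite expr0 invr1 => t1 t2.
    by move: (lt_le_trans t1 t2); rewrite ltxx.
  have /andP[p0 p1] := exp2V_itv N; have /andP[q0 q1] := exp2V_itv N.+1.
  have qp : 2 ^- N.+1 <= 2 ^- N :> R.
    by rewrite lef_pV2 ?posrE ?exprn_gt0// ler_weXn2l// ler1n.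
  have gS : g N.+1 t = g N t + c N * \1_(I N) t by rewrite /g big_nat_recr.
  have IE : \1_(I N) t = ((2 ^- N.+1 < t) && (t <= 2 ^- N))%:R :> R.
    rewrite indicE; congr (nat_of_bool _)%:R; apply/idP/idP.
      by move=> /set_mem; rewrite /I/= in_itv.
    by move=> h; apply/mem_set; rewrite /I/= in_itv.
  rewrite gS IE; split=> [tq|qt t1].
    by rewrite IH0 ?(le_trans tq)// ltNge tq/= mulr0 addr0.
  rewrite qt/=; have [tp|pt] := leP t (2 ^- N); last by rewrite mulr0 addr0 IH1.
  rewrite IH0// add0r mulr1 /c; have t0 := lt_trans q0 qt.
  rewrite ler_pM//; first by rewrite omega_le// ltW.
  by rewrite -[leLHS]invrK lef_pV2// posrE invr_gt0 exprn_gt0.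
have mI j : measurable (I j) by exact: measurable_itv.
have g0 N t : 0 <= g N t.
  by rewrite /g sumr_ge0// => j _; rewrite mulr_ge0// indicE.
have LI j : lebesgue_measure (I j) = (2 ^- j.+1)%:E.
  have /andP[q0 _] := exp2V_itv j.+1.
  rewrite lebesgue_measure_itv/= lte_fin ltf_pV2 ?posrE ?exprn_gt0//.
  rewrite ltr_eXn2l ?ltr1n// ltnSn -EFinB; congr _%:E.
  have -> : 2 ^- j = 2 * 2 ^- j.+1 :> R by rewrite exprS invfM mulrA divff// mul1r.
  by lra.
have step N : (((\sum_(0 <= j < N) omega (2 ^- j.+1)) / 2)%:E <=
    \int[lebesgue_measure]_(t in `]0%R, 1%R]) (omega t / t)%:E)%E.
  have -> : (((\sum_(0 <= j < N) omega (2 ^- j.+1)) / 2)%:E =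
     \int[lebesgue_measure]_t (g N t)%:E)%E.
    under eq_integral do rewrite /g -sumEFin.
    rewrite (@ge0_integral_sum _ _ _ lebesgue_measure setT measurableT nat
      (fun j t => (c j * \1_(I j) t)%:E)); last 2 first.
    - move=> j; apply/measurable_EFinP/measurable_funM; first exact: measurable_cst.
      by apply: measurable_indic; exact: mI.
    - by move=> j t _; rewrite lee_fin mulr_ge0// indicE.
    rewrite mulr_suml -sumEFin; apply: eq_bigr => j _.
    under eq_integral do rewrite EFinM.
    rewrite ge0_integralZl; [|exact: measurableT
      |by apply/measurable_EFinP; apply: measurable_indic; exact: mI
      |by move=> t _; rewrite lee_fin indicE|by rewrite lee_fin].
    rewrite (integral_indic_setT (mI j) (LI j)) -EFinM /c; congr _%:E.
    rewrite -mulrA; congr (_ * _); rewrite exprS invfM mulrCA mulrV ?mulr1//.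
    by rewrite unitfE expf_neq0.
  rewrite [leRHS]integral_mkcond; apply: leintT => t; first by rewrite lee_fin.
  rewrite patchE; case: ifPn => [/set_mem|/negP tI].
    rewrite /= in_itv/= lee_fin => /andP[t0 t1].
    have [tN|Nt] := leP t (2 ^- N); last by have [_ ->] := gP N t.
    have [-> // _] := gP N t; apply: divr_ge0; last exact: ltW.
    by rewrite omega_ge0// t1 ltW.
  rewrite lee_fin; have [tN|Nt] := leP t (2 ^- N); first by have [->] := gP N t.
  have [t1|t1] := leP t 1.
    exfalso; apply: tI; apply/mem_set; rewrite /= in_itv/= t1 andbT.
    by apply: lt_trans Nt; have /andP[] := exp2V_itv N.
  rewrite /g big1// => j _; rewrite indicE memNset ?mulr0//.
  rewrite /I/= in_itv/= => /andP[_ tj]; have /andP[_ /(le_trans tj)] := exp2V_itv j.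
  by rewrite leNgt t1.
have dfin : (\int[lebesgue_measure]_(t in `]0%R, 1%R]) (omega t / t)%:E)%E \is a fin_num.
  rewrite ge0_fin_numE//; apply: le_trans (step 0%N).
  by rewrite big_nil mul0r.
exists (2 * fine (\int[lebesgue_measure]_(t in `]0%R, 1%R]) (omega t / t)%:E)%E + 1).
  rewrite ltr_wpDl// mulr_ge0// fine_ge0//; apply: le_trans (step 0%N).
  by rewrite big_nil mul0r.
move=> N; have := step N; rewrite -(fineK dfin) lee_fin.
have : \sum_(1 <= j < N) omega (2 ^- j) <= \sum_(0 <= j < N) omega (2 ^- j.+1).
  case: N => [|N]; first by rewrite !big_geq.
  by rewrite big_add1/= [leRHS]big_nat_recr//= lerDl.
lra.
Qed.
End dini.

Section CZop.
Context {R : realType} {n : nat}.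
Local Notation Rn := (Rn R n.+1).
Local Notation leb := (@lebesgue_Rn R n.+1).

Record CZop (omega : R -> R) (T : (Rn -> R) -> Rn -> R) (K : Rn -> Rn -> R) : Prop := {
  cz_omega : modulus_of_continuity omega;
  cz_dini : dini omega;
  cz_lin : forall (a : R) f g, L2 f -> L2 g ->
    {ae leb, forall x, T (fun x => a * f x + g x) x = a * T f x + T g x};
  cz_bd : exists2 C : R, 0 < C & forall f, L2 f -> L2 (T f) /\
    ('N[leb]_2%:E[EFin \o T f] <= C%:E * 'N[leb]_2%:E[EFin \o f])%E;
  cz_K : CZ_kernel omega K;
  cz_rep : forall f, L2 f -> \forall x \ae leb, ~ closure [set y | f y != 0] x ->
    T f x = \int[leb]_y (K x y * f y) }.

Lemma CZ_operatorP omega T : modulus_of_continuity omega -> dini omega ->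
  CZ_operator omega T -> exists K, CZop omega T K.
Proof.
move=> mo di [lin bd [K hK rep]]; exists K; split => // a f g hf hg.
by apply: filterS (lin a f g hf hg) => x /(_ I).
Qed.

Context {omega : R -> R} {T : (Rn -> R) -> Rn -> R} {K : Rn -> Rn -> R}.
Hypothesis cz : CZop omega T K.

Let homega := cz_omega cz.
Let hdini := cz_dini cz.
Let Tlin := cz_lin cz.
Let Tbd := cz_bd cz.
Let hK := cz_K cz.
Let Trep := cz_rep cz.

Lemma T_sq : exists2 C : R, 0 < C & forall f, L2 f -> L2 (T f) /\
  (sqint (T f) <= C%:E * sqint f)%E.
Proof.
have [C C0 H] := Tbd; exists (C ^+ 2); first by rewrite exprn_gt0.
move=> f hf; have [hTf le] := H f hf; split => //.
have C0' : (0 <= C%:E)%E by rewrite lee_fin ltW.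
rewrite -!powR_Lnorm2 (_ : (C ^+ 2)%:E = C%:E `^ 2)%E; last first.
  by rewrite poweR_EFin powR_mulrn// ltW.
rewrite -poweRM ?Lnorm_ge0//; apply: gt0_ler_poweR => //.
- by rewrite in_itv/= leey Lnorm_ge0.
- by rewrite in_itv/= leey mule_ge0// Lnorm_ge0.
Qed.

Lemma L2_T f : L2 f -> L2 (T f).
Proof. by move=> hf; have [C _ H] := T_sq; have [] := H f hf. Qed.

Lemma sqint0_ae (f : Rn -> R) : mfun f -> sqint f = 0%E -> {ae leb, forall x, f x = 0}.
Proof.
move=> mf f0.
have mf2 := mfunE (mfunX 2 mf).
have /(ae_eq_integral_abs leb measurableT mf2) : (\int[leb]_x `|((f x) ^+ 2)%:E| = 0)%E.
  rewrite -[RHS]f0; apply: eq_integral => x _ /=.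
  by rewrite ger0_norm// sqr_ge0.
by apply: filterS => x /(_ I)/= [/eqP]; rewrite sqrf_eq0 => /eqP.
Qed.

Lemma T_sub f g : L2 f -> L2 g ->
  {ae leb, forall x, T (fun x => f x - g x) x = T f x - T g x}.
Proof.
move=> hf hg; have := Tlin (-1) hg hf.
have -> : (fun x => -1 * g x + f x) = (fun x => f x - g x).
  by apply/funext => x; rewrite mulN1r addrC.
by apply: filterS => x ->; rewrite mulN1r addrC.
Qed.

(** [T] acts on functions, not on classes; linearity and boundedness make it respect equality almost
    everywhere. *)
Lemma T_ae f g : L2 f -> L2 g -> {ae leb, forall x, f x = g x} ->
  {ae leb, forall x, T f x = T g x}.
Proof.
move=> hf hg fg; have hfg := L2B hf hg.
have [C C0 /(_ _ hfg)[hT le]] := T_sq.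
have fg0 : sqint (fun x => f x - g x) = 0%E.
  rewrite /sqint -[RHS](integral0 leb setT); apply: ae_eq_int.
  - by move=> x; rewrite lee_fin sqr_ge0.
  - by [].
  - by apply: filterS fg => x ->; rewrite subrr expr0n.
have T0 : sqint (T (fun x => f x - g x)) = 0%E.
  by apply/eqP; rewrite eq_le sqint_ge0 andbT; move: le; rewrite fg0 mule0.
have := sqint0_ae (L2_mfun hT) T0; have := T_sub hf hg.
by apply: filterS2 => x -> /eqP; rewrite subr_eq0 => /eqP.
Qed.

Lemma T_0 : {ae leb, forall x, T (fun=> 0) x = 0}.
Proof.
have := T_sub L2_0 L2_0; rewrite (_ : (fun x => 0 - 0) = (fun=> 0 : R)).
  by apply: filterS => x ->; rewrite subrr.
by apply/funext => x; rewrite subrr.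
Qed.

Lemma T_sum (I : Type) (r : seq I) (f : I -> Rn -> R) : (forall i, L2 (f i)) ->
  {ae leb, forall x, T (fun x => \sum_(i <- r) f i x) x = \sum_(i <- r) T (f i) x}.
Proof.
move=> hf; elim: r => [|i r IH].
  rewrite (_ : (fun x => _) = (fun=> 0 : R)); last by apply/funext => x; rewrite big_nil.
  by apply: filterS T_0 => x ->; rewrite big_nil.
have := Tlin 1 (hf i) (L2_sum r hf).
rewrite (_ : (fun x => 1 * f i x + \sum_(i <- r) f i x) =
  (fun x => \sum_(i <- i :: r) f i x)); last first.
  by apply/funext => x; rewrite big_cons mul1r.
by move: IH; apply: filterS2 => x IH ->; rewrite big_cons IH mul1r.
Qed.

Lemma cube_far (x y : Rn) (d : R) : ~ cube (x - const_mx d) (2 * d) y ->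
  exists i, d < `|x ord0 i - y ord0 i|.
Proof.
move=> xy; apply: contrapT => H; apply: xy => i; rewrite !mxE.
have : ~~ (d < `|x ord0 i - y ord0 i|) by apply/negP => h; apply: H; exists i.
by rewrite -leNgt ler_norml => /andP[h1 h2]; apply/andP; split; lra.
Qed.

(** Vanishing on a cube around [x] puts [x] off the closed support. The exceptional null set serves
    all [d] at once. *)
Lemma T_rep f : L2 f -> {ae leb, forall x, forall d, 0 < d ->
  (forall y, cube (x - const_mx d) (2 * d) y -> f y = 0) ->
  T f x = \int[leb]_y (K x y * f y)}.
Proof.
move=> hf; apply: filterS (Trep hf) => x H d d0 fx; apply: H.
move=> /(_ (ball x d) (nbhsx_ballx x d d0))[y [/= /eqP fy]]; move=> xy0; have [_ xy] := xy0.
apply: fy; apply: fx => i; have := xy ord0 i; rewrite /ball/= !mxE ltr_norml => /andP[x1 x2].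
by apply/andP; split; lra.
Qed.

(** Translates coordinatewise distances, which suit cubes, into the Euclidean ones of the kernel
    condition; the factor [n.+1] compares the Euclidean norm with the maximum norm. *)
Lemma Kdiff (x x' y : Rn) (s rho : R) (j : nat) : (1 <= j)%N -> 0 < s ->
  (forall i, `|x ord0 i - x' ord0 i| < s) -> 2 ^+ j * (n.+1%:R * s) <= rho ->
  (exists i, rho <= `|x ord0 i - y ord0 i|) ->
  `|K x y - K x' y| + `|K y x - K y x'| <= omega (2 ^- j) * rho ^- n.+1.
Proof.
move=> j1 s0 xx' jr [i hi].
have ns0 : 0 < n.+1%:R * s by rewrite mulr_gt0.
have rho0 : 0 < rho by apply: lt_le_trans jr; rewrite mulr_gt0// exprn_gt0.
have e1 : enorm (x - x') < n.+1%:R * s by apply: enorm_lt => k; rewrite !mxE.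
have e2 : rho <= enorm (x - y).
  by apply: le_trans hi _; have := enorm_ge (x - y) i; rewrite !mxE.
have j2 : 2 <= 2 ^+ j :> R.
  by rewrite -{1}(expr1 2) ler_weXn2l// ler1n.
have lt2 : 2 * enorm (x - x') < enorm (x - y) by nra.
have [_ /(_ x x' y lt2)] := hK; move/le_trans; apply.
have /andP[p0 p1] := exp2V_itv (R := R) j.
have xy0 : 0 < enorm (x - y) by exact: lt_le_trans e2.
have r0 : 0 <= enorm (x - x') / enorm (x - y) by rewrite divr_ge0 ?enorm_ge0.
have rj : enorm (x - x') / enorm (x - y) <= 2 ^- j.
  rewrite ler_pdivrMr// mulrC ler_pdivlMr ?exprn_gt0// mulrC.
  by apply: le_trans e2; apply: le_trans jr; rewrite ler_pM2l ?exprn_gt0// ltW.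
apply: ler_pM.
- by rewrite omega_ge0// r0 (le_trans rj).
- by rewrite invr_ge0 exprn_ge0// ltW.
- exact: omega_le.
- by rewrite lef_pV2 ?posrE ?exprn_gt0// lerXn2r ?nnegrE// ltW.
Qed.

(** Otherwise the Dini sums would contain arbitrarily many terms that exceed [e]. *)
Lemma omega_cvg0 (e : R) : 0 < e -> exists2 j : nat, (1 <= j)%N & omega (2 ^- j) <= e.
Proof.
move=> e0; have [W W0 HW] := dini_sum homega hdini.
pose M := (Num.trunc (W / e)).+1.
apply: contrapT => H.
have lt j : (1 <= j)%N -> e <= omega (2 ^- j).
  by move=> j1; rewrite leNgt; apply/negP => h; apply: H; exists j => //; exact: ltW.
have : \sum_(1 <= j < M.+1) e <= W.
  apply: le_trans (HW M.+1); rewrite big_nat_cond [leRHS]big_nat_cond.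
  by apply: ler_sum => j /andP[/andP[j1 _] _]; exact: lt.
rewrite sumr_const_nat subn1/= -mulr_natl -ler_pdivlMr//.
have /andP[_] := truncn_itv (ltW (divr_gt0 W0 e0)).
by rewrite -/M => /lt_le_trans h /h; rewrite ltxx.
Qed.

(** By the kernel condition [K x] is continuous off [x], so its strict superlevel sets there are
    open. The indicator erases the value [K x x], about which nothing is known. *)
Lemma K_mfun (x : Rn) : mfun (fun y => \1_(~` [set x]) y * K x y).
Proof.
have mO (r : R) (s : bool) : measurable [set y : Rn | y <> x /\ (r < (-1) ^+ s * K x y)].
  apply: measurable_open_cubes => y [yx ry].
  have /rowP/existsNP[i /eqP xyi] : x <> y by move=> e; apply: yx.
  pose rho := `|y ord0 i - x ord0 i|.
  have rho0 : 0 < rho by rewrite normr_gt0 subr_eq0 eq_sym.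
  pose e := ((-1) ^+ s * K x y - r) * rho ^+ n.+1 / 2.
  have e0 : 0 < e by rewrite divr_gt0// mulr_gt0 ?exprn_gt0// subr_gt0.
  have [j j1 oj] := omega_cvg0 e0.
  (* [2 * h] is the largest side for which [Kdiff] applies at distance [rho]; after division by
     rho^N, with N the dimension, [e] is half of the margin in the inequality at [y]. *)
  pose h := rho / (2 ^+ j * n.+1%:R) / 2.
  have h0 : 0 < h by rewrite !divr_gt0// mulr_gt0// exprn_gt0.
  exists h => // z zh.
  have zy k : `|y ord0 k - z ord0 k| < 2 * h.
    by have := zh k; rewrite !mxE => /andP[z1 z2]; rewrite ltr_norml; apply/andP; split; lra.
  have hr : 2 ^+ j * (n.+1%:R * (2 * h)) <= rho.
    rewrite le_eqVlt; apply/orP; left; apply/eqP; rewrite /h.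
    have : 2 ^+ j != 0 :> R by rewrite expf_neq0.
    have : n.+1%:R != 0 :> R by rewrite pnatr_eq0.
    by move: (2 ^+ j) (n.+1%:R : R) => u v v0 u0; field; rewrite u0 v0.
  have := Kdiff j1 (_ : 0 < 2 * h) zy hr (ex_intro _ i (lexx _)).
  have h20 : 0 < 2 * h by rewrite mulr_gt0.
  move=> /(_ h20) kd.
  have kz : `|K x y - K x z| < (-1) ^+ s * K x y - r.
    apply: (@le_lt_trans _ _ (e * rho ^- n.+1)).
      apply: le_trans (_ : omega (2 ^- j) * rho ^- n.+1 <= _); last first.
        by rewrite ler_wpM2r// invr_ge0 exprn_ge0// ltW.
      by apply: le_trans kd; rewrite lerDr.
    rewrite /e mulrAC mulfK ?expf_neq0 ?gt_eqF// ltr_pdivrMr// ltr_pMr ?ltr1n//.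
    by rewrite subr_gt0.
  split.
    move=> zx; have := zy i; rewrite zx -/rho => rh.
    have : 2 * h <= 2 ^+ j * (n.+1%:R * (2 * h)).
      by rewrite mulrA ler_peMl ?(ltW h20)// -natrX -natrM ler1n muln_gt0 expn_gt0.
    by move=> /le_trans/(_ hr); rewrite leNgt rh.
  move: kz ry; case: (s); rewrite ?expr1 ?expr0 ?mulN1r ?mul1r ltr_norml => /andP[]; lra.
apply: (measurability _ (RGenOInfty.measurableE R)).
move=> _ [_ [r ->] <-]; rewrite setTI.
have mx : measurable [set x].
  rewrite (_ : [set x] = cube x 0); first exact: measurable_cube.
  apply/seteqP; split=> [y -> i|y H]; first by rewrite addr0 lexx.
  by apply/rowP => i; have := H i; rewrite addr0 => /le_anti.
have [r0|r0] := ltP r 0.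
  rewrite (_ : _ @^-1` _ = [set x] `|` [set y : Rn | y <> x /\ (r < (-1) ^+ false * K x y)]).
    by apply: measurableU => //; exact: mO.
  apply/seteqP; split=> y/=; rewrite in_itv/= andbT indicE.
    have [->|/eqP yx] := eqVneq y x; first by left.
    by rewrite mem_set// !mul1r => ?; right.
  case=> [->|[yx]]; first by rewrite memNset/= ?mul0r// => /(_ erefl).
  by rewrite mem_set// !mul1r.
rewrite (_ : _ @^-1` _ = [set y : Rn | y <> x /\ (r < (-1) ^+ false * K x y)]); first exact: mO.
apply/seteqP; split=> y/=; rewrite in_itv/= andbT indicE.
  have [->|/eqP yx] := eqVneq y x; last by rewrite mem_set// !mul1r.
  by rewrite memNset/= ?mul0r ?ltNge ?r0// => /(_ erefl).
by case=> yx; rewrite mem_set// !mul1r.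
Qed.

Lemma K_mul_mfun (x : Rn) (f : Rn -> R) : mfun f -> f x = 0 -> mfun (fun y => K x y * f y).
Proof.
move=> mf fx; have := mfunM (K_mfun x) mf; congr mfun; apply/funext => y.
rewrite indicE; have [->|/eqP yx] := eqVneq y x; first by rewrite fx !mulr0.
by rewrite mem_set// mul1r.
Qed.

Lemma K_integrable (x : Rn) (d : R) (f : Rn -> R) : leb.-integrable setT (EFin \o f) ->
  0 < d -> (forall y, cube (x - const_mx d) (2 * d) y -> f y = 0) ->
  leb.-integrable setT (EFin \o (fun y => K x y * f y)).
Proof.
move=> intf d0 fx; have /integrableP[/measurable_EFinP mf _] := intf.
have fxx : f x = 0.
  by apply: fx => i; rewrite !mxE; apply/andP; split; lra.
have [[CK CK0 HK] _] := hK.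
apply: (@le_integrable _ _ _ leb setT measurableT _ (EFin \o (fun y => CK * d ^- n.+1 * f y))).
- exact: mfunE (K_mul_mfun mf fxx).
- move=> y _ /=; rewrite lee_fin !normrM.
  have [yx|/cube_far[i hi]] := pselect (cube (x - const_mx d) (2 * d) y).
    by rewrite fx// normr0 !mulr0.
  rewrite ler_wpM2r//.
  have xy : x != y by apply/eqP => e; move: hi; rewrite e subrr normr0 ltNge ltW.
  apply: le_trans (HK x y xy) _; rewrite (gtr0_norm CK0) ler_wpM2l ?(ltW CK0)//.
  rewrite ger0_norm ?invr_ge0 ?exprn_ge0 ?(ltW d0)//.
  have de : d <= enorm (x - y).
    by apply: le_trans (ltW hi) _; have := enorm_ge (x - y) i; rewrite !mxE.
  rewrite lef_pV2 ?posrE ?exprn_gt0//; last exact: lt_le_trans de.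
  by rewrite lerXn2r// nnegrE ?enorm_ge0// ltW.
- exact: (@integrableZl _ _ _ leb setT measurableT (CK * d ^- n.+1) _ intf).
Qed.

(** As [b] has mean zero, [K x c] may be subtracted from the kernel, and its regularity in the
    second variable gives the factor omega (2^-j) at distance 2^j N s. *)
Lemma T_atom (c : Rn) (s : R) (b : Rn -> R) : 0 < s -> L2 b ->
  (forall x, ~ hcube c s x -> b x = 0) -> \int[leb]_y b y = 0 ->
  {ae leb, forall x, forall j, (1 <= j)%N ->
    (exists i : 'I_n.+1, 2 ^+ j * (n.+1%:R * s) <= `|(x : Rn) ord0 i - c ord0 i|) ->
    `|T b x| <= omega (2 ^- j) * (2 ^+ j * (n.+1%:R * s)) ^- n.+1 * \int[leb]_y `|b y|}.
Proof.
move=> s0 hb bs b0; have ib := L2_integrable hb bs.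
apply: (ae_mono (T_rep hb)) => x Tx j j1 far.
set rho := 2 ^+ j * _ in far *.
have s2 : 2 * s <= rho.
  rewrite /rho mulrA ler_pM2r//; apply: (@le_trans _ _ (2 ^+ 1 * 1)); first by rewrite mulr1.
  by apply: ler_pM => //; rewrite ?ler_weXn2l// ?ler1n.
have rho0 : 0 < rho by lra.
have vanish (z : Rn) : (z = x \/ z = x) -> forall y, cube (x - const_mx (s / 2)) (2 * (s / 2)) y -> b y = 0.
  move=> _ y xy; apply: bs => yc; have [i hi] := far.
  have := xy i; have := yc i; rewrite !mxE => /andP[y1 y2] /andP[y3 y4].
  by move: hi; rewrite leNgt ltr_norml => /negP; apply; apply/andP; split; lra.
have {}vanish := vanish x (or_introl erefl).
have s20 : 0 < s / 2 by rewrite divr_gt0.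
rewrite (Tx _ s20 vanish).
have iK := K_integrable ib s20 vanish.
have icb : leb.-integrable setT (EFin \o (fun y => K x c * b y)).
  exact: (@integrableZl _ _ _ leb setT measurableT (K x c) _ ib).
have -> : \int[leb]_y (K x y * b y) = \int[leb]_y (K x y * b y - K x c * b y).
  rewrite RintegralB//; rewrite [X in _ = _ - X](_ : _ = 0) ?subr0//.
  by rewrite RintegralZl// b0 mulr0.
have iD : leb.-integrable setT (EFin \o (fun y => K x y * b y - K x c * b y)).
  by have := integrableB measurableT iK icb.
apply: le_trans (le_normr_Rintegral measurableT iD) _.
have inb : leb.-integrable setT (EFin \o (fun y => `|b y|)).
  exact: integrable_norm.
rewrite -RintegralZl//; apply: le_Rintegral => //.
- exact: integrable_norm.
- exact: (@integrableZl _ _ _ leb setT measurableT _ _ inb).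
move=> y _; rewrite -mulrBl normrM.
have [yc|yc] := pselect (hcube c s y); last by rewrite (bs _ yc) normr0 !mulr0.
rewrite ler_wpM2r// distrC.
have := @Kdiff c y x s rho j j1 s0.
have cy i : `|c ord0 i - y ord0 i| < s.
  by have := yc i; rewrite ltr_norml => /andP[y1 y2]; apply/andP; split; lra.
have [i hi] := far.
have hi' : rho <= `|c ord0 i - x ord0 i| by rewrite distrC.
move=> /(_ cy (lexx _) (ex_intro _ i hi')); apply: le_trans.
by rewrite lerDr.
Qed.

(* The dilate by 4N + 1, N = n + 1, is large enough for the kernel estimates in the
   Euclidean norm to hold off it. *)
Definition dil (c : Rn) (s : R) : set Rn :=
  cube (c - const_mx (2 * n.+1%:R * s)) ((4 * n.+1%:R + 1) * s).

Lemma dilP c s x : dil c s x <-> forall i,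
  - (2 * n.+1%:R * s) <= x ord0 i - c ord0 i <= (2 * n.+1%:R + 1) * s.
Proof.
by split=> H i; have := H i; rewrite ?mxE => /andP[h1 h2]; apply/andP; split; lra.
Qed.

(** Shell j has measure at most (4 r j)^N, against the bound omega (2^-j) (r j)^-N for [T b] on it,
    with N the dimension; what remains is 4^N times the Dini sum. *)
Lemma T_atom_integral : exists2 C : R, 0 < C & forall (c : Rn) (s : R) (b : Rn -> R),
  0 < s -> L2 b -> (forall x, ~ hcube c s x -> b x = 0) -> \int[leb]_y b y = 0 ->
  (\int[leb]_(x in ~` dil c s) `|T b x|%:E <= (C * \int[leb]_y `|b y|)%:E)%E.
Proof.
have [W W0 HW] := dini_sum homega hdini.
exists (W * 4 ^+ n.+1); first by rewrite mulr_gt0// exprn_gt0.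
move=> c s b s0 hb bs b0.
set B := \int[leb]_y `|b y|.
have B0 : 0 <= B by apply: Rintegral_ge0.
pose r j := 2 ^+ j * (n.+1%:R * s).
have r0 j : 0 < r j by rewrite !mulr_gt0// exprn_gt0.
pose Q j := cube (c - const_mx (r j)) (2 * r j).
pose a j := omega (2 ^- j) * (r j) ^- n.+1 * B.
have a0 j : 0 <= a j.
  have /andP[p0 p1] := exp2V_itv (R := R) j.
  rewrite mulr_ge0// mulr_ge0//; first by rewrite omega_ge0// p1 ltW.
  by rewrite invr_ge0 exprn_ge0// ltW.
have mQ j : measurable (Q j) by exact: measurable_cube.
pose g x := (\sum_(0 <= j <oo) (a j.+1 * \1_(Q j.+2) x)%:E)%E.
have g0 x : (0 <= g x)%E.
  by apply: nneseries_ge0 => j _ _; rewrite lee_fin mulr_ge0// indicE.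
have mterm j : measurable_fun [set: Rn] (fun x => (a j * \1_(Q j.+1) x)%:E).
  exact: mfunE (mfunZ _ (mfun1 (mQ _))).
have mg : measurable_fun [set: Rn] g.
  apply: ge0_emeasurable_sum => [j x _ _|j _]; last exact: mterm.
  by rewrite lee_fin mulr_ge0// indicE.
have dom : {ae leb, forall x, ~ dil c s x -> (`|T b x|%:E <= g x)%E}.
  apply: (ae_mono (T_atom s0 hb bs b0)) => x Hx xd.
  have x1 : ~ Q 1%N x.
    move=> x1; apply: xd; apply/dilP => i; have := x1 i; rewrite !mxE /r expr1.
    by move=> /andP[h1 h2]; apply/andP; split; nra.
  have [j [xj xj1]] : exists j, ~ Q j.+1 x /\ Q j.+2 x.
    have [N HN] : exists N, Q N.+1 x.
      pose u := (\sum_i `|x ord0 i - c ord0 i|) / (n.+1%:R * s).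
      have u0 : 0 <= u by rewrite divr_ge0 ?sumr_ge0// mulr_ge0// ltW.
      exists (Num.trunc u) => i; rewrite !mxE.
      have xi : `|x ord0 i - c ord0 i| <= r (Num.trunc u).+1.
        apply: (@le_trans _ _ (u * (n.+1%:R * s))).
          rewrite /u divfK ?gt_eqF ?mulr_gt0//.
          by rewrite (bigD1 i)//= lerDl sumr_ge0.
        rewrite /r ler_wpM2r ?mulr_ge0 ?(ltW s0)//.
        have /andP[_ /ltW/le_trans] := truncn_itv u0; apply.
        by rewrite -natrX ler_nat ltnW// ltn_expl.
      by move: xi; rewrite ler_norml => /andP[h1 h2]; apply/andP; split; lra.
    elim: N HN => // N IH HN; have [h|h] := pselect (Q N.+1 x); first exact: IH.
    by exists N.
  have [i hi] := cube_far (x := c) xj.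
  have := Hx j.+1 isT; move=> /(_ (ex_intro _ i _)); rewrite distrC => /(_ (ltW hi)) le.
  apply: (@le_trans _ _ (a j.+1 * \1_(Q j.+2) x)%:E).
    by rewrite lee_fin indicE mem_set// mulr1.
  apply: (@nneseries_ge_term _ (fun j => (a j.+1 * \1_(Q j.+2) x)%:E)) => k.
  by rewrite lee_fin mulr_ge0// indicE.
have mT := mfun_norm (L2_mfun (L2_T hb)).
have mD : measurable (~` dil c s) by apply: measurableC; exact: measurable_cube.
apply: (@le_trans _ _ (\int[leb]_x g x)%E).
  apply: (@le_trans _ _ (\int[leb]_(x in ~` dil c s) g x)%E); last exact: leintS.
  apply: ae_ge0_le_integral => //.
  - exact: mfunED.
  - exact: measurable_funTS.
rewrite /g integral_nneseries; [|exact: measurableT|by move=> j; exact: mterm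
  |by move=> j x _; rewrite lee_fin mulr_ge0// indicE].
have term j : (\int[leb]_x (a j.+1 * \1_(Q j.+2) x)%:E)%E =
    (omega (2 ^- j.+1) * 4 ^+ n.+1 * B)%:E.
  under eq_integral do rewrite EFinM.
  rewrite intZ; [|exact: mfunE (mfun1 (mQ _))|exact: a0|by move=> x; rewrite lee_fin indicE].
  rewrite integral_leb_indic// lebesgue_cube; last by rewrite mulr_ge0// ltW.
  rewrite -EFinM /a; congr _%:E.
  rewrite (_ : 2 * r j.+2 = 4 * r j.+1); last by rewrite /r exprS; ring.
  move: (r j.+1) (r0 j.+1) => u u0; have : u ^+ n.+1 != 0 by rewrite expf_neq0// gt_eqF.
  by rewrite exprMn; move: (u ^+ n.+1) (4 ^+ n.+1 : R) => p q p0; field.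
rewrite (eq_eseriesr (fun j _ => term j)).
apply: lime_le; first by apply: is_cvg_nneseries => j _ _; rewrite lee_fin -?term;
  rewrite mulr_ge0// mulr_ge0// ?exprn_ge0// omega_ge0// ltW ?andbT; have /andP[] := exp2V_itv (R := R) j.+1.
near=> N.
rewrite sumEFin lee_fin -mulr_suml ler_wpM2r// -mulr_suml ler_wpM2r ?exprn_ge0//.
by apply: le_trans (HW N.+1); rewrite big_add1.
Unshelve. all: by end_near.
Qed.

End CZop.

Section integrals.
Context {R : realType} {n : nat}.
Local Notation Rn := (Rn R n.+1).
Local Notation leb := (@lebesgue_Rn R n.+1).

Lemma EFin_Rint (D : set Rn) (f : Rn -> R) : measurable D ->
  leb.-integrable D (EFin \o f) ->
  ((\int[leb]_(x in D) f x)%:E = \int[leb]_(x in D) (f x)%:E)%E.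
Proof. by move=> mD fi; rewrite /Rintegral fineK// integrable_fin_num. Qed.

Lemma int1 (D : set Rn) (f : Rn -> R) :
  (\int[leb]_(x in D) (f x)%:E = \int[leb]_x (\1_D x * f x)%:E)%E.
Proof.
rewrite integral_mkcond; apply: eq_integral => x _; rewrite patchE indicE.
by case: ifPn => _; rewrite ?mul1r ?mul0r.
Qed.

Lemma integral_cond_bigcup_le (J : set nat) (F : nat -> set Rn) (f : Rn -> \bar R) :
  (forall i, J i -> measurable (F i)) -> trivIset J F ->
  measurable_fun [set: Rn] f -> (forall x, 0 <= f x)%E ->
  (\sum_(0 <= i <oo | i \in J) \int[leb]_(x in F i) f x <= \int[leb]_x f x)%E.
Proof.
move=> mF tF mf f0; rewrite -ge0_integral_bigcup_cond//.
  by apply: leintS.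
exact: measurable_funTS.
Qed.

Lemma stop_parent (c c' : Rn) (s : R) (k : nat) (f : Rn -> R) (lam : R) : 0 < s ->
  (forall j c'', (j < k)%N -> dyadic c s j c'' ->
     hcube c' (s / 2 ^+ k) `<=` hcube c'' (s / 2 ^+ j) ->
     (\int[leb]_(x in hcube c'' (s / 2 ^+ j)) `|f x|%:E <=
        (lam * (s / 2 ^+ j) ^+ n.+1)%:E)%E) ->
  (0 < k)%N -> dyadic c s k c' ->
  (\int[leb]_(x in hcube c' (s / 2 ^+ k)) `|f x|%:E <=
        (2 ^+ n.+1 * lam * (s / 2 ^+ k) ^+ n.+1)%:E)%E.
Proof.
move=> s0 H; case: k H => // k H _ dc'; have [c'' dc'' sub] := dyadic_parent s0 dc'.
apply: (@le_trans _ _ (\int[leb]_(x in hcube c'' (s / 2 ^+ k)) `|f x|%:E)%E).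
  by apply: leintS => // x _; rewrite lee_fin.
apply: le_trans (H k c'' (ltnSn k) dc'' sub) _; rewrite lee_fin.
have -> : s / 2 ^+ k = 2 * (s / 2 ^+ k.+1).
  by rewrite exprS; field; rewrite expf_neq0.
by rewrite exprMn mulrA [lam * _]mulrC.
Qed.

Lemma atomP (h : Rn -> R) (c : Rn) (s : R) : 0 < s -> L2 h ->
  leb.-integrable setT (EFin \o h) ->
  let a : R := (\int[leb]_(x in hcube c s) h x) / s ^+ n.+1 in
  let b := fun x => \1_(hcube c s) x * (h x - a) in
  [/\ L2 b, (forall x, ~ hcube c s x -> b x = 0), \int[leb]_x b x = 0,
    ((`|a| * s ^+ n.+1)%:E <= \int[leb]_(x in hcube c s) `|h x|%:E)%E &
    ((\int[leb]_x `|b x|)%:E <= 2%:E * \int[leb]_(x in hcube c s) `|h x|%:E)%E].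
Proof.
move=> s0 hh ih a b.
have mP := measurable_hcube c s.
have sn0 : 0 < s ^+ n.+1 by rewrite exprn_gt0.
have lebP : leb (hcube c s) = (s ^+ n.+1)%:E by rewrite lebesgue_hcube// ltW.
have h1 : L2 (fun x => \1_(hcube c s) x * h x) by exact: L2_restrict.
have i1 : leb.-integrable setT (EFin \o (\1_(hcube c s) : Rn -> R)).
  apply/integrableP; split; first exact: mfunE (mfun1 mP).
  rewrite (eq_integral (fun x => (\1_(hcube c s) x)%:E)); last first.
    by move=> x _ /=; rewrite ger0_norm// indicE.
  by rewrite integral_leb_indic// lebP ltry.
have L1 : L2 (\1_(hcube c s) : Rn -> R).
  apply: (L2_bounded (mfun1 mP) (M := 1) (c := c) (s := s)).
    by move=> x; rewrite indicE; case: (_ \in _); rewrite ?normr1 ?normr0.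
  by move=> x xP; rewrite indicE memNset.
have bE : b = (fun x => (- a) * \1_(hcube c s) x + \1_(hcube c s) x * h x).
  by apply/funext => x; rewrite /b; ring.
have Lb : L2 b by rewrite bE; exact: L2_lin.
have bs x : ~ hcube c s x -> b x = 0 by move=> xP; rewrite /b indicE memNset// mul0r.
have ib := L2_integrable Lb bs.
have ih1 : leb.-integrable setT (EFin \o (fun x => \1_(hcube c s) x * h x)).
  by apply: (L2_integrable h1 (c := c) (s := s)) => x xP; rewrite indicE memNset// mul0r.
have iahP : leb.-integrable setT (EFin \o (fun x => - a * \1_(hcube c s) x)).
  exact: (@integrableZl _ _ _ leb setT measurableT (- a) _ i1).
have hPE : \int[leb]_(x in hcube c s) h x = \int[leb]_x (\1_(hcube c s) x * h x).
  by rewrite /Rintegral int1.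
have P1 : \int[leb]_x (\1_(hcube c s) x : R) = s ^+ n.+1.
  by rewrite /Rintegral integral_leb_indic// lebP.
have hPfin : (\int[leb]_(x in hcube c s) `|h x|%:E < +oo)%E.
  have /integrableP[_] := ih; apply: le_lt_trans; apply: leintS => // x _.
have hPfin' : (\int[leb]_(x in hcube c s) `|h x|%:E)%E \is a fin_num.
  by rewrite ge0_fin_numE//; apply: integral_ge0 => x _; rewrite lee_fin.
have ha : ((`|a| * s ^+ n.+1)%:E <= \int[leb]_(x in hcube c s) `|h x|%:E)%E.
  rewrite /a normrM normfV (gtr0_norm sn0) divfK ?gt_eqF//.
  rewrite -(fineK hPfin') lee_fin.
  have := @le_normr_Rintegral _ _ _ leb (hcube c s) h mP.
  by apply; exact: (integrableS measurableT mP _ ih).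
split => //.
- rewrite bE RintegralD// RintegralZl// P1 -hPE /a mulNr divfK ?gt_eqF// addNr//.
have inb : leb.-integrable setT (EFin \o (fun y => `|b y|)) by exact: integrable_norm.
rewrite EFin_Rint//.
apply: (@le_trans _ _ (\int[leb]_x (`|\1_(hcube c s) x * h x|%:E + `|a|%:E * (\1_(hcube c s) x)%:E)))%E.
  apply: leintT => x; first by rewrite lee_fin.
  rewrite -EFinM -EFinD lee_fin bE addrC; apply: le_trans (ler_normD _ _) _.
  by rewrite lerD2l [X in X <= _]normrM normrN [`|\1__ _|]ger0_norm// indicE.
have mh1 := L2_mfun h1.
rewrite intD; [|exact: mfunE (mfun_norm mh1)|exact: measurable_funeM (mfunE (mfun1 mP))
  |by move=> x; rewrite lee_fin|by move=> x; rewrite -EFinM lee_fin mulr_ge0// indicE].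
rewrite intZ; [|exact: mfunE (mfun1 mP)|by []|by move=> x; rewrite lee_fin indicE].
rewrite integral_leb_indic// lebP.
rewrite (_ : (\int[leb]_x `|\1_(hcube c s) x * h x|%:E)%E =
  (\int[leb]_(x in hcube c s) `|h x|%:E)%E); last first.
  by rewrite [RHS]int1; apply: eq_integral => x _; rewrite normrM [`|\1__ _|]ger0_norm// indicE.
by rewrite -EFinM (mule_natl _ 2) mule2n leeD2l.
Qed.

End integrals.

(** * Oscillation of T and the weak (1,1) inequality *)

Section weak_type.
Context {R : realType} {n : nat}.
Local Notation Rn := (Rn R n.+1).
Local Notation leb := (@lebesgue_Rn R n.+1).
Context {omega : R -> R} {T : (Rn -> R) -> Rn -> R} {K : Rn -> Rn -> R}.
Hypothesis cz : CZop omega T K.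

Lemma dil_hcube (c : Rn) (s : R) : 0 < s ->
  dil c s `<=` hcube (c - const_mx (2 * n.+1%:R * s)) ((4 * n.+1%:R + 2) * s).
Proof. by move=> s0 x /dilP H i; have := H i; rewrite !mxE => /andP[h1 h2]; apply/andP; split; lra. Qed.

(* If the averages of h over the dilated ancestors of the cube are at most t, then
   T h oscillates at most like t on it: each dyadic shell contributes omega (2 ^- j) t. *)
Lemma T_osc : exists2 W : R, 0 < W & forall (k : nat) (A : nat -> Rn) (s t : R) (h : Rn -> R),
  0 < s -> 0 <= t ->
  (forall j, (j <= k)%N -> hcube (A 0%N) s `<=` hcube (A j) (s * 2 ^+ j)) ->
  L2 h -> (forall x, ~ dil (A k) (s * 2 ^+ k) x -> h x = 0) ->
  (forall x, dil (A 0%N) s x -> h x = 0) ->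
  (forall j, (1 <= j <= k)%N ->
    \int[leb]_(x in dil (A j) (s * 2 ^+ j)) `|h x|%:E <= (t * (s * 2 ^+ j) ^+ n.+1)%:E)%E ->
  exists2 g : Rn -> R, {ae leb, forall x, hcube (A 0%N) s x -> T h x = g x} &
    forall x x', hcube (A 0%N) s x -> hcube (A 0%N) s x' -> `|g x - g x'| <= W * t.
Proof.
have [W W0 HW] := dini_sum (cz_omega cz) (cz_dini cz); exists W => //.
move=> k A s t h s0 t0 nest hh hk h0 avg.
have sk0 j : 0 < s * 2 ^+ j by rewrite mulr_gt0// exprn_gt0.
have ih : leb.-integrable setT (EFin \o h).
  apply: (L2_integrable hh) => x xN; apply: hk => xd; apply: xN.
  exact: dil_hcube xd.
have ns0 : 0 < n.+1%:R * s by rewrite mulr_gt0.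
have vanish x : hcube (A 0%N) s x ->
    forall y, cube (x - const_mx (n.+1%:R * s)) (2 * (n.+1%:R * s)) y -> h y = 0.
  move=> xP y xy; apply: h0; apply/dilP => i; have := xP i; have := xy i.
  by rewrite !mxE => /andP[y1 y2] /andP[x1 x2]; apply/andP; split; lra.
exists (fun x => \int[leb]_y (K x y * h y)).
  by apply: (ae_mono (T_rep cz hh)) => x Tx xP; exact: (Tx _ ns0 (vanish x xP)).
move=> x x' xP xP'.
have iK := K_integrable cz ih ns0 (vanish x xP).
have iK' := K_integrable cz ih ns0 (vanish x' xP').
rewrite -RintegralB//.
have iD : leb.-integrable setT (EFin \o (fun y => K x y * h y - K x' y * h y)).
  by have := integrableB measurableT iK iK'.
apply: le_trans (le_normr_Rintegral measurableT iD) _.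
rewrite -lee_fin EFin_Rint//; last exact: integrable_norm.
pose rho j := 2 ^+ j * (n.+1%:R * s).
pose a j := omega (2 ^- j) * rho j ^- n.+1.
have rho0 j : 0 < rho j by rewrite mulr_gt0// exprn_gt0.
have a0 j : 0 <= a j.
  have /andP[p0 p1] := exp2V_itv (R := R) j.
  rewrite mulr_ge0//; first by rewrite (omega_ge0 (cz_omega cz))// p1 ltW.
  by rewrite invr_ge0 exprn_ge0// ltW.
have mh := L2_mfun hh.
have md j : measurable (dil (A j) (s * 2 ^+ j)) by exact: measurable_cube.
have mterm j : mfun (fun y => \1_(dil (A j) (s * 2 ^+ j)) y * `|h y|).
  by apply: mfunM; [exact: mfun1|exact: mfun_norm].
apply: (@le_trans _ _ (\int[leb]_y \sum_(1 <= j < k.+1)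
    ((a j)%:E * (\1_(dil (A j) (s * 2 ^+ j)) y * `|h y|)%:E)))%E.
  apply: leintT => y; first by rewrite lee_fin.
  have terms0 j : (0 <= (a j)%:E * (\1_(dil (A j) (s * 2 ^+ j)) y * `|h y|)%:E)%E.
    by rewrite -EFinM lee_fin mulr_ge0// mulr_ge0// indicE.
  rewrite -mulrBl normrM.
  have [hy|hy] := eqVneq (h y) 0.
    by rewrite [in leLHS]hy normr0 mulr0; apply: sume_ge0 => j _; exact: terms0.
  have yk : dil (A k) (s * 2 ^+ k) y by apply: contrapT => /hk/eqP; rewrite (negbTE hy).
  have [j [/andP[j1 jk] [yj yj1]]] : exists j, (1 <= j <= k)%N /\
      dil (A j) (s * 2 ^+ j) y /\ ~ dil (A j.-1) (s * 2 ^+ j.-1) y.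
    have y0 : ~ dil (A 0%N) (s * 2 ^+ 0) y.
      by rewrite expr0 mulr1 => /h0/eqP; rewrite (negbTE hy).
    elim: k yk {nest hk avg iK iK' iD} => [|k IH] yk; first by [].
    have [yk'|yk'] := pselect (dil (A k) (s * 2 ^+ k) y).
      by have [j [/andP[j1 jk] H]] := IH yk'; exists j; split => //; rewrite j1 ltnW.
    by exists k.+1; rewrite ltnSn.
  rewrite (bigD1_seq j)/= ?mem_index_iota ?j1 ?ltnS ?iota_uniq//.
  rewrite -[leLHS]adde0; apply: leeD; last by apply: sume_ge0 => i _; exact: terms0.
  rewrite indicE mem_set// mul1r -EFinM lee_fin ler_wpM2r//.
  have j1E : j = j.-1.+1 by rewrite prednK.
  (* Off the dilate of the cube at [A j.-1], some coordinate of [y] is at least 2N sides away from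
     the whole cube, and 2N sides at level j - 1 are exactly [rho j]. *)
  have far : exists i, rho j <= `|x ord0 i - y ord0 i|.
    have : exists i, ~ (- (2 * n.+1%:R * (s * 2 ^+ j.-1)) <= y ord0 i - A j.-1 ord0 i <=
         (2 * n.+1%:R + 1) * (s * 2 ^+ j.-1)).
      by apply/existsNP => H; apply: yj1; apply/dilP.
    case=> i Hi; exists i; rewrite leNgt; apply/negP => lt; apply: Hi.
    have j1k : (j.-1 <= k)%N by rewrite (leq_trans (leq_pred j)).
    have := nest _ j1k x xP i; move: lt; rewrite /rho {1}j1E exprS ltr_norml.
    move: (2 ^+ j.-1) (sk0 j.-1) => u u0 /andP[x1 x2] /andP[x3 x4].
    by apply/andP; split; nra.
  have xx' i : `|x ord0 i - x' ord0 i| < s.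
    have := xP i; have := xP' i; rewrite ltr_norml => /andP[x1 x2] /andP[x3 x4].
    by apply/andP; split; lra.
  have := Kdiff cz j1 s0 xx' (lexx (rho j)) far; apply: le_trans.
  by rewrite lerDl.
rewrite (@ge0_integral_sum _ _ _ leb setT measurableT nat
    (fun j y => ((a j)%:E * (\1_(dil (A j) (s * 2 ^+ j)) y * `|h y|)%:E)%E)); last 2 first.
- by move=> j; exact: measurable_funeM (mfunE (mterm j)).
- by move=> j y _; rewrite -EFinM lee_fin mulr_ge0// mulr_ge0// indicE.
apply: (@le_trans _ _ (\sum_(1 <= j < k.+1) (omega (2 ^- j) * t)%:E)%E).
  rewrite big_nat_cond [leRHS]big_nat_cond; apply: lee_sum => j /andP[/andP[j1 jk] _].
  rewrite intZ; [|exact: mfunE (mterm j)|exact: a0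
    |by move=> y; rewrite lee_fin mulr_ge0// indicE].
  rewrite -int1; apply: (@le_trans _ _ ((a j)%:E * (t * (s * 2 ^+ j) ^+ n.+1)%:E))%E.
    by apply: lee_wpmul2l; [rewrite lee_fin|apply: avg; rewrite j1 -ltnS].
  have /andP[p0 p1] := exp2V_itv (R := R) j.
  have w0 : 0 <= omega (2 ^- j) by rewrite (omega_ge0 (cz_omega cz))// p1 ltW.
  rewrite -EFinM lee_fin /a -mulrA ler_wpM2l// mulrCA ler_piMr//.
  rewrite mulrC ler_pdivrMr ?exprn_gt0// mul1r lerXn2r ?nnegrE ?(ltW (rho0 j)) ?(ltW (sk0 j))// /rho.
  by rewrite [s * _]mulrC ler_pM2l ?exprn_gt0// ler_peMl ?(ltW s0)// ler1n.
by rewrite sumEFin lee_fin -mulr_suml ler_wpM2r.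
Qed.

(* Calderon-Zygmund decomposition with finitely many atoms: the tail, small in L2, is
   put in the good part, so that T need not commute with an infinite sum. *)
Lemma weak_type : exists2 C : R, 0 < C & forall (c : Rn) (s lam : R) (h : Rn -> R),
  0 < s -> 0 < lam -> L2 h -> (forall x, ~ hcube c s x -> h x = 0) ->
  (\int[leb]_x `|h x|%:E <= (lam * s ^+ n.+1)%:E)%E ->
  (lam%:E * leb [set x : Rn | (lam < `|T h x|)%R] <= C%:E * \int[leb]_x `|h x|%:E)%E.
Proof.
have [C0 C00 HC0] := T_sq cz; have [CA CA0 HCA] := T_atom_integral cz.
pose m := n.+1.
(* The three terms belong to the L2 estimate of the good part, the measure of the dilated cubes, and
   the atoms off these dilates. Here [m] is the dimension. *)
pose C := 4 * C0 * (4 ^+ m + 2) + (4 * m%:R + 1) ^+ m + 4 * CA.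
have n0 : 0 < m%:R :> R by rewrite ltr0n.
exists C.
  by rewrite !addr_gt0 ?mulr_gt0 ?exprn_gt0 ?addr_gt0 ?mulr_gt0 ?exprn_gt0.
move=> c s lam h s0 l0 hh hs hB.
have ih := L2_integrable hh hs.
have mh := L2_mfun hh.
have Bfin : (\int[leb]_x `|h x|%:E)%E \is a fin_num.
  rewrite ge0_fin_numE; last by apply: integral_ge0 => x _; rewrite lee_fin.
  by apply: le_lt_trans hB _; rewrite ltry.
set B := (\int[leb]_x `|h x|%:E)%E in hB Bfin *.
have B0 : (0 <= B)%E by apply: integral_ge0 => x _; rewrite lee_fin.
(* A null [h] is treated apart because the L2 tail will be made smaller than lam B, which has to be
   positive. *)
have [BE|BN] := eqVneq B 0%E.
  have h0 : {ae leb, forall x, h x = 0}.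
    have /(ae_eq_integral_abs leb measurableT (mfunE mh)) := BE.
    by move=> H; apply: (ae_mono H) => x /(_ I)/= [].
  have T0 := T_ae cz hh L2_0 h0.
  rewrite BE mule0 (_ : leb _ = 0%E) ?mule0//.
  apply/eqP; rewrite eq_le leb_ge0 andbT.
  have [N [mN N0 HN]] : {ae leb, forall x, T h x = 0}.
    by apply: (ae_mono2 T0 (T_0 cz)) => x -> ->.
  rewrite -N0; apply: leb_le => x /= lx; apply: HN => /= Tx.
  by move: lx; rewrite Tx normr0 ltNge ltW.
have Bpos : 0 < fine B by rewrite fine_gt0// lt_neqAle eq_sym BN B0 ltey_eq Bfin.
pose S (c' : Rn) (s' : R) := ~ (\int[leb]_(x in hcube c' s') `|h x|%:E <= (lam * s' ^+ m)%:E)%E.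
have [J [cs [ks [JS tJ Jmax Jout]]]] := @stopping_cubes R n c s S s0.
pose sd i := s / 2 ^+ ks i.
pose P i := hcube (cs i) (sd i).
have sd0 i : 0 < sd i by rewrite divr_gt0// exprn_gt0.
have mP i : measurable (P i) by exact: measurable_hcube.
have lebP i : leb (P i) = (sd i ^+ m)%:E by rewrite lebesgue_hcube// ltW.
have Sc : (\int[leb]_(x in hcube c s) `|h x|%:E <= (lam * s ^+ m)%:E)%E.
  apply: le_trans hB.
  by apply: leintS => // x _; rewrite lee_fin.
have ks0 i : J i -> (0 < ks i)%N.
  move=> Ji; have [di Si] := JS i Ji; rewrite lt0n; apply/eqP => k0.
  move: di Si; rewrite k0 => -[z hz]; rewrite expr0 divr1 (_ : cs i = c); first by move=> /(_ Sc).
  apply/rowP => j; have [] := hz j; rewrite expn0 ltnS leqn0 => /eqP ->.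
  by rewrite mul0r addr0.
pose I i := (\int[leb]_(x in P i) `|h x|%:E)%E.
have I0 i : (0 <= I i)%E by apply: integral_ge0 => x _; rewrite lee_fin.
have Iup i : J i -> (I i <= (2 ^+ m * lam * sd i ^+ m)%:E)%E.
  move=> Ji; apply: (@stop_parent _ _ c _ s (ks i) h lam s0) => //.
  - by move=> j c'' jk dc sub; apply: contrapT; exact: (Jmax i j c'' Ji jk dc sub).
  - exact: ks0.
  - by have [] := JS i Ji.
have Ilo i : J i -> ((lam * sd i ^+ m)%:E <= I i)%E.
  by move=> Ji; have [_ /negP] := JS i Ji; rewrite -ltNge => /ltW.
have sumI : (\sum_(0 <= i <oo | i \in J) I i <= B)%E.
  apply: integral_cond_bigcup_le; [by move=> i _; exact: mP|exact: tJ
    |exact: mfunE (mfun_norm mh)|by move=> x; rewrite lee_fin].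
have sumP : (lam%:E * \sum_(0 <= i <oo | i \in J) leb (P i) <= B)%E.
  rewrite -nneseriesZl; last by move=> i _; exact: leb_ge0.
  apply: le_trans sumI; apply: lee_nneseries => [i _ _|i /set_mem Ji].
    by rewrite mule_ge0// ?lee_fin ?(ltW l0)// leb_ge0.
  by rewrite lebP -EFinM; exact: Ilo.
pose a i := (\int[leb]_(x in P i) h x) / sd i ^+ m.
pose b i : Rn -> R := if i \in J then (fun x => \1_(P i) x * (h x - a i)) else (fun=> 0).
have bP i := atomP (cs i) (sd0 i) hh ih.
have Lb i : L2 (b i) by rewrite /b; case: ifP => _; [have [] := bP i|exact: L2_0].
have aup i : J i -> `|a i| <= 2 ^+ m * lam.
  move=> Ji; have [_ _ _ ha _] := bP i; have := le_trans ha (Iup i Ji).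
  by rewrite lee_fin ler_pM2r// exprn_gt0.
have mh2 : measurable_fun [set: Rn] (fun x => ((h x) ^+ 2)%:E) by exact: mfunE (mfunX 2 mh).
have h20 x : (0 <= ((h x) ^+ 2)%:E)%E by rewrite lee_fin sqr_ge0.
pose Q2 i := (\int[leb]_(x in P i) ((h x) ^+ 2)%:E)%E.
have sumQ2 : (\sum_(0 <= i <oo | i \in J) Q2 i < +oo)%E.
  apply: le_lt_trans (_ : sqint h < +oo)%E; first exact: integral_cond_bigcup_le.
  by have /L2P[] := hh.
(* The cubes of index at least [N] stay in the good part; their share of its square integral is
   comparable with that of the other parts, at most lam B. *)
have [N HN] : exists N, (\sum_(N <= i <oo | i \in J) Q2 i <= (lam * fine B)%:E)%E.
  have := nneseries_tail_cvg sumQ2.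
  have lB0 : 0 < lam * fine B by rewrite mulr_gt0.
  have /fine_cvgP[Hfin Hcvg] := nneseries_tail_cvg sumQ2 (fun i _ =>
    @integral_ge0 _ _ _ leb (P i) _ (fun x _ => h20 x)).
  have /cvgrPdist_le/(_ _ lB0) := Hcvg.
  move=> /(filterI Hfin)[N _ /(_ N (leqnn N))[/= Nfin]]; rewrite sub0r normrN => Nle.
  by exists N; rewrite -(fineK Nfin) lee_fin; apply: le_trans (ler_norm _) Nle.
pose U := \bigcup_(i in J) P i.
pose JN := [set i | J i /\ (N <= i)%N].
pose UN := \bigcup_(i in JN) P i.
have mU : measurable U by apply: bigcup_measurable.
have mUN : measurable UN by apply: bigcup_measurable.
have tJN : trivIset JN P by apply: sub_trivIset tJ => i [].
have UNQ2 : (\int[leb]_(x in UN) ((h x) ^+ 2)%:E <= (lam * fine B)%:E)%E.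
  apply: le_trans HN; rewrite ge0_integral_bigcup_cond; [|by move=> i _; exact: mP
    |exact: tJN|exact: measurable_funTS mh2|by move=> x _; exact: h20].
  rewrite eseries_mkcond (nneseries_split 0 N); last first.
    by move=> i _; case: ifP => // _; exact: integral_ge0.
  rewrite add0n big_nat big1 ?add0e.
    rewrite [leRHS]eseries_mkcond; apply: lee_nneseries => [i _ _|i _].
      by case: ifP => // _; exact: integral_ge0.
    case: ifPn => [/set_mem[Ji _]|_]; first by rewrite mem_set.
    by case: ifP => // _; exact: integral_ge0.
  by move=> i /andP[_ iN]; rewrite memNset// => -[_]; rewrite leqNgt iN.
have lebU : (lam%:E * leb U <= B)%E by rewrite measure_bigcup.
pose sb x := \sum_(0 <= i < N) b i x.
pose g x := h x - sb x.
have Lsb : L2 sb by exact: L2_sum.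
have Lg : L2 g by exact: L2B.
have PQ i : J i -> P i `<=` hcube c s by move=> /JS[di _]; exact: dyadicS.
have dens : {ae leb, forall x, (hcube c s `\` U) x -> (`|h x|%:E <= lam%:E)%E}.
  apply: (@dyadic_density R n c s (fun x => `|h x|%:E) lam).
  - exact: s0.
  - exact: ltW.
  - exact: mfunED (mfun_norm mh).
  - by move=> x; rewrite lee_fin.
  - by apply: measurableD => //; exact: measurable_hcube.
  - by move=> x [].
  - move=> x j c' [xQ xU] dc' xc'; have := Jout x j c' xQ xU dc' xc' => /contrapT.
    rewrite lebesgue_hcube ?EFinM//; by rewrite divr_ge0 ?exprn_ge0// ltW.
have sbE x i : J i -> P i x -> sb x = if (i < N)%N then h x - a i else 0.
  move=> Ji xPi.
  have bj j : j != i -> b j x = 0.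
    move=> ji; rewrite /b; case: ifPn => // /set_mem Jj; rewrite indicE memNset ?mul0r//.
    move=> xPj; move/trivIsetP : tJ => /(_ j i Jj Ji ji) /seteqP[/(_ x) H _].
    by apply: H.
  case: ifPn => iN; last first.
    rewrite /sb big_nat big1// => j /andP[_ jN]; apply: bj.
    by apply: contraNneq iN => <-.
  rewrite /sb (bigD1_seq i)/= ?mem_index_iota ?iota_uniq// big1 ?addr0; last first.
    by move=> j ji; exact: bj.
  by rewrite /b mem_set// indicE mem_set// mul1r.
have sb0 x : ~ U x -> sb x = 0.
  move=> xU; rewrite /sb big1// => j _; rewrite /b; case: ifPn => // /set_mem Jj.
  by rewrite indicE memNset ?mul0r// => xPj; apply: xU; exists j.
(* On a removed cube [g] is the average [a i], at most 2^m lam; on the cubes of the tail it is [h];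
   elsewhere |h| <= lam, so that h^2 <= lam |h|. *)
have gbd : {ae leb, forall x, (((g x) ^+ 2)%:E <= (4 ^+ m * lam ^+ 2)%:E * (\1_U x)%:E +
     (\1_UN x * (h x) ^+ 2)%:E + lam%:E * `|h x|%:E)%E}.
  apply: (ae_mono dens) => x dx; rewrite -!EFinM -!EFinD lee_fin.
  have t1 : 0 <= 4 ^+ m * lam ^+ 2 * \1_U x.
    by rewrite !mulr_ge0 ?exprn_ge0 ?(ltW l0)// indicE.
  have t2 : 0 <= \1_UN x * (h x) ^+ 2 by rewrite mulr_ge0 ?sqr_ge0// indicE.
  have t3 : 0 <= lam * `|h x| by rewrite mulr_ge0// ltW.
  have [[i Ji xPi]|xU] := pselect (U x).
    rewrite /g (sbE x i Ji xPi); case: ifPn => iN.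
      rewrite opprB addrCA subrr addr0 -real_normK ?num_real//.
      rewrite -addrA -[leLHS]addr0; apply: lerD; last by rewrite addr_ge0.
      rewrite indicE mem_set ?mulr1; last by exists i.
      rewrite (_ : 4 ^+ m * _ = (2 ^+ m * lam) ^+ 2); last first.
        by rewrite exprMn -exprM mulnC exprM (_ : 2 ^+ 2 = 4)// expr2; lra.
      by rewrite lerXn2r ?nnegrE ?mulr_ge0 ?exprn_ge0 ?(ltW l0)// aup.
    rewrite subr0 [\1_UN x]indicE (_ : (x \in UN) = true) ?mul1r; last first.
      by apply/mem_set; exists i => //; split => //; rewrite leqNgt.
    by rewrite addrAC lerDr addr_ge0.
  rewrite /g (sb0 x xU) subr0.
  apply: (@le_trans _ _ (lam * `|h x|)); last by rewrite lerDr addr_ge0.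
  have [xQ|xQ] := pselect (hcube c s x); last by rewrite (hs x xQ) normr0 mulr0 expr0n.
  rewrite -real_normK ?num_real// expr2 ler_wpM2r//.
  by have := dx (conj xQ xU); rewrite lee_fin.
have mgb : mfun (fun x => \1_UN x * (h x) ^+ 2) by apply: mfunM; [exact: mfun1|exact: mfunX].
have mnh := mfunE (mfun_norm mh).
have sqg : (sqint g <= ((4 ^+ m + 2) * lam * fine B)%:E)%E.
  have mA := measurable_funeM ((4 ^+ m * lam ^+ 2)%:E) (mfunE (mfun1 mU)).
  have mC := measurable_funeM lam%:E mnh.
  have A0 x : (0 <= (4 ^+ m * lam ^+ 2)%:E * (\1_U x)%:E)%E.
    by rewrite -EFinM lee_fin !mulr_ge0 ?exprn_ge0 ?(ltW l0)// indicE.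
  have B'0 x : (0 <= (\1_UN x * (h x) ^+ 2)%:E)%E.
    by rewrite lee_fin mulr_ge0 ?sqr_ge0// indicE.
  have C'0 x : (0 <= lam%:E * `|h x|%:E)%E by rewrite -EFinM lee_fin mulr_ge0// ltW.
  apply: (@le_trans _ _ (\int[leb]_x ((4 ^+ m * lam ^+ 2)%:E * (\1_U x)%:E +
     (\1_UN x * (h x) ^+ 2)%:E + lam%:E * `|h x|%:E))%E).
    apply: ae_le_int.
    - by move=> x; rewrite lee_fin sqr_ge0.
    - by move=> x; rewrite adde_ge0// adde_ge0.
    - exact: gbd.
  rewrite intD; [|exact: emeasurable_funD mA (mfunE mgb)|exact: mC
    |by move=> x; exact: adde_ge0|exact: C'0].
  rewrite intD; [|exact: mA|exact: mfunE mgb|exact: A0|exact: B'0].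
  rewrite (@intZ _ _ (4 ^+ m * lam ^+ 2) (fun x => (\1_U x)%:E)); [|exact: mfunE (mfun1 mU)
    |by rewrite mulr_ge0 ?exprn_ge0 ?(ltW l0)
    |by move=> x; rewrite lee_fin indicE].
  rewrite integral_leb_indic// -int1 (@intZ _ _ lam (fun x => `|h x|%:E));
    [|exact: mnh|exact: ltW|by move=> x; rewrite lee_fin].
  rewrite -/B -(fineK Bfin).
  have h1 : ((4 ^+ m * lam ^+ 2)%:E * leb U <= (4 ^+ m * lam * fine B)%:E)%E.
    have -> : (4 ^+ m * lam ^+ 2)%:E = ((4 ^+ m * lam)%:E * lam%:E)%E.
      by rewrite -EFinM expr2 mulrA.
    rewrite -muleA [in leRHS]EFinM; apply: lee_wpmul2l.
      by rewrite lee_fin mulr_ge0 ?exprn_ge0// ltW.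
    by rewrite fineK.
  apply: le_trans (leeD (leeD h1 UNQ2) (lexx _)) _.
  by rewrite -EFinM -!EFinD lee_fin; lra.
pose V := ~` \bigcup_(i in J) dil (cs i) (sd i).
have mV : measurable V.
  by apply: measurableC; apply: bigcup_measurable => i _; exact: measurable_cube.
have Tdec : {ae leb, forall x, T h x = T g x + \sum_(0 <= i < N) T (b i) x}.
  have := T_sub cz hh Lsb; have := T_sum cz (index_iota 0 N) Lb.
  by move=> H1 H2; apply: (ae_mono2 H1 H2) => x <- ->; rewrite subrK.
have [Nul [mNul Nul0 HNul]] := Tdec.
pose E1 := [set x : Rn | lam / 2 < `|T g x|].
pose sT x := \1_V x * \sum_(0 <= i < N) `|T (b i) x|.
pose E3 := [set x : Rn | lam / 2 < `|sT x|].
have l20 : 0 < lam / 2 by rewrite divr_gt0.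
have cover : [set x : Rn | lam < `|T h x|] `<=`
   (E1 `|` E3) `|` ((\bigcup_(i in J) dil (cs i) (sd i)) `|` Nul).
  move=> x /= lx; apply: contrapT => H; have xNul : ~ Nul x by move=> ?; apply: H; right; right.
  have xV : V x by move=> ?; apply: H; right; left.
  have x1 : `|T g x| <= lam / 2 by rewrite leNgt; apply/negP => ?; apply: H; left; left.
  have x3 : `|sT x| <= lam / 2 by rewrite leNgt; apply/negP => ?; apply: H; left; right.
  have Tx : T h x = T g x + \sum_(0 <= i < N) T (b i) x.
    by apply: contrapT => H'; apply: xNul; exact: HNul.
  move: lx; rewrite Tx ltNge => /negP; apply.
  apply: le_trans (ler_normD _ _) _; rewrite (splitr lam) lerD//.
  move: x3; rewrite /sT indicE mem_set// mul1r ger0_norm ?sumr_ge0//; apply: le_trans.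
  exact: ler_norm_sum.
have mTb i : mfun (fun x => `|T (b i) x|) by apply/mfun_norm/L2_mfun/(L2_T cz)/Lb.
have msT : mfun sT by apply: mfunM; [exact: mfun1|exact: mfun_sum].
have le1 : (lam%:E * leb E1 <= (4 * C0 * (4 ^+ m + 2) * fine B)%:E)%E.
  have [LTg sqTg] := HC0 g Lg.
  have := markov_sq l20 (L2_mfun LTg); rewrite -/E1 => mk.
  have -> : (lam%:E * leb E1 = (4 / lam)%:E * (((lam / 2) ^+ 2)%:E * leb E1))%E.
    rewrite muleA -EFinM; congr (_%:E * _)%E; field; exact: lt0r_neq0.
  have C0' : (0 <= C0%:E)%E by rewrite lee_fin ltW.
  have := le_trans mk (le_trans sqTg (lee_wpmul2l C0' sqg)).
  have l4 : (0 <= (4 / lam)%:E)%E by rewrite lee_fin divr_ge0// ltW.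
  move=> /(lee_wpmul2l l4)/le_trans; apply; rewrite -!EFinM lee_fin le_eqVlt.
  apply/orP; left; apply/eqP; field; exact: lt0r_neq0.
have le2 : (lam%:E * leb (\bigcup_(i in J) dil (cs i) (sd i)) <= ((4 * m%:R + 1) ^+ m * fine B)%:E)%E.
  have hl : (leb (\bigcup_(i in J) dil (cs i) (sd i)) <=
     ((4 * m%:R + 1) ^+ m)%:E * \sum_(0 <= i <oo | i \in J) leb (P i))%E.
    rewrite bigcup_mkcond; apply: le_trans (leb_bigcup _) _.
    rewrite -nneseriesZl; last by move=> i _; exact: leb_ge0.
    rewrite [leRHS]eseries_mkcond; apply: lee_nneseries => [i _ _|i _]; first exact: leb_ge0.
    case: ifPn => _; last by rewrite (@measure0 _ _ _ leb).
    rewrite lebP -EFinM -exprMn /dil lebesgue_cube//.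
    by rewrite mulr_ge0 ?(ltW (sd0 i))// addr_ge0.
  have l0' : (0 <= lam%:E)%E by rewrite lee_fin ltW.
  apply: le_trans (lee_wpmul2l l0' hl) _; rewrite muleCA EFinM fineK//.
  by apply: lee_wpmul2l => //; rewrite lee_fin exprn_ge0// addr_ge0.
have le3 : (lam%:E * leb E3 <= (4 * CA * fine B)%:E)%E.
  have := markov l20 msT; rewrite -/E3 => mk.
  have -> : (lam%:E * leb E3 = 2%:E * ((lam / 2)%:E * leb E3))%E.
    by rewrite muleA -EFinM; congr (_%:E * _)%E; field.
  have h2 : (\int[leb]_x `|sT x|%:E <= (2 * CA * fine B)%:E)%E.
    rewrite (_ : (\int[leb]_x _)%E = (\sum_(0 <= i < N) \int[leb]_(x in V) `|T (b i) x|%:E)%E); last first.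
      rewrite -(@ge0_integral_sum _ _ _ leb V mV nat (fun i x => `|T (b i) x|%:E)); last 2 first.
      - by move=> i; exact: mfunED (mTb i).
      - by move=> i x _; rewrite lee_fin.
      rewrite [RHS](eq_integral (fun x => (\sum_(0 <= i < N) `|T (b i) x|)%:E)); last first.
        by move=> x _; rewrite sumEFin.
      rewrite [RHS]int1; apply: eq_integral => x _; rewrite ger0_norm//.
      by rewrite mulr_ge0 ?sumr_ge0// indicE.
    apply: (@le_trans _ _ (\sum_(0 <= i < N) (2 * CA)%:E * (if i \in J then I i else 0))%E).
      apply: lee_sum => i _; case: ifPn => iJ; last first.
        rewrite mule0 /b (negbTE iJ).
        have T00 : (\int[leb]_x `|T (fun=> 0) x|%:E = 0)%E.
          rewrite -[RHS](integral0 leb setT); apply: ae_eq_int.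
          - by move=> x; rewrite lee_fin.
          - by [].
          - by apply: (ae_mono (T_0 cz)) => x ->; rewrite normr0.
        by rewrite -T00; apply: leintS => // x _; rewrite lee_fin.
      have [bL2 bs b0 _ bI] := bP i.
      apply: (@le_trans _ _ (\int[leb]_(x in ~` dil (cs i) (sd i)) `|T (b i) x|%:E)%E).
        apply: leintS => [x xV xd|x _]; last by rewrite lee_fin.
        by apply: xV; exists i => //; exact/set_mem.
      have := HCA (cs i) (sd i) (b i) (sd0 i); rewrite /b iJ => /(_ bL2 bs b0)/le_trans; apply.
      rewrite EFinM [(2 * CA)%:E]EFinM [(2%:E * _)%E]muleC -muleA; apply: lee_wpmul2l => //.
      by rewrite lee_fin ltW.
    rewrite -ge0_sume_distrr; last by move=> i _; case: ifP.
    rewrite [in leRHS]EFinM fineK//; apply: lee_wpmul2l; first by rewrite lee_fin mulr_ge0// ltW.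
    apply: le_trans sumI; rewrite eseries_mkcond.
    by apply: nneseries_lim_ge => i _ _; case: ifP.
  have := le_trans mk h2 => /(lee_wpmul2l (ler0n _ 2 : (0 <= 2%:E)%E))/le_trans; apply.
  by rewrite -EFinM lee_fin; lra.
have := leb_le cover => /le_trans le; have {}le := le _ (leb_setU _ _).
have l0' : (0 <= lam%:E)%E by rewrite lee_fin ltW.
apply: le_trans (lee_wpmul2l l0' le) _.
apply: (@le_trans _ _ (lam%:E * (leb E1 + leb E3 + leb (\bigcup_(i in J) dil (cs i) (sd i)))))%E.
  apply: lee_wpmul2l => //; apply: leeD; first exact: leb_setU.
  by apply: le_trans (leb_setU _ _) _; rewrite [X in (_ + X)%E]Nul0 adde0.
rewrite -[in leRHS](fineK Bfin) -EFinM ge0_muleDr ?adde_ge0 ?leb_ge0//.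
rewrite ge0_muleDr ?leb_ge0//.
apply: le_trans (leeD (leeD le1 le3) le2) _.
by rewrite -!EFinD lee_fin /C; lra.
Qed.

End weak_type.

(** * Norms of cubes in L^(n/delta) *)

Section mfun_extra.
Context {R : realType} {n : nat}.
Local Notation Rn := (Rn R n.+1).
Local Notation leb := (@lebesgue_Rn R n.+1).

Lemma mfun_comp (g : R -> R) (f : Rn -> R) : measurable_fun [set: R] g -> mfun f ->
  mfun (fun x => g (f x)).
Proof. by move=> mg mf; exact: (measurableT_comp mg mf). Qed.

Lemma mfunV (f : Rn -> R) : mfun f -> (forall x, 0 <= f x) -> mfun (fun x => (f x)^-1).
Proof.
move=> mf f0; rewrite (_ : (fun x => _) = (fun t => t `^ (- 1)) \o f).
  exact: (mfun_comp (measurable_powR (- 1)) mf).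
by apply/funext => x /=; rewrite powR_inv1.
Qed.

Lemma intZD (D : set Rn) (k : R) (f : Rn -> R) : measurable D -> mfun f -> 0 <= k ->
  (forall x, 0 <= f x) ->
  (\int[leb]_(x in D) (k * f x)%:E = k%:E * \int[leb]_(x in D) (f x)%:E)%E.
Proof.
move=> mD mf k0 f0; rewrite (int1 D) (int1 D) -intZ.
- by apply: eq_integral => x _; rewrite -EFinM mulrCA.
- by apply: mfunE; apply: mfunM => //; exact: mfun1.
- exact: k0.
- by move=> x; rewrite lee_fin mulr_ge0// indicE.
Qed.

Lemma intDD (D : set Rn) (f g : Rn -> R) : measurable D -> mfun f -> mfun g ->
  (forall x, 0 <= f x) -> (forall x, 0 <= g x) ->
  (\int[leb]_(x in D) (f x + g x)%:E =
   \int[leb]_(x in D) (f x)%:E + \int[leb]_(x in D) (g x)%:E)%E.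
Proof.
move=> mD mf mg f0 g0; rewrite (int1 D) (int1 D) (int1 D) -intD.
- by apply: eq_integral => x _; rewrite -EFinD mulrDr.
- by apply: mfunE; apply: mfunM => //; exact: mfun1.
- by apply: mfunE; apply: mfunM => //; exact: mfun1.
- by move=> x; rewrite lee_fin mulr_ge0// indicE.
- by move=> x; rewrite lee_fin mulr_ge0// indicE.
Qed.

Lemma int_indic (D B : set Rn) : measurable D -> measurable B ->
  (\int[leb]_(x in D) (\1_B x)%:E = leb (B `&` D))%E.
Proof.
move=> mD mB; rewrite (int1 D) -integral_leb_indic; last exact: measurableI.
by apply: eq_integral => x _; rewrite indicI /= mulrC.
Qed.

End mfun_extra.

Section log_holder.
Context {R : realType} {n : nat}.
Local Notation Rn := (Rn R n.+1).
Local Notation leb := (@lebesgue_Rn R n.+1).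
Local Notation N := (n.+1%:R : R).
Context (s : Rn -> R) (C0 si : R).
Hypotheses (C00 : 0 < C0) (si0 : 0 < si) (s1 : forall x, si <= s x <= 1)
  (s3 : forall x y, `|s x - s y| <= C0 / ln (expR 1 + (enorm (x - y))^-1))
  (s4 : forall x, `|s x - si| <= C0 / ln (expR 1 + enorm x)).

(* With s = 1 / q and lam = ln l, this is the modular of the indicator of D divided by
   l in L^q. *)
Definition modular (lam : R) (D : set Rn) : \bar R :=
  (\int[leb]_(x in D) (expR (- lam / s x))%:E)%E.

Let s0 x : 0 < s x. Proof. by apply: lt_le_trans si0 _; have /andP[] := s1 x. Qed.

Lemma ln_ge1 (t : R) : 0 <= t -> 1 <= ln (expR 1 + t).
Proof.
move=> t0; rewrite -[leLHS](expRK 1) ler_ln ?posrE ?expR_gt0//; first by rewrite lerDl.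
by rewrite ltr_pwDl// expR_gt0.
Qed.

Let N1 : 1 <= N. Proof. by rewrite ler1n. Qed.

(* Feasibility on a small cube plus log-Hoelder continuity determine expR (- lam / s)
   up to a constant on the whole cube. *)
Lemma modular_small : exists2 C : R, 0 < C & forall (a : Rn) (L lam : R),
  0 < L -> L < 1 -> (modular lam (cube a L) <= 1)%E ->
  forall y, cube a L y -> expR (- lam / s y) <= C / L ^+ n.+1.
Proof.
pose D := C0 / si * (ln 2 + N * ln N + N).
exists (2 * expR D); first by rewrite mulr_gt0// expR_gt0.
move=> a L lam L0 L1 Hl y yQ.
have Ln0 : 0 < L ^+ n.+1 by rewrite exprn_gt0.
have LnE : L ^+ n.+1 = expR (N * ln L).
  by rewrite mulrC expRM_natr lnK.
(* If the integrand exceeded 2 / L^N everywhere on the cube, the modular would be at least 2. *)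
have [x xQ xl] : exists2 x, cube a L x & expR (- lam / s x) <= 2 / L ^+ n.+1.
  apply: contrapT => H.
  have : ((2 / L ^+ n.+1)%:E * leb (cube a L) <= modular lam (cube a L))%E.
    rewrite -integral_leb_cst; last exact: measurable_cube.
    apply: leint => x xQ; first by rewrite lee_fin divr_ge0// ltW.
    by rewrite lee_fin leNgt; apply/negP => /ltW h; apply: H; exists x.
  rewrite (lebesgue_cube a (ltW L0)) -EFinM divfK ?gt_eqF// => /le_trans/(_ Hl).
  by rewrite lee_fin; lra.
pose M := ln 2 - N * ln L.
have L1' : ln L < 0 by rewrite ln_lt0// L0.
have ln20 : 0 < ln 2 :> R by rewrite ln_gt0// ltr1n.
have M0 : 0 < M.
  have : 0 < N * (- ln L) by rewrite mulr_gt0// oppr_gt0.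
  by rewrite /M; lra.
have ME : 2 / L ^+ n.+1 = expR M.
  by rewrite LnE -expRN -{1}(@lnK _ 2) ?posrE// -expRD.
have lM : - lam <= s x * M.
  by move: xl; rewrite ME ler_expR ler_pdivrMr// mulrC.
(* [M] grows like N log (1 / L), while the log-Hoelder modulus at distances up to N L is of order 1
   / log (1 / L): the product stays bounded. *)
have key : `|s x - s y| * M <= C0 * (ln 2 + N * ln N + N).
  have [->|xy] := eqVneq x y.
    rewrite subrr normr0 mul0r mulr_ge0 ?(ltW C00)// !addr_ge0 ?(ltW ln20)//.
    by rewrite mulr_ge0// ln_ge0.
  have e0 : 0 < enorm (x - y).
    have /rowP/existsNP[i /eqP xyi] : x <> y by apply/eqP.
    by apply: lt_le_trans (enorm_ge _ i); rewrite !mxE normr_gt0 subr_eq0.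
  have e1 : enorm (x - y) <= N * L.
    apply: enorm_le => [|i]; first exact: ltW.
    have /andP[x1 x2] := xQ i; have /andP[y1 y2] := yQ i.
    by rewrite !mxE ler_norml; apply/andP; split; lra.
  set E := ln (expR 1 + (enorm (x - y))^-1).
  have E1 : 1 <= E by apply: ln_ge1; rewrite invr_ge0 enorm_ge0.
  have E2 : - ln L - ln N <= E.
    rewrite -opprD -lnM ?posrE// -lnV ?posrE ?mulr_gt0// /E.
    rewrite ler_ln ?posrE ?invr_gt0 ?mulr_gt0//; last first.
      by rewrite addr_gt0 ?expR_gt0 ?invr_gt0.
    apply: (@le_trans _ _ (enorm (x - y))^-1); last by rewrite lerDr ltW// expR_gt0.
    by rewrite lef_pV2 ?posrE ?mulr_gt0// mulrC.
  have ME2 : M <= (ln 2 + N * ln N + N) * E.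
    have lnN : 0 <= ln N by rewrite ln_ge0.
    rewrite /M; have : N * (- ln L - ln N) <= N * E by rewrite ler_pM2l.
    have : ln 2 <= ln 2 * E by rewrite ler_peMr// ltW.
    have : N * ln N <= N * ln N * E by rewrite ler_peMr// mulr_ge0.
    by nra.
  apply: le_trans (_ : C0 / E * ((ln 2 + N * ln N + N) * E) <= _); last first.
    rewrite [X in _ <= X * _](_ : C0 = C0 / E * E); last by rewrite divfK// gt_eqF// (lt_le_trans ltr01).
    by rewrite -!mulrA (mulrC E).
  by apply: ler_pM; [exact: normr_ge0|exact: ltW|exact: s3|exact: ME2].
rewrite (_ : 2 * expR D / L ^+ n.+1 = expR (M + D)); last by rewrite expRD -ME mulrAC.
rewrite ler_expR ler_pdivrMr//.
apply: (le_trans lM).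
have D0 : D * si = C0 * (ln 2 + N * ln N + N) by rewrite /D mulrAC divfK// gt_eqF.
have h1 : (s x - s y) * M <= C0 * (ln 2 + N * ln N + N).
  by apply: le_trans key; rewrite ler_pM2r// ler_norm.
have D1 : 0 <= D.
  have lnN : 0 <= ln N by rewrite ln_ge0.
  by rewrite mulr_ge0 ?divr_ge0 ?(ltW C00) ?(ltW si0)// !addr_ge0 ?(ltW ln20)// mulr_ge0.
have h2 : D * si <= D * s y by rewrite ler_wpM2l//; have /andP[] := s1 y.
by rewrite D0 in h2; lra.
Qed.

(* Since s >= si, its limit at infinity, the estimate can only fail near the origin, on
   a cube whose side is the power si / 2 of that of the given one. *)
Lemma modular_large : exists2 C : R, 0 < C & forall (a : Rn) (L lam : R),
  1 <= L -> (modular lam (cube a L) <= 1)%E ->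
  forall y, cube a L y -> expR (- lam / s y) <= C / L ^+ n.+1 +
    expR (- (si * N * ln L)) * \1_(cube (const_mx (- expR (si / 2 * ln L))) (2 * expR (si / 2 * ln L))) y.
Proof.
pose k := si / (2 * N).
have k0 : 0 < k by rewrite divr_gt0// mulr_gt0.
pose D := C0 / (si * k).
exists (expR D); first exact: expR_gt0.
move=> a L lam L1 Hl y yQ.
have L0 : 0 < L by exact: lt_le_trans L1.
have lnL : 0 <= ln L by rewrite ln_ge0.
have LnE : L ^+ n.+1 = expR (N * ln L) by rewrite mulrC expRM_natr lnK.
have Ln0 : 0 < L ^+ n.+1 by rewrite exprn_gt0.
have lowb (t : R) : (forall x, cube a L x -> t <= expR (- lam / s x)) -> 0 <= t ->
    t * L ^+ n.+1 <= 1.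
  move=> Ht t0; rewrite -lee_fin; apply: le_trans Hl.
  rewrite EFinM -(lebesgue_cube a (ltW L0)) -integral_leb_cst; last exact: measurable_cube.
  by apply: leint => x xQ; rewrite lee_fin//; exact: Ht.
have lam0 : 0 <= lam.
  rewrite leNgt; apply/negP => lam0.
  have : expR (- lam) * L ^+ n.+1 <= 1.
    apply: lowb; last exact: expR_ge0.
    move=> x _; rewrite ler_expR ler_pdivlMr// ler_piMr//; first by rewrite oppr_ge0 ltW.
    by have /andP[] := s1 x.
  have : 1 < expR (- lam) by rewrite expR_gt1 oppr_gt0.
  have : 1 <= L ^+ n.+1 by rewrite exprn_ege1.
  by nra.
(* Since 1 / s <= 1 / si and lam >= 0, the modular is at least expR (- lam / si) L^N; feasibility
   forces expR lam to be at least L^(si N). *)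
have lamL : si * N * ln L <= lam.
  have : expR (- lam / si) * L ^+ n.+1 <= 1.
    apply: lowb; last exact: expR_ge0.
    move=> x _; rewrite ler_expR !mulNr lerN2; apply: ler_wpM2l => //.
    by rewrite lef_pV2 ?posrE//; have /andP[] := s1 x.
  rewrite LnE -expRD -[leRHS]expR0 ler_expR mulNr addrC subr_le0 ler_pdivlMr//.
  by rewrite mulrC mulrA.
have /andP[sy1 sy2] := s1 y.
(* Far from the origin, s y - si is at most C0 / E and N ln L at most E / k, so that their product
   is bounded. Near the origin only [lamL] is available, on a cube of half-side L^(si / 2). *)
have [h|h] := leP (si / 2 * ln L) (ln (expR 1 + enorm y)).
- apply: (@le_trans _ _ (expR D / L ^+ n.+1)); last first.
    by rewrite lerDl mulr_ge0 ?expR_ge0//.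
  rewrite LnE -expRN -expRD ler_expR ler_pdivrMr//.
  set E := ln (expR 1 + _) in h.
  have E1 : 1 <= E by apply: ln_ge1; exact: enorm_ge0.
  have E0 : 0 < E by exact: lt_le_trans E1.
  have h4 : s y - si <= C0 / E by apply: le_trans (s4 y); exact: ler_norm.
  have h5 : N * ln L * (s y - si) <= D * si.
    have -> : D * si = C0 / k.
      by rewrite /D; field; rewrite !gt_eqF.
    apply: le_trans (_ : E / k * (C0 / E) <= _); last first.
      by rewrite le_eqVlt; apply/orP; left; apply/eqP; field; rewrite !gt_eqF.
    apply: ler_pM => //; first by rewrite mulr_ge0.
      by rewrite subr_ge0.
    rewrite ler_pdivlMr//; apply: le_trans h; rewrite le_eqVlt /k; apply/orP; left; apply/eqP.
    by field; rewrite gt_eqF// (lt_le_trans ltr01).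
  have D1 : 0 <= D by rewrite /D divr_ge0 ?(ltW C00)// mulr_ge0 ?(ltW si0) ?(ltW k0).
  have h6 : D * si <= D * s y by rewrite ler_wpM2l.
  by lra.
- apply: (@le_trans _ _ (expR (- (si * N * ln L)))).
    rewrite ler_expR ler_pdivrMr// mulNr lerN2; apply: le_trans lamL.
    by rewrite ler_piMr// mulr_ge0// mulr_ge0// ltW.
  rewrite indicE mem_set ?mulr1 ?lerDr; first by rewrite divr_ge0 ?expR_ge0 ?(ltW Ln0).
  have h7 : enorm y <= expR (si / 2 * ln L).
    have e0 : 0 < expR 1 + enorm y by rewrite ltr_pwDl ?expR_gt0 ?enorm_ge0.
    by move: h; rewrite -ltr_expR lnK ?posrE//; have := @expR_gt0 R 1; lra.
  move=> i; rewrite mxE.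
  by have := le_trans (enorm_ge y i) h7; rewrite ler_norml => /andP[]; lra.
Qed.

(** For L < 1 the integrand is at most of size L^-N. For L >= 1 the exceptional cube at the origin
    meets the small cube in measure at most 2^N (L' L)^(N si / 2), and the factor L^(- si N) there
    turns this into 2^N (L' / L)^(N si / 2). This balance dictates the exponent of the
    conclusion. *)
Lemma modular_sub : exists2 C : R, 1 <= C & forall (a : Rn) (L : R) (c : Rn) (L' lam : R),
  0 < L' -> L' <= L -> cube c L' `<=` cube a L -> (modular lam (cube a L) <= 1)%E ->
  (modular lam (cube c L') <= (C * expR (N * (si / 2) * (ln L' - ln L)))%:E)%E.
Proof.
have [C1 C10 H1] := modular_small; have [C2 C20 H2] := modular_large.
exists (1 + C1 + C2 + 2 ^+ n.+1) => [|a L c L' lam L'0 L'L PQ Hl].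
  by rewrite -!addrA lerDl !addr_ge0 ?(ltW C10) ?(ltW C20)// exprn_ge0.
have L0 : 0 < L by exact: lt_le_trans L'L.
have u0 : ln L' - ln L <= 0 by rewrite subr_le0 ler_ln ?posrE.
have si1 : si <= 1 by have /andP[h1 h2] := s1 0; exact: le_trans h1 h2.
set X := expR _; have X0 : 0 < X by exact: expR_gt0.
have ratio : L' ^+ n.+1 / L ^+ n.+1 <= X.
  have -> : L' ^+ n.+1 / L ^+ n.+1 = expR (N * (ln L' - ln L)).
    rewrite mulrBr expRB; congr (_ / _); by rewrite mulrC expRM_natr lnK ?posrE.
  rewrite ler_expR -mulrA ler_pM2l ?(lt_le_trans ltr01)//.
  by rewrite -[leLHS]mul1r ler_wnM2r// ler_pdivrMr; lra.
have mP : measurable (cube c L' : set Rn) by exact: measurable_cube.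
have vP := lebesgue_cube c (ltW L'0).
have p2 : 0 <= 2 ^+ n.+1 :> R by rewrite exprn_ge0.
have [Ls|Lb] := ltP L 1.
  apply: (@le_trans _ _ (\int[leb]_(x in cube c L') (C1 / L ^+ n.+1)%:E)%E).
    apply: leint => x xP; first by rewrite lee_fin expR_ge0.
    by rewrite lee_fin; apply: (H1 a L lam) => //; exact: PQ.
  rewrite (integral_leb_cst _ mP) vP -EFinM lee_fin -mulrA (mulrC (L ^+ _)^-1).
  by apply: ler_pM => //; [exact: ltW|rewrite divr_ge0 ?exprn_ge0// ltW|
    lra].
set rho := expR (si / 2 * ln L) in H2.
pose B : set Rn := cube (const_mx (- expR (si / 2 * ln L))) (2 * expR (si / 2 * ln L)).
have mB : measurable B by exact: measurable_cube.
have lnL : 0 <= ln L by rewrite ln_ge0.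
pose e := expR (- (si * N * ln L)).
have e0 : 0 < e by exact: expR_gt0.
have volB : (leb (B `&` cube c L') <= (2 ^+ n.+1 * expR (N * (si / 2) * (ln L' + ln L)))%:E)%E.
  have [L'1|L'1] := ltP L' 1.
    apply: (@le_trans _ _ (leb (cube c L'))).
      by apply: leb_le => x [].
    rewrite vP lee_fin; have -> : L' ^+ n.+1 = expR (N * ln L') by rewrite mulrC expRM_natr lnK ?posrE.
    apply: (@le_trans _ _ (expR (N * (si / 2) * (ln L' + ln L)))); last first.
      by rewrite ler_peMl ?expR_ge0// exprn_ege1// ler1n.
    have l0 : ln L' <= 0 by rewrite ln_le0// ltW.
    rewrite ler_expR -mulrA ler_pM2l ?(lt_le_trans ltr01)//.
    have : si / 2 * ln L >= 0 by rewrite mulr_ge0// divr_ge0// ltW.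
    have : (1 - si / 2) * ln L' <= 0 by rewrite mulr_ge0_le0//; lra.
    by lra.
  apply: (@le_trans _ _ (leb B)); first by apply: leb_le => x [].
  rewrite lebesgue_cube ?mulr_ge0 ?expR_ge0// lee_fin exprMn ler_wpM2l// -expRM_natr ler_expR.
  have l0 : 0 <= ln L' by rewrite ln_ge0.
  have : 0 <= N * (si / 2) * ln L' by rewrite !mulr_ge0 ?divr_ge0// ltW.
  by lra.
apply: (@le_trans _ _ (\int[leb]_(x in cube c L') (C2 / L ^+ n.+1 + e * \1_B x)%:E)%E).
  apply: leint => x xP; first by rewrite lee_fin expR_ge0.
  by rewrite lee_fin; apply: (H2 a L lam) => //; exact: PQ.
have CL0 : 0 <= C2 / L ^+ n.+1 by rewrite divr_ge0 ?exprn_ge0// ltW.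
have B0 x : 0 <= \1_B x :> R by rewrite indicE.
rewrite (intDD mP (mfun_cst _) (mfunZ e (mfun1 mB)) (fun=> CL0)); last first.
  by move=> x; rewrite mulr_ge0// ltW.
rewrite (intZD mP (mfun1 mB) (ltW e0) B0) (integral_leb_cst _ mP) vP int_indic//.
apply: (@le_trans _ _ ((C2 / L ^+ n.+1)%:E * (L' ^+ n.+1)%:E +
   e%:E * (2 ^+ n.+1 * expR (N * (si / 2) * (ln L' + ln L)))%:E)%E).
  by rewrite leeD2l// lee_pmul2l// lte_fin.
rewrite -!EFinM -EFinD lee_fin.
have -> : e * (2 ^+ n.+1 * expR (N * (si / 2) * (ln L' + ln L))) = 2 ^+ n.+1 * X.
  rewrite mulrCA -expRD; congr (_ * expR _); by field.
rewrite -mulrA (mulrC (L ^+ _)^-1).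
have : C2 * (L' ^+ n.+1 / L ^+ n.+1) <= C2 * X by rewrite ler_pM2l.
have : 0 <= (1 + C1) * X by rewrite mulr_ge0 ?addr_ge0 ?(ltW C10)// ltW.
by lra.
Qed.

Hypothesis ms : mfun s.

Lemma mfun_modular (lam : R) : mfun (fun x => expR (- lam / s x)).
Proof.
apply: (mfun_comp (@measurable_expR R)); apply: mfunM; first exact: mfun_cst.
by apply: mfunV => // x; exact: ltW.
Qed.

Lemma modular_shift (lam mu : R) (D : set Rn) : measurable D -> 0 <= mu ->
  (modular (lam - mu) D <= (expR (mu / si))%:E * modular lam D)%E.
Proof.
move=> mD mu0; rewrite /modular -(intZD mD (mfun_modular lam) (expR_ge0 _)); last first.
  by move=> x; exact: expR_ge0.
apply: leint => x _; first by rewrite lee_fin expR_ge0.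
rewrite -expRD lee_fin ler_expR opprB mulrBl mulNr lerD2r.
by apply: ler_wpM2l => //; rewrite lef_pV2 ?posrE//; have /andP[] := s1 x.
Qed.

(** Lowering [lam] by mu >= 0 multiplies the modular by at most expR (mu / si), which [modular_sub]
    compensates for the given mu; when mu is negative, monotonicity is enough. In terms of expR lam,
    the gain is (L' / L)^(N si^2 / 2) up to a constant. *)
Lemma modular_decay : exists2 C : R, 1 <= C & forall (a : Rn) (L : R) (c : Rn) (L' lam : R),
  0 < L' -> L' <= L -> cube c L' `<=` cube a L -> (modular lam (cube a L) <= 1)%E ->
  (modular (lam - si * (N * (si / 2) * (ln L - ln L') - ln C)) (cube c L') <= 1)%E.
Proof.
have [C C1 H] := modular_sub; exists C => // a L c L' lam L'0 L'L PQ Hl.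
have Hs := H a L c L' lam L'0 L'L PQ Hl.
set mu := _ * (_ - ln C).
have [mu0|mu0] := leP 0 mu.
  apply: (le_trans (modular_shift lam (measurable_cube c L') mu0)).
  apply: (@le_trans _ _ ((expR (mu / si))%:E * (C * expR (N * (si / 2) * (ln L' - ln L)))%:E)%E).
    by rewrite lee_pmul2l// lte_fin expR_gt0.
  rewrite -EFinM lee_fin -{1}(@lnK _ C) ?posrE ?(lt_le_trans ltr01)// -!expRD.
  rewrite /mu mulrAC mulfV ?gt_eqF// mul1r -[leRHS]expR0 ler_expR.
  by rewrite le_eqVlt; apply/orP; left; apply/eqP; field.
apply: le_trans (_ : modular lam (cube c L') <= _)%E; last first.
  apply: le_trans Hl; apply: leintS => // x _; by rewrite lee_fin expR_ge0.
apply: leint => x _; first by rewrite lee_fin expR_ge0.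
rewrite lee_fin ler_expR ler_pM2r ?invr_gt0// lerN2; lra.
Qed.

End log_holder.

Section symbol.
Context {R : realType} {n : nat}.
Local Notation Rn := (Rn R n.+1).
Local Notation leb := (@lebesgue_Rn R n.+1).
Local Notation N := (n.+1%:R : R).
Context (s : Rn -> R) (C0 si : R) (q : Rn -> \bar R).
Hypotheses (C00 : 0 < C0) (si0 : 0 < si) (s1 : forall x, si <= s x <= 1)
  (s3 : forall x y, `|s x - s y| <= C0 / ln (expR 1 + (enorm (x - y))^-1))
  (s4 : forall x, `|s x - si| <= C0 / ln (expR 1 + enorm x))
  (ms : mfun s) (hq : forall x, q x = ((s x)^-1)%:E).

Definition phi (Q : set Rn) : R := fine (pnorm q (EFin \o \1_Q)).

Let s0 x : 0 < s x. Proof. by apply: lt_le_trans si0 _; have /andP[] := s1 x. Qed.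

Lemma modularE (l : R) (D : set Rn) : 0 < l ->
  (\int[leb]_x phi_exponent (q x) (`|(EFin \o \1_D) x| * l^-1%:E) = modular s (ln l) D)%E.
Proof.
move=> l0; rewrite /modular (int1 D); apply: eq_integral => x _.
rewrite hq [X in phi_exponent _ (`|X| * _)%E](_ : _ = (\1_D x)%:E)// indicE.
case: (x \in D) => /=; last first.
  by rewrite normr0 !mul0r powR0// invr_neq0// gt_eqF.
rewrite normr1 !mul1r /powR gt_eqF ?invr_gt0//.
by rewrite lnV ?posrE// mulrC.
Qed.

Lemma pnormE (D : set Rn) : pnorm q (EFin \o \1_D) =
  ereal_inf [set l%:E | l in [set l : R | 0 < l /\ (modular s (ln l) D <= 1)%E]].
Proof.
congr ereal_inf; apply/seteqP; split => _ [l [l0 hl] <-]; exists l => //; split => //.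
  by rewrite -modularE.
by rewrite modularE.
Qed.

(** With [phi_feasible], a crude bound whose purpose is that norms of cubes are positive and finite,
    so that [phi] loses nothing by taking [fine]. *)
Lemma phi_bounds (a : Rn) (L l : R) : 0 < L -> 0 < l ->
  (modular s (ln l) (cube a L) <= 1)%E -> Num.min 1 (L ^+ n.+1) <= l.
Proof.
move=> L0 l0 H; rewrite ge_min; case: (leP 1 l) => [//|l1] /=.
have : ((l^-1)%:E * leb (cube a L) <= modular s (ln l) (cube a L))%E.
  rewrite -integral_leb_cst; last exact: measurable_cube.
  apply: leint => x _; first by rewrite lee_fin invr_ge0 ltW.
  rewrite lee_fin -{1}(@lnK _ l) ?posrE// -expRN ler_expR ler_pdivlMr//.
  rewrite ler_piMr//; last by have /andP[] := s1 x.
  by rewrite oppr_ge0 ln_le0// ltW.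
move=> /le_trans/(_ H); rewrite (lebesgue_cube a (ltW L0)) -EFinM lee_fin.
by rewrite mulrC ler_pdivrMr// mul1r.
Qed.

Lemma phi_feasible (a : Rn) (L : R) : 0 < L ->
  (modular s (ln (Num.max 1%R (L ^+ n.+1)%R)) (cube a L) <= 1)%E.
Proof.
move=> L0; set l := Num.max _ _.
have l1 : 1 <= l by rewrite le_max lexx.
have l0 : 0 < l by exact: lt_le_trans l1.
apply: (@le_trans _ _ ((l^-1)%:E * leb (cube a L))%E).
  rewrite -integral_leb_cst; last exact: measurable_cube.
  apply: leint => x _; first by rewrite lee_fin expR_ge0.
  rewrite lee_fin -[leRHS]lnK ?posrE ?invr_gt0// lnV ?posrE// ler_expR ler_pdivrMr//.
  rewrite mulNr lerN2 ler_piMr ?ln_ge0//.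
  by have /andP[] := s1 x.
rewrite (lebesgue_cube a (ltW L0)) -EFinM lee_fin mulrC ler_pdivrMr// mul1r.
by rewrite le_max lexx orbT.
Qed.

Lemma pnorm_phi (a : Rn) (L : R) : 0 < L ->
  pnorm q (EFin \o \1_(cube a L)) = (phi (cube a L))%:E /\ 0 < phi (cube a L).
Proof.
move=> L0.
have h1 : (pnorm q (EFin \o \1_(cube a L)) <= (Num.max 1 (L ^+ n.+1))%:E)%E.
  rewrite pnormE; apply: ereal_inf_lbound; exists (Num.max 1 (L ^+ n.+1)) => //; split.
    by rewrite lt_max ltr01.
  exact: phi_feasible.
have m0 : 0 < Num.min 1 (L ^+ n.+1) by rewrite lt_min ltr01 exprn_gt0.
have h2 : ((Num.min 1 (L ^+ n.+1))%:E <= pnorm q (EFin \o \1_(cube a L)))%E.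
  rewrite pnormE; apply: le_ereal_inf_tmp => _ [l [l0 hl] <-].
  by rewrite lee_fin; exact: phi_bounds hl.
have fin : pnorm q (EFin \o \1_(cube a L)) \is a fin_num.
  rewrite fin_numE; apply/andP; split.
    by rewrite gt_eqF// (lt_le_trans _ h2)// ltNyr.
  by rewrite lt_eqF// (le_lt_trans h1)// ltry.
have E : pnorm q (EFin \o \1_(cube a L)) = (phi (cube a L))%:E by rewrite fineK.
split=> //; by move: h2; rewrite E lee_fin; exact: lt_le_trans.
Qed.

Lemma phi_le (a : Rn) (L l : R) : 0 < L -> 0 < l ->
  (modular s (ln l) (cube a L) <= 1)%E -> phi (cube a L) <= l.
Proof.
move=> L0 l0 hl; rewrite -lee_fin -(pnorm_phi a L0).1 pnormE.
by apply: ereal_inf_lbound; exists l.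
Qed.

Lemma phi_ge (a : Rn) (L t : R) : 0 < L ->
  (forall l, 0 < l -> (modular s (ln l) (cube a L) <= 1)%E -> t <= l) -> t <= phi (cube a L).
Proof.
move=> L0 H; rewrite -lee_fin -(pnorm_phi a L0).1 pnormE.
by apply: le_ereal_inf_tmp => _ [l [l0 hl] <-]; rewrite lee_fin; exact: H.
Qed.

(** [modular_decay] for sides L and L / 2^k, which gives theta = 2^(- N si^2 / 2). *)
Lemma phi_decay : exists2 C : R, 0 < C & exists2 theta : R, 0 < theta < 1 &
  forall (a : Rn) (L : R) (c : Rn) (k : nat), 0 < L -> cube c (L / 2 ^+ k) `<=` cube a L ->
  phi (cube c (L / 2 ^+ k)) <= C * theta ^+ k * phi (cube a L).
Proof.
have [C C1 H] := modular_decay C00 si0 s1 s3 s4 ms.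
have C0' : 0 < C by exact: lt_le_trans C1.
have ln20 : 0 < ln 2 :> R by rewrite ln_gt0// ltr1n.
pose eta := si * (N * (si / 2)) * ln 2.
have eta0 : 0 < eta by rewrite !mulr_gt0 ?divr_gt0.
exists (expR (si * ln C)); first exact: expR_gt0.
exists (expR (- eta)); first by rewrite expR_gt0 expR_lt1 oppr_lt0.
move=> a L c k L0 PQ.
have p2 : 0 < 2 ^+ k :> R by rewrite exprn_gt0.
have L'0 : 0 < L / 2 ^+ k by rewrite divr_gt0.
set mu := si * (N * (si / 2) * (ln L - ln (L / 2 ^+ k)) - ln C).
have muE : expR (si * ln C) * expR (- eta) ^+ k = expR (- mu).
  rewrite -expRM_natr -expRD /mu ln_div ?posrE// lnXn// -mulr_natr /eta.
  by congr expR; ring.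
rewrite muE [_ * phi _]mulrC expRN ler_pdivlMr ?expR_gt0//; apply: phi_ge => // l l0 hl.
rewrite -ler_pdivlMr ?expR_gt0//; have lmu0 : 0 < l / expR mu by rewrite divr_gt0 ?expR_gt0.
apply: (phi_le L'0 lmu0).
rewrite ln_div ?posrE ?expR_gt0// expRK; apply: (H a L c _ _ L'0 _ PQ hl).
rewrite ler_pdivrMr// ler_peMr//; first exact: ltW.
by rewrite exprn_ege1// ler1n.
Qed.

End symbol.

(** * Oscillation of the symbol *)

Section cubes.
Context {R : realType} {n : nat}.
Local Notation Rn := (Rn R n.+1).
Local Notation leb := (@lebesgue_Rn R n.+1).

Lemma compact_cube (a : Rn) (L : R) : compact (cube a L : set Rn).
Proof.
have := @rV_compact R n.+1 (fun i => `[a ord0 i, a ord0 i + L]%classic)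
  (fun i => @segment_compact R _ _).
congr compact; apply/seteqP; split => x /= h i; have := h i; by rewrite in_itv.
Qed.

Lemma cubes_cube (a : Rn) (L : R) : 0 < L -> cubes (cube a L).
Proof. by move=> L0; exists a, L. Qed.

Lemma hcube_cubeS (c : Rn) (l : R) (c' : Rn) (l' : R) : 0 < l ->
  hcube c l `<=` hcube c' l' -> cube c l `<=` cube c' l'.
Proof.
move=> l0 H x xc i.
have cc' := H c (hcube_corner c l0).
have /andP[x1 x2] := xc i; have /andP[c1 c2] := cc' i.
rewrite (le_trans c1 x1)/= leNgt; apply/negP => x3.
pose y : Rn := \row_j if j == i then Num.max (c ord0 i) (c' ord0 i + l') else c ord0 j.
have : hcube c l y.
  move=> j; rewrite mxE; case: eqP => [->|_]; last by rewrite lexx ltrDl.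
  by rewrite le_max lexx gt_max ltrDl l0/= (lt_le_trans x3).
by move=> /H /(_ i) /andP[_]; rewrite mxE eqxx gt_max ltxx andbF.
Qed.

Lemma cube_hcube_ae (a : Rn) (L : R) : 0 < L ->
  {ae leb, forall x, cube a L x -> hcube a L x}.
Proof.
move=> L0; exists (cube a L `\` hcube a L); split.
- by apply: measurableD; [exact: measurable_cube|exact: measurable_hcube].
- have h := @measureD _ _ R leb _ _ (measurable_cube a L) (measurable_hcube a L).
  have vQ := lebesgue_cube a (ltW L0).
  have fQ : (leb (cube a L) < +oo)%E by rewrite vQ ltry.
  transitivity (leb (cube a L) - leb (cube a L `&` hcube a L))%E; first exact: h fQ.
  rewrite (_ : _ `&` _ = hcube a L); last first.
    by rewrite setIidr//; exact: hcube_cube.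
  by rewrite vQ (lebesgue_hcube a (ltW L0)) subee.
- by move=> x /= /not_implyP[].
Qed.

Lemma average_dist (P : set Rn) (v : R) (b : Rn -> R) (t : R) : measurable P ->
  leb P = v%:E -> 0 < v -> leb.-integrable P (EFin \o b) ->
  ((`|average b P - t| * v)%:E <= \int[leb]_(x in P) `|b x - t|%:E)%E.
Proof.
move=> mP vP v0 ib.
have it : leb.-integrable P (EFin \o (fun=> t)).
  apply/integrableP; split; first exact: measurable_cst.
  rewrite (eq_integral (fun=> `|t|%:E))//.
  by rewrite (integral_leb_cst _ mP) vP -EFinM ltry.
have ibt : leb.-integrable P (EFin \o (fun x => b x - t)).
  by have := integrableB mP ib it; apply: eq_integrable.
have -> : `|average b P - t| * v = `|\int[leb]_(x in P) (b x - t)|.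
  have vP' : fine (leb P) = v by rewrite vP.
  have ct : \int[leb]_(x in P) t = t * v.
    by rewrite (Rintegral_cst leb mP); congr (_ * _).
  rewrite (RintegralB mP ib it) ct /average vP'.
  rewrite -[X in _ * X = _](gtr0_norm v0) -normrM mulrBl mulrAC mulVf ?gt_eqF// mul1r.
  by [].
rewrite (EFin_normr_Rintegral mP ibt).
have /integrableP[mbt _] := ibt.
exact: (le_abse_integral leb mP mbt).
Qed.

End cubes.

Section oscillation.
Context {R : realType} {n : nat}.
Local Notation Rn := (Rn R n.+1).
Local Notation leb := (@lebesgue_Rn R n.+1).
Context (phi : set Rn -> R) (b : Rn -> R) (M : R).
Hypotheses (phi0 : forall (a : Rn) L, 0 < L -> 0 < phi (cube a L))
  (phid : exists2 C : R, 0 < C & exists2 theta : R, 0 < theta < 1 &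
    forall (a : Rn) (L : R) (c : Rn) (k : nat), 0 < L -> cube c (L / 2 ^+ k) `<=` cube a L ->
    phi (cube c (L / 2 ^+ k)) <= C * theta ^+ k * phi (cube a L))
  (bloc : locally_integrable_Rn b) (M0 : 0 <= M)
  (bM : forall (a : Rn) (L : R), 0 < L ->
    (\int[leb]_(x in cube a L) `|b x - average b (cube a L)|%:E <=
       (M * phi (cube a L) * L ^+ n.+1)%:E)%E).

Lemma loc_int_cube (a : Rn) (L : R) : leb.-integrable (cube a L) (EFin \o b).
Proof. by apply: bloc; exact: compact_cube. Qed.

Lemma loc_int_mfun : mfun b.
Proof.
pose F (k : nat) : set Rn := cube (- const_mx k%:R) (2 * k%:R).
have FT : \bigcup_k F k = [set: Rn].
  apply/seteqP; split => // x _; have [k hk] : exists k : nat, enorm x <= k%:R.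
    have := @archi_boundP R (enorm x) (enorm_ge0 x).
    by exists (Num.bound (enorm x)); exact: ltW.
  exists k => // i; rewrite !mxE; have := le_trans (enorm_ge x i) hk.
  by rewrite ler_norml => /andP[h1 h2]; rewrite h1/= -[X in _ <= X]opprK; lra.
rewrite /mfun -FT; apply/measurable_fun_bigcup => [k|k]; first exact: measurable_cube.
by have /integrableP[/measurable_EFinP] := loc_int_cube (- const_mx k%:R) (2 * k%:R).
Qed.

(* Telescoping of the averages along dyadic cubes converges geometrically because phi
   decays; the density lemma then turns the bound on averages into a pointwise one. *)
Lemma osc_pt : exists2 C : R, 0 < C & forall (a : Rn) (L : R), 0 < L ->
  {ae leb, forall x, cube a L x -> `|b x - average b (cube a L)| <= C * phi (cube a L)}.
Proof.
have [C C0 [th /andP[th0 th1] H]] := phid.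
have q0 : 0 < 1 - th by rewrite subr_gt0.
(* [M * C] bounds the mean oscillation on the small cube; the other term sums the telescoping
   differences, where each halving costs the volume ratio 2^N of the parent, with N the
   dimension. *)
pose W := M * C + 2 ^+ n.+1 * M * C / (1 - th).
have W0 : 0 <= W.
  by rewrite addr_ge0 ?divr_ge0 ?mulr_ge0 ?(ltW C0) ?(ltW q0)// exprn_ge0.
exists (W + 1) => [|a L L0]; first by rewrite ltr_wpDl.
set Q := cube a L; set t := average b Q.
have pQ := phi0 a L0.
have p2 k : 0 < 2 ^+ k :> R by rewrite exprn_gt0.
have Lk k : 0 < L / 2 ^+ k by rewrite divr_gt0.
have step k c : dyadic a L k c ->
  `|average b (cube c (L / 2 ^+ k)) - t| <=
    2 ^+ n.+1 * M * C * phi Q * \sum_(j < k) th ^+ j.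
  elim: k c => [|k IH] c hc.
    have -> : c = a.
      case: hc => z hz; apply/rowP => i; have [z1 ->] := hz i.
      by move: z1; rewrite expn0 ltnS leqn0 => /eqP ->; rewrite mul0r addr0.
    by rewrite expr0 divr1 subrr normr0 big_ord0 mulr0.
  have [c' hc' sub] := dyadic_parent L0 hc.
  have sub' := hcube_cubeS (Lk k.+1) sub.
  have Pin : cube c' (L / 2 ^+ k) `<=` Q := hcube_cubeS (Lk k) (dyadicS L0 hc').
  have vP := lebesgue_cube c (ltW (Lk k.+1)).
  have vP0 : 0 < (L / 2 ^+ k.+1) ^+ n.+1 by rewrite exprn_gt0.
  have h1 : `|average b (cube c (L / 2 ^+ k.+1)) - average b (cube c' (L / 2 ^+ k))| <=
      2 ^+ n.+1 * M * phi (cube c' (L / 2 ^+ k)).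
    rewrite -(ler_pM2r vP0) -lee_fin.
    apply: le_trans (average_dist _ (measurable_cube c _) vP vP0 (loc_int_cube c _)) _.
    apply: (@le_trans _ _ (\int[leb]_(x in cube c' (L / 2 ^+ k))
        `|b x - average b (cube c' (L / 2 ^+ k))|%:E)%E).
      by apply: leintS => // x _; rewrite lee_fin.
    apply: le_trans (bM c' (Lk k)) _; rewrite lee_fin.
    have -> : L / 2 ^+ k = 2 * (L / 2 ^+ k.+1) by rewrite exprS; field; rewrite gt_eqF.
    by rewrite exprMn le_eqVlt; apply/orP; left; apply/eqP; ring.
  rewrite -(subrKA (average b (cube c' (L / 2 ^+ k)))).
  apply: le_trans (ler_normD _ _) _; rewrite big_ord_recr/= mulrDr addrC.
  apply: lerD; first exact: IH.
  apply: le_trans h1 _; rewrite -!mulrA; apply: ler_wpM2l; first by rewrite exprn_ge0.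
  apply: ler_wpM2l => //; apply: le_trans (H a L c' k L0 Pin) _.
  by rewrite le_eqVlt; apply/orP; left; apply/eqP; ring.
have geo k : \sum_(j < k) th ^+ j <= (1 - th)^-1.
  rewrite -(ler_pM2l q0) mulfV ?gt_eqF//.
  have := subrX1 th k; have : 0 <= th ^+ k by rewrite exprn_ge0// ltW.
  by lra.
have mb := loc_int_mfun.
have mbt : mfun (fun x => `|b x - t|) by apply: mfun_norm; apply: mfunB => //; exact: mfun_cst.
have key k c : dyadic a L k c ->
  (\int[leb]_(x in hcube c (L / 2 ^+ k)) `|b x - t|%:E <=
    (W * phi Q)%:E * leb (hcube c (L / 2 ^+ k)))%E.
  move=> hc; set P := cube c (L / 2 ^+ k).
  have mP : measurable P by exact: measurable_cube.
  have vP := lebesgue_cube c (ltW (Lk k)).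
  have Pin : P `<=` Q := hcube_cubeS (Lk k) (dyadicS L0 hc).
  rewrite (lebesgue_hcube c (ltW (Lk k))) -EFinM.
  apply: (@le_trans _ _ (\int[leb]_(x in P) `|b x - t|%:E)%E).
    by apply: leintS => [|x _]; [exact: hcube_cube|rewrite lee_fin].
  apply: (@le_trans _ _ (\int[leb]_(x in P) (`|b x - average b P| + `|average b P - t|)%:E)%E).
    apply: leint => x _; first by rewrite lee_fin.
    by rewrite lee_fin -(subrKA (average b P)); exact: ler_normD.
  rewrite (intDD mP (mfun_norm (mfunB mb (mfun_cst _))) (mfun_cst _)
    (fun x => normr_ge0 _) (fun=> normr_ge0 _)).
  rewrite (integral_leb_cst _ mP) vP.
  apply: le_trans (leeD (bM c (Lk k)) (lexx _)) _.
  rewrite -EFinM -EFinD lee_fin -mulrDl; apply: ler_wpM2r; first by rewrite exprn_ge0// ltW.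
  rewrite /W mulrDl; apply: lerD.
    rewrite -!mulrA; apply: ler_wpM2l => //; apply: le_trans (H a L c k L0 Pin) _.
    rewrite -mulrA; apply: ler_wpM2l; first exact: ltW.
    by rewrite ler_piMl ?(ltW pQ)// exprn_ile1// ltW.
  apply: le_trans (step k c hc) _; rewrite [leRHS]mulrAC; apply: ler_wpM2l; last exact: geo.
  by rewrite !mulr_ge0 ?(ltW C0) ?(ltW pQ)// exprn_ge0.
have dens := @dyadic_density R n a L (fun x => `|b x - t|%:E) (W * phi Q) (hcube a L)
  L0 (mulr_ge0 W0 (ltW pQ)) (mfunED mbt) (fun x => normr_ge0 _) (measurable_hcube a L)
  (@subset_refl _ _) (fun x k c _ hc _ => key k c hc).
apply: (ae_mono2 dens (cube_hcube_ae a L0)) => x h1 h2 /h2 /h1.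
rewrite lee_fin => /le_trans; apply; rewrite ler_pM2r// lerDl.
exact: ler01.
Qed.

End oscillation.

(** * Commutators on bounded functions *)

Section covering.
Context {R : realType} {n : nat}.
Local Notation Rn := (Rn R n.+1).
Local Notation leb := (@lebesgue_Rn R n.+1).
Local Notation N := (n.+1%:R : R).

Lemma measurable_dil (c : Rn) (s : R) : measurable (dil c s).
Proof. exact: measurable_cube. Qed.

Lemma dil_corner (c : Rn) (s : R) : 0 < s -> dil c s c.
Proof.
move=> s0; apply/dilP => i; rewrite subrr oppr_le0.
by rewrite !mulr_ge0 ?addr_ge0// ltW.
Qed.

Lemma seq_argmax (s : nat -> R) (l : seq nat) : l != [::] ->
  exists2 i0, i0 \in l & forall i, i \in l -> s i <= s i0.
Proof.
elim: l => // a [_ _|a' l IH _].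
  by exists a; rewrite ?mem_head// => i; rewrite inE => /eqP ->.
have [//|i0 il hi] := IH.
have [h|h] := leP (s a) (s i0).
  exists i0; first by rewrite inE il orbT.
  by move=> i; rewrite inE => /predU1P[->//|]; exact: hi.
exists a; first exact: mem_head.
by move=> i; rewrite inE => /predU1P[->//|/hi/le_trans]; apply; exact: ltW.
Qed.

Lemma dil_meet (c c' : Rn) (s s' : R) : 0 < s' -> s' <= s ->
  dil c' s' `&` dil c s !=set0 ->
  hcube c' s' `<=` cube (c - const_mx ((6 * N + 2) * s)) (2 * (6 * N + 2) * s).
Proof.
move=> s'0 ss' [z [/dilP z1 /dilP z2]] x xP i; rewrite !mxE.
have /andP[a1 a2] := z1 i; have /andP[b1 b2] := z2 i; have /andP[x1 x2] := xP i.
have N0 : 1 <= N by rewrite ler1n.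
have h : N * s' <= N * s by rewrite ler_wpM2l.
have h' : s <= N * s by rewrite ler_peMl// (le_trans _ ss')// ltW.
by apply/andP; split; lra.
Qed.

(** Vitali selection: the largest cube is kept, every cube whose dilate meets its dilate lies in a
    fixed multiple of it, and the others are left to induction. The selection separates dilates
    rather than cubes because the integrals are taken over dilates. *)
Lemma vitali_dil (f : Rn -> R) (lam : R) (c : nat -> Rn) (s : nat -> R) (l : seq nat) :
  mfun f -> (forall x, 0 <= f x) -> 0 < lam ->
  (forall i, i \in l -> 0 < s i /\
     ((lam * s i ^+ n.+1)%:E <= \int[leb]_(x in dil (c i) (s i)) (f x)%:E)%E) ->
  (lam%:E * leb (\bigcup_(i in [set` l]) hcube (c i) (s i)) <=
   ((2 * (6 * N + 2)) ^+ n.+1)%:E *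
     \int[leb]_(x in \bigcup_(i in [set` l]) dil (c i) (s i)) (f x)%:E)%E.
Proof.
move=> mf f0 lam0; have [k] := ubnP (size l); elim: k l => // k IH l lk H.
set K := _ ^+ n.+1; have K0 : 0 <= K.
  by rewrite exprn_ge0// mulr_ge0// addr_ge0// mulr_ge0.
have [->|l0] := eqVneq l [::].
  rewrite (_ : [set` [::]] = set0) ?bigcup_set0 ?measure0 ?mule0//.
    by rewrite mule_ge0 ?lee_fin// integral_ge0// => x _; rewrite lee_fin.
  by apply/seteqP; split.
have [i0 il hmax] := seq_argmax s l0.
have [s0 hi0] := H i0 il.
pose a i := `[< dil (c i) (s i) `&` dil (c i0) (s i0) = set0 >].
pose l' := seq.filter a l.
have ai0 : ~~ a i0.
  apply/asboolPn => h0; have : set0 (c i0) by rewrite -h0; split; exact: dil_corner.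
  by [].
have lk' : (size l' < k)%N.
  rewrite ltnS in lk; apply: leq_trans lk; rewrite size_filter ltn_neqAle count_size andbT.
  rewrite -all_count; apply/negP => /allP /(_ i0 il); exact/negP.
have mD (l2 : seq nat) : measurable (\bigcup_(i in [set` l2]) dil (c i) (s i)).
  by apply: bigcup_measurable => i _; exact: measurable_dil.
have IH' := IH l' lk' (fun i il' => H i (mem_subseq (filter_subseq a l) il')).
pose B : set Rn := cube (c i0 - const_mx ((6 * N + 2) * s i0)) (2 * (6 * N + 2) * s i0).
have BE : leb B = (K * s i0 ^+ n.+1)%:E.
  rewrite /B lebesgue_cube; first by rewrite exprMn.
  by rewrite !mulr_ge0 ?addr_ge0 ?mulr_ge0// ltW.
have sub : \bigcup_(i in [set` l]) hcube (c i) (s i) `<=`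
    B `|` \bigcup_(i in [set` l']) hcube (c i) (s i).
  move=> x [i /= hil xi]; have [ai|ai] := boolP (a i).
    by right; exists i => //=; rewrite mem_filter ai.
  left; have [si0 _] := H i hil.
  apply: (@dil_meet _ (c i) _ (s i)) => //; first exact: hmax.
  by apply/set0P/eqP => h; move/asboolPn: ai; apply.
pose D1 := dil (c i0) (s i0).
pose D2 := \bigcup_(i in [set` l']) dil (c i) (s i).
have disj : [disjoint D1 & D2].
  apply/disj_set2P; apply/seteqP; split => // x [x1 [i /= hi x2]].
  move: hi; rewrite mem_filter => /andP[/asboolP h _].
  by suff : set0 x by []; rewrite -h; split.
apply: (@le_trans _ _ (K%:E * \int[leb]_(x in D1 `|` D2) (f x)%:E)%E); last first.
  apply: lee_wpmul2l; first by rewrite lee_fin.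
  apply: leintS => [x [x1|[i /= hi xi]]|x _]; last by rewrite lee_fin.
    by exists i0.
  by exists i => //; rewrite /= in hi *; move: hi; rewrite mem_filter => /andP[].
rewrite (ge0_integral_setU leb (measurable_dil _ _) (mD l') (mfunED mf) (fun x _ => f0 x) disj).
rewrite ge0_muleDr; last 2 first.
- by apply: integral_ge0 => x _; rewrite lee_fin.
- by apply: integral_ge0 => x _; rewrite lee_fin.
apply: (@le_trans _ _ (lam%:E * (leb B + leb (\bigcup_(i in [set` l']) hcube (c i) (s i))))%E).
  apply: lee_wpmul2l; first by rewrite lee_fin ltW.
  by apply: le_trans (leb_le sub) _; exact: leb_setU.
rewrite ge0_muleDr; [|exact: leb_ge0|exact: leb_ge0].
apply: leeD; last exact: IH'.
by rewrite BE -EFinM mulrCA EFinM; apply: lee_wpmul2l; [rewrite lee_fin|exact: hi0].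
Qed.

End covering.

(** * Expansion of the commutator around a constant *)

Section expansion.
Context {R : realType} {n : nat}.
Local Notation Rn := (Rn R n.+1).
Local Notation leb := (@lebesgue_Rn R n.+1).
Context {omega : R -> R} {T : (Rn -> R) -> Rn -> R} {K : Rn -> Rn -> R}.
Hypothesis cz : CZop omega T K.
Variable b : Rn -> R.

(** The number (-1)^k binomial(m, k), in the form of the recursion that one more commutator
    produces. *)
Fixpoint comm_coef (m k : nat) : R :=
  match m, k with
  | 0%N, 0%N => 1
  | 0%N, _.+1 => 0
  | m'.+1, 0%N => comm_coef m' 0
  | m'.+1, k'.+1 => comm_coef m' k - comm_coef m' k'
  end.

Lemma comm_coef_gt m k : (m < k)%N -> comm_coef m k = 0.
Proof.
elim: m k => [|m IH] [|k]//= mk; rewrite !IH ?subrr//; exact: ltnW.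
Qed.

Lemma L2_shift (c : R) k (f : Rn -> R) :
  (forall j, (j <= k)%N -> L2 (fun x => b x ^+ j * f x)) ->
  L2 (fun x => (b x - c) ^+ k * f x).
Proof.
elim: k f => [|k IH] f H.
  have := H 0%N isT; congr L2; apply/funext => x.
have h1 : L2 (fun x => (b x - c) ^+ k * (b x * f x)).
  apply: IH => j jk; have := H j.+1 jk; congr L2; apply/funext => x.
  by rewrite exprSr mulrA.
have h2 : L2 (fun x => (b x - c) ^+ k * f x).
  by apply: IH => j jk; apply: H; exact: leqW.
have := L2_lin (- c) h2 h1; congr L2; apply/funext => x; rewrite exprSr; ring.
Qed.

(** A constant commutes with [T], so [b] may be replaced by [b - c], and the identity is the
    binomial formula for the shifted symbol. *)
Lemma comm_expansion (c : R) m (f : Rn -> R) :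
  (forall k, (k <= m)%N -> L2 (fun x => b x ^+ k * f x)) ->
  {ae leb, forall x, iter_commutator m b T f x =
    \sum_(k < m.+1) comm_coef m k * (b x - c) ^+ (m - k) *
      T (fun y => (b y - c) ^+ k * f y) x}.
Proof.
elim: m f => [|m IH] f H.
  apply: aeW => x; rewrite big_ord1 /= mul1r mul1r.
  by congr (T _ x); apply/funext => y; rewrite expr0 mul1r.
have Hb k : (k <= m)%N -> L2 (fun x => b x ^+ k * (b \* f) x).
  by move=> km; have := H k.+1 km; congr L2; apply/funext => x; rewrite exprSr mulrA.
have step : {ae leb, forall x, forall k, (k <= m)%N ->
    T (fun y => (b y - c) ^+ k * (b \* f) y) x =
    c * T (fun y => (b y - c) ^+ k * f y) x + T (fun y => (b y - c) ^+ k.+1 * f y) x}.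
  apply: ae_foralln => k; have [km|km] := leqP k m; last by apply: aeW.
  have h1 : L2 (fun x => (b x - c) ^+ k * f x).
    by apply: L2_shift => j jk; apply: H; exact: leq_trans jk (leqW km).
  have h2 : L2 (fun x => (b x - c) ^+ k.+1 * f x).
    by apply: L2_shift => j jk; apply: H; exact: leq_trans jk _.
  apply: (ae_mono (cz_lin cz c h1 h2)) => x hx _; rewrite -hx; congr (T _ x).
  by apply/funext => y /=; rewrite exprS; ring.
have h1 := IH f (fun k km => H k (leqW km)); have h2 := IH _ Hb.
have h3 := ae_mono2 h1 h2 (fun x a b => conj a b).
apply: (ae_mono2 h3 step) => x [e1 e2] e3.
rewrite [LHS](_ : _ = b x * iter_commutator m b T f x - iter_commutator m b T (b \* f) x)//.
rewrite e1 e2 [X in _ - X = _](eq_bigr (fun k : 'I_m.+1 => c * (comm_coef m k * (b x - c) ^+ (m - k) *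
    T (fun y => (b y - c) ^+ k * f y) x) + comm_coef m k * (b x - c) ^+ (m - k) *
    T (fun y => (b y - c) ^+ k.+1 * f y) x)); last first.
  move=> k _; have km : (k <= m)%N by rewrite -ltnS.
  by rewrite (e3 _ km); ring.
rewrite big_split/= -mulr_sumr opprD addrA -mulrBl mulr_sumr.
pose X k := T (fun y => (b y - c) ^+ k * f y) x.
rewrite [RHS]big_ord_recl/= subn0.
rewrite [in RHS](eq_bigr (fun k : 'I_m.+1 => comm_coef m k.+1 * (b x - c) ^+ (m - k) * X k.+1
   - comm_coef m k * (b x - c) ^+ (m - k) * X k.+1)); last first.
  by move=> k _; rewrite /bump/= add1n subSS !mulrBl.
rewrite sumrB addrA; congr (_ - _).
rewrite big_ord_recl/= subn0 [in RHS]big_ord_recr/= (comm_coef_gt (ltnSn m)) !mul0r addr0.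
congr (_ + _); first by rewrite exprS; ring.
apply: eq_bigr => k _; rewrite /bump/= add1n.
have -> : (m - k = (m - k.+1).+1)%N by rewrite subnSK.
by rewrite exprS /X; ring.
Qed.

End expansion.

Section stopping_tools.
Context {R : realType} {n : nat}.
Local Notation Rn := (Rn R n.+1).
Local Notation leb := (@lebesgue_Rn R n.+1).
Local Notation N := (n.+1%:R : R).

Lemma leb_bigcup_fin (E : nat -> set Rn) (v : R) (m : nat) : 0 <= v ->
  (forall k, (k < m)%N -> leb (E k) <= v%:E)%E ->
  (leb (\bigcup_(k in [set k | (k < m)%N]) E k) <= (m%:R * v)%:E)%E.
Proof.
move=> v0; elim: m => [|m IH] H.
  rewrite (_ : \bigcup_(_ in _) _ = set0) ?measure0 ?mul0r//.
  by apply/seteqP; split => // x [].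
apply: (@le_trans _ _ (leb (\bigcup_(k in [set k | (k < m)%N]) E k `|` E m))).
  apply: leb_le => x [k /= km xk]; move: km; rewrite ltnS leq_eqVlt => /predU1P[kE|km].
    by right; rewrite -kE.
  by left; exists k.
apply: le_trans (leb_setU _ _) _; rewrite -natr1 mulrDl mul1r EFinD; apply: leeD.
  by apply: IH => k km; apply: H; exact: ltnW.
exact: H.
Qed.

Lemma stop_total (J : set nat) (P : nat -> set Rn) (f : Rn -> R) (a : R) : 0 <= a ->
  (forall i, J i -> measurable (P i)) -> trivIset J P -> mfun f -> (forall x, 0 <= f x) ->
  (forall i, J i -> leb (P i) <= a%:E * \int[leb]_(x in P i) (f x)%:E)%E ->
  (leb (\bigcup_(i in J) P i) <= a%:E * \int[leb]_x (f x)%:E)%E.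
Proof.
move=> a0 mP tP mf f0 H.
have mU : measurable (\bigcup_(i in J) P i) by apply: bigcup_measurable.
have mc (c : R) (A : set Rn) : measurable_fun A (fun=> c%:E : \bar R) by exact: measurable_cst.
have -> : leb (\bigcup_(i in J) P i) = (\int[leb]_(x in \bigcup_(i in J) P i) 1%:E)%E.
  by rewrite (integral_leb_cst _ mU) mul1e.
rewrite (ge0_integral_bigcup_cond mP tP (mc 1 _) (fun x _ => lee01)).
rewrite -(intZ (mfunE mf) a0 (fun x => f0 x)).
apply: le_trans (integral_cond_bigcup_le mP tP _ _); last 2 first.
- by apply: mfunE; exact: mfunZ.
- by move=> x; rewrite mule_ge0 ?lee_fin.
apply: lee_nneseries => [i _ _|i iJ]; first by apply: integral_ge0 => x _; rewrite lee_fin.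
have Ji : J i by move: iJ; rewrite inE.
by rewrite (integral_leb_cst _ (mP i Ji)) mul1e (intZD (mP i Ji) mf a0 f0); exact: H.
Qed.

Lemma vitali_countable (f : Rn -> R) (lam : R) (c : nat -> Rn) (s : nat -> R) (J : set nat) :
  mfun f -> (forall x, 0 <= f x) -> 0 < lam ->
  (forall i, J i -> 0 < s i /\
     ((lam * s i ^+ n.+1)%:E <= \int[leb]_(x in dil (c i) (s i)) (f x)%:E)%E) ->
  (lam%:E * leb (\bigcup_(i in J) hcube (c i) (s i)) <=
   ((2 * (6 * N + 2)) ^+ n.+1)%:E * \int[leb]_x (f x)%:E)%E.
Proof.
move=> mf f0 lam0 H; set K := _ ^+ n.+1.
have K0 : 0 <= K by rewrite exprn_ge0// mulr_ge0// addr_ge0// mulr_ge0.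
pose F M : set Rn := \bigcup_(i in J `&` [set i | (i < M)%N]) hcube (c i) (s i).
have mF M : measurable (F M).
  by apply: bigcup_measurable => i _; exact: measurable_hcube.
have FE : \bigcup_M F M = \bigcup_(i in J) hcube (c i) (s i).
  apply/seteqP; split => x.
    by move=> [M _ [i [Ji _] xi]]; exists i.
  by move=> [i Ji xi]; exists i.+1 => //; exists i => //; split => //=.
have ndF : nondecreasing_seq F.
  by move=> M M' MM'; apply/subsetPset => x [i [Ji /= iM] xi]; exists i => //; split => //=;
    exact: leq_trans MM'.
rewrite -FE; have mUF : measurable (\bigcup_M F M) by exact: bigcup_measurable.
have cv0 := @nondecreasing_cvg_mu _ Rn R leb F mF mUF ndF.
have cv := cvgeZl (isT : lam%:E \is a fin_num) cv0.
rewrite -(cvg_lim _ cv)//; apply: lime_le; first by apply/cvg_ex; eexists; exact: cv.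
near=> M => /=.
pose l := [seq i <- iota 0 M | `[< J i >]].
have lE : [set` l] = J `&` [set i | (i < M)%N].
  apply/seteqP; split => i /=; rewrite mem_filter mem_iota add0n leq0n /=.
    by move=> /andP[/asboolP].
  by move=> [Ji iM]; rewrite iM andbT; apply/asboolP.
have := @vitali_dil R n f lam c s l mf f0 lam0.
rewrite lE => /(_ _)/le_trans; apply.
  move=> i il; apply: H; have : [set` l] i by [].
  by rewrite lE => -[].
apply: lee_wpmul2l; first by rewrite lee_fin.
by apply: leintS => // x _; rewrite lee_fin.
Unshelve. all: end_near.
Qed.

(** The exceptional sets take at most one half and one quarter of [P], so some point avoids both and
    the null set. *)
Lemma exists_good (P E B : set Rn) (Q : Rn -> Prop) (v : R) : 0 < v -> leb P = v%:E ->
  (leb (P `&` E) <= (v / 2)%:E)%E -> (leb B <= (v / 4)%:E)%E -> {ae leb, forall x, Q x} ->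
  exists x, [/\ P x, ~ E x, ~ B x & Q x].
Proof.
move=> v0 vP vE vB [Z [mZ Z0 hZ]]; apply: contrapT => H.
have : (leb P <= leb ((P `&` E) `|` B `|` Z))%E.
  apply: leb_le => x Px; have [Ex|Ex] := pselect (E x); first by left; left.
  have [Bx|Bx] := pselect (B x); first by left; right.
  right; apply: hZ => /= Qx; apply: H; by exists x.
apply/negP; rewrite -ltNge vP; apply: le_lt_trans (leb_setU _ _) _.
have -> : leb Z = 0%E by exact: Z0.
rewrite adde0; apply: le_lt_trans (leb_setU _ _) _.
apply: le_lt_trans (leeD vE vB) _; rewrite -EFinD lte_fin.
by lra.
Qed.

Lemma dilS (c c' : Rn) (s s' : R) : 0 < s' -> hcube c' s' `<=` hcube c s -> 0 < s ->
  dil c' s' `<=` dil c s.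
Proof.
move=> s'0 sub s0 x xc; apply/dilP => i.
have sub' := hcube_cubeS s'0 sub.
have /andP[h1 h2] := sub' _ (hcube_cube (hcube_corner c' s'0)) i.
have : cube c' s' (c' + const_mx s').
  by move=> j; rewrite !mxE; apply/andP; split; lra.
move=> /sub' /(_ i); rewrite !mxE => /andP[h3 h4].
have /dilP/(_ i)/andP[h5 h6] := xc.
have ss' : s' <= s.
  by lra.
have h : N * s' <= N * s by rewrite ler_wpM2l.
by apply/andP; split; lra.
Qed.

End stopping_tools.

Section commutator_tools.
Context {R : realType} {n : nat}.
Local Notation Rn := (Rn R n.+1).
Local Notation leb := (@lebesgue_Rn R n.+1).
Context {omega : R -> R} {T : (Rn -> R) -> Rn -> R} {K : Rn -> Rn -> R}.
Hypothesis cz : CZop omega T K.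
Variables (b : Rn -> R).
Hypothesis mb : mfun b.

Lemma commS m (f : Rn -> R) x : iter_commutator m.+1 b T f x =
  b x * iter_commutator m b T f x - iter_commutator m b T (b \* f) x.
Proof. by []. Qed.

Lemma comm_dom_b m (f : Rn -> R) : commutator_domain m.+1 b f -> commutator_domain m b (b \* f).
Proof.
by move=> H k km; have := H k.+1 km; congr L2; apply/funext => x; rewrite exprSr mulrA.
Qed.

Lemma comm_dom_le m (f : Rn -> R) : commutator_domain m.+1 b f -> commutator_domain m b f.
Proof. by move=> H k km; apply: H; exact: leqW. Qed.

Lemma comm_mfun m (f : Rn -> R) : commutator_domain m b f -> mfun (iter_commutator m b T f).
Proof.
elim: m f => [|m IH] f H.
  apply: L2_mfun; apply: (L2_T cz); have := H 0%N isT; congr L2.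
  by apply/funext => x; rewrite expr0 mul1r.
apply: mfunB; last exact: IH (comm_dom_b H).
by apply: mfunM => //; apply: IH; exact: comm_dom_le.
Qed.

Lemma comm_lin m (a : R) (f g : Rn -> R) : commutator_domain m b f -> commutator_domain m b g ->
  {ae leb, forall x, iter_commutator m b T (fun y => a * f y + g y) x =
     a * iter_commutator m b T f x + iter_commutator m b T g x}.
Proof.
elim: m f g => [|m IH] f g Hf Hg.
  have h k : commutator_domain 0 b k -> L2 k.
    by move=> /(_ 0%N isT); congr L2; apply/funext => x; rewrite expr0 mul1r.
  exact: (cz_lin cz a (h _ Hf) (h _ Hg)).
have h1 := IH _ _ (comm_dom_le Hf) (comm_dom_le Hg).
have h2 := IH _ _ (comm_dom_b Hf) (comm_dom_b Hg).
apply: (ae_mono2 h1 h2) => x e1 e2.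
rewrite !commS e1 (_ : b \* _ = (fun y => a * (b \* f) y + (b \* g) y)).
  by rewrite e2; ring.
by apply/funext => y /=; ring.
Qed.

(* On these functions all the iterated commutators are defined through L2 functions,
   and the estimates below are qualitatively finite. *)
Definition nice (u : Rn -> R) := mfun u /\ exists M (c0 : Rn) s0,
  [/\ forall x, `|u x| <= M, forall x, ~ hcube c0 s0 x -> u x = 0 &
      forall x, M < `|b x| -> u x = 0].

Lemma nice_restrict (u : Rn -> R) (D : set Rn) : measurable D -> nice u ->
  nice (fun x => \1_D x * u x).
Proof.
move=> mD [mu [M [c0 [s0 [h1 h2 h3]]]]]; split; first by apply: mfunM => //; exact: mfun1.
exists M, c0, s0; split => x.
- rewrite normrM; apply: le_trans (h1 x); rewrite ler_piMl// indicE.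
  by case: (_ \in _); rewrite ?normr1 ?normr0.
- by move=> /h2 ->; rewrite mulr0.
- by move=> /h3 ->; rewrite mulr0.
Qed.

Lemma nice_dom (u : Rn -> R) m : nice u -> commutator_domain m b u.
Proof.
move=> [mu [M [c0 [s0 [h1 h2 h3]]]]] k _.
have M0 : 0 <= M by apply: le_trans (h1 0).
apply: (L2_bounded (c := c0) (s := s0) (M := M ^+ k * M)).
- by apply: mfunM => //; exact: mfunX.
- move=> x; rewrite normrM normrX; have [bM|bM] := leP `|b x| M.
    by apply: ler_pM => //; rewrite ?exprn_ge0// lerXn2r ?nnegrE.
  by rewrite (h3 _ bM) normr0 mulr0 mulr_ge0// exprn_ge0.
- by move=> x /h2 ->; rewrite mulr0.
Qed.

Lemma nice_L2 (u : Rn -> R) (D : set Rn) (c : R) k : measurable D -> nice u ->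
  L2 (fun x => (b x - c) ^+ k * (\1_D x * u x)).
Proof.
move=> mD nu; apply: L2_shift => j _.
exact: (nice_dom (m := j) (nice_restrict mD nu) (leqnn j)).
Qed.

End commutator_tools.

(** * The local bilinear form *)

Section one_step.
Context {R : realType} {n : nat}.
Local Notation Rn := (Rn R n.+1).
Local Notation leb := (@lebesgue_Rn R n.+1).
Local Notation N := (n.+1%:R : R).
Context {omega : R -> R} {T : (Rn -> R) -> Rn -> R} {K : Rn -> Rn -> R}.
Hypothesis cz : CZop omega T K.
Context (b : Rn -> R) (m : nat) (psi beta : Rn -> R -> R).
Hypotheses (mb : mfun b) (psi0 : forall c s, 0 < s -> 0 < psi c s)
  (hbeta : forall c s, 0 < s ->
    {ae leb, forall x, dil c s x -> `|b x - beta c s| <= psi c s}).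

Definition moment (c : Rn) (s : R) (k : nat) (D : set Rn) (u : Rn -> R) : Rn -> R :=
  fun y => (b y - beta c s) ^+ k * (\1_D y * u y).

Lemma osc_power (c : Rn) (s : R) k (g : Rn -> R) (D : set Rn) : 0 < s -> mfun g ->
  measurable D -> (forall x, ~ dil c s x -> g x = 0) ->
  (\int[leb]_(x in D) `|(b x - beta c s) ^+ k * g x|%:E <=
    (psi c s ^+ k)%:E * \int[leb]_(x in D) `|g x|%:E)%E.
Proof.
move=> s0 mg mD g0.
have p0 : 0 <= psi c s ^+ k by rewrite exprn_ge0// ltW// psi0.
rewrite -(intZD mD (mfun_norm mg) p0 (fun x => normr_ge0 _)).
rewrite (int1 D) (int1 D); apply: ae_le_int.
- by move=> x; rewrite lee_fin mulr_ge0// indicE.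
- by move=> x; rewrite lee_fin !mulr_ge0// indicE.
apply: (ae_mono (hbeta c s0)) => x hx; rewrite lee_fin; apply: ler_wpM2l.
  by rewrite indicE.
have [xd|xd] := pselect (dil c s x); last by rewrite (g0 _ xd) mulr0 normr0 mulr0.
rewrite normrM normrX; apply: ler_wpM2r => //.
by rewrite lerXn2r ?nnegrE ?hx// ltW// psi0.
Qed.

Lemma moment_L2 c s k D u : measurable D -> nice b u -> L2 (moment c s k D u).
Proof. by move=> mD nu; exact: nice_L2. Qed.

Lemma indic_out (D : set Rn) (u : Rn -> R) x : ~ D x -> \1_D x * u x = 0.
Proof. by move=> xD; rewrite indicE memNset// mul0r. Qed.

(** The large cube provides the centre and the scale [psi] of the moment, the small one its support.
    The level carries a free factor [A], by which the exceptional set can be made a small fraction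
    of the small cube. *)
Lemma weak_moment : exists2 C : R, 0 < C &
  forall u (c : Rn) (s : R) (c1 : Rn) (s1 t A : R) k,
  nice b u -> 0 < s -> 0 < s1 -> dil c1 s1 `<=` dil c s -> 0 < t -> 1 <= A ->
  (\int[leb]_(x in dil c1 s1) `|u x|%:E <= (t * s1 ^+ n.+1)%:E)%E ->
  (leb [set x : Rn | (A * psi c s ^+ k * t < `|T (moment c s k (dil c1 s1) u) x|)%R] <=
    (C / A * s1 ^+ n.+1)%:E)%E.
Proof.
have [C C0 H] := weak_type cz; exists C => // u c s c1 s1 t A k nu s0 s10 sub t0 A1 hu.
have A0 : 0 < A by exact: lt_le_trans A1.
have p0 : 0 < psi c s ^+ k by rewrite exprn_gt0// psi0.
set h := moment _ _ _ _ _.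
have Lh : L2 h by apply: moment_L2 => //; exact: measurable_dil.
have mu : mfun (fun x => \1_(dil c1 s1) x * u x).
  by apply: mfunM; [apply: mfun1; exact: measurable_dil|case: nu].
have hint : (\int[leb]_x `|h x|%:E <= (psi c s ^+ k * t * s1 ^+ n.+1)%:E)%E.
  apply: (le_trans (osc_power k s0 mu measurableT _)).
    by move=> x xd; apply: indic_out => /sub.
  rewrite -mulrA EFinM lee_pmul2l ?lte_fin//; apply: le_trans hu.
  rewrite (int1 (dil _ _)) le_eqVlt; apply/orP; left; apply/eqP.
  by apply: eq_integral => x _; rewrite normrM ger0_norm// indicE.
have L0 : 0 < A * psi c s ^+ k * t by rewrite !mulr_gt0.
have B4 : 1 <= 4 * N + 2.
  have : 1 <= N by rewrite ler1n.
  by lra.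
have := H (c1 - const_mx (2 * N * s1)) ((4 * N + 2) * s1) (A * psi c s ^+ k * t) h.
move=> /(_ _ L0 Lh _ _)/le_trans.
have -> : (C / A * s1 ^+ n.+1)%:E = ((A * psi c s ^+ k * t)^-1%:E *
   (C%:E * (psi c s ^+ k * t * s1 ^+ n.+1)%:E))%E.
  by rewrite -!EFinM; congr EFin; field; rewrite !gt_eqF.
rewrite lee_pdivlMl// => ->//.
- by rewrite mulr_gt0// (lt_le_trans ltr01).
- move=> x xd; rewrite /h /moment indic_out ?mulr0// => /(dil_hcube s10); exact: xd.
- apply: le_trans hint _; rewrite lee_fin exprMn.
  have : 1 <= (4 * N + 2) ^+ n.+1 by exact: exprn_ege1.
  have e0 : 0 <= psi c s ^+ k * t * s1 ^+ n.+1 by rewrite !mulr_ge0 ?(ltW p0) ?(ltW t0)// exprn_ge0// ltW.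
  move=> e1; rewrite -[leLHS]mul1r.
  have -> : A * psi c s ^+ k * t * ((4 * N + 2) ^+ n.+1 * s1 ^+ n.+1) =
     (A * (4 * N + 2) ^+ n.+1) * (psi c s ^+ k * t * s1 ^+ n.+1) by ring.
  by apply: ler_wpM2r => //; apply: (le_trans A1); rewrite ler_peMr// ltW.
- by rewrite lee_pmul2l ?lte_fin.
Qed.

(* Off this set all the terms T ((b - beta)^k u) of the expansion of the commutator are
   controlled by the average t of u. *)
Definition bad_set (A : R) (c : Rn) (s t : R) (u : Rn -> R) : set Rn :=
  \bigcup_(k in [set k | (k < m.+1)%N])
    [set x : Rn | A * psi c s ^+ k * t < `|T (moment c s k (dil c s) u) x|].

Lemma measurable_bad_set A c s t u : nice b u -> measurable (bad_set A c s t u).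
Proof.
move=> nu; apply: bigcup_measurable => k _; apply: mfun_gt; apply: mfun_norm.
by apply: L2_mfun; apply: (L2_T cz); apply: moment_L2 => //; exact: measurable_dil.
Qed.

(** A cube is stopped when the bad set fills more than the fraction 2^-(n+2) of it, or when the
    average of |u| over its dilate exceeds A t. The ancestors satisfy neither. As a parent is
    2^(n+1) times as large as its child, the bad set then fills at most half of a stopped cube. Each
    rule stops at most a quarter of the measure of the original cube. *)
Lemma stop_step : exists2 A : R, 1 <= A & forall u (c : Rn) (s t : R),
  nice b u -> 0 < s -> 0 < t ->
  (\int[leb]_(x in dil c s) `|u x|%:E <= (t * s ^+ n.+1)%:E)%E ->
  exists (J : set nat) (c' : nat -> Rn) (k' : nat -> nat), [/\
    forall i, J i -> dyadic c s (k' i) (c' i) /\ (0 < k' i)%N,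
    trivIset J (fun i => hcube (c' i) (s / 2 ^+ k' i)),
    (leb (\bigcup_(i in J) hcube (c' i) (s / 2 ^+ k' i)) <= (s ^+ n.+1 / 2)%:E)%E,
    forall i j c'', J i -> (j < k' i)%N -> dyadic c s j c'' ->
      hcube (c' i) (s / 2 ^+ k' i) `<=` hcube c'' (s / 2 ^+ j) ->
      (leb (hcube c'' (s / 2 ^+ j) `&` bad_set A c s t u) <=
         ((s / 2 ^+ j) ^+ n.+1 / 2 ^+ n.+2)%:E)%E /\
      (\int[leb]_(x in dil c'' (s / 2 ^+ j)) `|\1_(dil c s) x * u x|%:E <=
         (A * t * (s / 2 ^+ j) ^+ n.+1)%:E)%E &
    {ae leb, forall x, hcube c s x ->
       ~ (\bigcup_(i in J) hcube (c' i) (s / 2 ^+ k' i)) x -> ~ bad_set A c s t u x}].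
Proof.
have [C C0 HC] := weak_moment.
pose KK : R := (2 * (6 * N + 2)) ^+ n.+1.
have KK0 : 0 <= KK by rewrite exprn_ge0// mulr_ge0// addr_ge0// mulr_ge0.
(* The second term makes the cubes stopped by the bad set fill at most a quarter, through the weak
   (1,1) bound; the third does so for those stopped by large averages, through the Vitali lemma. *)
pose A : R := 1 + 4 * 2 ^+ n.+2 * (m.+1%:R * C) + 4 * KK.
have p20 : 0 < 2 ^+ n.+2 :> R by rewrite exprn_gt0.
have mC0 : 0 < m.+1%:R * C by rewrite mulr_gt0.
have X0 : 0 <= 4 * 2 ^+ n.+2 * (m.+1%:R * C).
  by apply: mulr_ge0; [apply: mulr_ge0 => //|]; exact: ltW.
have A1 : 1 <= A by rewrite /A; lra.
have A0 : 0 < A by exact: lt_le_trans A1.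
exists A => // u c s t nu s0 t0 hu.
set E := bad_set A c s t u.
have mE : measurable E by exact: measurable_bad_set.
have sn0 : 0 < s ^+ n.+1 by rewrite exprn_gt0.
have vE : (leb E <= (m.+1%:R * (C / A * s ^+ n.+1))%:E)%E.
  apply: leb_bigcup_fin => [|k km].
    by rewrite mulr_ge0 ?divr_ge0// ltW.
  exact: HC.
have vE' : 2 ^+ n.+2 * (m.+1%:R * (C / A * s ^+ n.+1)) <= s ^+ n.+1 / 4.
  have -> : 2 ^+ n.+2 * (m.+1%:R * (C / A * s ^+ n.+1)) =
    (4 * 2 ^+ n.+2 * (m.+1%:R * C)) / A * (s ^+ n.+1 / 4) by field; rewrite gt_eqF.
  rewrite ler_piMl//; first by rewrite divr_ge0// ltW.
  by rewrite ler_pdivrMr// mul1r /A; lra.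
pose f x := `|\1_(dil c s) x * u x|.
have mf : mfun f.
  apply: mfun_norm; apply: mfunM; [apply: mfun1; exact: measurable_dil|by case: nu].
have f0 x : 0 <= f x by exact: normr_ge0.
have fint : (\int[leb]_x (f x)%:E <= (t * s ^+ n.+1)%:E)%E.
  apply: le_trans hu; rewrite (int1 (dil c s)) le_eqVlt; apply/orP; left; apply/eqP.
  by apply: eq_integral => x _; rewrite /f normrM ger0_norm// indicE.
pose S (c'' : Rn) (s'' : R) := ((s'' ^+ n.+1 / 2 ^+ n.+2)%:E < leb (hcube c'' s'' `&` E))%E \/
  ((A * t * s'' ^+ n.+1)%:E < \int[leb]_(x in dil c'' s'') (f x)%:E)%E.
have [J [c' [k' [H1 tJ H3 H4]]]] := stopping_cubes c S s0.
have sk k : 0 < s / 2 ^+ k by rewrite divr_gt0// exprn_gt0.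
exists J, c', k'; split.
- move=> i Ji; have [di Si] := H1 i Ji; split => //; rewrite lt0n; apply/eqP => k0.
  rewrite k0 expr0 divr1 in di Si.
  have ci : c' i = c.
    case: di => z hz; apply/rowP => l; have [z1 ->] := hz l.
    by move: z1; rewrite expn0 ltnS leqn0 => /eqP ->; rewrite mul0r addr0.
  case: Si; rewrite ci; apply/negP; rewrite -leNgt.
    apply: le_trans (leb_le (@subIsetr _ _ E)) _; apply: le_trans vE _.
    rewrite lee_fin ler_pdivlMr// mulrC; apply: le_trans vE' _.
    by rewrite ler_pdivrMr// ler_peMr ?(ltW sn0)// ler1n.
  apply: (@le_trans _ _ (\int[leb]_x (f x)%:E)%E).
    by apply: leintS => [//|x _]; rewrite lee_fin.
  apply: le_trans fint _; rewrite lee_fin; apply: ler_wpM2r; first exact: ltW.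
  by rewrite ler_peMl// ltW.
- exact: tJ.
- pose J1 := J `&` [set i | (((s / 2 ^+ k' i) ^+ n.+1 / 2 ^+ n.+2)%:E <
      leb (hcube (c' i) (s / 2 ^+ k' i) `&` E))%E].
  pose J2 := J `&` [set i | ((A * t * (s / 2 ^+ k' i) ^+ n.+1)%:E <
      \int[leb]_(x in dil (c' i) (s / 2 ^+ k' i)) (f x)%:E)%E].
  apply: (@le_trans _ _ (leb (\bigcup_(i in J1) hcube (c' i) (s / 2 ^+ k' i) `|`
     \bigcup_(i in J2) hcube (c' i) (s / 2 ^+ k' i)))%E).
    apply: leb_le => x [i Ji xi]; have [_ [h|h]] := H1 i Ji; [left|right]; exists i => //; split => //.
  apply: le_trans (leb_setU _ _) _.
  have -> : s ^+ n.+1 / 2 = s ^+ n.+1 / 4 + s ^+ n.+1 / 4 by field.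
  rewrite EFinD; apply: leeD.
    have p2' : 0 <= 2 ^+ n.+2 :> R by exact: ltW.
    apply: (le_trans (@stop_total _ _ J1 _ (\1_E : Rn -> R) (2 ^+ n.+2) p2' _ _ (mfun1 mE) _ _)).
    + by move=> i _; exact: measurable_hcube.
    + by apply: sub_trivIset tJ => i [].
    + by move=> x; rewrite indicE.
    + move=> i [Ji /= hi]; rewrite (int_indic (measurable_hcube _ _) mE).
      rewrite (lebesgue_hcube _ (ltW (sk _))) setIC.
      apply: le_trans (_ : (2 ^+ n.+2)%:E * ((s / 2 ^+ k' i) ^+ n.+1 / 2 ^+ n.+2)%:E <= _)%E.
        by rewrite -EFinM lee_fin [leRHS]mulrC divfK// gt_eqF.
      by rewrite lee_pmul2l ?lte_fin// ltW.
    + rewrite (integral_leb_indic mE).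
      apply: (@le_trans _ _ ((2 ^+ n.+2)%:E * (m.+1%:R * (C / A * s ^+ n.+1))%:E)%E).
        by rewrite lee_pmul2l ?lte_fin.
      by rewrite -EFinM lee_fin.
  have At0 : 0 < A * t by rewrite mulr_gt0.
  have hJ2 i : J2 i -> 0 < s / 2 ^+ k' i /\ ((A * t * (s / 2 ^+ k' i) ^+ n.+1)%:E <=
      \int[leb]_(x in dil (c' i) (s / 2 ^+ k' i)) (f x)%:E)%E.
    by move=> [Ji /= /ltW hi].
  have := vitali_countable mf f0 At0 hJ2.
  rewrite -lee_pdivlMl// => /le_trans; apply.
  apply: (@le_trans _ _ ((A * t)^-1%:E * (KK%:E * (t * s ^+ n.+1)%:E))%E).
    apply: lee_wpmul2l; first by rewrite lee_fin invr_ge0 ltW.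
    by apply: lee_wpmul2l.
  rewrite -!EFinM lee_fin.
  have -> : (A * t)^-1 * (KK * (t * s ^+ n.+1)) = (4 * KK) / A * (s ^+ n.+1 / 4).
    by field; rewrite !gt_eqF.
  rewrite ler_piMl//; first by rewrite divr_ge0// ltW.
  rewrite ler_pdivrMr// mul1r /A.
  by lra.
- move=> i j c'' Ji jk dc sub; have nS := H3 i j c'' Ji jk dc sub; split; rewrite leNgt;
    apply/negP => h; apply: nS; [by left|by right].
- set U := \bigcup_(i in J) _.
  have mU : measurable U by apply: bigcup_measurable => i _; exact: measurable_hcube.
  have mQU : measurable (hcube c s `\` U) by apply: measurableD => //; exact: measurable_hcube.
  have i20 : 0 <= (2 ^+ n.+2)^-1 :> R by rewrite invr_ge0 ltW.
  (* Around points outside the stopped cubes the bad set has density at most 2^-(n+2), which is less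
     than 1, so its indicator vanishes there almost everywhere. *)
  have := @dyadic_density R n c s (fun x => (\1_E x)%:E) (2 ^+ n.+2)^-1 (hcube c s `\` U) s0 i20
    (mfunED (mfun1 mE)) _ mQU (@subDsetl _ _ _) _.
  move=> dens; apply: (ae_mono (dens _ _)).
  + by move=> x; rewrite lee_fin indicE.
  + move=> x k c'' [xQ xU] dc xc.
    rewrite (int_indic (measurable_hcube _ _) mE) (lebesgue_hcube _ (ltW (sk _))) setIC.
    have nS := H4 x k c'' xQ xU dc xc.
    rewrite leNgt; apply/negP => h; apply: nS; left.
    by move: h; rewrite -EFinM mulrC.
  + move=> x hx xQ xU xE; have := hx (conj xQ xU); rewrite lee_fin indicE mem_set//.
    by apply/negP; rewrite -ltNge invf_lt1// exprn_egt1// ltr1n.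
Qed.

Lemma moment_diff (c : Rn) (s : R) k (D D1 : set Rn) u : D1 `<=` D ->
  moment c s k (D `\` D1) u = fun y => moment c s k D u y - moment c s k D1 u y.
Proof.
move=> sub; apply/funext => y; rewrite /moment -mulrBr -mulrBl; congr (_ * (_ * _)).
rewrite !indicE in_setD; have [yD1|yD1] := boolP (y \in D1).
  by rewrite (mem_set (sub _ (set_mem yD1))) subrr.
by rewrite andbT subr0.
Qed.

(* The parent of a stopped cube contains points outside the bad set, where T of the
   moments is controlled; T_osc and weak_moment carry the control over to the cube. *)
Lemma osc_stop (A : R) : 1 <= A -> exists2 C : R, 0 < C &
  forall u (c : Rn) (s t : R) (c1 : Rn) (k1 : nat),
  nice b u -> 0 < s -> 0 < t -> dyadic c s k1 c1 -> (0 < k1)%N ->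
  (forall j c'', (j < k1)%N -> dyadic c s j c'' ->
     hcube c1 (s / 2 ^+ k1) `<=` hcube c'' (s / 2 ^+ j) ->
     (leb (hcube c'' (s / 2 ^+ j) `&` bad_set A c s t u) <=
         ((s / 2 ^+ j) ^+ n.+1 / 2 ^+ n.+2)%:E)%E /\
     (\int[leb]_(x in dil c'' (s / 2 ^+ j)) `|\1_(dil c s) x * u x|%:E <=
         (A * t * (s / 2 ^+ j) ^+ n.+1)%:E)%E) ->
  {ae leb, forall x, hcube c1 (s / 2 ^+ k1) x -> forall k, (k <= m)%N ->
    `|T (moment c s k (dil c s `\` dil c1 (s / 2 ^+ k1)) u) x| <= C * psi c s ^+ k * t}.
Proof.
move=> A1; have A0 : 0 < A by exact: lt_le_trans A1.
have [W W0 HW] := T_osc cz; have [C C0 HC] := weak_moment.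
have p2n0 : 0 < 2 ^+ n.+1 :> R by rewrite exprn_gt0.
(* [A'] keeps the exceptional set of the small dilate below a quarter of the cube. The terms of [C']
   bound, at the good point, T of the moment on the large dilate and on the small one, and then the
   oscillation over the cube. *)
pose A' := 1 + 4 * C; have A'1 : 1 <= A' by rewrite /A' lerDl mulr_ge0// ltW.
have A'0 : 0 < A' by exact: lt_le_trans A'1.
pose C' := A + A' * (2 ^+ n.+1 * A) + W * A.
have C'0 : 0 < C' by rewrite /C' !addr_gt0 ?mulr_gt0.
exists C' => // u c s t c1 k1 nu s0 t0 d1 k10 H.
set s1 := s / 2 ^+ k1; have s10 : 0 < s1 by rewrite divr_gt0// exprn_gt0.
have sub1 : dil c1 s1 `<=` dil c s by apply: dilS => //; exact: dyadicS.
have sE j : (j <= k1)%N -> s1 * 2 ^+ j = s / 2 ^+ (k1 - j).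
  by move=> jk; rewrite /s1 -{1}(subnK jk) exprD; field; rewrite !expf_neq0.
(* [T_osc] climbs from the small cube upwards, so the ancestors are numbered by generations above
   it. *)
have [Aj HA] : exists Aj : nat -> Rn, forall j, (j <= k1)%N -> dyadic c s (k1 - j) (Aj j) /\
    hcube c1 s1 `<=` hcube (Aj j) (s / 2 ^+ (k1 - j)).
  suff /choice[Aj HA] : forall j, exists c', (j <= k1)%N -> dyadic c s (k1 - j) c' /\
    hcube c1 s1 `<=` hcube c' (s / 2 ^+ (k1 - j)) by exists Aj.
  move=> j; have [jk|jk] := leqP j k1; last by exists 0.
  by have [c' h1 h2] := dyadic_ancestor s0 (leq_subr j k1) d1; exists c'.
have A0E : Aj 0%N = c1.
  have [h1 h2] := HA 0%N isT; rewrite subn0 in h1 h2.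
  apply: (dyadic_uniq (x := c1) s0 h1 d1); last exact: hcube_corner.
  by apply: h2; exact: hcube_corner.
have AkE : Aj k1 = c.
  have [[z hz] _] := HA k1 (leqnn _); rewrite subnn in hz.
  apply/rowP => l; have [z1 ->] := hz l.
  by move: z1; rewrite expn0 ltnS leqn0 => /eqP ->; rewrite mul0r addr0.
have mu1 (D : set Rn) : measurable D -> mfun (fun x => \1_D x * u x).
  by move=> mD; apply: mfunM; [exact: mfun1|case: nu].
have mdil := @measurable_dil R n.
have mdd : measurable (dil c s `\` dil c1 s1) by exact: measurableD.
have ui (D : set Rn) x : `|\1_D x * u x| <= `|u x|.
  by rewrite normrM ler_piMl// indicE; case: (_ \in _); rewrite ?normr1 ?normr0.
suff hk k : (k <= m)%N -> {ae leb, forall x, hcube c1 s1 x ->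
    `|T (moment c s k (dil c s `\` dil c1 s1) u) x| <= C' * psi c s ^+ k * t}.
  have : {ae leb, forall x, forall k, (k <= m)%N -> hcube c1 s1 x ->
    `|T (moment c s k (dil c s `\` dil c1 s1) u) x| <= C' * psi c s ^+ k * t}.
    apply: ae_foralln => k; have [km|km] := leqP k m; last by apply: aeW.
    by apply: (ae_mono (hk k km)).
  by move/ae_mono; apply => x hx xP k km; exact: hx.
move=> km; have p0 : 0 < psi c s ^+ k by rewrite exprn_gt0// psi0.
set h := moment _ _ _ _ _.
have Lh : L2 h by exact: moment_L2.
have [g gE gosc] : exists2 g : Rn -> R, {ae leb, forall x, hcube c1 s1 x -> T h x = g x} &
    forall x x', hcube c1 s1 x -> hcube c1 s1 x' -> `|g x - g x'| <= W * (psi c s ^+ k * (A * t)).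
  rewrite -A0E; apply: (HW k1 Aj s1 (psi c s ^+ k * (A * t)) h) => //.
  - by rewrite !mulr_ge0 ?(ltW p0) ?(ltW A0)// ltW.
  - by move=> j jk; rewrite A0E sE//; exact: (HA j jk).2.
  - move=> x; rewrite AkE sE// subnn expr0 divr1 => xd.
    by rewrite /h /moment indic_out ?mulr0// => -[].
  - by move=> x; rewrite A0E => xd; rewrite /h /moment indic_out ?mulr0// => -[].
  - move=> j /andP[j1 jk]; rewrite sE//; have [dj subj] := HA j jk.
    have kj : (k1 - j < k1)%N by rewrite ltn_subrL j1.
    apply: (le_trans (osc_power k s0 (mu1 _ mdd) (mdil _ _) _)).
      by move=> x xd; apply: indic_out => -[].
    rewrite -mulrA EFinM lee_pmul2l ?lte_fin//.
    apply: le_trans (H _ _ kj dj subj).2; apply: leint => x _; rewrite lee_fin//.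
    rewrite !normrM; apply: ler_wpM2r => //; rewrite !indicE in_setD.
    by case: (_ \in dil c s); case: (x \in _); rewrite ?normr1 ?normr0.
have [cp dp subp] : exists2 cp, dyadic c s k1.-1 cp & hcube c1 s1 `<=` hcube cp (s / 2 ^+ k1.-1).
  by apply: dyadic_ancestor => //; exact: leq_pred.
have [hb1 hb2] := H k1.-1 cp (ltac:(by rewrite prednK)) dp subp.
have sp : s / 2 ^+ k1.-1 = 2 * s1.
  by rewrite /s1 -{2}(prednK k10) exprS; field; rewrite expf_neq0.
have spn : (s / 2 ^+ k1.-1) ^+ n.+1 = 2 ^+ n.+1 * s1 ^+ n.+1 by rewrite sp exprMn.
have sn0 : 0 < s1 ^+ n.+1 by rewrite exprn_gt0.
have vP := lebesgue_hcube c1 (ltW s10).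
have vE : (leb (hcube c1 s1 `&` bad_set A c s t u) <= (s1 ^+ n.+1 / 2)%:E)%E.
  apply: (le_trans (leb_le _) (le_trans hb1 _)); first by apply: setSI; exact: subp.
  rewrite spn lee_fin (exprS 2 n.+1); move: p2n0; set p := 2 ^+ n.+1 => p00.
  set q := s1 ^+ n.+1; have -> : p * q / (2 * p) = q / 2 by field; rewrite gt_eqF.
  exact: lexx.
have t'0 : 0 < 2 ^+ n.+1 * A * t by rewrite !mulr_gt0.
have hint1 : (\int[leb]_(x in dil c1 s1) `|u x|%:E <= (2 ^+ n.+1 * A * t * s1 ^+ n.+1)%:E)%E.
  apply: (@le_trans _ _ (\int[leb]_(x in dil cp (s / 2 ^+ k1.-1)) `|\1_(dil c s) x * u x|%:E)%E).
    apply: (@le_trans _ _ (\int[leb]_(x in dil c1 s1) `|\1_(dil c s) x * u x|%:E)%E).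
      apply: leint => x xd; first by rewrite lee_fin.
      by rewrite lee_fin normrM indicE mem_set ?normr1 ?mul1r//; exact: sub1.
    apply: leintS => [|x _]; last by rewrite lee_fin.
    by apply: dilS => //; rewrite sp mulr_gt0.
  by apply: le_trans hb2 _; rewrite spn lee_fin le_eqVlt; apply/orP; left; apply/eqP; ring.
have vB := HC u c s c1 s1 (2 ^+ n.+1 * A * t) A' k nu s0 s10 sub1 t'0 A'1 hint1.
set B := [set x | _] in vB.
have vB' : (leb B <= (s1 ^+ n.+1 / 4)%:E)%E.
  apply: le_trans vB _; rewrite lee_fin mulrC ler_pM2l// ler_pdivrMr// /A'; lra.
have Tsub := T_sub cz (moment_L2 c s k (mdil c s) nu) (moment_L2 c s k (mdil c1 s1) nu).
rewrite -(moment_diff c s k u sub1) -/h in Tsub.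
have [x0 [x0P x0E x0B [e1 e2]]] := exists_good sn0 vP vE vB'
  (ae_mono2 gE Tsub (fun x a b => conj a b)).
have bd1 : `|T (moment c s k (dil c s) u) x0| <= A * psi c s ^+ k * t.
  by rewrite leNgt; apply/negP => hh; apply: x0E; exists k.
have bd2 : `|T (moment c s k (dil c1 s1) u) x0| <= A' * psi c s ^+ k * (2 ^+ n.+1 * A * t).
  by rewrite leNgt; apply/negP => hh; exact: x0B.
apply: (ae_mono gE) => x hx xP; rewrite (hx xP) -[g x](subrK (g x0)).
apply: (le_trans (ler_normD _ _)).
have := gosc x x0 xP x0P; rewrite -(e1 x0P) e2 addrC.
have := ler_normB (T (moment c s k (dil c s) u) x0) (T (moment c s k (dil c1 s1) u) x0).
rewrite /C'.
have -> : (A + A' * (2 ^+ n.+1 * A) + W * A) * psi c s ^+ k * t = A * psi c s ^+ k * t +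
  A' * psi c s ^+ k * (2 ^+ n.+1 * A * t) + W * (psi c s ^+ k * (A * t)) by ring.
move=> b1 b2; rewrite [leRHS]addrC; apply: lerD => //.
by apply: le_trans b1 _; exact: lerD.
Qed.

Definition local_form u (G : Rn -> R) (c : Rn) (s : R) : \bar R :=
  (\int[leb]_(x in hcube c s)
     (`|iter_commutator m b T (fun y => \1_(dil c s) y * u y) x| * G x)%:E)%E.

Lemma comm_moment (c : Rn) (s : R) (D : set Rn) u : measurable D -> nice b u ->
  {ae leb, forall x, iter_commutator m b T (fun y => \1_D y * u y) x =
    \sum_(k < m.+1) comm_coef m k * (b x - beta c s) ^+ (m - k) * T (moment c s k D u) x}.
Proof.
move=> mD nu; apply: (comm_expansion cz) => k km.
exact: (nice_dom mb (m := m) (nice_restrict mD nu) km).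
Qed.

(** In each term of the expansion the powers psi^(m-k), from the factor outside [T], and psi^k, from
    the moment, multiply to psi^m. *)
Lemma comm_bound (c : Rn) (s t C : R) (D : set Rn) u : 0 < s -> 0 <= t -> 0 <= C ->
  measurable D -> nice b u ->
  {ae leb, forall x, dil c s x ->
    (forall k, (k <= m)%N -> `|T (moment c s k D u) x| <= C * psi c s ^+ k * t) ->
    `|iter_commutator m b T (fun y => \1_D y * u y) x| <=
      (\sum_(k < m.+1) `|comm_coef m k : R|) * C * psi c s ^+ m * t}.
Proof.
move=> s0 t0 C0 mD nu; apply: (ae_mono2 (hbeta c s0) (comm_moment c s mD nu)) => x hx -> xd H.
apply: (le_trans (ler_norm_sum _ _ _)); rewrite !mulr_suml; apply: ler_sum => k _.
have km : (k <= m)%N by rewrite -ltnS.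
have p0 : 0 <= psi c s by rewrite ltW// psi0.
have -> : psi c s ^+ m = psi c s ^+ (m - k) * psi c s ^+ k by rewrite -exprD subnK.
rewrite !normrM normrX -!mulrA; apply: ler_wpM2l => //.
rewrite mulrCA; apply: ler_pM => //.
  by rewrite lerXn2r ?nnegrE ?hx.
by rewrite mulrA; exact: H.
Qed.

Lemma comm_split (D D1 : set Rn) u : measurable D -> measurable D1 -> D1 `<=` D -> nice b u ->
  {ae leb, forall x, iter_commutator m b T (fun y => \1_D y * u y) x =
    iter_commutator m b T (fun y => \1_D1 y * u y) x +
    iter_commutator m b T (fun y => \1_(D `\` D1) y * u y) x}.
Proof.
move=> mD mD1 sub nu.
have d1 := nice_dom mb (m := m) (nice_restrict mD1 nu).
have d2 := nice_dom mb (m := m) (nice_restrict (measurableD mD mD1) nu).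
apply: (ae_mono (comm_lin cz 1 d1 d2)) => x; rewrite mul1r => <-.
congr (iter_commutator m b T _ x); apply/funext => y; rewrite !indicE in_setD.
have [yD1|yD1] := boolP (y \in D1).
  by rewrite (mem_set (sub _ (set_mem yD1))) andbF mul0r addr0 mul1r.
by rewrite andbT mul0r mulr0 add0r.
Qed.

(* The part of the form that is not controlled by averages is the same form on
   disjoint subcubes that cover at most half of the cube. *)
Lemma one_step : exists2 C : R, 0 < C & forall u (G : Rn -> R) (c : Rn) (s t : R),
  nice b u -> mfun G -> (forall x, 0 <= G x) -> 0 < s -> 0 < t ->
  (\int[leb]_(x in dil c s) `|u x|%:E <= (t * s ^+ n.+1)%:E)%E ->
  exists (J : set nat) (c' : nat -> Rn) (s' : nat -> R), [/\
    forall i, J i -> 0 < s' i /\ hcube (c' i) (s' i) `<=` hcube c s,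
    trivIset J (fun i => hcube (c' i) (s' i)),
    (leb (\bigcup_(i in J) hcube (c' i) (s' i)) <= (s ^+ n.+1 / 2)%:E)%E &
    (local_form u G c s <= (C * psi c s ^+ m * t)%:E * \int[leb]_(x in hcube c s) (G x)%:E +
      \sum_(0 <= i <oo | i \in J) local_form u G (c' i) (s' i))%E].
Proof.
have [A A1 HA] := stop_step; have [C C0 HC] := osc_stop A1.
have A0 : 0 < A by exact: lt_le_trans A1.
pose Cm : R := \sum_(k < m.+1) `|comm_coef m k|.
have Cm0 : 0 <= Cm by apply: sumr_ge0.
pose D := Cm * A + Cm * C + 1.
have D0 : 0 < D by rewrite ltr_wpDl// addr_ge0// mulr_ge0// ltW.
exists D => // u G c s t nu mG G0 s0 t0 hu.
have [J [c' [k' [J1 J2 J3 J4 J5]]]] := HA u c s t nu s0 t0 hu.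
have sk k : 0 < s / 2 ^+ k by rewrite divr_gt0// exprn_gt0.
have J1' i : J i -> hcube (c' i) (s / 2 ^+ k' i) `<=` hcube c s.
  by move=> /J1[di _]; exact: dyadicS.
exists J, c', (fun i => s / 2 ^+ k' i).
split; [by move=> i Ji; split; [exact: sk|exact: J1']|exact: J2|exact: J3|].
have p0 : 0 <= psi c s ^+ m by rewrite exprn_ge0// ltW// psi0.
set U := \bigcup_(i in J) hcube (c' i) (s / 2 ^+ k' i) in J3 *.
have mP i : measurable (hcube (c' i) (s / 2 ^+ k' i)) by exact: measurable_hcube.
have mU : measurable U by exact: bigcup_measurable.
have UQ : U `<=` hcube c s by move=> x [i Ji xi]; exact: (J1' i Ji).
have mdil := @measurable_dil R n.
have hd : hcube c s `<=` dil c s.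
  move=> x xQ; apply/dilP => i; have /andP[h1 h2] := xQ i.
  have N0 : 0 <= N * s by rewrite mulr_ge0// ltW.
  by apply/andP; split; lra.
pose F x := `|iter_commutator m b T (fun y => \1_(dil c s) y * u y) x|.
have mF D' : measurable D' ->
    mfun (fun x => `|iter_commutator m b T (fun y => \1_D' y * u y) x|).
  move=> mD'; apply: mfun_norm; apply: (comm_mfun cz mb).
  exact: (nice_dom mb (m := m) (nice_restrict mD' nu)).
have off : {ae leb, forall x, hcube c s x -> ~ U x -> F x <= D * psi c s ^+ m * t}.
  have h := comm_bound c s0 (ltW t0) (ltW A0) (mdil c s) nu.
  apply: (ae_mono2 J5 h) => x hE hb xQ xU.
  apply: le_trans (hb (hd _ xQ) _) _.
    move=> k km; rewrite leNgt; apply/negP => hk; apply: (hE xQ xU).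
    by exists k.
  rewrite -/Cm; apply: ler_wpM2r; first exact: ltW.
  apply: ler_wpM2r => //; rewrite /D.
  have : 0 <= Cm * C by rewrite mulr_ge0// ltW.
  by lra.
(* On a stopped cube the function is split at its dilate: [osc_stop] controls the outer part, and
   the inner part is the integrand of the local form of that cube. *)
have on : {ae leb, forall x, forall i, J i -> hcube (c' i) (s / 2 ^+ k' i) x ->
    F x <= D * psi c s ^+ m * t +
      `|iter_commutator m b T (fun y => \1_(dil (c' i) (s / 2 ^+ k' i)) y * u y) x|}.
  apply: ae_foralln => i; have [Ji|Ji] := pselect (J i); last by apply: aeW.
  have [di k0] := J1 i Ji.
  have sub : dil (c' i) (s / 2 ^+ k' i) `<=` dil c s by apply: dilS => //; exact: J1'.
  have mdd := measurableD (mdil c s) (mdil (c' i) (s / 2 ^+ k' i)).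
  have h1 := HC u c s t (c' i) (k' i) nu s0 t0 di k0 (fun j c'' => J4 i j c'' Ji).
  have h2 := comm_bound c s0 (ltW t0) (ltW C0) mdd nu.
  have h3 := comm_split (mdil c s) (mdil _ _) sub nu.
  apply: (ae_mono2 (ae_mono2 h1 h2 (fun x a b => conj a b)) h3) => x [e1 e2] e3 _ xP.
  rewrite /F e3 addrC; apply: (le_trans (ler_normD _ _)); apply: lerD => //.
  apply: le_trans (e2 (hd _ (J1' i Ji x xP)) (e1 xP)) _.
  rewrite -/Cm; apply: ler_wpM2r; first exact: ltW.
  apply: ler_wpM2r => //; rewrite /D.
  have : 0 <= Cm * A by rewrite mulr_ge0// ltW.
  by lra.
pose kap := D * psi c s ^+ m * t.
have kap0 : 0 <= kap by rewrite /kap !mulr_ge0 ?(ltW t0) ?(ltW D0)//.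
have mFG : mfun (fun x => F x * G x) by apply: mfunM => //; exact: mF.
have FG0 x : 0 <= F x * G x by rewrite mulr_ge0// /F.
have QU : hcube c s = (hcube c s `\` U) `|` U by rewrite setUC setDUK.
have mQU : measurable (hcube c s `\` U) by apply: measurableD => //; exact: measurable_hcube.
have dj : [disjoint hcube c s `\` U & U].
  by apply/disj_set2P; apply/seteqP; split => // x [[_ h1] h2].
have split_int (g : Rn -> R) : mfun g -> (forall x, 0 <= g x) ->
  (\int[leb]_(x in hcube c s) (g x)%:E = \int[leb]_(x in hcube c s `\` U) (g x)%:E +
    \sum_(0 <= i <oo | i \in J) \int[leb]_(x in hcube (c' i) (s / 2 ^+ k' i)) (g x)%:E)%E.
  move=> mg g0; rewrite {1}QU.
  rewrite (ge0_integral_setU leb mQU mU (mfunED mg) (fun x _ => g0 x) dj); congr (_ + _)%E.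
  exact: (ge0_integral_bigcup_cond (fun i _ => mP i) J2 (mfunED mg) (fun x _ => g0 x)).
have int0 (E : set Rn) (g : Rn -> R) : (forall x, 0 <= g x) -> (0 <= \int[leb]_(x in E) (g x)%:E)%E.
  by move=> g0; apply: integral_ge0 => x _; rewrite lee_fin.
rewrite /local_form (split_int _ mFG FG0) (split_int G mG G0) ge0_muleDr; last 2 first.
- exact: int0.
- by apply: nneseries_ge0 => i _ _; exact: int0.
rewrite -[leRHS]addeA; apply: leeD.
  rewrite -(intZD mQU mG kap0 G0) (int1 (hcube c s `\` U)) (int1 (hcube c s `\` U)).
  apply: ae_le_int.
  - by move=> x; rewrite lee_fin mulr_ge0// indicE.
  - by move=> x; rewrite lee_fin; apply: mulr_ge0; [rewrite indicE|exact: mulr_ge0].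
  apply: (ae_mono off) => x hx; rewrite lee_fin.
  have [[xQ xU]|xQ] := pselect ((hcube c s `\` U) x); last by rewrite !indicE memNset// !mul0r.
  by apply: ler_wpM2l; [rewrite indicE|apply: ler_wpM2r => //; exact: hx].
rewrite -nneseriesZl//; last by move=> i _; exact: int0.
rewrite -nneseriesD; last 2 first.
- by move=> i _ _; rewrite mule_ge0 ?lee_fin//; exact: int0.
- by move=> i _ _; apply: int0 => x; rewrite mulr_ge0.
apply: lee_nneseries => [i _ _|i iJ]; first exact: int0.
have Ji : J i by move: iJ; rewrite inE.
pose Fi x := `|iter_commutator m b T (fun y => \1_(dil (c' i) (s / 2 ^+ k' i)) y * u y) x| * G x.
have mFi : mfun Fi by apply: mfunM => //; exact: mF.
have Fi0 x : 0 <= Fi x by rewrite mulr_ge0.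
rewrite -(intZD (mP i) mG kap0 G0) -(intDD (mP i) (mfunZ kap mG) mFi _ Fi0); last first.
  by move=> x; rewrite mulr_ge0.
rewrite (int1 (hcube (c' i) _)) (int1 (hcube (c' i) _)).
apply: ae_le_int.
- by move=> x; rewrite lee_fin mulr_ge0// indicE.
- move=> x; rewrite lee_fin; apply: mulr_ge0; first by rewrite indicE.
  by apply: addr_ge0 => //; exact: mulr_ge0.
apply: (ae_mono on) => x hx; rewrite lee_fin.
have [xP|xP] := pselect (hcube (c' i) (s / 2 ^+ k' i) x); last by rewrite !indicE memNset// !mul0r.
apply: ler_wpM2l; first by rewrite indicE.
by rewrite /Fi -mulrDl; apply: ler_wpM2r => //; exact: hx.
Qed.

End one_step.

Section contraction.
Context {R : realType} {n : nat}.
Local Notation Rn := (Rn R n.+1).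
Local Notation leb := (@lebesgue_Rn R n.+1).
Local Notation N := (n.+1%:R : R).
Context {omega : R -> R} {T : (Rn -> R) -> Rn -> R} {K : Rn -> Rn -> R}.
Hypothesis cz : CZop omega T K.
Context (b : Rn -> R) (m : nat) (psi beta : Rn -> R -> R).
Hypotheses (mb : mfun b) (psi0 : forall c s, 0 < s -> 0 < psi c s)
  (hbeta : forall c s, 0 < s ->
    {ae leb, forall x, dil c s x -> `|b x - beta c s| <= psi c s}).

Lemma int_sum_le (D : set Rn) (f : nat -> Rn -> R) (v : nat -> R) (k : nat) : measurable D ->
  (forall j, mfun (f j)) -> (forall j x, 0 <= f j x) ->
  (forall j, (j < k)%N -> \int[leb]_(x in D) (f j x)%:E <= (v j)%:E)%E ->
  (\int[leb]_(x in D) (\sum_(j < k) f j x)%:E <= (\sum_(j < k) v j)%:E)%E.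
Proof.
move=> mD mf f0; elim: k => [|k IH] H.
  by rewrite big_ord0 (eq_integral (fun=> 0%E)) ?integral0// => x _; rewrite big_ord0.
rewrite big_ord_recr/= (eq_integral (fun x => (\sum_(j < k) f j x + f k x)%:E)); last first.
  by move=> x _; rewrite big_ord_recr.
rewrite (intDD mD (mfun_sum _ (fun i : 'I_k => mf i)) (mf k) _ (f0 k)); last first.
  by move=> x; apply: sumr_ge0.
rewrite EFinD; apply: leeD; last exact: H.
by apply: IH => j jk; apply: H; exact: ltnW.
Qed.

Lemma mul_indic_le (D : set Rn) (u : Rn -> R) x : `|\1_D x * u x| <= `|u x|.
Proof.
by rewrite normrM ler_piMl// indicE; case: (_ \in _); rewrite ?normr1 ?normr0.
Qed.

(** [L] may depend on [u] and [G]; what matters is the proportionality to the volume, which halves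
    at each iteration. Since |t| <= 1 + t^2, the L2 bound of [T] suffices, and [G] vanishes where
    the powers of [b] outside [T] are large. *)
Lemma local_form_apriori u (G : Rn -> R) : nice b u -> nice b G -> (forall x, 0 <= G x) ->
  exists2 L : R, 0 <= L & forall c s, 0 < s ->
    (local_form (T := T) b m u G c s <= (L * s ^+ n.+1)%:E)%E.
Proof.
move=> nu [mG [M' [_ [_ [h1' _ h3']]]]] G0.
have M'0 : 0 <= M' by apply: le_trans (h1' 0).
have [mu [M [_ [_ [h1 _ h3]]]]] := nu.
have M0 : 0 <= M by apply: le_trans (h1 0).
have [C C0 HC] := T_sq cz.
pose a k : R := `|comm_coef m k| * M' ^+ (m - k) * M'.
have a0 k : 0 <= a k by rewrite !mulr_ge0// exprn_ge0.
pose V k : R := 1 + C * ((M ^+ k * M) ^+ 2 * (4 * N + 2) ^+ n.+1).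
have N4 : 0 <= (4 * N + 2) ^+ n.+1 by rewrite exprn_ge0// addr_ge0// mulr_ge0.
have V0 k : 0 <= V k.
  by rewrite addr_ge0// mulr_ge0 ?(ltW C0)// mulr_ge0// sqr_ge0.
exists (\sum_(k < m.+1) a k * V k) => [|c s s0].
  by apply: sumr_ge0 => k _; exact: mulr_ge0.
have mdil := @measurable_dil R n c s.
have mQ := measurable_hcube c s.
have vQ := lebesgue_hcube c (ltW s0).
pose h := fun y => \1_(dil c s) y * u y.
have dh : commutator_domain m b h := nice_dom mb (m := m) (nice_restrict mdil nu).
pose Tk k := T (fun y => (b y - 0) ^+ k * h y).
have Lk k : L2 (fun y => (b y - 0) ^+ k * h y).
  apply: L2_shift => j _; exact: (nice_dom mb (m := j) (nice_restrict mdil nu)).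
have mTk k : mfun (Tk k) by apply: L2_mfun; apply: (L2_T cz).
pose f k x := a k * (1 + (Tk k x) ^+ 2).
have mf k : mfun (f k).
  by apply: mfunZ; apply: mfunD; [exact: mfun_cst|exact: mfunX].
have f0 k x : 0 <= f k x by rewrite mulr_ge0// addr_ge0// sqr_ge0.
apply: (@le_trans _ _ (\int[leb]_(x in hcube c s) (\sum_(k < m.+1) f k x)%:E)%E).
  rewrite /local_form (int1 (hcube c s)) (int1 (hcube c s)); apply: ae_le_int.
  - by move=> x; rewrite lee_fin; apply: mulr_ge0; [rewrite indicE|exact: mulr_ge0].
  - by move=> x; rewrite lee_fin; apply: mulr_ge0; [rewrite indicE|exact: sumr_ge0].
  apply: (ae_mono (comm_expansion cz 0 dh)) => x hx; rewrite lee_fin.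
  apply: ler_wpM2l; first by rewrite indicE.
  have [bM|bM] := ltP M' `|b x|; first by rewrite (h3' _ bM) mulr0; apply: sumr_ge0.
  have GM : G x <= M' by apply: le_trans (h1' x); exact: ler_norm.
  rewrite hx; apply: le_trans (ler_wpM2r (G0 x) (ler_norm_sum _ _ _)) _.
  rewrite mulr_suml; apply: ler_sum => k _; rewrite /f /a !normrM normrX subr0.
  have e1 : `|T (fun y => (b y - 0) ^+ k * h y) x| <= 1 + Tk k x ^+ 2.
    rewrite -/(Tk k x) -[Tk k x ^+ 2]real_normK ?num_real//.
    by have := sqr_ge0 (`|Tk k x| - 1); have := normr_ge0 (Tk k x); nra.
  have -> : `|comm_coef m k : R| * M' ^+ (m - k) * M' * (1 + Tk k x ^+ 2) =
    `|comm_coef m k : R| * M' ^+ (m - k) * (1 + Tk k x ^+ 2) * M' by ring.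
  apply: ler_pM => //.
  apply: ler_pM => //.
  by apply: ler_wpM2l => //; rewrite lerXn2r ?nnegrE.
rewrite mulr_suml; apply: (int_sum_le (v := fun k => a k * V k * s ^+ n.+1) mQ mf f0) => k km.
have g0 x : 0 <= 1 + Tk k x ^+ 2 by rewrite addr_ge0// sqr_ge0.
have mT2 : mfun (fun x => Tk k x ^+ 2) by exact: mfunX.
rewrite (intZD mQ (mfunD (mfun_cst 1) mT2) (a0 k) g0) -mulrA [leRHS]EFinM.
apply: lee_wpmul2l; first by rewrite lee_fin.
rewrite (intDD mQ (mfun_cst 1) mT2 (fun=> ler01) (fun x => sqr_ge0 _)).
rewrite (integral_leb_cst _ mQ) vQ mul1e /V mulrDl mul1r EFinD; apply: leeD => //.
apply: (@le_trans _ _ (sqint (Tk k))).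
  by apply: leintS => // x _; rewrite lee_fin sqr_ge0.
have [_ hT] := HC _ (Lk k); apply: (le_trans hT); rewrite -mulrA EFinM.
apply: lee_wpmul2l; first by rewrite lee_fin ltW.
have bd x : `|(b x - 0) ^+ k * h x| <= M ^+ k * M.
  rewrite subr0 normrM normrX; have [bM|bM] := ltP M `|b x|.
    by rewrite /h (h3 _ bM) mulr0 normr0 mulr0 mulr_ge0// exprn_ge0.
  apply: ler_pM => //.
    by rewrite lerXn2r ?nnegrE.
  by apply: le_trans (mul_indic_le _ _ _) _; exact: h1.
have sup x : ~ hcube (c - const_mx (2 * N * s)) ((4 * N + 2) * s) x -> (b x - 0) ^+ k * h x = 0.
  by move=> xd; rewrite /h indic_out ?mulr0// => /(dil_hcube s0).
apply: (le_trans (sqint_bounded bd sup)).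
rewrite lebesgue_hcube; last by rewrite mulr_ge0 ?addr_ge0 ?mulr_ge0// ltW.
by rewrite [((4 * N + 2) * s) ^+ _]exprMn -EFinM mulrA.
Qed.

(** Covers the cubes with zero average, to which [one_step] does not apply because it takes a
    positive [t]. *)
Lemma local_form0 u (G : Rn -> R) c s : nice b u -> (forall x, 0 <= G x) -> 0 < s ->
  (\int[leb]_(x in dil c s) `|u x|%:E = 0)%E -> local_form (T := T) b m u G c s = 0%E.
Proof.
move=> nu G0 s0 hu.
have mdil := @measurable_dil R n c s.
pose h := fun y => \1_(dil c s) y * u y.
have mh : mfun h by apply: mfunM; [exact: mfun1|case: nu].
have h0 : {ae leb, forall x, h x = 0}.
  have hi : (\int[leb]_x `|(EFin \o h) x| = 0)%E.
    rewrite -hu (int1 (dil c s)); apply: eq_integral => x _ /=.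
    by rewrite normrM ger0_norm// indicE.
  have mhE : measurable_fun [set: Rn] (EFin \o h) by exact: mfunE.
  have := (ae_eq_integral_abs leb measurableT mhE).1 hi.
  by apply: filterS => x /(_ I) [].
have L0 : {ae leb, forall x, forall k, T (moment b beta c s k (dil c s) u) x = 0}.
  apply: ae_foralln => k.
  have e := T_ae cz (moment_L2 beta mb c s k mdil nu) (L2_0 (n := n)).
  have h0' : {ae leb, forall x, moment b beta c s k (dil c s) u x = 0}.
    by apply: (ae_mono h0) => x hx; rewrite /moment -/(h x) hx mulr0.
  by apply: (ae_mono2 (e h0') (T_0 cz)) => x -> ->.
have E := comm_moment cz m beta mb c s mdil nu.
rewrite /local_form (int1 (hcube c s)) -[RHS](integral0 leb [set: Rn]).
apply: ae_eq_int => [x|//|].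
  by rewrite lee_fin; apply: mulr_ge0; [rewrite indicE|exact: mulr_ge0].
apply: (ae_mono2 L0 E) => x h1 h2; rewrite h2 big1 ?normr0 ?mul0r ?mulr0// => k _.
by rewrite h1 mulr0.
Qed.

(* Iterating one_step k times leaves a remainder of at most 2 ^- k times the a priori
   bound, so no sparse family has to be constructed. *)
Lemma form_bound : exists2 C : R, 0 < C & forall u (G : Rn -> R) (Phi : Rn -> \bar R) (kap : R),
  nice b u -> nice b G -> (forall x, 0 <= G x) ->
  measurable_fun [set: Rn] Phi -> (forall x, 0 <= Phi x)%E -> 0 < kap ->
  (forall c s x, 0 < s -> hcube c s x ->
    ((psi c s ^+ m)%:E * (\int[leb]_(x in dil c s) `|u x|%:E) *
       (\int[leb]_(x in hcube c s) (G x)%:E) <= (kap * s ^+ n.+1 * s ^+ n.+1)%:E * Phi x)%E) ->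
  (\int[leb]_x (`|iter_commutator m b T u x| * G x)%:E <= (C * kap)%:E * \int[leb]_x Phi x)%E.
Proof.
have [C C0 HC] := one_step cz m mb psi0 hbeta.
exists (2 * C); first by rewrite mulr_gt0.
move=> u G Phi kap nu nG G0 mPhi Phi0 kap0 H.
have [L L0 HL] := local_form_apriori nu nG G0.
have mG : mfun G by case: nG.
pose D : R := 2 * C * kap; have D0 : 0 < D by rewrite !mulr_gt0.
have intPhi (E : set Rn) : (0 <= \int[leb]_(x in E) Phi x)%E by apply: integral_ge0 => x _.
(* At depth 0 the remainder is the a priori bound; each level halves it because the subcubes cover
   at most half of the cube. *)
have key M : forall c s, 0 < s -> (local_form (T := T) b m u G c s <=
    D%:E * \int[leb]_(x in hcube c s) Phi x + (L * s ^+ n.+1 / 2 ^+ M)%:E)%E.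
  elim: M => [|M IH] c s s0.
    rewrite expr0 divr1; apply: le_trans (HL c s s0) _.
    by rewrite leeDr// mule_ge0// lee_fin ltW.
  have sn0 : 0 < s ^+ n.+1 by rewrite exprn_gt0.
  have mQ := measurable_hcube c s; have vQ := lebesgue_hcube c (ltW s0).
  have mdil := @measurable_dil R n c s.
  have [Mu hMu] : exists Mu : R, forall x, `|u x| <= Mu by case: nu => _ [Mu [_ [_ [? _ _]]]]; exists Mu.
  have [MG hMG] : exists MG : R, forall x, G x <= MG.
    by case: nG => _ [MG [_ [_ [h _ _]]]]; exists MG => x; apply: le_trans (h x); exact: ler_norm.
  have int_u0 : (0 <= \int[leb]_(x in dil c s) `|u x|%:E)%E.
    by apply: integral_ge0 => x _; rewrite lee_fin.
  have int_G0 : (0 <= \int[leb]_(x in hcube c s) (G x)%:E)%E.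
    by apply: integral_ge0 => x _; rewrite lee_fin.
  have fin_u : (\int[leb]_(x in dil c s) `|u x|%:E)%E \is a fin_num.
    rewrite ge0_fin_numE//; apply: (@le_lt_trans _ _ (\int[leb]_(x in dil c s) Mu%:E)%E).
      by apply: leint => x _; rewrite lee_fin.
    rewrite (integral_leb_cst _ mdil) /dil lebesgue_cube -?EFinM ?ltry//.
    by rewrite mulr_ge0 ?addr_ge0 ?mulr_ge0// ltW.
  have fin_G : (\int[leb]_(x in hcube c s) (G x)%:E)%E \is a fin_num.
    rewrite ge0_fin_numE//; apply: (@le_lt_trans _ _ (\int[leb]_(x in hcube c s) MG%:E)%E).
      by apply: leint => x _; rewrite lee_fin.
    by rewrite (integral_leb_cst _ mQ) vQ -EFinM ltry.
  pose Ur := fine (\int[leb]_(x in dil c s) `|u x|%:E)%E.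
  pose Vr := fine (\int[leb]_(x in hcube c s) (G x)%:E)%E.
  have UE : (\int[leb]_(x in dil c s) `|u x|%:E = Ur%:E)%E by rewrite fineK.
  have VE : (\int[leb]_(x in hcube c s) (G x)%:E = Vr%:E)%E by rewrite fineK.
  have Ur0 : 0 <= Ur by rewrite /Ur fine_ge0.
  have Vr0 : 0 <= Vr by rewrite /Vr fine_ge0.
  have rest0 : (0 <= (L * s ^+ n.+1 / 2 ^+ M.+1)%:E)%E.
    by rewrite lee_fin mulr_ge0 ?invr_ge0 ?exprn_ge0// mulr_ge0// ltW.
  have [U0|U0] := eqVneq Ur 0.
    rewrite local_form0//; last by rewrite UE U0.
    by rewrite adde_ge0// mule_ge0// lee_fin ltW.
  have Ur1 : 0 < Ur by rewrite lt_def U0.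
  pose t := Ur / s ^+ n.+1; have t0 : 0 < t by rewrite divr_gt0.
  have ht : (\int[leb]_(x in dil c s) `|u x|%:E <= (t * s ^+ n.+1)%:E)%E.
    by rewrite UE /t divfK// gt_eqF.
  have [J [c' [s' [J1 J2 J3 J4]]]] := HC u G c s t nu mG G0 s0 t0 ht.
  have mP i : measurable (hcube (c' i) (s' i)) by exact: measurable_hcube.
  set U := \bigcup_(i in J) hcube (c' i) (s' i) in J3.
  have mU : measurable U by exact: bigcup_measurable.
  have UQ : U `<=` hcube c s by move=> x [i Ji xi]; exact: ((J1 i Ji).2).
  have mQU : measurable (hcube c s `\` U) by exact: measurableD.
  have QU : hcube c s = (hcube c s `\` U) `|` U by rewrite setUC setDUK.
  have dj : [disjoint hcube c s `\` U & U].
    by apply/disj_set2P; apply/seteqP; split => // x [[_ h1] h2].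
  have mPhiD (E : set Rn) : measurable_fun E Phi by exact: measurable_funTS.
  have PhiU : (\int[leb]_(x in U) Phi x =
      \sum_(0 <= i <oo | i \in J) \int[leb]_(x in hcube (c' i) (s' i)) Phi x)%E.
    exact: (ge0_integral_bigcup_cond (fun i _ => mP i) J2 (mPhiD _) (fun x _ => Phi0 x)).
  have Phisplit : (\int[leb]_(x in hcube c s) Phi x =
      \int[leb]_(x in hcube c s `\` U) Phi x + \int[leb]_(x in U) Phi x)%E.
    by rewrite {1}QU; exact: (ge0_integral_setU leb mQU mU (mPhiD _) (fun x _ => Phi0 x) dj).
  have volU : (leb U = \sum_(0 <= i <oo | i \in J) leb (hcube (c' i) (s' i)))%E.
    have -> : leb U = (\int[leb]_(x in U) 1%:E)%E by rewrite (integral_leb_cst _ mU) mul1e.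
    have m1 (E : set Rn) : measurable_fun E (fun=> 1%:E : \bar R) by exact: measurable_cst.
    rewrite (ge0_integral_bigcup_cond (fun i _ => mP i) J2 (m1 _) (fun x _ => lee01)).
    apply: eq_eseriesr => i _; by rewrite (integral_leb_cst _ (mP i)) mul1e.
  have volQU : ((s ^+ n.+1 / 2)%:E <= leb (hcube c s `\` U))%E.
    have e : (leb (hcube c s) <= leb (hcube c s `\` U) + leb U)%E.
      by rewrite {1}QU; exact: leb_setU.
    have sE : s ^+ n.+1 = s ^+ n.+1 / 2 + s ^+ n.+1 / 2 by field.
    move: (le_trans e (leeD (lexx _) J3)); rewrite vQ {1}sE EFinD.
    by rewrite leeD2rE.
  (* The hypothesis holds at every point of the cube, so it can be integrated over the part not
     covered by subcubes, which has at least half the measure; hence the factor 2 in [D]. These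
     parts are disjoint through all the iterations. *)
  have first : ((C * psi c s ^+ m * t)%:E * (\int[leb]_(x in hcube c s) (G x)%:E) <=
      D%:E * \int[leb]_(x in hcube c s `\` U) Phi x)%E.
    rewrite VE -EFinM; set e := _ * Vr.
    have p0 : 0 <= psi c s ^+ m by rewrite exprn_ge0// ltW// psi0.
    have e0 : 0 <= e.
      apply: mulr_ge0 => //; apply: mulr_ge0; last exact: ltW.
      by apply: mulr_ge0 => //; exact: ltW.
    have k0 : 0 < C * kap * s ^+ n.+1 by rewrite !mulr_gt0.
    have h1 : (e%:E * leb (hcube c s `\` U) <=
        (C * kap * s ^+ n.+1)%:E * \int[leb]_(x in hcube c s `\` U) Phi x)%E.
      rewrite -(integral_leb_cst _ mQU) -ge0_integralZl//; last by rewrite lee_fin ltW.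
      apply: leint => x [xQ _]; first by rewrite lee_fin.
      have hx := H c s x s0 xQ; rewrite UE VE -!EFinM in hx.
      have -> : e = (C / s ^+ n.+1) * (psi c s ^+ m * Ur * Vr).
        by rewrite /e /t; field; rewrite gt_eqF.
      have -> : C * kap * s ^+ n.+1 = (C / s ^+ n.+1) * (kap * s ^+ n.+1 * s ^+ n.+1).
        by field; rewrite gt_eqF.
      rewrite EFinM [((C / s ^+ n.+1) * (kap * _ * _))%:E]EFinM -muleA.
      by apply: lee_wpmul2l => //; rewrite lee_fin divr_ge0// ltW.
    have h2 : (e%:E * (s ^+ n.+1 / 2)%:E <= (C * kap * s ^+ n.+1)%:E *
        \int[leb]_(x in hcube c s `\` U) Phi x)%E.
      by apply: le_trans h1; apply: lee_wpmul2l; rewrite ?lee_fin.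
    have s20 : 0 < s ^+ n.+1 / 2 by rewrite divr_gt0.
    rewrite -(@lee_pmul2l _ (s ^+ n.+1 / 2)%:E)// muleC; apply: le_trans h2 _.
    rewrite muleA -EFinM /D.
    by have -> : s ^+ n.+1 / 2 * (2 * C * kap) = C * kap * s ^+ n.+1 by field.
  apply: (le_trans J4); rewrite Phisplit.
  rewrite (ge0_muleDr _ (intPhi (hcube c s `\` U)) (intPhi U)) -[leRHS]addeA.
  apply: leeD => //.
  apply: (@le_trans _ _ (\sum_(0 <= i <oo | i \in J)
     (D%:E * \int[leb]_(x in hcube (c' i) (s' i)) Phi x +
      (L / 2 ^+ M)%:E * leb (hcube (c' i) (s' i))))%E).
    apply: lee_nneseries => [i _ _|i iJ].
      by apply: integral_ge0 => x _; rewrite lee_fin mulr_ge0.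
    have Ji : J i by move: iJ; rewrite inE.
    have [si0 _] := J1 i Ji; apply: le_trans (IH (c' i) (s' i) si0) _.
    apply: leeD => //; rewrite (lebesgue_hcube _ (ltW si0)) -EFinM lee_fin.
    by rewrite mulrAC.
  have LM0 : 0 <= L / 2 ^+ M by rewrite divr_ge0// exprn_ge0.
  rewrite nneseriesD; last 2 first.
  - by move=> i _ _; rewrite mule_ge0// lee_fin ltW.
  - by move=> i _ _; rewrite mule_ge0// lee_fin.
  rewrite nneseriesZl//.
  rewrite nneseriesZl//.
  rewrite -PhiU -volU; apply: leeD => //.
  apply: (@le_trans _ _ ((L / 2 ^+ M)%:E * (s ^+ n.+1 / 2)%:E)%E).
    by apply: lee_wpmul2l; rewrite ?lee_fin.
  rewrite -EFinM lee_fin (exprS 2 M) [2 * _]mulrC invfM mulrACA -!mulrA le_eqVlt.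
  by apply/orP; left; apply/eqP; ring.
(* A cube that contains both supports: its local form is the whole integral. *)
have [c [s [s0 hu hG]]] : exists c s, [/\ 0 < s, forall x, ~ hcube c s x -> u x = 0 &
    forall x, ~ hcube c s x -> G x = 0].
  have [_ [_ [c1 [s1 [_ h1 _]]]]] := nu; have [_ [_ [c2 [s2 [_ h2 _]]]]] := nG.
  pose B : R := 1 + enorm c1 + enorm c2 + `|s1| + `|s2|.
  have B0 : 0 < B.
    have := enorm_ge0 c1; have := enorm_ge0 c2; have := normr_ge0 s1.
    by have := normr_ge0 s2; rewrite /B; lra.
  have sub (c0 : Rn) s0 : enorm c0 + `|s0| < B -> hcube c0 s0 `<=` hcube (- const_mx B) (2 * B).
    move=> hB x xc i; rewrite !mxE; have /andP[e1 e2] := xc i.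
    have := enorm_ge c0 i; rewrite ler_norml => /andP[e3 e4].
    have hs := ler_norm s0; have hs' := normr_ge0 s0; apply/andP; split; lra.
  exists (- const_mx B), (2 * B); split; first by rewrite mulr_gt0.
    move=> x xB; apply: h1 => xc; apply: xB; apply: sub xc.
    by rewrite /B; have := enorm_ge0 c2; have := normr_ge0 s2; lra.
  move=> x xB; apply: h2 => xc; apply: xB; apply: sub xc.
  by rewrite /B; have := enorm_ge0 c1; have := normr_ge0 s1; lra.
have hd : hcube c s `<=` dil c s.
  move=> x xQ; apply/dilP => i; have /andP[h1 h2] := xQ i.
  have N0 : 0 <= N * s by rewrite mulr_ge0// ltW.
  by apply/andP; split; lra.
have uE : (fun y => \1_(dil c s) y * u y) = u.
  apply/funext => y; have [yd|yd] := pselect (dil c s y); first by rewrite indicE mem_set// mul1r.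
  by rewrite indic_out// hu// => /hd.
have lhsE : (\int[leb]_x (`|iter_commutator m b T u x| * G x)%:E = local_form (T := T) b m u G c s)%E.
  rewrite /local_form uE (int1 (hcube c s)); apply: eq_integral => x _.
  have [xQ|xQ] := pselect (hcube c s x); first by rewrite indicE mem_set// mul1r.
  by rewrite indicE memNset// mul0r hG// mulr0.
rewrite lhsE; apply: (@le_trans _ _ (D%:E * \int[leb]_(x in hcube c s) Phi x)%E); last first.
  apply: lee_wpmul2l; first by rewrite lee_fin ltW.
  by apply: leintS.
apply/lee_addgt0Pr => e e0.
have [M hM] : exists M, L * s ^+ n.+1 / 2 ^+ M <= e.
  pose z := L * s ^+ n.+1 / e.
  have z0 : 0 <= z by rewrite divr_ge0 ?(ltW e0)// mulr_ge0// exprn_ge0// ltW.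
  exists (Num.bound z); rewrite ler_pdivrMr ?exprn_gt0// [leRHS]mulrC -ler_pdivrMr//.
  apply: le_trans (ltW (archi_boundP z0)) _.
  by rewrite -natrX ler_nat ltnW// ltn_expl.
apply: le_trans (key M c s s0) _; apply: leeD => //.
Qed.

End contraction.

(** * Generalized Phi-functions *)

Section phi_function.
Context {R : realType}.
Variable psi : R -> R.
Hypothesis hpsi : Phi_function psi.

Lemma Phi_ge0 t : 0 <= t -> 0 <= psi t. Proof. by case: hpsi => h _ _ _ _; exact: h. Qed.

Lemma Phi0 : psi 0 = 0. Proof. by case: hpsi. Qed.

Lemma Phi_conv (t x y : R) : 0 <= t <= 1 -> 0 <= x -> 0 <= y ->
  psi (t * x + (1 - t) * y) <= t * psi x + (1 - t) * psi y.
Proof.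
move=> /andP[t0 t1] x0 y0; case: hpsi => _ cv _ _ _.
have := cv (Itv01 t0 t1) x y; rewrite !convRE /=; apply.
  by apply/mem_set; rewrite /= in_itv/= x0.
by apply/mem_set; rewrite /= in_itv/= y0.
Qed.

Lemma Phi_star (t x : R) : 0 <= t <= 1 -> 0 <= x -> psi (t * x) <= t * psi x.
Proof.
by move=> t01 x0; have := Phi_conv t01 x0 (lexx 0); rewrite Phi0 !mulr0 !addr0.
Qed.

Lemma Phi_mono (x y : R) : 0 <= x -> x <= y -> psi x <= psi y.
Proof.
move=> x0 xy; have [y0|y0] := leP y 0.
  have -> : x = y by apply/eqP; rewrite eq_le xy (le_trans y0).
  by [].
have t01 : 0 <= x / y <= 1 by rewrite divr_ge0 ?(ltW y0)//= ler_pdivrMr// mul1r.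
have := Phi_star t01 (ltW y0); rewrite divfK ?gt_eqF// => /le_trans; apply.
by have /andP[_ h] := t01; rewrite ler_piMl// Phi_ge0// ltW.
Qed.

Lemma Phi_scale (k x : R) : 1 <= k -> 0 <= x -> k * psi x <= psi (k * x).
Proof.
move=> k1 x0; have k0 : 0 < k by exact: lt_le_trans k1.
have t01 : 0 <= k^-1 <= 1 by rewrite invr_ge0 (ltW k0)/= invf_le1.
have := Phi_star t01 (mulr_ge0 (ltW k0) x0); rewrite mulKf ?gt_eqF//.
by rewrite mulrC ler_pdivlMr// mulrC.
Qed.

Lemma Phi_large (M : R) : exists2 u, 0 <= u & M <= psi u.
Proof.
case: hpsi => _ _ _ _ /cvgryPge/(_ M) [u [_ hu]].
exists (Num.max 0 (u + 1)); first by rewrite le_max lexx.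
by apply: hu; rewrite lt_max ltrDl ltr01 orbT.
Qed.

(* Convexity makes psi left continuous on the positive half-line. *)
Lemma Phi_left (a c : R) : 0 <= a -> 0 <= c -> c < psi a ->
  exists q : rat, [/\ 0 <= ratr q :> R, ratr q < a & c < psi (ratr q)].
Proof.
move=> a0 c0 ca.
have a1 : 0 < a.
  by rewrite lt_def a0 andbT; apply/eqP => aE; move: ca; rewrite aE Phi0 ltNge c0.
pose S := psi (a + 1).
have S0 : 0 <= S by apply: Phi_ge0; rewrite addr_ge0.
pose d := Num.min a ((psi a - c) / (2 * (S + 1))).
have d0 : 0 < d by rewrite lt_min a1 divr_gt0 ?subr_gt0// mulr_gt0// ltr_wpDl.
have [q] := @rat_in_itvoo R (a - d) a (ltac:(by rewrite ltrBlDr ltrDl)).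
rewrite in_itv/= => /andP[q1 q2].
have q0 : 0 <= ratr q :> R.
  by apply: le_trans (ltW q1); rewrite subr_ge0 /d ge_min lexx.
exists q; split => //.
pose th := (a - ratr q) / (a + 1 - ratr q).
have e0 : 0 < a + 1 - ratr q by lra.
have th1 : th <= a - ratr q by rewrite /th ler_pdivrMr//; nra.
have th0 : 0 <= th by rewrite divr_ge0 ?(ltW e0)//; lra.
have th2 : th <= 1 by rewrite ler_pdivrMr//; lra.
have hh : 0 <= 1 - th <= 1 by apply/andP; split; lra.
have := Phi_conv hh q0 (ltac:(by rewrite addr_ge0) : 0 <= a + 1).
have -> : (1 - th) * ratr q + (1 - (1 - th)) * (a + 1) = a.
  by rewrite /th; field; rewrite gt_eqF.
have e : 1 - (1 - th) = th by ring.
rewrite e -/S => e1.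
have e2 : th * (S + 1) <= (psi a - c) / 2.
  apply: le_trans (_ : d * (S + 1) <= _).
    by apply: ler_wpM2r; [rewrite addr_ge0|apply: (le_trans th1); lra].
  rewrite -ler_pdivlMr ?ltr_wpDl// -mulrA -invfM.
  by rewrite /d ge_min lexx orbT.
have e3 : (1 - th) * psi (ratr q) <= psi (ratr q) by rewrite ler_piMl ?Phi_ge0//; lra.
have : psi a - th * S <= psi (ratr q) by lra.
have : th * S <= th * (S + 1) by apply: ler_wpM2l => //; lra.
by lra.
Qed.

End phi_function.

Section phi_norm.
Context {R : realType} {n : nat}.
Local Notation Rn := (Rn R n.+1).
Local Notation leb := (@lebesgue_Rn R n.+1).

(** By monotonicity and left continuity, Psi x (a x) exceeds c >= 0 exactly when Psi x does so at
    some nonnegative rational below a x; the superlevel set is thus a countable union. *)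
Lemma Phi_comp_mfun (Psi : Rn -> R -> R) (a : Rn -> R) : generalized_Phi Psi -> mfun a ->
  (forall x, 0 <= a x) -> mfun (fun x => Psi x (a x)).
Proof.
move=> [mPsi hPsi] ma a0; rewrite /mfun => _; apply: (measurability _ (RGenOInfty.measurableE R)) => //.
move=> /= _ [_ [c ->] <-]; rewrite setTI.
have [c0|c0] := ltP c 0.
  rewrite [X in measurable X](_ : _ = setT); first exact: measurableT.
  apply/seteqP; split => // x _ /=; rewrite in_itv/= andbT.
  by apply: (lt_le_trans c0); exact: (Phi_ge0 (hPsi x)).
rewrite [X in measurable X](_ : _ = \bigcup_(q : rat)
  (if 0 <= ratr q :> R then [set x | ratr q < a x] `&` [set x | c < Psi x (ratr q)] else set0)).
  apply: bigcupT_measurable_rat => q; case: ifPn => q0; last exact: measurable0.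
  by apply: measurableI; apply: mfun_gt => //; exact: mPsi.
apply/seteqP; split => x /=; rewrite in_itv/= andbT.
  move=> h; have [q [q0 qa hq]] := Phi_left (hPsi x) (a0 x) c0 h.
  by exists q => //; rewrite q0.
move=> [q _]; case: ifPn => // q0 [/= h1 h2].
by apply: (lt_le_trans h2); apply: (Phi_mono (hPsi x)) => //; exact: ltW.
Qed.

Definition Phi_mod (Psi : Rn -> R -> R) (f : Rn -> R) (l : R) : \bar R :=
  (\int[leb]_x (Psi x (`|f x| / l))%:E)%E.

Lemma luxemburg_ge0 (Phi : Rn -> \bar R -> \bar R) f : (0 <= luxemburg Phi f)%E.
Proof. by apply: le_ereal_inf_tmp => _ [l [l0 _] <-]; rewrite lee_fin ltW. Qed.

Lemma luxemburg_lt (Phi : Rn -> \bar R -> \bar R) f (x : R) : (luxemburg Phi f < x%:E)%E ->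
  exists l : R, [/\ 0 < l, l < x & (\int[leb]_y Phi y (`|f y| * l^-1%:E) <= 1)%E].
Proof.
move=> /ereal_inf_lt [_ [l [l0 hl] <-]]; rewrite lte_fin => lx; by exists l.
Qed.

Lemma Phi_norm_lt (Psi : Rn -> R -> R) f (x : R) : (Phi_norm Psi f < x%:E)%E ->
  exists l : R, [/\ 0 < l, l < x & (Phi_mod Psi f l <= 1)%E].
Proof. exact: luxemburg_lt. Qed.

Lemma luxemburg_ge (Phi : Rn -> \bar R -> \bar R) f (x : R) :
  (forall l : R, 0 < l -> (\int[leb]_y Phi y (`|f y| * l^-1%:E) <= 1)%E -> x <= l) ->
  (x%:E <= luxemburg Phi f)%E.
Proof. by move=> H; apply: le_ereal_inf_tmp => _ [l [l0 hl] <-]; rewrite lee_fin; exact: H. Qed.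

Lemma leb_bigcup_pos (F : nat -> set Rn) : (0 < leb (\bigcup_j F j))%E -> exists j, (0 < leb (F j))%E.
Proof.
move=> H; apply: contrapT => h; move: H; apply/negP; rewrite -leNgt.
apply: le_trans (leb_bigcup F) _; rewrite eseries0// => i _ _.
apply/eqP; rewrite eq_le leb_ge0 andbT leNgt; apply/negP => hi; by apply: h; exists i.
Qed.

(** On some [F j] of positive measure, g >= 1 / (j + 1) and Psi x j >= 1; convexity makes Psi grow
    at least linearly beyond j, so at small scales the modular exceeds 1. Positive norms give the
    quotients in the weight condition their meaning. *)
Lemma Phi_norm_pos (Psi : Rn -> R -> R) (g : Rn -> R) (Q : set Rn) : generalized_Phi Psi ->
  mfun g -> measurable Q -> (0 < leb Q)%E -> {ae leb, forall x, Q x -> 0 < g x} ->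
  (0 < Phi_norm Psi (\1_Q \* g)%R)%E.
Proof.
move=> [mPsi hPsi] mg mQ Q0 g0.
pose F j : set Rn := Q `&` [set x | j.+1%:R^-1 <= g x] `&` [set x | 1 <= Psi x j%:R].
have mF j : measurable (F j).
  apply: measurableI; last by apply: mfun_ge; exact: mPsi.
  by apply: measurableI => //; exact: mfun_ge.
have : (0 < leb (\bigcup_j F j))%E.
  have [Z [mZ Z0 hZ]] := g0.
  apply: (lt_le_trans Q0); apply: le_trans (_ : leb (\bigcup_j F j `|` Z) <= _)%E.
    apply: leb_le => x Qx; have [Zx|Zx] := pselect (Z x); first by right.
    left; have gx : 0 < g x by apply: contrapT => h; apply: Zx; apply: hZ => /= /(_ Qx).
    have [u u0 hu] := Phi_large (hPsi x) 1.
    pose j := maxn (Num.bound u) (Num.bound (g x)^-1).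
    exists j => //; split; [split => //=|].
      rewrite invf_ple ?posrE// (le_trans (ltW (archi_boundP _)))//; first by rewrite invr_ge0 ltW.
      by rewrite ler_nat leqW// leq_maxr.
    apply: (le_trans hu); apply: (Phi_mono (hPsi x)) => //.
    by apply: (le_trans (ltW (archi_boundP u0))); rewrite ler_nat leq_maxl.
  apply: le_trans (leb_setU _ _) _; have -> : leb Z = 0%E by exact: Z0.
  by rewrite adde0.
move=> /leb_bigcup_pos [j hj].
have [e e0 he] : exists2 e : R, 0 < e & (e%:E <= leb (F j))%E.
  case: (leb (F j)) hj => [r| |]; rewrite ?lte_fin.
  - by exists r.
  - by exists 1 => //; rewrite leey.
  - by [].
pose k : R := e^-1 + 1.
have k1 : 1 <= k by rewrite /k lerDr invr_ge0 ltW.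
have k0 : 0 < k by exact: lt_le_trans k1.
pose x0 : R := (k * j.+1%:R * j.+1%:R)^-1.
have x00 : 0 < x0 by rewrite invr_gt0 !mulr_gt0.
apply: (@lt_le_trans _ _ x0%:E); first by rewrite lte_fin.
apply: luxemburg_ge => l l0 hl; rewrite leNgt; apply/negP => lx.
have : (k%:E * leb (F j) <= 1)%E.
  apply: le_trans hl; rewrite -(integral_leb_cst _ (mF j)).
  rewrite integral_mkcond; apply: leintT => x; rewrite patchE; case: ifPn => //.
  - by move=> _; rewrite lee_fin ltW.
  - move=> /set_mem [[Qx /= gx] px]; rewrite lee_fin.
    have gx0 : 0 < g x by apply: lt_le_trans gx.
    rewrite indicE mem_set// mul1r (gtr0_norm gx0).
    apply: (@le_trans _ _ (k * Psi x j%:R)); first by rewrite ler_peMr// ltW.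
    apply: le_trans (Phi_scale (hPsi x) k1 _) _ => //.
    apply: (Phi_mono (hPsi x)); first by rewrite mulr_ge0// ltW.
    have h1 : k * j.+1%:R * j.+1%:R <= l^-1.
      by rewrite -[leLHS]invrK lef_pV2 ?posrE// ltW.
    have h2 : j.+1%:R^-1 * (k * j.+1%:R * j.+1%:R) <= g x * l^-1.
      by apply: ler_pM => //; rewrite !mulr_ge0// ltW.
    apply: le_trans h2.
    have -> : j.+1%:R^-1 * (k * j.+1%:R * j.+1%:R) = k * j.+1%:R.
      by rewrite [k * _ * _]mulrC mulKf ?pnatr_eq0.
    by rewrite ler_pM2l// ler_nat.
  - by move=> _; rewrite lee_fin; apply: (Phi_ge0 (hPsi x)); rewrite divr_ge0// ltW.
apply/negP; rewrite -ltNge; apply: (@lt_le_trans _ _ (k * e)%:E).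
  by rewrite lte_fin /k mulrDl mulVf ?gt_eqF// mul1r ltrDl.
by rewrite EFinM; apply: lee_wpmul2l => //; rewrite lee_fin ltW.
Qed.

(** D*(x, u) is at least u - D x 1, and D x 1 is bounded on a subset of positive measure. *)
Lemma Phi_conj_pos (D : Rn -> R -> R) (Q : set Rn) : generalized_Phi D ->
  measurable Q -> (0 < leb Q)%E ->
  (0 < luxemburg (Phi_conjugate D) (EFin \o \1_Q))%E.
Proof.
move=> [mD hD] mQ Q0.
pose F j : set Rn := Q `\` [set x | j%:R < D x 1].
have mF j : measurable (F j).
  by apply: measurableD => //; apply: mfun_gt; exact: mD.
have : (0 < leb (\bigcup_j F j))%E.
  apply: (lt_le_trans Q0); apply: leb_le => x Qx.
  exists (Num.bound (D x 1)) => //; split => //=; apply/negP; rewrite -leNgt.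
  by apply: ltW; apply: archi_boundP; apply: (Phi_ge0 (hD x)).
move=> /leb_bigcup_pos [j hj].
have [e e0 he] : exists2 e : R, 0 < e & (e%:E <= leb (F j))%E.
  case: (leb (F j)) hj => [r| |]; rewrite ?lte_fin.
  - by exists r.
  - by exists 1 => //; rewrite leey.
  - by [].
pose k : R := e^-1 + 1.
have k1 : 1 <= k by rewrite /k lerDr invr_ge0 ltW.
have k0 : 0 < k by exact: lt_le_trans k1.
pose x0 : R := (k + j%:R)^-1.
have x00 : 0 < x0 by rewrite invr_gt0 ltr_wpDr.
apply: (@lt_le_trans _ _ x0%:E); first by rewrite lte_fin.
apply: luxemburg_ge => l l0 hl; rewrite leNgt; apply/negP => lx.
have conj_ge0 x u : (0 <= Phi_conjugate D x u)%E.
  apply: ereal_sup_ubound; exists 0 => //=; by rewrite mul0e (Phi0 (hD x)) sube0.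
have : (k%:E * leb (F j) <= 1)%E.
  apply: le_trans hl; rewrite -(integral_leb_cst _ (mF j)).
  rewrite integral_mkcond; apply: leintT => x; rewrite patchE; case: ifPn => //.
    by move=> _; rewrite lee_fin ltW.
  move=> /set_mem [Qx /= /negP]; rewrite -leNgt => px.
  apply: (@le_trans _ _ (1%:E * l^-1%:E - (D x 1)%:E)%E); last first.
    have -> : (`|(EFin \o \1_Q) x| * l^-1%:E = l^-1%:E)%E.
      by rewrite /= indicE mem_set// normr1 mul1e.
    by apply: ereal_sup_ubound; exists 1%R; first exact: ler01.
  rewrite -EFinM -EFinB lee_fin mul1r lerBrDr.
  apply: le_trans (_ : k + j%:R <= _); first by rewrite lerD2l.
  by rewrite -[leLHS]invrK lef_pV2 ?posrE// ltW.
apply/negP; rewrite -ltNge; apply: (@lt_le_trans _ _ (k * e)%:E).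
  by rewrite lte_fin /k mulrDl mulVf ?gt_eqF// mul1r ltrDl.
by rewrite EFinM; apply: lee_wpmul2l => //; rewrite lee_fin ltW.
Qed.

(** The positive part of [k - f] is measurable and lies below [g]; its integral takes the place of
    that of [g], which may be only a lower integral. *)
Lemma int_add_le (f k : Rn -> R) (g : Rn -> \bar R) : mfun f -> mfun k ->
  (forall x, 0 <= f x) -> (forall x, 0 <= g x)%E -> (forall x, 0 <= k x) ->
  (forall x, (k x)%:E <= (f x)%:E + g x)%E ->
  (\int[leb]_x (k x)%:E <= \int[leb]_x (f x)%:E + \int[leb]_x g x)%E.
Proof.
move=> mf mk f0 g0 k0 H; pose d x := Num.max (k x - f x) 0.
have md : mfun d by apply: measurable_maxr; [exact: mfunB|exact: mfun_cst].
have d0 x : 0 <= d x by rewrite /d le_max lexx orbT.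
apply: (@le_trans _ _ (\int[leb]_x ((f x)%:E + (d x)%:E))%E).
  apply: leintT => x; first by rewrite lee_fin.
  rewrite -EFinD lee_fin /d; case: (leP (k x - f x) 0); lra.
rewrite (intD (mfunE mf) (mfunE md) (fun x => f0 x) (fun x => d0 x)); apply: leeD => //.
apply: leintT => x; first by rewrite lee_fin.
rewrite /d; case: (leP (k x - f x) 0) => h; first exact: g0.
by rewrite EFinB leeBlDl.
Qed.

(* Young's inequality for D and its conjugate; D* need not be measurable, as the
   integral of the other terms bounds its lower integral. *)
Lemma conj_young (D : Rn -> R -> R) (h : Rn -> R) (Q : set Rn) (l u : R) : generalized_Phi D ->
  mfun h -> measurable Q -> 0 < l -> 0 < u -> (Phi_mod D (\1_Q \* h)%R l <= 1)%E ->
  (\int[leb]_x Phi_conjugate D x (`|(EFin \o \1_Q) x| * u^-1%:E) <= 1)%E ->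
  (\int[leb]_(x in Q) `|h x|%:E <= (2 * l * u)%:E)%E.
Proof.
move=> hD mh mQ l0 u0 h1 h2.
have [mD hD'] := hD.
have mk : mfun (fun x => \1_Q x * `|h x|) by apply: mfunM; [exact: mfun1|exact: mfun_norm].
have mQh : mfun (\1_Q \* h) by apply: mfunM => //; exact: mfun1.
have lu0 : 0 < (l * u)^-1 by rewrite invr_gt0 mulr_gt0.
have k0 x : 0 <= (l * u)^-1 * (\1_Q x * `|h x|).
  by rewrite mulr_ge0 ?(ltW lu0)// mulr_ge0// indicE.
have a0 x : 0 <= `|(\1_Q \* h) x| / l by rewrite divr_ge0// ltW.
have ma : mfun (fun x => `|(\1_Q \* h) x| / l).
  by apply: mfunM; [exact: mfun_norm|exact: mfun_cst].
have conj_ge0 x t : (0 <= Phi_conjugate D x t)%E.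
  apply: ereal_sup_ubound; exists 0 => //=; by rewrite mul0e (Phi0 (hD' x)) sube0.
have Hpt x : (((l * u)^-1 * (\1_Q x * `|h x|))%:E <= (D x (`|(\1_Q \* h)%R x| / l))%:E +
    Phi_conjugate D x (`|(EFin \o \1_Q) x| * u^-1%:E))%E.
  have [Qx|Qx] := pselect (Q x); last first.
    rewrite [X in (X%:E <= _)%E](_ : _ = 0) ?adde_ge0// ?lee_fin.
      exact: (Phi_ge0 (hD' x)).
    by rewrite indicE memNset// mul0r mulr0.
  rewrite -leeBlDl//.
  have -> : (`|(EFin \o \1_Q) x| * u^-1%:E = u^-1%:E)%E.
    by rewrite /= indicE mem_set// normr1 mul1e.
  apply: ereal_sup_ubound; exists (`|h x| / l)%R; first by rewrite /= divr_ge0// ltW.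
  rewrite (_ : (\1_Q \* h)%R x = h x); last by rewrite /= indicE mem_set// mul1r.
  rewrite indicE mem_set// mul1r -EFinM (_ : `|h x| / l * u^-1 = (l * u)^-1 * `|h x|)//.
  by field; rewrite !gt_eqF.
have H := int_add_le (Phi_comp_mfun hD ma a0) (mfunZ (l * u)^-1 mk)
  (fun x => Phi_ge0 (hD' x) (a0 x)) (fun x => conj_ge0 x (`|(EFin \o \1_Q) x| * u^-1%:E)%E) k0 Hpt.
have k1 x : 0 <= \1_Q x * `|h x| by rewrite mulr_ge0// indicE.
have hZ := intZ (mfunE mk) (ltW lu0) (fun x => k1 x).
rewrite (int1 Q).
have : ((l * u)^-1%:E * \int[leb]_x (\1_Q x * `|h x|)%:E <= 2%:E)%E.
  rewrite -hZ; apply: (le_trans H); have := leeD h1 h2; rewrite -EFinD; exact.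
rewrite lee_pdivrMl ?mulr_gt0// -EFinM => /le_trans; apply.
by rewrite lee_fin le_eqVlt; apply/orP; left; apply/eqP; ring.
Qed.

(** With t = A a + B b, both a and b are at most the inverses at t + e. If D (a b / (2 C)) exceeded
    t + e, the inverse of D there would be at most a b / (2 C), and the hypothesis would give a b <=
    a b / 2. *)
Lemma inverse_young (A B D : R -> R) (C a b : R) :
  Phi_function A -> Phi_function B -> Phi_function D -> 0 < C ->
  (forall t, 0 <= t -> inf [set u | 0 <= u /\ t <= A u] * inf [set u | 0 <= u /\ t <= B u]
     <= C * inf [set u | 0 <= u /\ t <= D u]) ->
  0 <= a -> 0 <= b -> D (a * b / (2 * C)) <= A a + B b.
Proof.
move=> hA hB hD C0 H a0 b0.
have A0 := Phi_ge0 hA a0; have B0 := Phi_ge0 hB b0.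
have [ab0|ab0] := leP (a * b) 0.
  have -> : a * b = 0 by apply/eqP; rewrite eq_le ab0 mulr_ge0.
  by rewrite mul0r (Phi0 hD) addr_ge0.
pose t := A a + B b.
have t0 : 0 <= t by rewrite addr_ge0.
apply/ler_addgt0Pr => e e0; rewrite -/t.
have te0 : 0 <= t + e by rewrite addr_ge0// ltW.
have inv_ge (F : R -> R) (c : R) : Phi_function F -> 0 <= c -> F c <= t ->
    c <= inf [set u | 0 <= u /\ t + e <= F u].
  move=> hF c0 Fc; apply: lb_le_inf.
    by have [u u0 hu] := Phi_large hF (t + e); exists u.
  move=> u [u0 hu]; rewrite leNgt; apply/negP => uc.
  by have := Phi_mono hF u0 (ltW uc); lra.
have hA' := inv_ge A a hA a0 (ltac:(by rewrite /t lerDl)).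
have hB' := inv_ge B b hB b0 (ltac:(by rewrite /t lerDr)).
have h := le_trans (ler_pM a0 b0 hA' hB') (H _ te0).
rewrite leNgt; apply/negP => hz.
have z0 : 0 <= a * b / (2 * C) by rewrite divr_ge0 ?(ltW ab0)// mulr_ge0// ltW.
have : inf [set u | 0 <= u /\ t + e <= D u] <= a * b / (2 * C).
  apply: ge_inf; first by exists 0 => u [].
  by split => //; exact: ltW.
rewrite -(ler_pM2l C0) => /(le_trans h).
have -> : C * (a * b / (2 * C)) = a * b / 2 by field; rewrite gt_eqF.
by lra.
Qed.

(** In 4 C, the factor 2 C comes from [inverse_young]; the other 2, by convexity, halves the sum of
    the two modulars, which is at most 2. *)
Lemma prod_holder (A B D : Rn -> R -> R) (C l l' : R) (f g : Rn -> R) :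
  generalized_Phi A -> generalized_Phi B -> generalized_Phi D -> 0 < C ->
  (forall x t, 0 <= t -> Phi_inverse A x t * Phi_inverse B x t <= C * Phi_inverse D x t) ->
  mfun f -> mfun g -> 0 < l -> 0 < l' -> (Phi_mod A f l <= 1)%E -> (Phi_mod B g l' <= 1)%E ->
  (Phi_mod D (fun x => f x * g x)%R (4 * C * l * l') <= 1)%E.
Proof.
move=> hA hB hD C0 H mf mg l0 l'0 h1 h2.
have ma : mfun (fun x => `|f x| / l) by apply: mfunM; [exact: mfun_norm|exact: mfun_cst].
have mb : mfun (fun x => `|g x| / l') by apply: mfunM; [exact: mfun_norm|exact: mfun_cst].
have a0 x : 0 <= `|f x| / l by rewrite divr_ge0// ltW.
have b0 x : 0 <= `|g x| / l' by rewrite divr_ge0// ltW.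
have A0 x := Phi_ge0 (hA.2 x) (a0 x); have B0 x := Phi_ge0 (hB.2 x) (b0 x).
have mA := Phi_comp_mfun hA ma a0; have mB := Phi_comp_mfun hB mb b0.
have i20 : 0 <= 2^-1 :> R by rewrite invr_ge0.
apply: (@le_trans _ _ (\int[leb]_x ((2^-1)%:E * (A x (`|f x| / l) + B x (`|g x| / l'))%:E))%E).
  apply: leintT => x.
    rewrite lee_fin; apply: (Phi_ge0 (hD.2 x)); rewrite divr_ge0// !mulr_ge0// ltW//.
  have h := inverse_young (hA.2 x) (hB.2 x) (hD.2 x) C0 (H x) (a0 x) (b0 x).
  rewrite -EFinM lee_fin; apply: le_trans (ler_wpM2l i20 h).
  have -> : `|f x * g x| / (4 * C * l * l') = 2^-1 * (`|f x| / l * (`|g x| / l') / (2 * C)).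
    by rewrite normrM; field; rewrite !gt_eqF.
  apply: (Phi_star (hD.2 x)); first by rewrite i20 invf_le1// ler1n.
  by apply: divr_ge0; [exact: mulr_ge0|apply: mulr_ge0 => //; exact: ltW].
rewrite (intZ (mfunE (mfunD mA mB)) i20); last by move=> x; rewrite lee_fin addr_ge0.
have := intD (mfunE mA) (mfunE mB) (fun x => A0 x) (fun x => B0 x) => e.
apply: (@le_trans _ _ ((2^-1)%:E * (1 + 1))%E); last first.
  by rewrite -EFinD -EFinM lee_fin; lra.
apply: lee_wpmul2l => //; apply: le_trans (leeD h1 h2).
by rewrite /Phi_mod -e.
Qed.

Lemma mul_inf_le (k X a : R) : 0 <= k -> (forall l, a < l -> X <= k * l) -> X <= k * a.
Proof.
move=> k0 H; apply/ler_addgt0Pr => e e0.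
have k1 : 0 < k + 1 by rewrite ltr_wpDl.
have := H (a + e / (k + 1)) (ltac:(by rewrite ltrDl divr_gt0)).
move=> /le_trans; apply; rewrite mulrDr lerD2l mulrCA ler_piMr ?(ltW e0)//.
by rewrite ler_pdivrMr// mul1r lerDl.
Qed.

Section holder.
Variables A B D : Rn -> R -> R.
Hypotheses (hA : generalized_Phi A) (hB : generalized_Phi B) (hD : generalized_Phi D)
  (hF : condition_F A B D).

Lemma Phi_norm1_pos (Psi : Rn -> R -> R) (a : Rn) (L : R) : generalized_Phi Psi -> 0 < L ->
  (0 < Phi_norm Psi \1_(cube a L))%E.
Proof.
move=> hPsi L0.
have -> : \1_(cube a L) = (\1_(cube a L) \* (fun=> 1))%R :> (Rn -> R).
  by apply/funext => x /=; rewrite mulr1.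
apply: Phi_norm_pos => //; [exact: mfun_cst|exact: measurable_cube| |].
  by rewrite (lebesgue_cube a (ltW L0)) lte_fin exprn_gt0.
by apply: aeW => x _.
Qed.

Lemma pos_real (x : \bar R) : (0 < x)%E -> (x < +oo)%E -> exists2 r : R, 0 < r & x = r%:E.
Proof. by case: x => [r| |]//; rewrite lte_fin; exists r. Qed.

(** Since all these norms are positive, a finite product bounds each of its factors: the third
    clause of condition F makes the norms for D and its conjugate finite, then the first clause
    those for A and B. *)
Lemma cube_norms (a : Rn) (L : R) : 0 < L -> exists a1 b1 d1 c1 : R,
  [/\ 0 < a1, 0 < b1, 0 < d1 & 0 < c1] /\
  [/\ Phi_norm A \1_(cube a L) = a1%:E, Phi_norm B \1_(cube a L) = b1%:E,
     Phi_norm D \1_(cube a L) = d1%:E &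
     luxemburg (Phi_conjugate D) (EFin \o \1_(cube a L)) = c1%:E].
Proof.
move=> L0; case: hF => [[C1 C10 H1] _ [C3 C30 H3]].
have cQ := cubes_cube a L0.
have vQ := lebesgue_cube a (ltW L0).
have A0 := Phi_norm1_pos a hA L0; have B0 := Phi_norm1_pos a hB L0.
have D0 := Phi_norm1_pos a hD L0.
have c0 : (0 < luxemburg (Phi_conjugate D) (EFin \o \1_(cube a L)))%E.
  apply: Phi_conj_pos => //; first exact: measurable_cube.
  by rewrite vQ lte_fin exprn_gt0.
have h3 := H3 _ cQ; rewrite vQ -EFinM in h3.
have Doo : (Phi_norm D \1_(cube a L) < +oo)%E.
  rewrite ltey; apply/eqP => e; move: h3; rewrite e gt0_mulye//.
have coo : (luxemburg (Phi_conjugate D) (EFin \o \1_(cube a L)) < +oo)%E.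
  by rewrite ltey; apply/eqP => e; move: h3; rewrite e gt0_muley.
have h1 := H1 _ cQ.
have [d1 d10 dE] := pos_real D0 Doo.
rewrite dE -EFinM in h1.
have Aoo : (Phi_norm A \1_(cube a L) < +oo)%E.
  by rewrite ltey; apply/eqP => e; move: h1; rewrite e gt0_mulye.
have Boo : (Phi_norm B \1_(cube a L) < +oo)%E.
  by rewrite ltey; apply/eqP => e; move: h1; rewrite e gt0_muley.
have [a1 a10 aE] := pos_real A0 Aoo; have [b1 b10 bE] := pos_real B0 Boo.
have [c1 c10 cE] := pos_real c0 coo.
by exists a1, b1, d1, c1.
Qed.

(** The product rule and Young's inequality for D give the constant 8 C2 = 2 * 4 C2 and the norm of
    the indicator for D*, which the third and first clauses of condition F bound by |Q| over the
    norms for A and B. The norm of [f] is taken positive and finite to exclude 0 times infinity on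
    the right. *)
Lemma Phi_holder : exists2 C : R, 0 < C & forall (a : Rn) (L : R) (f g : Rn -> R), 0 < L ->
  mfun f -> mfun g -> (0 < Phi_norm A (\1_(cube a L) \* f)%R < +oo)%E ->
  (\int[leb]_(x in cube a L) `|f x * g x|%:E <= (C * L ^+ n.+1)%:E *
    ((Phi_norm A (\1_(cube a L) \* f)%R / Phi_norm A \1_(cube a L)) *
     (Phi_norm B (\1_(cube a L) \* g)%R / Phi_norm B \1_(cube a L))))%E.
Proof.
case: (hF) => [[C1 C10 H1] [C2 C20 H2] [C3 C30 H3]].
exists (8 * C2 * C1 * C3) => [|a L f g L0 mf mg /andP[f0 foo]].
  by rewrite !mulr_gt0.
have [a1 [b1 [d1 [c1 [[a10 b10 d10 c10] [aE bE dE cE]]]]]] := cube_norms a L0.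
have [x x0 xE] := pos_real f0 foo.
set Q := cube a L; have mQ : measurable Q by exact: measurable_cube.
have cQ : cubes Q by exact: cubes_cube.
have Ln0 : 0 < L ^+ n.+1 by rewrite exprn_gt0.
have vQ := lebesgue_cube a (ltW L0).
have K0 : 0 < 8 * C2 * C1 * C3 * L ^+ n.+1 by rewrite !mulr_gt0.
rewrite xE aE bE inver gt_eqF// inver gt_eqF//.
have g0 := luxemburg_ge0 (fun x => er_map (B x)) (EFin \o (\1_Q \* g)%R).
have [goo|] := eqVneq (Phi_norm B (\1_Q \* g)%R) +oo%E.
  by rewrite goo gt0_mulye ?lte_fin ?invr_gt0// -EFinM gt0_muley ?lte_fin ?divr_gt0//
    gt0_muley ?lte_fin// leey.
rewrite -ltey => goo.
have /ge0_fin_numE/esym yfin := g0.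
have yE : Phi_norm B (\1_Q \* g)%R = (fine (Phi_norm B (\1_Q \* g)%R))%:E.
  by rewrite fineK// ge0_fin_numE.
set y := fine _ in yE; have y0 : 0 <= y by rewrite -lee_fin -yE.
have main l l' u : x < l -> y < l' -> c1 < u ->
    (\int[leb]_(x in Q) `|f x * g x|%:E <= (8 * C2 * l * l' * u)%:E)%E.
  move=> xl yl' cu.
  have [l1 [l10 l1l hl1]] : exists l1 : R, [/\ 0 < l1, l1 < l &
      (Phi_mod A (\1_Q \* f)%R l1 <= 1)%E].
    by apply: Phi_norm_lt; rewrite xE lte_fin.
  have [l2 [l20 l2l hl2]] : exists l2 : R, [/\ 0 < l2, l2 < l' &
      (Phi_mod B (\1_Q \* g)%R l2 <= 1)%E].
    by apply: Phi_norm_lt; rewrite yE lte_fin.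
  have [u1 [u10 u1u hu1]] := luxemburg_lt (ltac:(by rewrite cE lte_fin) :
    (luxemburg (Phi_conjugate D) (EFin \o \1_Q) < u%:E)%E).
  have mQf : mfun (\1_Q \* f)%R by apply: mfunM => //; exact: mfun1.
  have mQg : mfun (\1_Q \* g)%R by apply: mfunM => //; exact: mfun1.
  have hp := prod_holder hA hB hD C20 H2 mQf mQg l10 l20 hl1 hl2.
  have hp' : (Phi_mod D (\1_Q \* (fun x => f x * g x))%R (4 * C2 * l1 * l2) <= 1)%E.
    rewrite (_ : (\1_Q \* _)%R = (fun x => (\1_Q \* f)%R x * (\1_Q \* g)%R x))//.
    apply/funext => z /=; rewrite indicE; case: (_ \in _); by rewrite ?mul1r ?mul0r.
  have ll0 : 0 < 4 * C2 * l1 * l2 by rewrite !mulr_gt0.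
  apply: le_trans (conj_young hD (mfunM mf mg) mQ ll0 u10 hp' hu1) _.
  rewrite lee_fin.
  have -> : 2 * (4 * C2 * l1 * l2) * u1 = 8 * C2 * (l1 * l2 * u1) by ring.
  have -> : 8 * C2 * l * l' * u = 8 * C2 * (l * l' * u) by ring.
  apply: ler_wpM2l; first by rewrite mulr_ge0// ltW.
  apply: ler_pM; [by rewrite mulr_ge0// ltW|exact: ltW| |exact: ltW].
  by apply: ler_pM; [exact: ltW|exact: ltW|exact: ltW|exact: ltW].
have int0 : (0 <= \int[leb]_(x in Q) `|f x * g x|%:E)%E.
  by apply: integral_ge0 => z _; rewrite lee_fin.
have intfin : (\int[leb]_(x in Q) `|f x * g x|%:E)%E \is a fin_num.
  rewrite ge0_fin_numE//; apply: le_lt_trans (main (x + 1) (y + 1) (c1 + 1) _ _ _) _;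
    by rewrite ?ltrDl ?ltry.
rewrite -(fineK intfin) in main *; set X := fine _ in main *.
have main2 : X <= 8 * C2 * x * y * c1.
  have C80 : 0 <= 8 * C2 by rewrite mulr_ge0// ltW.
  apply: mul_inf_le; first by rewrite !mulr_ge0// ltW.
  move=> u cu; have u0 : 0 < u by exact: lt_trans cu.
  rewrite -[leRHS]mulrA [y * u]mulrC mulrA.
  apply: mul_inf_le; first by rewrite !mulr_ge0// ltW.
  move=> l' yl'; have l'0 : 0 < l' by exact: le_lt_trans yl'.
  have -> : 8 * C2 * x * u * l' = 8 * C2 * u * l' * x by ring.
  apply: mul_inf_le; first by rewrite !mulr_ge0// ltW.
  move=> l xl; rewrite -lee_fin; apply: le_trans (main l l' u xl yl' cu) _.
  by rewrite lee_fin le_eqVlt; apply/orP; left; apply/eqP; ring.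
have h3 := H3 _ cQ; rewrite dE cE vQ -!EFinM lee_fin in h3.
have h1 := H1 _ cQ; rewrite aE bE dE -!EFinM lee_fin in h1.
rewrite yE -!EFinM lee_fin; apply: (le_trans main2).
have cle : c1 <= C1 * C3 * L ^+ n.+1 / (a1 * b1).
  rewrite ler_pdivlMr ?mulr_gt0//; apply: le_trans (_ : c1 * (C1 * d1) <= _).
    by rewrite ler_pM2l.
  by rewrite mulrCA -mulrA ler_pM2l// mulrC.
have -> : 8 * C2 * C1 * C3 * L ^+ n.+1 * (x / a1 * (y / b1)) =
   8 * C2 * x * y * (C1 * C3 * L ^+ n.+1 / (a1 * b1)).
  by field; rewrite !gt_eqF.
by apply: ler_wpM2l => //; rewrite !mulr_ge0// ltW.
Qed.

End holder.

End phi_norm.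

(** * Variable exponents *)

Section exponent_norm.
Context {R : realType} {n : nat}.
Local Notation Rn := (Rn R n.+1).
Local Notation leb := (@lebesgue_Rn R n.+1).
Local Notation N := (n.+1%:R : R).

Lemma conj_real (r : R) : 1 < r -> hoelder_conjugate (r%:E) = (r / (r - 1))%:E.
Proof.
move=> r1; rewrite /hoelder_conjugate/= eqe gt_eqF ?(lt_trans ltr01)//.
by rewrite inver subr_eq0 gt_eqF.
Qed.

Lemma conj_ge1 (x : \bar R) : (1 <= x)%E -> (1 <= hoelder_conjugate x)%E.
Proof.
case: x => [r|_|]; [|by rewrite hoelder_conjugatey|by []].
rewrite lee_fin le_eqVlt => /predU1P[<-|r1]; first by rewrite hoelder_conjugate1 leey.
by rewrite conj_real// lee_fin ler_pdivlMr ?subr_gt0//; lra.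
Qed.

Lemma phi_exp_ge0 (x t : \bar R) : (0 <= phi_exponent x t)%E.
Proof.
case: x => [r| |] /=; [exact: poweR_ge0| |by []].
by case: ifPn.
Qed.

Lemma phi_exp_le (x t u : \bar R) : (1 <= x)%E -> (0 <= t)%E -> (t <= u)%E ->
  (phi_exponent x t <= phi_exponent x u)%E.
Proof.
case: x => [r| |]//= r1 t0 tu.
  have r0 : 0 <= r by exact: le_trans ler01 r1.
  by apply: (gt0_ler_poweR r0) => //; rewrite in_itv/= leey ?t0 ?(le_trans t0 tu).
case: ifPn => // t1; first by rewrite (lt_le_trans t1 tu).
by case: ifPn.
Qed.

Lemma phi_exp0 (x : \bar R) : (1 <= x)%E -> phi_exponent x 0 = 0%E.
Proof.
case: x => [r| |]//= r1; first by rewrite powR0// gt_eqF// (lt_le_trans ltr01).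
by rewrite ltNge lee01.
Qed.

Lemma phi_exp_le_id (x : \bar R) (t : R) : (1 <= x)%E -> 0 <= t <= 1 ->
  (phi_exponent x t%:E <= t%:E)%E.
Proof.
case: x => [r| |]//= r1 /andP[t0 t1].
  rewrite lee_fin; have [->|tn] := eqVneq t 0.
    by rewrite powR0// gt_eqF// (lt_le_trans ltr01).
  by apply: ge1r_powR => //; rewrite t1 andbT lt_def tn.
by rewrite lte_fin ltNge t1/= lee_fin.
Qed.

Context (q : Rn -> \bar R).
Hypothesis q1 : forall x, (1 <= q x)%E.

Lemma pnorm_ge0 f : (0 <= pnorm q f)%E. Proof. exact: luxemburg_ge0. Qed.

Lemma pnorm_le (f g : Rn -> \bar R) : (forall x, `|f x| <= `|g x|)%E ->
  (pnorm q f <= pnorm q g)%E.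
Proof.
move=> fg; apply: le_ereal_inf_tmp => _ [l [l0 hl] <-].
apply: ereal_inf_lbound; exists l => //; split => //; apply: le_trans hl.
apply: leintT => x; first exact: phi_exp_ge0.
apply: phi_exp_le => //; first by rewrite mule_ge0// lee_fin invr_ge0 ltW.
by apply: lee_wpmul2r => //; rewrite lee_fin invr_ge0 ltW.
Qed.

Lemma pnormZ_le (c : R) (f : Rn -> \bar R) : 0 < c ->
  (pnorm q (fun x => c%:E * f x) <= c%:E * pnorm q f)%E.
Proof.
move=> c0; rewrite -lee_pdivrMl//; apply: le_ereal_inf_tmp => _ [l [l0 hl] <-].
rewrite lee_pdivrMl//; apply: ereal_inf_lbound; exists (c * l) => //; split.
  by rewrite mulr_gt0.
rewrite (eq_integral (fun x => phi_exponent (q x) (`|f x| * l^-1%:E)%E))// => x _.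
congr phi_exponent; rewrite abseM gee0_abs ?lee_fin ?ltW// invfM EFinM.
rewrite [(c%:E * _)%E]muleC -muleA; congr (_ * _)%E.
by rewrite muleA -!EFinM mulfV ?mul1r// gt_eqF.
Qed.

Lemma pnormZ (c : R) (f : Rn -> \bar R) : 0 < c ->
  (pnorm q (fun x => c%:E * f x) = c%:E * pnorm q f)%E.
Proof.
move=> c0; apply/eqP; rewrite eq_le pnormZ_le//=.
rewrite -lee_pdivlMl//; apply: le_trans (pnormZ_le _ _); last by rewrite invr_gt0.
by apply: pnorm_le => x; rewrite muleA -EFinM mulVf ?gt_eqF// mul1e.
Qed.

(** For arguments at most 1, every [phi_exponent] with exponent at least 1 lies below the identity,
    which makes the bound uniform in the exponent. *)
Lemma pnorm_bounded (f : Rn -> R) (Q : set Rn) (M V : R) : measurable Q -> leb Q = V%:E ->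
  0 < M -> 1 <= V -> (forall x, `|f x| <= M) -> (forall x, ~ Q x -> f x = 0) ->
  (pnorm q (EFin \o f) <= (M * V)%:E)%E.
Proof.
move=> mQ vQ M0 V1 fM f0; have V0 : 0 < V by exact: lt_le_trans V1.
apply: ereal_inf_lbound; exists (M * V) => //; split; first by rewrite mulr_gt0.
apply: (@le_trans _ _ (\int[leb]_(x in Q) (V^-1)%:E)%E); last first.
  by rewrite (integral_leb_cst _ mQ) vQ -EFinM mulVf// gt_eqF.
rewrite [leRHS]integral_mkcond; apply: leintT => x; first exact: phi_exp_ge0.
rewrite patchE; case: ifPn => [_|/negP xQ]; last first.
  by rewrite /= f0 ?normr0 ?mul0e ?phi_exp0// => /mem_set.
have e : 0 <= `|f x| / (M * V) <= V^-1.
  rewrite divr_ge0 ?mulr_ge0 ?(ltW M0) ?(ltW V0)//= ler_pdivrMr ?mulr_gt0//.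
  by rewrite mulrCA mulVf ?gt_eqF// mulr1.
have /andP[e0 e1] := e.
have V11 : V^-1 <= 1 by rewrite invf_le1.
apply: le_trans (phi_exp_le_id (q1 x) (t := `|f x| / (M * V)) _) _; last by rewrite lee_fin.
by rewrite e0 (le_trans e1).
Qed.

Lemma pnorm_indic_pos (Q : set Rn) (V : R) : measurable Q -> leb Q = V%:E -> 0 < V ->
  (0 < pnorm q (EFin \o \1_Q))%E.
Proof.
move=> mQ vQ V0; pose e := Num.min V 1 / 2.
have e0 : 0 < e by rewrite divr_gt0// lt_min V0 ltr01.
have eV : e < V by rewrite /e; case: (leP V 1) => h; lra.
have e1 : e < 1 by rewrite /e; case: (leP V 1) => h; lra.
apply: (@lt_le_trans _ _ e%:E); first by rewrite lte_fin.
apply: luxemburg_ge => l l0 hl; rewrite leNgt; apply/negP => le.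
have l1 : 1 < l^-1 by rewrite invf_gt1// (lt_trans le).
suff : ((l^-1)%:E * leb Q <= 1)%E.
  apply/negP; rewrite -ltNge vQ -EFinM lte_fin.
  by rewrite mulrC ltr_pdivlMr// mul1r (lt_trans le).
apply: le_trans hl; rewrite -(integral_leb_cst _ mQ) integral_mkcond; apply: leintT => x.
  by rewrite patchE; case: ifPn => // _; rewrite lee_fin ltW// (lt_trans ltr01).
rewrite patchE; case: ifPn => [xQ|_]; last exact: phi_exp_ge0.
rewrite /= indicE xQ normr1 mul1e; case: (q x) (q1 x) => [r| |]//= r1.
  by rewrite lee_fin -[leLHS]powRr1 ?(ltW (lt_trans ltr01 l1))//; apply: ler_powR => //; exact: ltW.
by rewrite lte_fin l1 leey.
Qed.

End exponent_norm.

(** * Exponents q for which averages are bounded on L^q *)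

Section exponent_bound.
Context {R : realType} {n : nat}.
Local Notation Rn := (Rn R n.+1).
Local Notation leb := (@lebesgue_Rn R n.+1).
Local Notation N := (n.+1%:R : R).
Context (q : Rn -> \bar R) (MM : (Rn -> R) -> Rn -> \bar R) (C K : R).
Hypotheses (q1 : forall x, (1 <= q x)%E) (C0 : 0 < C) (K0 : 0 < K)
  (MMb : forall f, mfun f -> (pnorm q (EFin \o f) < +oo)%E ->
     (pnorm q (MM f) <= K%:E * pnorm q (EFin \o f))%E)
  (MMge : forall f (a : Rn) (l : R) x, mfun f -> (forall y, 0 <= f y) -> 0 < l -> hcube a l x ->
     (\int[leb]_(y in hcube a l) (f y)%:E <= (C * l ^+ n.+1)%:E * MM f x)%E).

Lemma leb_bigcup_seq (I : eqType) (r : seq I) (F : I -> set Rn) (v : R) : 0 <= v ->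
  (forall i, i \in r -> leb (F i) <= v%:E)%E ->
  (leb (\bigcup_(i in [set` r]) F i) <= ((size r)%:R * v)%:E)%E.
Proof.
move=> v0; elim: r => [|i r IH] H.
  rewrite (_ : \bigcup_(_ in _) _ = set0) ?measure0 ?mul0r//.
  by apply/seteqP; split => // x [].
apply: (@le_trans _ _ (leb (F i `|` \bigcup_(j in [set` r]) F j))).
  apply: leb_le => x [j /=]; rewrite inE => /predU1P[->|jr] xj; first by left.
  by right; exists j.
apply: le_trans (leb_setU _ _) _; rewrite /= -natr1 mulrDl mul1r EFinD [leRHS]addeC; apply: leeD.
  by apply: H; rewrite mem_head.
by apply: IH => j jr; apply: H; rewrite inE jr orbT.
Qed.

(** Pigeonhole over the 2^(j N) dyadic subcubes, with N the dimension; the factor 1/2 makes the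
    contradiction strict. *)
Lemma dense_dyadic (a : Rn) (L : R) (E : set Rn) (v : R) (j : nat) : 0 < L -> 0 < v ->
  (v%:E <= leb (E `&` hcube a L))%E ->
  exists2 c, dyadic a L j c &
    ((v / 2 / (2 ^+ j) ^+ n.+1)%:E <= leb (E `&` hcube c (L / 2 ^+ j)))%E.
Proof.
move=> L0 v0 hv; apply: contrapT => H.
pose corner (z : {ffun 'I_n.+1 -> 'I_(2 ^ j)}) : Rn :=
  \row_i (a ord0 i + (z i : nat)%:R * (L / 2 ^+ j)).
have dz z : dyadic a L j (corner z).
  by exists [ffun i => z i : nat] => i; rewrite ffunE mxE; split.
have w0 : 0 <= v / 2 / (2 ^+ j) ^+ n.+1 by rewrite !divr_ge0 ?exprn_ge0// ltW.
have small z : z \in enum {ffun 'I_n.+1 -> 'I_(2 ^ j)} ->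
    (leb (E `&` hcube (corner z) (L / 2 ^+ j)) <= (v / 2 / (2 ^+ j) ^+ n.+1)%:E)%E.
  move=> _; rewrite leNgt; apply/negP => h; apply: H; exists (corner z) => //; exact: ltW.
have := leb_bigcup_seq w0 small.
rewrite -cardE card_ffun !card_ord natrX natrX [_ * (_ / _)]mulrC divfK; last first.
  by rewrite !expf_neq0.
apply/negP; rewrite -ltNge; apply: (@lt_le_trans _ _ v%:E); first by rewrite lte_fin; lra.
apply: le_trans hv _; apply: leb_le => x [xE xQ].
have [c [[z hz] xc]] := dyadic_exists j L0 xQ.
pose z' : {ffun 'I_n.+1 -> 'I_(2 ^ j)} := [ffun i => Ordinal (hz i).1].
exists z'; first by rewrite /= mem_enum.
split => //; have -> : corner z' = c by apply/rowP => i; rewrite mxE ffunE /= (hz i).2.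
exact: xc.
Qed.

(* For nested dyadic cubes Q_l of side s 2 ^- l, a maximal operator that dominates
   averages increases this function by a factor proportional to the number of levels
   that are dropped, which makes norms of cubes grow geometrically. *)
Definition stack (Qs : nat -> set Rn) (L : nat) (x : Rn) : R :=
  \sum_(l < L.+1) (2 ^+ l) ^+ n.+1 * \1_(Qs l) x.

Lemma stack_ge0 Qs L x : 0 <= stack Qs L x.
Proof. by apply: sumr_ge0 => l _; rewrite mulr_ge0 ?exprn_ge0// indicE. Qed.

Lemma stack_mfun Qs L : (forall l, measurable (Qs l)) -> mfun (stack Qs L).
Proof. by move=> mQ; apply: mfun_sum => l; apply: mfunZ; exact: mfun1. Qed.

(** Only the cubes that contain [x] contribute at [x], and their weights form a geometric sum, at
    most twice its last term. *)
Lemma stack_max Qs L x : (forall l l', (l <= l')%N -> Qs l' `<=` Qs l) -> Qs 0%N x ->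
  exists i, [/\ (i <= L)%N, Qs i x & stack Qs L x <= 2 * (2 ^+ i) ^+ n.+1].
Proof.
move=> nst x0; elim: L => [|L [i [iL xi hi]]].
  exists 0%N; split => //; rewrite /stack big_ord1 expr0 expr1n mul1r mulr1 indicE.
  by rewrite (mem_set (x0 : Qs ord0 x)) ler1n.
rewrite /stack big_ord_recr/= -/(stack Qs L x).
have [xL|xL] := pselect (Qs L.+1 x); last first.
  by exists i; split => //; [exact: leqW|rewrite indicE memNset// mulr0 addr0].
exists L.+1; split => //; rewrite indicE mem_set// mulr1.
have : stack Qs L x <= 2 * (2 ^+ L) ^+ n.+1.
  apply: (le_trans hi); rewrite ler_pM2l//; rewrite lerXn2r ?nnegrE ?exprn_ge0//.
  by rewrite ler_weXn2l// ler1n.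
have : 2 * (2 ^+ L) ^+ n.+1 <= (2 ^+ L.+1) ^+ n.+1 :> R.
  rewrite [2 ^+ L.+1]exprS exprMn; apply: ler_wpM2r; first by rewrite !exprn_ge0.
  by rewrite ler_eXnr ?ler1n.
by lra.
Qed.

(** Every level l from i to L contributes exactly s^N to the integral over [Qs i]. If [Qs i] is the
    cube that [stack_max] gives at [x] for L - k levels, at least k such levels remain, so the
    average of the full stack over it is at least k 2^(i N). *)
Lemma stack_step (c : nat -> Rn) (s : R) (k L : nat) : 0 < s -> (0 < k)%N -> (k <= L)%N ->
  (forall l l', (l <= l')%N ->
     hcube (c l') (s / 2 ^+ l') `<=` hcube (c l) (s / 2 ^+ l)) ->
  let Qs l := hcube (c l) (s / 2 ^+ l) in
  forall x, ((k%:R / 2)%:E * (stack Qs (L - k) x)%:E <= C%:E * MM (stack Qs L) x)%E.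
Proof.
move=> s0 k0 kL nst Qs x.
have sl l : 0 < s / 2 ^+ l by rewrite divr_gt0// exprn_gt0.
have mQ l : measurable (Qs l) by exact: measurable_hcube.
have mS := stack_mfun L mQ.
have MM0 : (0 <= MM (stack Qs L) x)%E.
  have := MMge mS (stack_ge0 Qs L) ltr01 (hcube_corner x ltr01).
  have i0 : (0 <= \int[leb]_(y in hcube x 1) (stack Qs L y)%:E)%E.
    by apply: integral_ge0 => y _; rewrite lee_fin stack_ge0.
  move=> /(le_trans i0); rewrite expr1n mulr1 pmule_rge0// lte_fin//.
have [x0|x0] := pselect (Qs 0%N x); last first.
  rewrite /stack big1 ?mule0 ?mule_ge0 ?lee_fin ?(ltW C0)// => l _.
  by rewrite indicE memNset ?mulr0// => /(nst 0%N l isT).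
have [i [iL xi hi]] := stack_max (L - k) nst x0.
have vi := lebesgue_hcube (c i) (ltW (sl i)).
have stackS m y : stack Qs m.+1 y = stack Qs m y + (2 ^+ m.+1) ^+ n.+1 * \1_(Qs m.+1) y.
  by rewrite /stack big_ord_recr.
have term_int l : (i <= l)%N ->
    (\int[leb]_(y in Qs i) ((2 ^+ l) ^+ n.+1 * \1_(Qs l) y)%:E = (s ^+ n.+1)%:E)%E.
  move=> il; have p0 : 0 <= (2 ^+ l) ^+ n.+1 :> R by rewrite !exprn_ge0.
  rewrite (intZD (mQ i) (mfun1 (mQ l)) p0); last by move=> y; rewrite indicE.
  rewrite (int_indic (mQ i) (mQ l)) (_ : Qs l `&` Qs i = Qs l); last first.
    by rewrite setIidl//; exact: nst.
  by rewrite (lebesgue_hcube _ (ltW (sl l))) -EFinM -exprMn mulrC divfK.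
have key m : ((m.+1%:R * s ^+ n.+1)%:E <= \int[leb]_(y in Qs i) (stack Qs (i + m) y)%:E)%E.
  elim: m => [|m IH].
    rewrite mul1r addn0 -(term_int i (leqnn i)); apply: leint => y _.
      by rewrite lee_fin mulr_ge0 ?exprn_ge0// indicE.
    rewrite lee_fin /stack big_ord_recr/= lerDr; apply: sumr_ge0 => l _.
    by rewrite mulr_ge0 ?exprn_ge0// indicE.
  rewrite addnS (eq_integral (fun y => (stack Qs (i + m) y +
    (2 ^+ (i + m).+1) ^+ n.+1 * \1_(Qs (i + m).+1) y)%:E)); last by move=> y _; rewrite stackS.
  rewrite (intDD (mQ i) (stack_mfun _ mQ) (mfunZ _ (mfun1 (mQ _))) (stack_ge0 Qs _)); last first.
    by move=> y; rewrite mulr_ge0 ?exprn_ge0// indicE.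
  rewrite term_int; last by rewrite leqW// leq_addr.
  by rewrite -natr1 mulrDl mul1r EFinD; apply: leeD.
have sn0 : 0 < s ^+ n.+1 by rewrite exprn_gt0.
have hL : (i + k <= L)%N by move: iL kL; lia.
have lower : ((k%:R * s ^+ n.+1)%:E <= \int[leb]_(y in Qs i) (stack Qs L y)%:E)%E.
  have := key (L - i)%N; rewrite subnKC ?(leq_trans _ hL) ?leq_addr//; apply: le_trans.
  rewrite lee_fin; apply: ler_wpM2r; first exact: ltW.
  by rewrite ler_nat leqW// leq_subRL ?(leq_trans _ hL) ?leq_addr.
have hx := le_trans lower (MMge mS (stack_ge0 Qs L) (sl i) xi).
have p0 : 0 < (2 ^+ i) ^+ n.+1 :> R by rewrite !exprn_gt0.
apply: (@le_trans _ _ (((2 ^+ i) ^+ n.+1 / s ^+ n.+1)%:E * (k%:R * s ^+ n.+1)%:E)%E).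
  rewrite -!EFinM lee_fin; have : k%:R * stack Qs (L - k) x <= k%:R * (2 * (2 ^+ i) ^+ n.+1).
    by rewrite ler_wpM2l.
  have -> : (2 ^+ i) ^+ n.+1 / s ^+ n.+1 * (k%:R * s ^+ n.+1) = k%:R * (2 ^+ i) ^+ n.+1 :> R.
    by rewrite mulrCA divfK// gt_eqF.
  by lra.
have q0 : 0 <= (2 ^+ i) ^+ n.+1 / s ^+ n.+1 by rewrite divr_ge0// ltW.
apply: le_trans (lee_wpmul2l _ hx) _; first by rewrite lee_fin.
rewrite muleA -EFinM expr_div_n mulrCA (_ : _ / _ * (_ / _) = 1) ?mulr1//.
by field; rewrite !gt_eqF// exprn_gt0.
Qed.

(* If p exceeded P on a set of positive measure, then on its intersection with a small
   dyadic cube, of measure f, the norm of the indicator in L^(p') would be at most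
   f `^ (1 - 1 / P); comparing with stack along the cubes that contain it bounds
   2 ^+ k below a smaller power, a contradiction for large k. *)
Lemma conj_bound (p : Rn -> \bar R) : (forall x, q x = hoelder_conjugate (p x)) ->
  (forall x, 1 <= p x)%E -> measurable_fun [set: Rn] p ->
  exists P : R, {ae leb, forall x, (p x <= P%:E)%E}.
Proof.
move=> hq p1 mp.
(* By [stack_step], dropping [k0] levels gains k0 / 2 >= 2 C K, so the norms of stacks at least
   double every [k0] levels. *)
pose k0 := (Num.bound (4 * C * K)).+1.
have k01 : 4 * C * K <= k0%:R.
  have h : 0 <= 4 * C * K by rewrite !mulr_ge0 ?(ltW C0) ?(ltW K0).
  by apply: le_trans (ltW (archi_boundP h)) _; rewrite ler_nat leqW.
have k00 : 0 < k0%:R :> R by rewrite ltr0n.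
(* With this exponent (2^k)^Pn is the square of the volume ratio 2^(k k0 N) after k k0 levels,
   whereas [key] bounds it by a multiple of the ratio itself. A natural exponent allows ordinary
   powers. *)
pose Pn := (2 * k0 * n.+1)%N; pose P : R := Pn%:R.
have P1 : 1 < P by rewrite ltr1n /Pn; lia.
have P0 : 0 < P by exact: lt_trans P1.
exists P; pose E : set Rn := [set x | (P%:E < p x)%E].
have mE : measurable E.
  rewrite /E -[X in measurable X]setTI; exact: (emeasurable_fun_o_infty measurableT mp).
suff E0 : leb E = 0%E by exists E; split => // x /= /negP; rewrite -ltNge.
apply: contrapT => Epos.
have {}Epos : (0 < leb E)%E by rewrite lt0e leb_ge0 andbT; apply/eqP.
have : (0 < leb (\bigcup_j (E `&` hcube (- const_mx j.+1%:R)%R (2 * j.+1%:R)%R)))%E.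
  apply: (lt_le_trans Epos); apply: leb_le => x Ex.
  exists (Num.bound (enorm x)) => //; split => // i; rewrite !mxE.
  have h := archi_boundP (enorm_ge0 x).
  have h1 : (Num.bound (enorm x))%:R <= (Num.bound (enorm x)).+1%:R :> R by rewrite ler_nat.
  have := enorm_ge x i; rewrite ler_norml => /andP[h2 h3].
  by apply/andP; split; lra.
move=> /leb_bigcup_pos [j hj].
set a : Rn := - const_mx j.+1%:R in hj; set s : R := 2 * j.+1%:R in hj.
have s0 : 0 < s by rewrite mulr_gt0.
have sn0 : 0 < s ^+ n.+1 by rewrite exprn_gt0.
have [v v0 hv] : exists2 v : R, 0 < v & (v%:E <= leb (E `&` hcube a s))%E.
  case: (leb _) hj => [r| |]; rewrite ?lte_fin.
  - by exists r.
  - by exists 1 => //; rewrite leey.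
  - by [].
set b0 := pnorm q (EFin \o \1_(hcube a s)).
have mQ0 := measurable_hcube a s; have vQ0 := lebesgue_hcube a (ltW s0).
have b0pos : (0 < b0)%E := pnorm_indic_pos q1 mQ0 vQ0 sn0.
have [x0 x00 hx0] : exists2 x0 : R, 0 < x0 & (x0%:E <= b0)%E.
  case: b0 b0pos => [r| |]; rewrite ?lte_fin.
  - by exists r.
  - by exists 1 => //; rewrite leey.
  - by [].
pose B := 2 * C * K * s ^+ n.+1.
have B0 : 0 < B by rewrite /B !mulr_gt0.
have key (k : nat) : s <= 2 ^+ (k * k0) ->
    x0 ^+ Pn * (2 ^+ k) ^+ Pn <= B ^+ Pn * (2 / v) * (2 ^+ (k * k0)) ^+ n.+1.
  move=> hs; set jj := (k * k0)%N.
  have p2 l : 0 < 2 ^+ l :> R by rewrite exprn_gt0.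
  have sl l : 0 < s / 2 ^+ l by rewrite divr_gt0.
  have [cj dj hF] := dense_dyadic jj s0 v0 hv.
  (* The chain of ancestors of the dense cube, continued below level [jj] by its own corner so that
     the cubes are nested for all indices. *)
  have [c Hc] : exists c : nat -> Rn, forall l, if (l < jj)%N then dyadic a s l (c l) /\
      hcube cj (s / 2 ^+ jj) `<=` hcube (c l) (s / 2 ^+ l) else c l = cj.
    suff /choice[c Hc] : forall l, exists c', if (l < jj)%N then dyadic a s l c' /\
      hcube cj (s / 2 ^+ jj) `<=` hcube c' (s / 2 ^+ l) else c' = cj by exists c.
    move=> l; case: ltnP => ljj; last by exists cj.
    by have [c' h1 h2] := dyadic_ancestor s0 (ltnW ljj) dj; exists c'.
  have nst l l' : (l <= l')%N -> hcube (c l') (s / 2 ^+ l') `<=` hcube (c l) (s / 2 ^+ l).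
    move=> ll; have := Hc l'; have := Hc l; case: (ltnP l jj) => [ljj [d1 s1]|jl ->].
      case: (ltnP l' jj) => [l'jj [d2 s2]|jl' ->].
        apply: (dyadic_nested (x := cj) s0 ll d1 d2); [apply: s1|apply: s2]; exact: hcube_corner.
      apply: subset_trans s1; apply: hcubeS => // i; rewrite lerD2l ler_pM2l// lef_pV2 ?posrE//.
      by rewrite ler_weXn2l// ler1n.
    rewrite ltnNge (leq_trans jl ll)/= => ->; apply: hcubeS => // i.
    rewrite lerD2l ler_pM2l// lef_pV2 ?posrE//.
    by rewrite ler_weXn2l// ler1n.
  pose Qs l := hcube (c l) (s / 2 ^+ l).
  have cjj : c jj = cj by have := Hc jj; rewrite ltnn.
  have c0 : hcube (c 0%N) (s / 2 ^+ 0) = hcube a s.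
    rewrite expr0 divr1; congr hcube; have := Hc 0%N; case: ltnP => [_ [[z hz] _]|j0 ->].
      apply/rowP => i; have [z1 ->] := hz i.
      by move: z1; rewrite expn0 ltnS leqn0 => /eqP ->; rewrite mul0r addr0.
    have jj0 : jj = 0%N by apply/eqP; rewrite -leqn0.
    case: dj => z hz; apply/rowP => i; have [z1 ->] := hz i.
    by move: z1; rewrite jj0 expn0 ltnS leqn0 => /eqP ->; rewrite mul0r addr0.
  have mQs l : measurable (Qs l) by exact: measurable_hcube.
  pose X l := pnorm q (EFin \o stack Qs l).
  have Xfin l : (X l < +oo)%E.
    pose M : R := \sum_(i < l.+1) (2 ^+ i) ^+ n.+1.
    have M0 : 0 < M.
      rewrite /M big_ord_recl/= expr0 expr1n ltr_wpDr//; apply: sumr_ge0 => i _.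
      by rewrite !exprn_ge0.
    pose V := s ^+ n.+1 + 1.
    have QsQ i : Qs i `<=` cube a (s + 1).
      move=> x xi; have : hcube a s x by rewrite -c0; exact: (nst 0%N i).
      by move=> h u; have /andP[h1 h2] := h u; rewrite h1/=; lra.
    have s10 : 0 <= s + 1 by rewrite addr_ge0// ltW.
    have V1 : 1 <= (s + 1) ^+ n.+1 by rewrite exprn_ege1// lerDr ltW.
    apply: le_lt_trans (pnorm_bounded q1 (measurable_cube a _) (lebesgue_cube a s10) M0 V1 _ _) _.
    - move=> x; rewrite ger0_norm ?stack_ge0//; apply: ler_sum => i _.
      by rewrite ler_piMr ?exprn_ge0// indicE; case: (_ \in _).
    - move=> x xc; rewrite /stack big1// => i _; rewrite indicE memNset ?mulr0//.
      by move=> /QsQ.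
    - by rewrite ltry.
  have Xstep l : (k0 <= l)%N -> (2%:E * X (l - k0)%N <= X l)%E.
    move=> kl; have k00' : 0 < k0%:R / 2 :> R by rewrite divr_gt0.
    have h1 : ((k0%:R / 2)%:E * X (l - k0)%N <= C%:E * (K%:E * X l))%E.
      rewrite /X -(pnormZ q1 _ k00').
      apply: (@le_trans _ _ (pnorm q (fun x => C%:E * MM (stack Qs l) x)%E)).
        apply: pnorm_le => // x.
        have hs' := stack_step s0 (ltn0Sn _ : (0 < k0)%N) kl nst x.
        have e0 : (0 <= (k0%:R / 2)%:E * (stack Qs (l - k0) x)%:E)%E.
          by rewrite mule_ge0// lee_fin ?stack_ge0// ltW.
        rewrite gee0_abs// gee0_abs; first exact: hs'.
        exact: le_trans e0 hs'.
      rewrite (pnormZ q1 _ C0); apply: lee_wpmul2l; first by rewrite lee_fin ltW.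
      by apply: MMb; [exact: stack_mfun|exact: Xfin].
    have CK0 : 0 < C * K by rewrite mulr_gt0.
    rewrite -(@lee_pmul2l _ (C * K)%:E)//; rewrite muleA in h1.
    apply: le_trans h1; rewrite muleA -EFinM; apply: lee_wpmul2r; first exact: pnorm_ge0.
    by rewrite lee_fin; lra.
  have Xiter i : (i <= k)%N -> ((2 ^+ i)%:E * X 0%N <= X (i * k0)%N)%E.
    elim: i => [|i IH] ik; first by rewrite expr0 mul1e mul0n.
    have h := Xstep (i.+1 * k0)%N (ltac:(by rewrite mulSn leq_addr)).
    rewrite mulSn addKn in h; rewrite mulSn; apply: le_trans h.
    rewrite exprS EFinM -muleA; apply: lee_wpmul2l; first by rewrite lee_fin.
    by apply: IH; exact: ltnW.
  have X0E : (x0%:E <= X 0%N)%E.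
    apply: le_trans hx0 _; apply: pnorm_le => // x /=.
    by rewrite /stack big_ord1 expr0 expr1n mul1r /Qs c0.
  set F := E `&` hcube cj (s / 2 ^+ jj) in hF.
  have mF : measurable F by apply: measurableI => //; exact: measurable_hcube.
  have vP := lebesgue_hcube cj (ltW (sl jj)).
  have Fle : (leb F <= ((s / 2 ^+ jj) ^+ n.+1)%:E)%E by rewrite -vP; apply: leb_le => x [].
  have w0 : 0 < v / 2 / (2 ^+ jj) ^+ n.+1 by rewrite !divr_gt0 ?exprn_gt0.
  have [f f0 fE] : exists2 f : R, 0 < f & leb F = f%:E.
    apply: pos_real; first by apply: lt_le_trans hF; rewrite lte_fin.
    by apply: le_lt_trans Fle _; rewrite ltry.
  rewrite fE !lee_fin in hF Fle.
  have f1 : f <= 1.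
    by apply: (le_trans Fle); rewrite exprn_ile1// ?(ltW (sl _))// ler_pdivrMr// mul1r.
  pose lam := f `^ (1 - P^-1).
  have lam0 : 0 < lam by rewrite powR_gt0.
  have normF : (pnorm q (EFin \o \1_F) <= lam%:E)%E.
    apply: ereal_inf_lbound; exists lam => //; split => //.
    apply: (@le_trans _ _ (\int[leb]_(x in F) (f^-1)%:E)%E); last first.
      by rewrite (integral_leb_cst _ mF) fE -EFinM mulVf// gt_eqF.
    rewrite [leRHS]integral_mkcond; apply: leintT => x; first exact: phi_exp_ge0.
    rewrite patchE; case: ifPn => [xF|xF]; last first.
      by rewrite /= indicE (negbTE xF) normr0 mul0e phi_exp0.
    have [Ex _] := set_mem xF.
    rewrite /= indicE xF normr1 mul1e.
    have lamV : lam^-1 = f `^ (- (1 - P^-1)) by rewrite powRN.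
    have lam1 : 1 <= lam^-1.
      rewrite invf_ge1//; rewrite -[leRHS](powRr0 f); apply: ger_powR; first by rewrite f0.
      by rewrite subr_ge0 invf_le1// ltW.
    have [r rE rP] : exists2 r : R, q x = r%:E & r <= P / (P - 1).
      move: Ex; rewrite /E /= hq; case: (p x) => [r| |]//; last first.
        rewrite hoelder_conjugatey => _; exists 1 => //.
        by rewrite ler_pdivlMr ?subr_gt0// mul1r; lra.
      rewrite lte_fin => rP; have r1 := lt_trans P1 rP.
      rewrite conj_real//; exists (r / (r - 1)) => //.
      rewrite ler_pdivrMr ?subr_gt0// mulrAC ler_pdivlMr ?subr_gt0//.
      by nra.
    rewrite rE /= lee_fin; apply: le_trans (ler_powR lam1 rP) _.
    rewrite lamV -powRrM (_ : _ * _ = -1) ?powR_inv1 ?(ltW f0)//.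
    by field; rewrite subr_eq0 !gt_eqF.
  have i1fin : (pnorm q (EFin \o \1_F) < +oo)%E by apply: le_lt_trans normF _; rewrite ltry.
  (* Every cube of the chain up to level [jj] contains [F], so its average of the indicator is f
     over its volume; by [stack_max] the largest of these at a point dominates a multiple of the
     stack. *)
  have start : ((f / (2 * C * s ^+ n.+1))%:E * X jj <= K%:E * lam%:E)%E.
    have e0 : 0 < f / (2 * C * s ^+ n.+1) by rewrite divr_gt0// !mulr_gt0.
    rewrite /X -(pnormZ q1 _ e0); apply: (@le_trans _ _ (pnorm q (MM \1_F))); last first.
      apply: (le_trans (MMb (mfun1 mF) i1fin)); apply: lee_wpmul2l => //.
      by rewrite lee_fin ltW.
    apply: pnorm_le => // x.
    have ind0 y : 0 <= \1_F y :> R by rewrite indicE.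
    have MM0 : (0 <= MM \1_F x)%E.
      have := MMge (mfun1 mF) ind0 ltr01 (hcube_corner x ltr01).
      have i0 : (0 <= \int[leb]_(y in hcube x 1) (\1_F y)%:E)%E.
        by apply: integral_ge0 => y _; rewrite lee_fin.
      by move=> /(le_trans i0); rewrite expr1n mulr1 pmule_rge0// lte_fin.
    rewrite gee0_abs; last by rewrite mule_ge0 ?lee_fin ?stack_ge0// ltW.
    rewrite gee0_abs//; have [xQ|xQ] := pselect (Qs 0%N x); last first.
      rewrite /= /stack big1 ?mule0// => l _.
      by rewrite indicE memNset ?mulr0// => /(nst 0%N l isT).
    have [i [ij xi hi]] := stack_max jj nst xQ.
    have hm := MMge (mfun1 mF) ind0 (sl i) xi.
    rewrite (int_indic (measurable_hcube _ _) mF) in hm.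
    have FI : F `&` Qs i = F.
      rewrite setIidl//; apply: subset_trans (nst i jj ij); rewrite cjj; exact: subIsetr.
    rewrite -/(Qs i) FI fE in hm.
    have t0 : 0 < C * (s / 2 ^+ i) ^+ n.+1 by rewrite mulr_gt0 ?exprn_gt0.
    rewrite -lee_pdivrMl// in hm; apply: le_trans hm.
    rewrite -!EFinM lee_fin; apply: le_trans (ler_wpM2l (ltW e0) hi) _.
    rewrite le_eqVlt; apply/orP; left; apply/eqP.
    by rewrite expr_div_n; field; rewrite !expf_neq0 ?gt_eqF.
  (* [lam] equals f times [mu], and the power [Pn] of [mu] is 1 / f, which the choice of a dense
     cube bounds by a multiple of 2^(jj N). *)
  pose mu := f `^ (- P^-1).
  have mu0 : 0 < mu by rewrite powR_gt0.
  have muE : mu ^+ Pn = f^-1.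
    rewrite -powR_mulrn ?powR_ge0// -powRrM mulNr mulVf ?gt_eqF//.
    by rewrite powR_inv1// ltW.
  have lamE : lam = f * mu.
    rewrite /lam /mu powRD; last by rewrite (gt_eqF f0) implybT.
    by rewrite powRr1// ltW.
  have e0 : 0 < f / (2 * C * s ^+ n.+1) by rewrite divr_gt0// !mulr_gt0.
  have Xj : (X jj <= (B * mu)%:E)%E.
    rewrite -(@lee_pmul2l _ (f / (2 * C * s ^+ n.+1))%:E)//; apply: (le_trans start).
    rewrite -!EFinM lee_fin lamE le_eqVlt; apply/orP; left; apply/eqP.
    by rewrite /B; field; rewrite expf_neq0 ?gt_eqF.
  have fin1 : x0 * 2 ^+ k <= B * mu.
    rewrite -lee_fin; apply: le_trans Xj; apply: le_trans (Xiter k (leqnn k)).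
    by rewrite mulrC EFinM; apply: lee_wpmul2l => //; rewrite lee_fin ltW.
  rewrite -exprMn; apply: (@le_trans _ _ ((B * mu) ^+ Pn)).
    by rewrite lerXn2r ?nnegrE// mulr_ge0 ?exprn_ge0// ltW.
  rewrite exprMn muE -mulrA; apply: ler_wpM2l; first by rewrite exprn_ge0// ltW.
  rewrite -[leRHS]invrK lef_pV2 ?posrE//; last by rewrite invr_gt0 mulr_gt0 ?divr_gt0 ?exprn_gt0.
  apply: le_trans hF; rewrite le_eqVlt; apply/orP; left; apply/eqP.
  by rewrite -/jj; field; rewrite !expf_neq0 ?gt_eqF.
pose B' := B ^+ Pn * (2 / v).
have B'0 : 0 < B' by rewrite mulr_gt0 ?exprn_gt0 ?divr_gt0.
pose kk := maxn (Num.bound s) (Num.bound (B' / x0 ^+ Pn)).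
have x0P : 0 < x0 ^+ Pn by rewrite exprn_gt0.
have two_ge (k : nat) : k%:R <= 2 ^+ k :> R by rewrite -natrX ler_nat ltnW// ltn_expl.
have hkk : s <= 2 ^+ (kk * k0).
  apply: le_trans (ltW (archi_boundP (ltW s0))) _.
  apply: le_trans (two_ge _); rewrite ler_nat (leq_trans (leq_maxl _ (Num.bound (B' / x0 ^+ Pn))))//.
  by rewrite leq_pmulr.
have := key kk hkk; rewrite -/B'.
have -> : (2 ^+ kk) ^+ Pn = (2 ^+ (kk * k0)) ^+ n.+1 * (2 ^+ (kk * k0)) ^+ n.+1 :> R.
  by rewrite -!exprM -exprD; congr (_ ^+ _); rewrite /Pn -mulnDr addnn -mul2n !mulnA;
    congr (_ * _)%N; rewrite -!mulnA; congr (_ * _)%N; rewrite mulnC.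
rewrite mulrA ler_pM2r; last by rewrite !exprn_gt0.
apply/negP; rewrite -ltNge mulrC -ltr_pdivrMr//.
have h0 : 0 <= B' / x0 ^+ Pn by rewrite divr_ge0// ltW.
apply: (lt_le_trans (archi_boundP h0)).
rewrite -exprM; apply: le_trans (two_ge _); rewrite ler_nat.
apply: (leq_trans (leq_maxr (Num.bound s) _)); rewrite -mulnA leq_pmulr//.
Qed.

End exponent_bound.

(** * Hoelder inequality and duality for bounded exponents *)

Section variable_holder.
Context {R : realType} {n : nat}.
Local Notation Rn := (Rn R n.+1).
Local Notation leb := (@lebesgue_Rn R n.+1).

Lemma young_exp (r a b : R) : 1 <= r -> 0 <= a -> 0 <= b ->
  ((a * b)%:E <= (a `^ r)%:E + phi_exponent (hoelder_conjugate r%:E) b%:E)%E.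
Proof.
move=> r1 a0 b0; move: r1; rewrite le_eqVlt => /predU1P[<-|r1].
  rewrite hoelder_conjugate1 powRr1//=; case: ifPn => [_|]; first by rewrite addey ?leey.
  by rewrite -leNgt lee_fin => b1; rewrite adde0 lee_fin ler_piMr.
rewrite conj_real//= -EFinD lee_fin.
have r0 : 0 < r by lra.
have q0 : 0 < r / (r - 1) by rewrite divr_gt0// subr_gt0.
have e1 : r^-1 + (r / (r - 1))^-1 = 1.
  by field; rewrite subr_eq0 !gt_eqF.
apply: le_trans (conjugate_powR a0 b0 r0 q0 e1) _; apply: lerD.
  by rewrite ler_pdivrMr// ler_peMr ?powR_ge0// ltW.
rewrite ler_pdivrMr// ler_peMr ?powR_ge0//.
by rewrite ler_pdivlMr ?subr_gt0//; lra.
Qed.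

Lemma mfun_powR (a r : Rn -> R) : mfun a -> mfun r -> mfun (fun x => a x `^ r x).
Proof.
move=> ma mr; rewrite /mfun /powR; apply: measurable_fun_ifT.
- by apply: measurable_fun_eqr => //; exact: mfun_cst.
- have mz : measurable_fun [set: R] (fun t : R => (t == 0)%:R : R); last exact: (mfun_comp mz mr).
  rewrite (_ : (fun _ => _) = \1_[set 0 : R]); first by apply: measurable_indic.
  apply/funext => t; rewrite indicE; case: (eqVneq t 0) => [->|t0]; first by rewrite mem_set.
  by rewrite memNset//; exact/eqP.
- apply: (mfun_comp (@measurable_expR R)); apply: mfunM => //.
  by apply: (mfun_comp (@measurable_ln R)).
Qed.

Lemma int_infty_null (F : Rn -> \bar R) (Z : set Rn) (v : R) : measurable Z ->
  (forall x, 0 <= F x)%E -> (forall x, Z x -> F x = +oo%E) ->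
  (\int[leb]_x F x <= v%:E)%E -> leb Z = 0%E.
Proof.
move=> mZ F0 FZ hF; apply/eqP; rewrite eq_le leb_ge0 andbT.
apply/lee_addgt0Pr => e e0; rewrite add0e.
have M0 : 0 < Num.max 1 v / e by rewrite divr_gt0// lt_max ltr01.
rewrite -(lee_pmul2l _ (_ : 0 < (Num.max 1 v / e)%:E)%E)//.
rewrite -(integral_leb_cst _ mZ) -EFinM divfK ?gt_eqF//.
apply: (@le_trans _ _ v%:E); last by rewrite lee_fin le_max lexx orbT.
apply: le_trans hF; rewrite integral_mkcond; apply: leintT => x.
  by rewrite patchE; case: ifPn => // _; rewrite lee_fin ltW.
by rewrite patchE; case: ifPn => // /set_mem /FZ ->; rewrite leey.
Qed.

Lemma pnorm_fin_ae (q F : Rn -> \bar R) : (forall x, 1 <= q x)%E ->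
  measurable_fun [set: Rn] F -> (forall x, 0 <= F x)%E -> (pnorm q F < +oo)%E ->
  {ae leb, forall x, F x = (fine (F x))%:E}.
Proof.
move=> q1 mF F0 nF.
have [l l0 hl] : exists2 l : R, 0 < l &
    (\int[leb]_x phi_exponent (q x) (`|F x| * l^-1%:E) <= 1)%E.
  have n0 : (0 <= pnorm q F)%E by exact: pnorm_ge0.
  have [t tE] : exists t : R, pnorm q F = t%:E.
    by exists (fine (pnorm q F)); rewrite fineK// ge0_fin_numE.
  have /luxemburg_lt[l [l0 _ h]] : (pnorm q F < (t + 1)%:E)%E by rewrite tE lte_fin; lra.
  by exists l.
pose Z := [set x : Rn | F x = +oo%E].
have mZ : measurable Z.
  rewrite (_ : Z = setT `&` F @^-1` [set +oo%E]); last by rewrite setTI.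
  by apply: mF => //; exact: emeasurable_set1.
exists Z; split=> //.
  apply: (int_infty_null mZ _ _ hl) => [x|x Zx]; first exact: phi_exp_ge0.
  rewrite Zx gee0_abs ?leey// gt0_mulye ?lte_fin ?invr_gt0//.
  move: (q1 x); case: (q x) => [r| |]//= r1; last by rewrite ltry.
  by rewrite gt_eqF// (lt_le_trans ltr01).
move=> x /= hx; apply: contrapT => nZ; apply: hx; rewrite fineK// ge0_fin_numE//.
by rewrite ltey; apply/eqP.
Qed.

Section bounded_exponent.
Variables (pr : Rn -> R) (P : R).
Hypotheses (pr1 : forall x, 1 <= pr x) (prP : forall x, pr x <= P) (mpr : mfun pr).
Let p x := (pr x)%:E.
Let q x := hoelder_conjugate (p x).
Let p1 x : (1 <= p x)%E. Proof. by rewrite lee_fin. Qed.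
Let q1 x : (1 <= q x)%E. Proof. exact: conj_ge1. Qed.

Lemma holder_exp_real (F G : Rn -> R) (l l' : R) : mfun F -> mfun G ->
  (forall x, 0 <= F x) -> (forall x, 0 <= G x) -> 0 < l -> 0 < l' ->
  (\int[leb]_x phi_exponent (p x) (`|(F x)%:E| * l^-1%:E) <= 1)%E ->
  (\int[leb]_x phi_exponent (q x) (`|(G x)%:E| * l'^-1%:E) <= 1)%E ->
  (\int[leb]_x (F x * G x)%:E <= (2 * l * l')%:E)%E.
Proof.
move=> mF mG F0 G0 l0 l'0 h1 h2.
have ll : 0 < (l * l')^-1 by rewrite invr_gt0 mulr_gt0.
have mf : mfun (fun x => (l^-1 * F x) `^ pr x) by apply: mfun_powR => //; exact: mfunZ.
have mk : mfun (fun x => (l * l')^-1 * (F x * G x)) by apply: mfunZ; exact: mfunM.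
have := int_add_le mf mk (fun x => powR_ge0 _ _)
  (fun x => phi_exp_ge0 (q x) (`|(G x)%:E| * l'^-1%:E)%E) _ _.
have FG0 x : 0 <= F x * G x by exact: mulr_ge0.
have -> : (\int[leb]_x ((l * l')^-1 * (F x * G x))%:E = (l * l')^-1%:E * \int[leb]_x (F x * G x)%:E)%E.
  exact: (intZ (mfunE (mfunM mF mG)) (ltW ll) (fun x => FG0 x)).
move=> H; rewrite -(lee_pmul2l _ (_ : 0 < (l * l')^-1%:E)%E)//.
rewrite -EFinM (_ : _^-1 * _ = 1 + 1); last by field; rewrite !gt_eqF.
rewrite EFinD; apply: le_trans (leeD (le_trans _ h1) h2).
  apply: H => x; first by rewrite mulr_ge0// ltW.
  rewrite gee0_abs ?lee_fin// -EFinM.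
  have := @young_exp (pr x) (l^-1 * F x) (G x / l') (pr1 x) _ _.
  rewrite (_ : l^-1 * F x * (G x / l') = (l * l')^-1 * (F x * G x)); last by rewrite invfM; ring.
  by apply; rewrite mulr_ge0// invr_ge0 ltW.
apply: leintT => x; first by rewrite lee_fin powR_ge0.
by rewrite gee0_abs ?lee_fin//= mulrC.
Qed.

(** Extended values are allowed because [F] and [G] will be maximal functions; finite norms make
    them real almost everywhere. *)
Lemma holder_exp (F G : Rn -> \bar R) : measurable_fun [set: Rn] F -> measurable_fun [set: Rn] G ->
  (forall x, 0 <= F x)%E -> (forall x, 0 <= G x)%E -> (pnorm p F < +oo)%E -> (pnorm q G < +oo)%E ->
  (\int[leb]_x (F x * G x) <= 2%:E * (pnorm p F * pnorm q G))%E.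
Proof.
move=> mF mG F0 G0 nF nG.
have aF := pnorm_fin_ae p1 mF F0 nF; have aG := pnorm_fin_ae q1 mG G0 nG.
have fF0 x : 0 <= fine (F x) by exact: fine_ge0.
have fG0 x : 0 <= fine (G x) by exact: fine_ge0.
have mfF : mfun (fun x => fine (F x)).
  by apply: (measurableT_comp (fine_measurable _)).
have mfG : mfun (fun x => fine (G x)).
  by apply: (measurableT_comp (fine_measurable _)).
have fin (q' H : Rn -> \bar R) : (forall x, 1 <= q' x)%E -> (pnorm q' H < +oo)%E ->
    exists2 t : R, 0 <= t & pnorm q' H = t%:E.
  move=> q'1 h; exists (fine (pnorm q' H)); first by rewrite fine_ge0// pnorm_ge0.
  by rewrite fineK// ge0_fin_numE// pnorm_ge0.
have [s s0 sE] := fin p F p1 nF; have [t t0 tE] := fin q G q1 nG.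
rewrite sE tE -!EFinM.
have main l l' : s < l -> t < l' -> (\int[leb]_x (F x * G x) <= (2 * l * l')%:E)%E.
  move=> sl tl.
  have /luxemburg_lt[k [k0 kl hk]] : (pnorm p F < l%:E)%E by rewrite sE lte_fin.
  have /luxemburg_lt[k' [k'0 kl' hk']] : (pnorm q G < l'%:E)%E by rewrite tE lte_fin.
  apply: (@le_trans _ _ (2 * k * k')%:E); last first.
    by rewrite lee_fin -!mulrA ler_wpM2l// ler_pM// ltW.
  apply: (@le_trans _ _ (\int[leb]_x (fine (F x) * fine (G x))%:E)%E).
    apply: ae_le_int => [x|x|]; [exact: mule_ge0|by rewrite lee_fin mulr_ge0|].
    by apply: ae_mono2 aF aG _ => x {1}-> {1}->; rewrite -EFinM.
  apply: (holder_exp_real mfF mfG) => //.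
    apply: le_trans hk; apply: ae_le_int => [x|x|]; try exact: phi_exp_ge0.
    by apply: ae_mono aF _ => x <-.
  apply: le_trans hk'; apply: ae_le_int => [x|x|]; try exact: phi_exp_ge0.
  by apply: ae_mono aG _ => x <-.
have i0 : (0 <= \int[leb]_x (F x * G x))%E by apply: integral_ge0 => x _; exact: mule_ge0.
have [X XE] : exists X : R, (\int[leb]_x (F x * G x))%E = X%:E.
  exists (fine (\int[leb]_x (F x * G x))%E); rewrite fineK// ge0_fin_numE//.
  by apply: le_lt_trans (main (s + 1) (t + 1) _ _) _; rewrite ?ltry//; lra.
rewrite XE lee_fin mulrA; apply: mul_inf_le; first by rewrite mulr_ge0.
move=> l' tl'; have l'0 : 0 < l' by exact: le_lt_trans tl'.
rewrite mulrAC; apply: mul_inf_le; first by rewrite mulr_ge0// ltW.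
by move=> l sl; rewrite mulrAC -lee_fin -XE; exact: main.
Qed.

(* The test functions are (F / lam) `^ (p - 1) on D k; where p = 1 they are the indicator
   of D k, even at the zeros of F, since 0 `^ 0 = 1. *)
Lemma dual_exp (F : Rn -> R) (D : nat -> set Rn) (c : R) : mfun F -> (forall x, 0 <= F x) -> 0 <= c ->
  (forall k, measurable (D k)) -> (forall j k, (j <= k)%N -> D j `<=` D k) ->
  (forall x, exists k, D k x) -> (forall k x, D k x -> F x <= k%:R) ->
  (forall k, exists a l, 1 <= l /\ D k `<=` hcube a l) ->
  (forall k g, mfun g -> (forall x, 0 <= g x) -> (exists M, forall x, g x <= M) ->
    (forall x, ~ D k x -> g x = 0) -> (pnorm q (EFin \o g) < +oo)%E ->
    (\int[leb]_x (F x * g x)%:E <= c%:E * pnorm q (EFin \o g))%E) ->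
  (pnorm p (EFin \o F) <= c%:E)%E.
Proof.
move=> mF F0 c0 mD Dle Dall DF Dcube H; apply/lee_addgt0Pr => e e0; rewrite -EFinD.
have lam0 : 0 < c + e by lra.
set lam := c + e in lam0 *.
have cl : c < lam by rewrite /lam; lra.
pose a x := F x / lam.
have a0 x : 0 <= a x by rewrite divr_ge0// ltW.
have ma : mfun a by rewrite /a; under eq_fun do rewrite mulrC; exact: mfunZ.
pose h x := a x `^ pr x.
have mh : mfun h by exact: mfun_powR.
have h0 x : 0 <= h x by exact: powR_ge0.
have mhk k : mfun (fun x => \1_(D k) x * h x) by apply: mfunM => //; exact: mfun1.
have hk0 k x : 0 <= \1_(D k) x * h x by rewrite mulr_ge0// indicE.
apply: ereal_inf_lbound; exists lam => //; split => //.
rewrite [leLHS](_ : _ = \int[leb]_x (h x)%:E)%E; last first.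
  by apply: eq_integral => x _; rewrite /= ger0_norm.
suff fin k : (\int[leb]_x (\1_(D k) x * h x)%:E <= 1)%E.
  have hom x : {homo (fun k => (\1_(D k) x * h x)%:E) : j k / (j <= k)%N >-> (j <= k)%E}.
    move=> j k jk; rewrite lee_fin ler_wpM2r// !indicE.
    by case: (boolP (x \in D j)) => // /set_mem /(Dle _ _ jk) /mem_set ->.
  have := @cvg_monotone_convergence _ _ _ leb _ measurableT
    (fun k x => (\1_(D k) x * h x)%:E) (fun k => mfunE (mhk k)) (fun k x _ => hk0 k x)
    (fun x _ => hom x).
  have limE x : limn (fun k => (\1_(D k) x * h x)%:E) = (h x)%:E.
    apply/cvg_lim => //; have [k0 Dk] := Dall x; apply: cvg_near_cst.
    exists k0 => // k /= kk; rewrite indicE mem_set ?mul1r//.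
    by exact: Dle kk _ Dk.
  rewrite (eq_integral _ _ (fun x _ => limE x)) => cv.
  by apply: (cvge_to_le cv); near=> k; exact: fin.
rewrite leNgt; apply/negP => gt1.
have m0 : Num.max 1 (k%:R / lam) \is Num.nneg by rewrite nnegrE le_max ler01.
have aM x : D k x -> a x <= Num.max 1 (k%:R / lam).
  by move=> Dx; rewrite le_max ler_pM2r ?invr_gt0// DF// orbT.
have [r rE] : exists r : R, (\int[leb]_x (\1_(D k) x * h x)%:E)%E = r%:E.
  have [cc [l [l1 Dl]]] := Dcube k.
  pose B := Num.max 1 (k%:R / lam) `^ P.
  have B0 : 0 <= B by exact: powR_ge0.
  exists (fine (\int[leb]_x (\1_(D k) x * h x)%:E)%E); rewrite fineK// ge0_fin_numE; last first.
    by apply: integral_ge0 => x _; rewrite lee_fin.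
  apply: (@le_lt_trans _ _ (B%:E * leb (hcube cc l))%E); last first.
    rewrite lebesgue_hcube ?(le_trans ler01)// -EFinM ltry//.
  rewrite -integral_leb_cst; last exact: measurable_hcube.
  rewrite [leRHS]integral_mkcond; apply: leintT => x; first by rewrite lee_fin.
  rewrite patchE indicE; case: (boolP (x \in D k)) => [xD|xD]; last first.
    by rewrite mul0r; case: ifPn.
  have Dx := set_mem xD; rewrite mem_set; last exact: Dl.
  rewrite mul1r lee_fin; apply: (@le_trans _ _ (Num.max 1 (k%:R / lam) `^ pr x)).
    apply: ge0_ler_powR; [exact: le_trans (pr1 x)|exact: a0|exact: m0|exact: aM Dx].
  by apply: ler_powR => //; rewrite le_max lexx.
rewrite rE lte_fin in gt1.
have r0 : 0 < r by exact: lt_trans gt1.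
pose g x := \1_(D k) x * a x `^ (pr x - 1).
have g0 x : 0 <= g x by rewrite mulr_ge0 ?powR_ge0// indicE.
have mg : mfun g.
  apply: mfunM; first exact: mfun1.
  by apply: mfun_powR => //; apply: mfunB => //; exact: mfun_cst.
have gM x : g x <= Num.max 1 (k%:R / lam) `^ P.
  rewrite /g indicE; case: (boolP (x \in D k)) => [xD|xD]; last by rewrite mul0r powR_ge0.
  have Dx := set_mem xD; rewrite mul1r.
  apply: (@le_trans _ _ (Num.max 1 (k%:R / lam) `^ (pr x - 1))).
    by apply: ge0_ler_powR; [rewrite subr_ge0|exact: a0|exact: m0|exact: aM Dx].
  apply: ler_powR; first by rewrite le_max lexx.
  by have := prP x; lra.
have gD x : ~ D k x -> g x = 0 by move=> nD; rewrite /g indicE memNset ?mul0r.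
(* As r > 1 and the conjugate exponent is at least 1, dividing [g] by r divides its modular by at
   least r; where pr x = 1 the conjugate exponent is infinite and g / r is at most 1. *)
have ng : (pnorm q (EFin \o g) <= r%:E)%E.
  apply: ereal_inf_lbound; exists r => //; split => //.
  apply: (@le_trans _ _ (\int[leb]_x ((r^-1)%:E * (\1_(D k) x * h x)%:E))%E); last first.
    have ri0 : 0 <= r^-1 by rewrite invr_ge0 ltW.
    by rewrite (intZ (mfunE (mhk k)) ri0 (fun x => hk0 k x)) rE -EFinM mulVf// gt_eqF.
  apply: leintT => x; first exact: phi_exp_ge0.
  rewrite /= ger0_norm// /g indicE; case: (boolP (x \in D k)) => _; last first.
    by rewrite -EFinM !mul0r mule0 phi_exp0.
  rewrite !mul1r -EFinM /h /q /p; have := pr1 x; rewrite le_eqVlt => /predU1P[<-|px].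
    rewrite hoelder_conjugate1 subrr powRr0 /= lte_fin mul1r ltNge invf_le1// (ltW gt1)/=.
    by rewrite lee_fin mulr_ge0 ?invr_ge0 ?powR_ge0// ltW.
  rewrite conj_real//= lee_fin; have q0 : 1 <= pr x / (pr x - 1).
    by rewrite ler_pdivlMr ?subr_gt0//; lra.
  rewrite powRM ?powR_ge0 ?invr_ge0 ?(ltW r0)// -powRrM mulrCA mulfV ?mulr1 ?subr_eq0 ?gt_eqF//.
  rewrite mulrC; apply: ler_wpM2r; first exact: powR_ge0.
  rewrite -[leRHS]powRr1 ?invr_ge0 ?(ltW r0)//; apply: ger_powR => //.
  by rewrite invr_gt0 r0 invf_le1// ltW.
have := H k g mg g0 (ex_intro _ _ gM) gD (le_lt_trans ng (ltry _)).
(* The hypothesis for this test function gives lam r <= c r, although c < lam. *)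
rewrite [leLHS](_ : _ = (lam * r)%:E); last first.
  rewrite EFinM -rE -(intZ (mfunE (mhk k)) (ltW lam0) (fun x => hk0 k x)).
  apply: eq_integral => x _; rewrite -EFinM; congr EFin.
  rewrite /g /h mulrCA [RHS]mulrCA; congr (_ * _).
  have px0 : 0 < pr x := lt_le_trans ltr01 (pr1 x).
  rewrite -(mulr_powRB1 (a0 x) px0).
  by rewrite mulrA; congr (_ * _); rewrite /a mulrCA mulfV ?mulr1// gt_eqF.
move=> /le_trans /(_ (lee_wpmul2l (_ : 0 <= c%:E)%E ng)); rewrite lee_fin => /(_ c0).
by rewrite -EFinM lee_fin ler_pM2r// leNgt cl.
Unshelve. all: by end_near. Qed.

End bounded_exponent.
End variable_holder.

(** * Extension to L^p_v *)

Section sequences_ae.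
Context {R : realType} {n : nat}.
Local Notation Rn := (Rn R n.+1).
Local Notation leb := (@lebesgue_Rn R n.+1).

Lemma mfun_ae (f g : Rn -> R) : mfun f -> {ae leb, forall x, f x = g x} -> mfun g.
Proof.
move=> mf fg; apply/measurable_EFinP.
apply: (@ae_measurable_fun _ _ R leb _ setT (EFin \o f)).
- exact: measure_is_complete_caratheodory.
- by apply: ae_mono fg _ => x e _ /=; rewrite e.
- exact: mfunE.
Qed.

(** With [d] the tail of the geometric series, u - d and - u - d are nondecreasing from [k] on; the
    second fact bounds the first sequence, and d tends to 0. *)
Lemma geometric_cvg (u : nat -> R) (c : R) (k : nat) :
  (forall j, (k <= j)%N -> `|u j.+1 - u j| <= c * 2 ^- j) -> cvgn u.
Proof.
move=> H; have c0 : 0 <= c.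
  have := le_trans (normr_ge0 _) (H k (leqnn k)).
  by rewrite pmulr_lge0// invr_gt0 exprn_gt0.
pose d j : R := 2 * c * 2 ^- j.
have d0 : d @ \oo --> 0.
  rewrite (_ : d = geometric (2 * c) 2^-1); last by apply/funext => j; rewrite /d /geometric/= exprVn.
  by apply: cvg_geometric; rewrite ger0_norm ?invr_ge0// invf_lt1// ltr1n.
have dS j : d j = d j.+1 + c * 2 ^- j.
  by rewrite /d exprS; field; rewrite expf_neq0.
have dge j : 0 <= d j by rewrite /d !mulr_ge0// invr_ge0 exprn_ge0.
have inc (s : R) : `|s| = 1 -> forall i j, (k <= i)%N -> (i <= j)%N -> s * u i - d i <= s * u j - d j.
  move=> s1 i j ki /subnK <-; elim: (j - i)%N => // l IH.
  apply: (le_trans IH); rewrite addSn.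
  have kl : (k <= l + i)%N by rewrite (leq_trans ki) ?leq_addl.
  have := H _ kl; rewrite -[leLHS]mul1r -{1}s1 -normrM ler_norml => /andP[h _].
  by have := dS (l + i)%N; move: h; rewrite mulrBr; lra.
have -> : u = (fun j => (u j - d j) + d j) by apply/funext => j; rewrite subrK.
apply: is_cvgD; last by apply/cvg_ex; exists 0.
apply: (near_nondecreasing_is_cvgn (M := u k + d k)).
  exists k => // i /= ki j ij.
  by have := inc 1 (normr1 _) i j ki ij; rewrite !mul1r.
exists k => // i /= ki; have := inc (-1) (normrN1 _) k i (leqnn k) ki.
by have := dge i; lra.
Qed.

Lemma borel_cantelli (h : nat -> Rn -> R) (c : nat -> R) : (forall j, mfun (h j)) ->
  (forall j, leb [set x | (c j < h j x)%R] <= (2 ^- j)%:E)%E ->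
  {ae leb, forall x, exists k, forall j, (k <= j)%N -> h j x <= c j}.
Proof.
move=> mh H; pose F j := [set x : Rn | c j < h j x].
have mF j : measurable (F j) by exact: mfun_gt.
have sumF : (\sum_(j <oo) leb (F j) < +oo)%E.
  apply: (@le_lt_trans _ _ 2%:E); last by rewrite ltry.
  apply: lime_le; first by apply: is_cvg_nneseries => i _ _; exact: leb_ge0.
  apply: nearW => k; apply: (@le_trans _ _ (\sum_(0 <= j < k) (2 ^- j : R)%:E)%E).
    by apply: lee_sum => j _; exact: H.
  rewrite sumEFin lee_fin; suff : \sum_(0 <= j < k) (2 ^- j : R) = 2 - 2 * 2 ^- k.
    by move=> ->; rewrite gerBl mulr_ge0// invr_ge0 exprn_ge0.
  elim: k => [|k IH]; first by rewrite big_nil expr0 invr1; lra.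
  by rewrite big_nat_recr//= IH exprS; field; rewrite expf_neq0.
exists (lim_sup_set F); split; first by apply: bigcap_measurable => // k _; apply: bigcup_measurable.
  exact: (lim_sup_set_cvg0 mF sumF).
move=> x /= hx; apply: contrapT => nx; apply: hx.
have [k hk] : exists k, ~ (\bigcup_(j in [set j | (k <= j)%N]) F j) x.
  by apply: contrapT => hall; apply: nx => k _; apply: contrapT => hk; apply: hall; exists k.
by exists k => j kj; rewrite leNgt; apply/negP => hj; apply: hk; exists j.
Qed.

Lemma limn_einf_ge0 (u : nat -> \bar R) : (forall j, 0 <= u j)%E -> (0 <= limn_einf u)%E.
Proof.
move=> u0; rewrite limn_einf_lim; apply: lime_ge; first exact: is_cvg_einfs.
by apply: nearW => k; apply: le_ereal_inf_tmp => _ [j _ <-].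
Qed.

Lemma fatou_le (f : nat -> Rn -> \bar R) (g : Rn -> \bar R) (c : \bar R) :
  (forall j, measurable_fun [set: Rn] (f j)) -> (forall j x, 0 <= f j x)%E ->
  (forall x, 0 <= g x)%E ->
  {ae leb, forall x, (g x <= limn_einf (fun j => f j x))%E} ->
  (forall j, \int[leb]_x f j x <= c)%E -> (\int[leb]_x g x <= c)%E.
Proof.
move=> mf f0 g0 gf H.
have l0 x : (0 <= limn_einf (fun j => f j x))%E by exact: limn_einf_ge0.
apply: le_trans (ae_le_int g0 l0 gf) _.
have := @fatou _ _ _ leb _ measurableT f mf (fun j x _ => f0 j x).
move=> /le_trans; apply; rewrite limn_einf_lim; apply: lime_le; first exact: is_cvg_einfs.
apply: nearW => k; apply: le_trans (H k); apply: ereal_inf_lbound.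
by exists k => //=.
Qed.

Lemma powR_cvg (u : nat -> R) (a r : R) : 0 < a -> u @ \oo --> a ->
  (fun j => u j `^ r) @ \oo --> a `^ r.
Proof.
move=> a0 ua.
have ua0 : \forall j \near \oo, 0 < u j by exact: (cvgr_gt a ua).
rewrite /powR (gt_eqF a0).
have h : (fun j => expR (r * ln (u j))) @ \oo --> expR (r * ln a).
  apply: (continuous_cvg _ (@continuous_expR R _)); apply: cvgMr.
  by apply: (continuous_cvg _ (continuous_ln a0)).
apply: cvg_trans h; apply: near_eq_cvg.
by near=> j; rewrite gt_eqF//; near: j.
Unshelve. all: by end_near. Qed.

Lemma tail_int (G : nat -> set Rn) (g : Rn -> R) (e : R) : (forall k, measurable (G k)) ->
  (forall x, exists k0, forall k, (k0 <= k)%N -> G k x) -> mfun g -> (forall x, 0 <= g x) ->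
  (\int[leb]_x (g x)%:E < +oo)%E -> 0 < e ->
  exists k0, forall k, (k0 <= k)%N -> (\int[leb]_x ((1 - \1_(G k) x) * g x)%:E <= e%:E)%E.
Proof.
move=> mG Gx mg g0 ig e0.
have i01 k x : 0 <= (1 - \1_(G k) x : R) <= 1.
  by rewrite indicE; case: (_ \in _); rewrite ?subrr ?subr0 lexx ler01.
have mf k : mfun (fun x => (1 - \1_(G k) x) * g x).
  by apply: mfunM mg; apply: mfunB; [exact: mfun_cst|exact: mfun1].
have f0 k x : 0 <= (1 - \1_(G k) x) * g x by rewrite mulr_ge0//; case/andP: (i01 k x).
have gi : leb.-integrable setT (EFin \o g).
  apply/integrableP; split; first exact: mfunE.
  by under eq_integral do rewrite gee0_abs ?lee_fin//.
have cv0 : {ae leb, forall x, [set: Rn] x -> (fun k => ((1 - \1_(G k) x) * g x)%:E) @ \oo --> 0%E}.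
  apply: aeW => x _; have [k0 hk] := Gx x; apply: cvg_near_cst.
  by exists k0 => // k /= /hk Gk; rewrite indicE mem_set// subrr mul0r.
have dom : {ae leb, forall x, forall k, [set: Rn] x ->
    (`|((1 - \1_(G k) x) * g x)%:E| <= (EFin \o g) x)%E}.
  apply: aeW => x k _; rewrite gee0_abs ?lee_fin//= ler_piMl//; by case/andP: (i01 k x).
have [_ _] := @dominated_convergence _ _ _ leb _ measurableT
  (fun k x => ((1 - \1_(G k) x) * g x)%:E) (cst 0%E) (EFin \o g) (fun k => mfunE (mf k))
  (measurable_cst _) cv0 gi dom.
rewrite integral0 => cv.
have fin : \forall k \near \oo, (\int[leb]_x ((1 - \1_(G k) x) * g x)%:E < e%:E)%E.
  have e0' : ((0 : R)%:E < e%:E)%E by rewrite lte_fin.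
  exact: (cv _ (open_ereal_lt' e0')).
by have [k0 _ hk] := fin; exists k0 => k /hk /ltW.
Qed.

Lemma eventually_all (Q : nat -> nat -> Prop) (m : nat) :
  (forall i, (i < m)%N -> exists k0, forall k, (k0 <= k)%N -> Q i k) ->
  exists k0, forall k, (k0 <= k)%N -> forall i, (i < m)%N -> Q i k.
Proof.
elim: m => [|m IH] H; first by exists 0%N.
have [k0 h0] := IH (fun i im => H i (ltnW im)); have [k1 h1] := H m (ltnSn m).
exists (maxn k0 k1) => k; rewrite geq_max => /andP[kk0 kk1] i; rewrite ltnS leq_eqVlt.
by case/predU1P => [->|im]; [exact: h1|exact: h0].
Qed.

Definition window (k : nat) : set Rn := hcube (- const_mx k%:R) (2 * k%:R).

Lemma window_all (x : Rn) : exists k0, forall k, (k0 <= k)%N -> window k x.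
Proof.
exists (Num.bound (enorm x)) => k hk i.
have h : enorm x < k%:R by apply: lt_le_trans (archi_boundP (enorm_ge0 x)) _; rewrite ler_nat.
have := le_lt_trans (enorm_ge x i) h; rewrite !mxE ltr_norml => /andP[? ?].
by apply/andP; split; lra.
Qed.

Lemma windowS j k : (j <= k)%N -> window j `<=` window k.
Proof.
move=> jk x hx i; have := hx i; rewrite !mxE.
have : j%:R <= k%:R :> R by rewrite ler_nat.
by move=> ? /andP[? ?]; apply/andP; split; lra.
Qed.

Lemma le_set_nat (g : Rn -> R) (k : nat) : mfun g -> measurable [set x | g x <= k%:R].
Proof.
move=> mg; rewrite (_ : [set x | _] = ~` [set x | k%:R < g x]).
  by apply: measurableC; exact: mfun_gt.
by apply/seteqP; split => x /=; [move=> h; apply/negP; rewrite -leNgt|move/negP; rewrite -leNgt].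
Qed.

Lemma le_nat_all (t : R) : 0 <= t -> exists k0, forall k, (k0 <= k)%N -> t <= k%:R.
Proof.
move=> t0; exists (Num.bound t) => k hk; apply: ltW.
by apply: lt_le_trans (archi_boundP t0) _; rewrite ler_nat.
Qed.

End sequences_ae.

Section extension.
Context {R : realType} {n : nat}.
Local Notation Rn := (Rn R n.+1).
Local Notation leb := (@lebesgue_Rn R n.+1).
Context {omega : R -> R} {T : (Rn -> R) -> Rn -> R} {K : Rn -> Rn -> R}.
Hypothesis cz : CZop omega T K.
Context (b : Rn -> R) (m : nat) (pr : Rn -> R) (P : R) (v w : Rn -> R) (C : R).
Hypotheses (mb : mfun b) (pr1 : forall x, 1 <= pr x) (prP : forall x, pr x <= P)
  (mpr : mfun pr) (mv : mfun v) (mw : mfun w)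
  (v0 : {ae leb, forall x, 0 < v x}) (w0 : {ae leb, forall x, 0 < w x}) (C0 : 0 < C).
Local Notation p := (fun x => (pr x)%:E).
Local Notation Tm := (iter_commutator m b T).
Hypothesis bnd : forall u, nice b u -> (pnorm p (EFin \o (u \* v)%R) < +oo)%E ->
  (pnorm p (EFin \o (Tm u \* w)%R) <= C%:E * pnorm p (EFin \o (u \* v)%R))%E.
Let p1 x : (1 <= p x)%E. Proof. by rewrite lee_fin. Qed.

Lemma nice_lin (a : R) (f g : Rn -> R) : nice b f -> nice b g -> nice b (fun x => a * f x + g x).
Proof.
move=> [mf [M [c0 [s0 [h1 h2 h3]]]]] [mg [M' [c1 [s1 [k1 k2 k3]]]]].
split; first by apply: mfunD => //; exact: mfunZ.
have M0 : 0 <= M by apply: le_trans (h1 0).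
have M'0 : 0 <= M' by apply: le_trans (k1 0).
pose L : R := enorm c0 + enorm c1 + `|s0| + `|s1| + 1.
exists (`|a| * M + M' + M + M'), (- const_mx L), (2 * L); split => x.
- apply: (le_trans (ler_normD _ _)); rewrite normrM.
  have := k1 x; have := ler_wpM2l (normr_ge0 a) (h1 x); lra.
- move=> nx; rewrite h2 ?k2 ?mulr0 ?addr0// => hx; apply: nx => i; rewrite !mxE.
    have /andP[] := hx i; have := enorm_ge c1 i; have := enorm_ge0 c0; have := ler_norm s1.
    have := normr_ge0 s0; rewrite ler_norml /L => ? ? ? /andP[] ? ? ? ?; apply/andP; split; lra.
  have /andP[] := hx i; have := enorm_ge c0 i; have := enorm_ge0 c1; have := ler_norm s0.
  have := normr_ge0 s1; rewrite ler_norml /L => ? ? ? /andP[] ? ? ? ?; apply/andP; split; lra.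
- have aM : 0 <= `|a| * M by rewrite mulr_ge0.
  by move=> hb; rewrite h3 ?k3 ?mulr0 ?addr0//; apply: le_lt_trans hb; lra.
Qed.

Lemma comm_lin_nice (a : R) (f g : Rn -> R) : nice b f -> nice b g ->
  {ae leb, forall x, Tm (fun y => a * f y + g y) x = a * Tm f x + Tm g x}.
Proof. by move=> nf ng; apply: (comm_lin cz); exact: nice_dom. Qed.

Lemma pnorm_feasible (f : Rn -> R) (s : R) : mfun f -> (pnorm p (EFin \o f) < s%:E)%E ->
  [/\ 0 < s, mfun (fun x => (`|f x| / s) `^ pr x) &
    (\int[leb]_x ((`|f x| / s) `^ pr x)%:E <= 1)%E].
Proof.
move=> mf /luxemburg_lt[l [l0 ls hl]]; have s0 := lt_trans l0 ls.
have mF : mfun (fun x => (`|f x| / s) `^ pr x).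
  apply: mfun_powR mpr; under eq_fun do rewrite mulrC.
  by apply: mfunZ; exact: mfun_norm.
split; [exact: s0|exact: mF|].
apply: le_trans hl; apply: leintT => x; first by rewrite lee_fin powR_ge0.
rewrite /= lee_fin; apply: ge0_ler_powR.
- by apply: le_trans (pr1 x).
- by rewrite nnegrE divr_ge0// ltW.
- by rewrite nnegrE divr_ge0// ltW.
- by rewrite ler_wpM2l// lef_pV2// ltW.
Qed.

(** A triangle inequality up to a constant suffices. With M the maximum of |f| / s and |g| / s, the
    quotient |f + g| / (4 s) is at most M / 2, and (M / 2)^p <= M^p / 2 leaves half of each
    modular. *)
Lemma pnorm_add (f g : Rn -> R) (s : R) : mfun f -> mfun g ->
  (pnorm p (EFin \o f) < s%:E)%E -> (pnorm p (EFin \o g) < s%:E)%E ->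
  (pnorm p (EFin \o (fun x => (f x + g x)%R)) <= (4 * s)%:E)%E.
Proof.
move=> mf mg hf hg; have [s0 mf' If] := pnorm_feasible mf hf.
have [_ mg' Ig] := pnorm_feasible mg hg.
apply: ereal_inf_lbound; exists (4 * s); [split; first by rewrite mulr_gt0|by []].
have half : 0 <= 2^-1 :> R by rewrite invr_ge0.
have pf x : 0 <= (`|f x| / s) `^ pr x by exact: powR_ge0.
have pg x : 0 <= (`|g x| / s) `^ pr x by exact: powR_ge0.
apply: (@le_trans _ _ (\int[leb]_x (2^-1 * ((`|f x| / s) `^ pr x) + 2^-1 * ((`|g x| / s) `^ pr x))%:E)%E).
  apply: leintT => x; first exact: phi_exp_ge0.
  rewrite /= lee_fin -mulrDr; set M := Num.max (`|f x| / s) (`|g x| / s).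
  have M0 : 0 <= M by rewrite le_max divr_ge0// ltW.
  have MfD : M `^ pr x <= (`|f x| / s) `^ pr x + (`|g x| / s) `^ pr x.
    by rewrite /M; case: (leP (`|f x| / s)) => _; [rewrite lerDr powR_ge0|rewrite lerDl powR_ge0].
  apply: (@le_trans _ _ ((2^-1 * M) `^ pr x)).
    apply: ge0_ler_powR.
    - by apply: le_trans (pr1 x).
    - by rewrite nnegrE divr_ge0// mulr_ge0// ltW.
    - by rewrite nnegrE mulr_ge0.
    - rewrite ler_pdivrMr ?mulr_gt0//.
      have hfM : `|f x| <= M * s by rewrite -ler_pdivrMr// /M le_max lexx.
      have hgM : `|g x| <= M * s by rewrite -ler_pdivrMr// /M le_max lexx orbT.
      have := ler_normD (f x) (g x).
      by lra.
  rewrite powRM//; apply: ler_pM; rewrite ?powR_ge0//.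
  rewrite -[leRHS]powRr1//; apply: ger_powR => //.
  by rewrite invr_gt0 ltr0n/= invf_le1// ler1n.
rewrite (intDD measurableT (mfunZ _ mf') (mfunZ _ mg')
  (fun x => mulr_ge0 half (pf x)) (fun x => mulr_ge0 half (pg x))).
rewrite (intZD measurableT mf' half pf) (intZD measurableT mg' half pg).
apply: le_trans (leeD (lee_wpmul2l _ If) (lee_wpmul2l _ Ig)) _; rewrite ?lee_fin//.
by lra.
Qed.

Lemma pnorm_lin_lt (a : R) (f g : Rn -> R) (s : R) : mfun f -> mfun g ->
  (pnorm p (EFin \o f) < s%:E)%E -> (pnorm p (EFin \o g) < s%:E)%E ->
  (pnorm p (EFin \o (fun x => (a * f x + g x)%R)) < (5 * (`|a| + 1) * s)%:E)%E.
Proof.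
move=> mf mg hf hg; have [s0 _ _] := pnorm_feasible mf hf.
have a0 : 0 < `|a| + 1 by rewrite ltr_pwDr.
have e := pnormZ p1 (EFin \o f) a0.
have [t tE] : exists t : R, pnorm p (EFin \o f) = t%:E.
  exists (fine (pnorm p (EFin \o f))); rewrite fineK// ge0_fin_numE; last exact: (pnorm_ge0 p).
  exact: lt_trans hf (ltry _).
rewrite tE lte_fin in hf; pose s1 := (`|a| + 1) * s.
have s1s : s <= s1 by have := normr_ge0 a; rewrite /s1; nra.
have hf' : (pnorm p (EFin \o (fun x => (a * f x)%R)) < s1%:E)%E.
  apply: (@le_lt_trans _ _ ((`|a| + 1) * t)%:E); last by rewrite lte_fin ltr_pM2l.
  rewrite EFinM -tE -e; apply: (pnorm_le p1) => x /=.
  by rewrite lee_fin !normrM (ger0_norm (ltW a0)) ler_wpM2r// lerDl.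
have hg' : (pnorm p (EFin \o g) < s1%:E)%E by apply: (lt_le_trans hg); rewrite lee_fin.
apply: (le_lt_trans (pnorm_add (mfunZ a mf) mg hf' hg')).
by rewrite lte_fin -mulrA -/s1; lra.
Qed.

(** Where |Tm (z j) w| exceeds 2 C k 2^-j, it is at least 2^j times a bound of its norm, and since
    pr >= 1 so is the integrand of the modular. Such points have measure at most 2^-j, which is
    summable. *)
Lemma comm_small (z : nat -> Rn -> R) (k : R) : 0 < k -> (forall j, nice b (z j)) ->
  (forall j, pnorm p (EFin \o (z j \* v)%R) <= (k * 4 ^- j)%:E)%E ->
  {ae leb, forall x, exists c i, forall j, (i <= j)%N -> `|Tm (z j) x| <= c * 2 ^- j}.
Proof.
move=> k0 nz hz; pose h j x := `|Tm (z j) x * w x|.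
have mTw j : mfun (Tm (z j) \* w)%R.
  by apply: mfunM mw; exact: (comm_mfun cz mb (nice_dom mb (m := m) (nz j))).
have mh j : mfun (h j) by exact: (mfun_norm (mTw j)).
have Ck : 0 < 2 * C * k by rewrite !mulr_gt0.
have H j : (leb [set x | (2 * C * k * 2 ^- j < h j x)%R] <= (2 ^- j)%:E)%E.
  have j4 : 0 < 4 ^- j :> R by rewrite invr_gt0 exprn_gt0.
  have lt : (pnorm p (EFin \o (Tm (z j) \* w)%R) < (2 * C * k * 4 ^- j)%:E)%E.
    have zfin : (pnorm p (EFin \o (z j \* v)%R) < +oo)%E by apply: le_lt_trans (hz j) (ltry _).
    apply: le_lt_trans (bnd (nz j) zfin) _.
    apply: le_lt_trans (lee_wpmul2l _ (hz j)) _; first by rewrite lee_fin ltW.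
    by rewrite -EFinM lte_fin -!mulrA ltr_pMl ?ltr1n// !mulr_gt0.
  have [s0 mF IF] := pnorm_feasible (mTw j) lt.
  set F := (fun x => _) in mF.
  have mE : measurable [set x | 2 * C * k * 2 ^- j < h j x] by exact: mfun_gt.
  have j2 : 0 < 2 ^+ j :> R by rewrite exprn_gt0.
  rewrite -(lee_pmul2l _ (_ : 0 < (2 ^+ j)%:E)%E)// -EFinM mulfV ?gt_eqF//.
  apply: le_trans IF; rewrite -(integral_leb_cst _ mE) integral_mkcond; apply: leintT => x.
    by rewrite patchE; case: ifPn => // _; rewrite lee_fin ltW.
  rewrite patchE; case: ifPn => [/set_mem hx|_]; last by rewrite lee_fin powR_ge0.
  have big : 2 ^+ j <= h j x / (2 * C * k * 4 ^- j).
    rewrite ler_pdivlMr//; apply: ltW; apply: le_lt_trans hx.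
    rewrite le_eqVlt; apply/orP; left; apply/eqP.
    have -> : 4 ^+ j = 2 ^+ j * 2 ^+ j :> R by rewrite -exprMn; congr (_ ^+ _); ring.
    by field; rewrite gt_eqF.
  rewrite lee_fin; apply: (le_trans big); rewrite -[leLHS]powRr1.
    apply: ler_powR => //; apply: le_trans big.
    by rewrite -[leLHS](expr1n _ j) lerXn2r// ?nnegrE// ler1n.
  exact: le_trans (ltW j2) big.
have hBC := borel_cantelli mh H.
apply: (ae_mono2 hBC w0) => x [i hi] wx; exists (2 * C * k / w x), i => j ij.
have := hi j ij; rewrite /h normrM (gtr0_norm wx) -ler_pdivlMr// => /le_trans; apply.
by rewrite mulrAC.
Qed.

(* The rate 4 ^- j makes T (u j) converge almost everywhere by the Borel-Cantelli
   lemma, without completeness of L^p. *)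
Definition approx (f : Rn -> R) (u : nat -> Rn -> R) := forall j,
  [/\ nice b (u j), forall x, `|u j x| <= `|f x| &
      (pnorm p (EFin \o ((u j \- f) \* v)%R) <= (4 ^- j)%:E)%E].

Lemma weighted_mfun (f : Rn -> R) : Lp_weighted p v f -> mfun f.
Proof.
move=> [mfv _]; have mfv' : mfun (f \* v)%R by apply/measurable_EFinP.
have mv' : mfun (fun x => Num.max (v x) 0).
  by apply: measurable_maxr => //; exact: mfun_cst.
have v'0 x : 0 <= Num.max (v x) 0 by rewrite le_max lexx orbT.
apply: (mfun_ae (mfunM mfv' (mfunV mv' v'0))); apply: ae_mono v0 _ => x vx.
by rewrite /= max_l ?(ltW vx)// mulfK// gt_eqF.
Qed.

Lemma weighted_fin (f : Rn -> R) : Lp_weighted p v f ->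
  exists s : R, [/\ 0 <= s & pnorm p (EFin \o (f \* v)%R) = s%:E].
Proof.
move=> [_ nf]; have n0 := pnorm_ge0 p (EFin \o (f \* v)%R).
by exists (fine (pnorm p (EFin \o (f \* v)%R))); rewrite fine_ge0// fineK// ge0_fin_numE.
Qed.

Definition trunc (f : Rn -> R) (k : nat) : set Rn :=
  window k `&` [set x | `|f x| <= k%:R] `&` [set x | `|b x| <= k%:R].

Lemma measurable_trunc f k : mfun f -> measurable (trunc f k).
Proof.
move=> mf; apply: measurableI; first apply: measurableI; first exact: measurable_hcube.
  by apply: le_set_nat; exact: mfun_norm.
by apply: le_set_nat; exact: mfun_norm.
Qed.

Lemma trunc_all f (x : Rn) : exists k0, forall k, (k0 <= k)%N -> trunc f k x.
Proof.
have [k0 h0] := window_all x; have [k1 h1] := le_nat_all (normr_ge0 (f x)).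
have [k2 h2] := le_nat_all (normr_ge0 (b x)).
exists (maxn k0 (maxn k1 k2)) => k; rewrite !geq_max => /and3P[i0 i1 i2].
by split; first split; [exact: h0|exact: h1|exact: h2].
Qed.

Lemma trunc_nice f k : mfun f -> nice b (fun x => \1_(trunc f k) x * f x).
Proof.
move=> mf; have mt := measurable_trunc k mf; split; first by apply: mfunM mf; exact: mfun1.
exists k%:R, (- const_mx k%:R), (2 * k%:R); split => x.
- rewrite indicE; case: (boolP (x \in trunc f k)) => [/set_mem[[_ h] _]|_].
    by rewrite mul1r.
  by rewrite mul0r normr0.
- by move=> h; rewrite indicE memNset ?mul0r// => -[[]].
- by move=> h; rewrite indicE memNset ?mul0r// => -[_] /=; rewrite leNgt h.
Qed.

Lemma trunc_le f k x : `|\1_(trunc f k) x * f x| <= `|f x|.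
Proof.
by rewrite normrM ler_piMl// indicE; case: (_ \in _); rewrite ?normr1 ?normr0.
Qed.

Lemma trunc_pnorm f (e : R) : Lp_weighted p v f -> 0 < e ->
  exists k0, forall k, (k0 <= k)%N ->
    (pnorm p (EFin \o (((fun x => \1_(trunc f k) x * f x)%R \- f) \* v)%R) <= e%:E)%E.
Proof.
move=> Xf e0; have mf := weighted_mfun Xf; have [s [s0 sE]] := weighted_fin Xf.
have mfv : mfun (f \* v)%R by exact: mfunM.
have [|l0 mF IF] := @pnorm_feasible (f \* v)%R (s + 1) mfv.
  by rewrite sE lte_fin ltrDl.
set l := s + 1 in l0 mF IF.
(* [B] bounds the factor that the change of scale from l to e costs in the modular, uniformly in x;
   the boundedness of the exponent enters here. *)
pose B := Num.max 1 (l / e) `^ P.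
have B0 : 0 < B by rewrite powR_gt0// lt_max ltr01.
have [k0 hk] := @tail_int R n (trunc f) _ B^-1 (fun k => measurable_trunc k mf) (trunc_all f) mF
  (fun x => powR_ge0 _ _) (le_lt_trans IF (ltry _)) (ltac:(by rewrite invr_gt0)).
exists k0 => k /hk H; apply: ereal_inf_lbound; exists e; [split; [exact: e0|]|by []].
have i01 x : 0 <= 1 - \1_(trunc f k) x :> R by rewrite indicE; case: (_ \in _); rewrite ?subrr ?subr0.
have mg : mfun (fun x => (1 - \1_(trunc f k) x) * (`|(f \* v)%R x| / l) `^ pr x).
  by apply: mfunM mF; apply: mfunB; [exact: mfun_cst|apply: mfun1; exact: measurable_trunc].
apply: (@le_trans _ _ (B%:E * B^-1%:E)%E); last by rewrite -EFinM mulfV// gt_eqF.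
apply: le_trans (lee_wpmul2l _ H); last by rewrite lee_fin ltW.
rewrite -(intZ (mfunE mg) (ltW B0) (fun x => mulr_ge0 (i01 x) (powR_ge0 _ _))).
apply: leintT => x; first exact: phi_exp_ge0.
rewrite /= -EFinM lee_fin indicE; case: (_ \in _);
  rewrite ?mul0r ?mul1r ?subrr ?sub0r ?subr0 ?mul0r ?mulr0 ?normr0 ?mul1r.
  by rewrite mul0r powR0// gt_eqF// (lt_le_trans ltr01).
rewrite mulNr normrN.
have -> : `|f x * v x| / e = (l / e) * (`|f x * v x| / l) by field; rewrite !gt_eqF.
have M1 : 1 <= Num.max 1 (l / e) by rewrite le_max lexx.
have M0 : 0 <= Num.max 1 (l / e) by exact: le_trans ler01 M1.
have q0 : 0 <= `|f x * v x| / l by rewrite divr_ge0// ltW.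
apply: (@le_trans _ _ ((Num.max 1 (l / e) * (`|f x * v x| / l)) `^ pr x)).
  apply: ge0_ler_powR.
  - by apply: le_trans (pr1 x).
  - by rewrite nnegrE mulr_ge0// divr_ge0// ltW.
  - by rewrite nnegrE mulr_ge0.
  - by rewrite ler_wpM2r// le_max lexx orbT.
rewrite powRM//; apply: ler_wpM2r; first exact: powR_ge0.
exact: ler_powR.
Qed.

Lemma approx_exists f : Lp_weighted p v f -> exists u, approx f u.
Proof.
move=> Xf; have mf := weighted_mfun Xf.
have /choice[k hk] : forall j, exists k,
    (pnorm p (EFin \o (((fun x => \1_(trunc f k) x * f x)%R \- f) \* v)%R) <= (4 ^- j)%:E)%E.
  move=> j; have j0 : 0 < 4 ^- j :> R by rewrite invr_gt0 exprn_gt0.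
  by have [k0 h] := trunc_pnorm Xf j0; exists k0; apply: h.
exists (fun j x => \1_(trunc f (k j)) x * f x) => j.
by split; [exact: trunc_nice|exact: trunc_le|exact: hk].
Qed.

Lemma approx_lt f u j : approx f u -> mfun f ->
  mfun ((u j \- f) \* v)%R /\ (pnorm p (EFin \o ((u j \- f) \* v)%R) < (2 * 4 ^- j)%:E)%E.
Proof.
move=> au mf; have [[mu _] _ h] := au j; split; first by apply: mfunM mv; exact: mfunB.
by apply: (le_lt_trans h); rewrite lte_fin ltr_pMl ?ltr1n// invr_gt0 exprn_gt0.
Qed.

Lemma approx_cvg f u : Lp_weighted p v f -> approx f u ->
  {ae leb, forall x, cvgn (fun j => Tm (u j) x)}.
Proof.
move=> Xf au; have mf := weighted_mfun Xf.
pose z j x := -1 * u j x + u j.+1 x.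
have nz j : nice b (z j).
  by apply: nice_lin; [case: (au j)|case: (au j.+1)].
have hz j : (pnorm p (EFin \o (z j \* v)%R) <= (20 * 4 ^- j)%:E)%E.
  have [m1 l1] := approx_lt j au mf; have [m2 l2] := approx_lt j.+1 au mf.
  have l2' : (pnorm p (EFin \o ((u j.+1 \- f) \* v)%R) < (2 * 4 ^- j)%:E)%E.
    apply: (lt_le_trans l2); rewrite lee_fin ler_pM2l// lef_pV2 ?posrE ?exprn_gt0//.
    by rewrite ler_eXn2l// ltr1n.
  have := ltW (pnorm_lin_lt (-1) m1 m2 l1 l2').
  rewrite normrN1 (_ : 5 * (1 + 1) * (2 * 4 ^- j) = 20 * 4 ^- j :> R); last by ring.
  apply: le_trans; apply: (pnorm_le p1) => x /=.
  by rewrite le_eqVlt /z; apply/orP; left; apply/eqP; congr (`|_|%:E); ring.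
have hs := comm_small (ltr0n _ 20) nz hz.
have hl : {ae leb, forall x, forall j, Tm (z j) x = -1 * Tm (u j) x + Tm (u j.+1) x}.
  by apply: ae_foralln => j; apply: comm_lin_nice; [case: (au j)|case: (au j.+1)].
apply: (ae_mono2 hs hl) => x [c [i hi]] e; apply: (@geometric_cvg _ _ c i) => j ij.
by have := hi j ij; rewrite e mulN1r addrC.
Qed.

(** The upper limit exists and is measurable everywhere; by [extend_cvg] it is the limit almost
    everywhere. *)
Definition extend (U : (Rn -> R) -> nat -> Rn -> R) (f : Rn -> R) (x : Rn) : R :=
  fine (limn_esup (fun j => (Tm (U f j) x)%:E)).

Lemma extend_cvg U f : Lp_weighted p v f -> approx f (U f) ->
  {ae leb, forall x, (fun j => Tm (U f j) x) @ \oo --> extend U f x}.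
Proof.
move=> Xf au; apply: ae_mono (approx_cvg Xf au) _ => x /cvg_ex[l cl].
have cE : (fun j => (Tm (U f j) x)%:E) @ \oo --> l%:E by apply: cvg_EFin => //; exact: nearW.
by rewrite /extend (cvg_limn_einf_sup cE).2.
Qed.

Lemma weighted_lin (a : R) f g : Lp_weighted p v f -> Lp_weighted p v g ->
  Lp_weighted p v (fun x => a * f x + g x).
Proof.
move=> Xf Xg; have mf := weighted_mfun Xf; have mg := weighted_mfun Xg.
have mfv : mfun (f \* v)%R by exact: mfunM.
have mgv : mfun (g \* v)%R by exact: mfunM.
have [s [s0 sE]] := weighted_fin Xf; have [t [t0 tE]] := weighted_fin Xg.
split; first by apply: mfunE; apply: mfunM mv; apply: mfunD mg; exact: mfunZ.
pose k := s + t + 1.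
have hf : (pnorm p (EFin \o (f \* v)%R) < k%:E)%E by rewrite sE lte_fin /k; lra.
have hg : (pnorm p (EFin \o (g \* v)%R) < k%:E)%E by rewrite tE lte_fin /k; lra.
apply: lt_trans (ltry (5 * (`|a| + 1) * k)).
apply: le_lt_trans (pnorm_lin_lt a mfv mgv hf hg); apply: (pnorm_le p1) => x /=.
by rewrite le_eqVlt; apply/orP; left; apply/eqP; congr (`|_|%:E); ring.
Qed.

(** Stated for three sequences so that it yields the linearity of the extension and, with a = 0, the
    independence of its values from the approximating sequence. *)
Lemma comm_lin_cvg (a : R) (f g h : nat -> Rn -> R) (k : R) : 0 < k ->
  (forall j, nice b (f j)) -> (forall j, nice b (g j)) -> (forall j, nice b (h j)) ->
  (forall j, pnorm p (EFin \o ((fun x => a * f j x + g j x - h j x)%R \* v)%R) <= (k * 4 ^- j)%:E)%E ->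
  {ae leb, forall x, (fun j => a * Tm (f j) x + Tm (g j) x - Tm (h j) x) @ \oo --> (0 : R)}.
Proof.
move=> k0 nf ng nh H; pose z j x := -1 * h j x + (a * f j x + g j x).
have ny j : nice b (fun x => a * f j x + g j x) by exact: nice_lin.
have nz j : nice b (z j) by exact: (nice_lin _ (nh j) (ny j)).
have zE j : z j = (fun x => a * f j x + g j x - h j x).
  by apply/funext => x; rewrite /z mulN1r addrC.
have hs := comm_small k0 nz (fun j => ltac:(by rewrite zE; exact: H)).
have h1 : {ae leb, forall x, forall j, Tm (z j) x = -1 * Tm (h j) x + Tm (fun x => a * f j x + g j x) x}.
  by apply: ae_foralln => j; exact: comm_lin_nice.
have h2 : {ae leb, forall x, forall j, Tm (fun x => a * f j x + g j x) x = a * Tm (f j) x + Tm (g j) x}.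
  by apply: ae_foralln => j; exact: comm_lin_nice.
apply: (ae_mono2 hs (ae_mono2 h1 h2 (fun x => @conj _ _))) => x [c [i hi]] [e1 e2].
have c0 : (fun j => c * 2 ^- j) @ \oo --> (0 : R).
  rewrite (_ : (fun j => _) = geometric c 2^-1); last by apply/funext => j; rewrite /geometric/= exprVn.
  by apply: cvg_geometric; rewrite ger0_norm ?invr_ge0// invf_lt1// ltr1n.
have : (fun j => Tm (z j) x) @ \oo --> (0 : R).
  apply/norm_cvg0P; apply: (squeeze_cvgr _ (cvg_cst 0) c0).
  by exists i => // j /= ij; rewrite normr_ge0 hi.
apply: cvg_trans; apply: near_eq_cvg; apply: nearW => j.
by rewrite e1 e2 mulN1r addrC.
Qed.

Lemma extend_lin U (a : R) f g : (forall f, Lp_weighted p v f -> approx f (U f)) ->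
  Lp_weighted p v f -> Lp_weighted p v g ->
  {ae leb, forall x, extend U (fun x => a * f x + g x) x = a * extend U f x + extend U g x}.
Proof.
move=> hU Xf Xg; have Xh := weighted_lin a Xf Xg; set h := (fun x => a * f x + g x) in Xh *.
have mf := weighted_mfun Xf; have mg := weighted_mfun Xg; have mh := weighted_mfun Xh.
have a0 : 0 < `|a| + 1 by rewrite ltr_pwDr.
pose k := 100 * (`|a| + 1).
have k0 : 0 < k by rewrite /k mulr_gt0.
have main : {ae leb, forall x, (fun j => a * Tm (U f j) x + Tm (U g j) x - Tm (U h j) x) @ \oo --> (0 : R)}.
  apply: (comm_lin_cvg k0) => j; try by case: (hU _ Xf j); case: (hU _ Xg j); case: (hU _ Xh j).
  have [m1 l1] := approx_lt j (hU _ Xf) mf; have [m2 l2] := approx_lt j (hU _ Xg) mg.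
  have [m3 l3] := approx_lt j (hU _ Xh) mh.
  set q : R := 4 ^- j in l1 l2 l3 *.
  have q0 : 0 < q by rewrite invr_gt0 exprn_gt0.
  have h0 := pnorm_lin_lt a m1 m2 l1 l2.
  have m0 : mfun (fun x => a * ((U f j \- f) \* v)%R x + ((U g j \- g) \* v)%R x).
    by apply: mfunD m2; exact: mfunZ.
  have l3' : (pnorm p (EFin \o ((U h j \- h) \* v)%R) < (5 * (`|a| + 1) * (2 * q))%:E)%E.
    apply: (lt_le_trans l3); rewrite lee_fin ler_peMl ?mulr_ge0 ?(ltW q0)//.
    by have := normr_ge0 a; lra.
  have := ltW (pnorm_lin_lt (-1) m3 m0 l3' h0).
  rewrite normrN1 (_ : 5 * (1 + 1) * (5 * (`|a| + 1) * (2 * q)) = k * q); last by rewrite /k; ring.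
  apply: le_trans; apply: (pnorm_le p1) => x /=.
  by rewrite le_eqVlt /h; apply/orP; left; apply/eqP; congr (`|_|%:E); ring.
have eq3 := ae_mono2 (extend_cvg Xf (hU _ Xf)) (extend_cvg Xg (hU _ Xg)) (fun x => @conj _ _).
apply: (ae_mono2 (ae_mono2 eq3 (extend_cvg Xh (hU _ Xh)) (fun x => @conj _ _)) main).
move=> x [[cf cg] ch] c0.
have c1 : (fun j => a * Tm (U f j) x + Tm (U g j) x - Tm (U h j) x) @ \oo -->
    a * extend U f x + extend U g x - extend U h x.
  by apply: cvgB ch; apply: cvgD cg; exact: cvgMr.
by apply/esym/eqP; rewrite -subr_eq0; apply/eqP; exact: (cvg_unique _ c1 c0).
Qed.

(** Fatou's lemma for the modulars at every scale above C times the norm of f v; the approximations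
    are dominated by |f|, so their norms need no limit. *)
Lemma extend_bound U f : Lp_weighted p v f -> approx f (U f) ->
  Lp_weighted p w (extend U f) /\
  (pnorm p (EFin \o (extend U f \* w)%R) <= C%:E * pnorm p (EFin \o (f \* v)%R))%E.
Proof.
move=> Xf au; have [s [s0 sE]] := weighted_fin Xf.
have nu j : nice b (U f j) by case: (au j).
have mTu j : mfun (Tm (U f j)) by exact: (comm_mfun cz mb (nice_dom mb (m := m) (nu j))).
have mS : mfun (extend U f).
  have h : measurable_fun [set: Rn] (fun x => limn_esup (fun j => (Tm (U f j) x)%:E)).
    by apply: measurable_fun_limn_esup => j; exact: mfunE.
  exact: (measurableT_comp (fine_measurable measurableT) h).
have mSw : mfun (extend U f \* w)%R by exact: mfunM.
have main : (pnorm p (EFin \o (extend U f \* w)%R) <= C%:E * pnorm p (EFin \o (f \* v)%R))%E.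
  rewrite sE -EFinM; apply/lee_addgt0Pr => e e0; rewrite -EFinD.
  have Cs : 0 <= C * s by rewrite mulr_ge0// ltW.
  set l := C * s + e; have l0 : 0 < l by rewrite /l; lra.
  have F j : mfun (fun x => (`|(Tm (U f j) \* w)%R x| / l) `^ pr x) /\
      (\int[leb]_x ((`|(Tm (U f j) \* w)%R x| / l) `^ pr x)%:E <= 1)%E.
    have mF : mfun (Tm (U f j) \* w)%R by exact: mfunM.
    have uf : (pnorm p (EFin \o (U f j \* v)%R) <= s%:E)%E.
      rewrite -sE; apply: (pnorm_le p1) => x /=; rewrite lee_fin !normrM ler_wpM2r//.
      by case: (au j).
    have [|_ h1 h2] := @pnorm_feasible (Tm (U f j) \* w)%R l mF; last by split.
    apply: le_lt_trans (bnd (nu j) (le_lt_trans uf (ltry _))) _.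
    apply: le_lt_trans (lee_wpmul2l _ uf) _; first by rewrite lee_fin ltW.
    by rewrite -EFinM lte_fin /l; lra.
  apply: ereal_inf_lbound; exists l; [split; [exact: l0|]|by []].
  apply: (@fatou_le R n (fun j x => ((`|(Tm (U f j) \* w)%R x| / l) `^ pr x)%:E)).
  - by move=> j; apply: mfunE; case: (F j).
  - by move=> j x; rewrite lee_fin powR_ge0.
  - by move=> x; exact: phi_exp_ge0.
  - apply: ae_mono (extend_cvg Xf au) _ => x cx /=.
    have [a0|a0] := eqVneq (`|extend U f x * w x| / l) 0.
      rewrite a0 powR0; last by rewrite gt_eqF// (lt_le_trans ltr01).
      by apply: limn_einf_ge0 => j; rewrite lee_fin powR_ge0.
    have a1 : 0 < `|extend U f x * w x| / l by rewrite lt_neqAle eq_sym a0 divr_ge0// ltW.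
    have cv : (fun j => `|Tm (U f j) x * w x| / l) @ \oo --> `|extend U f x * w x| / l.
      by apply: cvgMl; apply: cvg_norm; exact: cvgMl.
    have cE : (fun j => ((`|Tm (U f j) x * w x| / l) `^ pr x)%:E) @ \oo -->
        ((`|extend U f x * w x| / l) `^ pr x)%:E.
      by apply: cvg_EFin; [exact: nearW|exact: powR_cvg].
    by rewrite (cvg_limn_einf_sup cE).1.
  - by move=> j; case: (F j).
split; last exact: main.
split; first exact: mfunE.
by apply: (le_lt_trans main); rewrite sE -EFinM ltry.
Qed.

(** By induction along the recursion of the commutator everything reduces to T on L2. There a square
    integral of 8^-j against a squared threshold C' 4^-j leaves measure 2^-j for the Borel-Cantelli
    lemma. *)
Lemma comm_cvg0 m' (h : nat -> Rn -> R) :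
  (forall j i, (i <= m')%N -> L2 (fun x => b x ^+ i * h j x) /\
     (sqint (fun x => b x ^+ i * h j x)%R <= (8 ^- j)%:E)%E) ->
  {ae leb, forall x, (fun j => iter_commutator m' b T (h j) x) @ \oo --> (0 : R)}.
Proof.
elim: m' h => [|m' IH] h H.
  have [C' C'0 hC] := T_sq cz.
  have e0 j : (fun x => b x ^+ 0 * h j x) = h j by apply/funext => x; rewrite expr0 mul1r.
  have hL j : L2 (h j) by have [] := H j 0%N isT; rewrite e0.
  have hs j : (sqint (h j) <= (8 ^- j)%:E)%E by have [_] := H j 0%N isT; rewrite e0.
  have mT j : mfun (T (h j)) by apply: L2_mfun; exact: (hC _ (hL j)).1.
  have BC := @borel_cantelli R n (fun j x => `|T (h j) x|) (fun j => Num.sqrt C' * 2 ^- j)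
    (fun j => mfun_norm (mT j)).
  have S0 : 0 < Num.sqrt C' by rewrite sqrtr_gt0.
  apply: ae_mono (BC _) _.
    move=> j; have j2 : 0 < 2 ^+ j :> R by rewrite exprn_gt0.
    have l0 : 0 < Num.sqrt C' * 2 ^- j by rewrite mulr_gt0// invr_gt0.
    have := markov_sq l0 (mT j) => /le_trans /(_ (hC _ (hL j)).2).
    have C'E : (0 <= C'%:E)%E by rewrite lee_fin ltW.
    move=> /le_trans /(_ (lee_wpmul2l C'E (hs j))).
    have k0 : 0 < C' * 4 ^- j by rewrite mulr_gt0// invr_gt0 exprn_gt0.
    have -> : (Num.sqrt C' / 2 ^+ j) ^+ 2 = C' * 4 ^- j.
      rewrite exprMn sqr_sqrtr ?ltW// exprVn -exprM mulnC exprM; congr (_ * (_ ^+ _)^-1); ring.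
    rewrite -EFinM -lee_pdivlMl// -EFinM => /le_trans; apply; rewrite lee_fin le_eqVlt.
    apply/orP; left; apply/eqP.
    have -> : 8 ^+ j = 4 ^+ j * 2 ^+ j :> R by rewrite -exprMn; congr (_ ^+ _); ring.
    by field; rewrite !gt_eqF// exprn_gt0.
  move=> x [k hk]; apply/norm_cvg0P.
  have c0 : (fun j => Num.sqrt C' * 2 ^- j) @ \oo --> (0 : R).
    rewrite (_ : (fun j => _) = geometric (Num.sqrt C') 2^-1); last first.
      by apply/funext => j; rewrite /geometric/= exprVn.
    by apply: cvg_geometric; rewrite ger0_norm ?invr_ge0// invf_lt1// ltr1n.
  apply: (squeeze_cvgr _ (cvg_cst 0) c0).
  by exists k => // j /= kj; rewrite normr_ge0 hk.
have h1 := IH h (fun j i im => H j i (leqW im)).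
have h2 : {ae leb, forall x, (fun j => iter_commutator m' b T (b \* h j) x) @ \oo --> (0 : R)}.
  apply: IH => j i im; have := H j i.+1 im.
  have -> : (fun x => b x ^+ i.+1 * h j x) = (fun x => b x ^+ i * (b \* h j) x) => //.
  by apply/funext => x /=; rewrite exprSr mulrA.
apply: (ae_mono2 h1 h2) => x c1 c2.
have : (fun j => b x * iter_commutator m' b T (h j) x - iter_commutator m' b T (b \* h j) x) @ \oo -->
    b x * 0 - 0 by apply: cvgB c2; exact: cvgMr.
by rewrite mulr0 subr0.
Qed.

Lemma trunc_sq f i (e : R) : mfun f -> L2 (fun x => b x ^+ i * f x) -> 0 < e ->
  exists k0, forall k, (k0 <= k)%N ->
    (sqint (fun x => b x ^+ i * (-1 * f x + \1_(trunc f k) x * f x))%R <= e%:E)%E.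
Proof.
move=> mf /L2P[mbf hf] e0.
have [k0 hk] := @tail_int R n (trunc f) _ e (fun k => measurable_trunc k mf) (trunc_all f)
  (mfunX 2 mbf) (fun x => sqr_ge0 _) hf e0.
exists k0 => k /hk; apply: le_trans; apply: leintT => x; first by rewrite lee_fin sqr_ge0.
rewrite lee_fin indicE; case: (_ \in _) => /=; rewrite ?mul1r ?mul0r ?subrr ?subr0 ?mul0r ?mul1r ?mulN1r.
  by rewrite addNr mulr0 expr0n.
by rewrite addr0 mulrN sqrrN.
Qed.

(** The truncations can be chosen to converge fast both in the weighted norm and, after
    multiplication by each b^i with i <= m, in L2. Along them the commutators tend to the extension
    and also to the commutator of [f]. *)
Lemma extend_agree U f : commutator_domain m b f -> Lp_weighted p v f -> approx f (U f) ->
  {ae leb, forall x, extend U f x = Tm f x}.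
Proof.
move=> df Xf au; have mf := weighted_mfun Xf.
have /choice[k hk] : forall j, exists k,
    (pnorm p (EFin \o (((fun x => \1_(trunc f k) x * f x)%R \- f) \* v)%R) <= (4 ^- j)%:E)%E /\
    forall i, (i < m.+1)%N ->
    (sqint (fun x => b x ^+ i * (-1 * f x + \1_(trunc f k) x * f x))%R <= (8 ^- j)%:E)%E.
  move=> j; have j4 : 0 < 4 ^- j :> R by rewrite invr_gt0 exprn_gt0.
  have j8 : 0 < 8 ^- j :> R by rewrite invr_gt0 exprn_gt0.
  have [k0 h0] := trunc_pnorm Xf j4.
  have [k1 h1] := @eventually_all (fun i k =>
      (sqint (fun x => b x ^+ i * (-1 * f x + \1_(trunc f k) x * f x))%R <= (8 ^- j)%:E)%E) m.+1
    (fun i im => trunc_sq mf (df i im) j8).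
  by exists (maxn k0 k1); split; [exact: h0 (leq_maxl _ _)|exact: h1 (leq_maxr _ _)].
pose u j x := \1_(trunc f (k j)) x * f x.
have nu j : nice b (u j) by exact: trunc_nice.
have au' : approx f u.
  by move=> j; split; [exact: nu|exact: trunc_le|exact: (hk j).1].
have c1 : {ae leb, forall x, (fun j => 0 * Tm (u j) x + Tm (U f j) x - Tm (u j) x) @ \oo --> (0 : R)}.
  apply: (@comm_lin_cvg 0 u (U f) u 20) => // [j|j]; first by case: (au j).
  have [m1 l1] := approx_lt j au' mf; have [m2 l2] := approx_lt j au mf.
  have := ltW (pnorm_lin_lt (-1) m1 m2 l1 l2).
  rewrite normrN1 (_ : 5 * (1 + 1) * (2 * 4 ^- j) = 20 * 4 ^- j :> R); last by ring.
  apply: le_trans; apply: (pnorm_le p1) => x /=.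
  by rewrite le_eqVlt; apply/orP; left; apply/eqP; congr (`|_|%:E); ring.
have c2 : {ae leb, forall x, (fun j => Tm (fun y => -1 * f y + u j y) x) @ \oo --> (0 : R)}.
  apply: (@comm_cvg0 m (fun j y => -1 * f y + u j y)) => j i im; split; last exact: (hk j).2.
  have := L2_lin (-1) (df i im) (nice_dom mb (m := m) (nu j) im).
  by congr L2; apply/funext => x; ring.
have e2 : {ae leb, forall x, forall j, Tm (fun y => -1 * f y + u j y) x = -1 * Tm f x + Tm (u j) x}.
  by apply: ae_foralln => j; exact: (comm_lin cz (-1) df (nice_dom mb (m := m) (nu j))).
apply: (ae_mono2 (ae_mono2 c1 c2 (fun x => @conj _ _))
  (ae_mono2 e2 (extend_cvg Xf au) (fun x => @conj _ _))) => x [d1 d2] [e3 d3].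
have d4 : (fun j => Tm (U f j) x - (0 * Tm (u j) x + Tm (U f j) x - Tm (u j) x) -
    Tm (fun y => -1 * f y + u j y) x) @ \oo --> extend U f x - 0 - 0 by apply: cvgB d2; exact: cvgB.
have d5 : (fun j => Tm (U f j) x - (0 * Tm (u j) x + Tm (U f j) x - Tm (u j) x) -
    Tm (fun y => -1 * f y + u j y) x) @ \oo --> Tm f x.
  by apply: cvg_near_cst; apply: nearW => j; rewrite e3; ring.
by have := cvg_unique _ d4 d5; rewrite !subr0; apply.
Qed.

Lemma extend_bounded_weighted : bounded_weighted p v w (commutator_domain m b) Tm.
Proof.
have /choice[U hU] : forall f, exists u, Lp_weighted p v f -> approx f u.
  move=> f; have [Xf|nXf] := pselect (Lp_weighted p v f).
    by have [u hu] := approx_exists Xf; exists u.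
  by exists (fun=> f).
split.
  move=> f Xf; exists (U f); split.
    move=> j; have [nu lu _] := hU f Xf j; split; first exact: nice_dom.
    have mu : mfun (U f j) by case: nu.
    split; first by apply: mfunE; exact: mfunM.
    case: Xf => _; apply: le_lt_trans; apply: (pnorm_le p1) => x /=.
    by rewrite lee_fin !normrM ler_wpM2r.
  have g0 : (fun j => (4 ^- j : R)%:E) @ \oo --> 0%E.
    apply: cvg_EFin; first exact: nearW.
    rewrite (_ : _ \o _ = geometric 1 4^-1); last first.
      by apply/funext => j; rewrite /geometric/= mul1r exprVn.
    by apply: cvg_geometric; rewrite ger0_norm ?invr_ge0// invf_lt1// ltr1n.
  apply: (squeeze_cvge _ (cvg_cst 0%E) g0); apply: nearW => j.
  rewrite (pnorm_ge0 p)/=; by case: (hU f Xf j).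
exists (extend U).
  split=> [a f g Xf Xg|f df Xf].
    by apply: ae_mono (extend_lin a hU Xf Xg) _ => x e _.
  by apply: ae_mono (extend_agree df Xf (hU f Xf)) _ => x e _.
by exists C; [exact: C0|move=> f Xf; exact: (extend_bound Xf (hU f Xf))].
Qed.

End extension.

(** * The theorem *)

Section bilinear.
Context {R : realType} {n : nat}.
Local Notation Rn := (Rn R n.+1).
Local Notation leb := (@lebesgue_Rn R n.+1).
Local Notation N := (n.+1%:R : R).

Lemma Phi_quot_ge0 (Psi : Rn -> R -> R) f Q : (0 <= Phi_norm Psi f / Phi_norm Psi \1_Q)%E.
Proof. by rewrite mule_ge0 ?inve_ge0 ?luxemburg_ge0. Qed.

Lemma Phi_maximal_ge (Psi : Rn -> R -> R) f (a : Rn) (L : R) x : 0 < L -> cube a L x ->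
  (Phi_norm Psi (\1_(cube a L) \* f)%R / Phi_norm Psi \1_(cube a L) <= Phi_maximal Psi f x)%E.
Proof.
by move=> L0 Qx; apply: ereal_sup_ubound; exists (cube a L) => //; split => //; exact: cubes_cube.
Qed.

Lemma Phi_maximal_ge0 (Psi : Rn -> R -> R) f x : (0 <= Phi_maximal Psi f x)%E.
Proof.
apply: le_trans (Phi_maximal_ge Psi f ltr01 (hcube_cube (hcube_corner x ltr01))).
exact: Phi_quot_ge0.
Qed.

Lemma mfun_weightV (v : Rn -> R) : mfun v -> {ae leb, forall x, 0 < v x} ->
  mfun (fun x => (v x)^-1).
Proof.
move=> mv v0; have mv' : mfun (fun x => Num.max (v x) 0).
  by apply: measurable_maxr => //; exact: mfun_cst.
apply: (mfun_ae (mfunV mv' _)) => [x|]; first by rewrite le_max lexx orbT.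
by apply: ae_mono v0 _ => x vx; rewrite max_l// ltW.
Qed.

Context {omega : R -> R} {T : (Rn -> R) -> Rn -> R} {K : Rn -> Rn -> R}.
Hypothesis cz : CZop omega T K.
Context (b : Rn -> R) (m : nat) (phi : set Rn -> R) (C1 : R) (A B D E H J : Rn -> R -> R)
  (v w : Rn -> R) (Sv : R) (pr : Rn -> R) (P : R).
Hypotheses (mb : mfun b) (C10 : 0 < C1) (phi0 : forall a L, 0 < L -> 0 < phi (cube a L))
  (osc : forall (a : Rn) (L : R), 0 < L -> {ae leb, forall x, cube a L x ->
     `|b x - average b (cube a L)| <= C1 * phi (cube a L)})
  (hA : generalized_Phi A) (hB : generalized_Phi B) (hD : generalized_Phi D)
  (hE : generalized_Phi E) (hH : generalized_Phi H) (hJ : generalized_Phi J)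
  (hABD : condition_F A B D) (hEHJ : condition_F E H J)
  (mv : mfun v) (mw : mfun w) (v0 : {ae leb, forall x, 0 < v x})
  (w0 : {ae leb, forall x, 0 < w x}) (Sv0 : 0 < Sv)
  (hvw : forall (a : Rn) (L : R), 0 < L -> ((phi (cube a L) ^+ m)%:E *
     (Phi_norm E (\1_(cube a L) \* w)%R / Phi_norm E \1_(cube a L)) *
     (Phi_norm A (\1_(cube a L) \* (fun x => (v x)^-1))%R / Phi_norm A \1_(cube a L)) <= Sv%:E)%E)
  (pr1 : forall x, 1 <= pr x) (prP : forall x, pr x <= P) (mpr : mfun pr).
Local Notation p := (fun x => (pr x)%:E).
Local Notation q := (fun x => hoelder_conjugate (pr x)%:E).
Hypotheses (hMB : Phi_maximal_bounded B p) (hMH : Phi_maximal_bounded H q).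
Local Notation Tm := (iter_commutator m b T).

(** All the factors in the weight condition are positive, so an infinite norm would make the product
    infinite. *)
Lemma weight_quot (a : Rn) (L : R) : 0 < L -> exists e1 a1 : R,
  [/\ 0 < e1 /\ 0 < a1, phi (cube a L) ^+ m * e1 * a1 <= Sv,
   (0 < Phi_norm E (\1_(cube a L) \* w)%R < +oo)%E /\
   (0 < Phi_norm A (\1_(cube a L) \* (fun x => (v x)^-1))%R < +oo)%E,
   (Phi_norm E (\1_(cube a L) \* w)%R / Phi_norm E \1_(cube a L))%E = e1%:E &
   (Phi_norm A (\1_(cube a L) \* (fun x => (v x)^-1))%R / Phi_norm A \1_(cube a L))%E = a1%:E].
Proof.
move=> L0; have [ea [_ [_ [_ [[ea0 _ _ _] [eaE _ _ _]]]]]] := cube_norms hA hB hD hABD a L0.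
have [ee [_ [_ [_ [[ee0 _ _ _] [eeE _ _ _]]]]]] := cube_norms hE hH hJ hEHJ a L0.
have mQ : measurable (cube a L) by exact: measurable_cube.
have Q0 : (0 < leb (cube a L))%E by rewrite lebesgue_cube ?ltW// lte_fin exprn_gt0.
have := hvw a L0; rewrite eaE eeE !inver !gt_eqF//.
have phm : 0 < phi (cube a L) ^+ m by rewrite exprn_gt0// phi0.
have := @Phi_norm_pos R n E w _ hE mw mQ Q0 (ae_mono w0 (fun x h _ => h)).
have vV : {ae leb, forall x, cube a L x -> 0 < (v x)^-1}.
  by apply: ae_mono v0 _ => x vx _; rewrite invr_gt0.
have := @Phi_norm_pos R n A _ _ hA (mfun_weightV mv v0) mQ Q0 vV.
move: (Phi_norm A _) (Phi_norm E _) => X Y.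
have posV (t : R) : 0 < t -> (0 < t^-1%:E)%E by move=> t0; rewrite lte_fin invr_gt0.
case: X => [X| |]//; case: Y => [Y| |]//; rewrite ?lte_fin => X0 Y0; last 3 first.
- by rewrite (gt0_mulye (posV _ ee0)) gt0_muley ?lte_fin// gt0_mulye ?leye_eq// mule_gt0// posV.
- rewrite (gt0_mulye (posV _ ea0)) gt0_muley ?leye_eq//.
  by rewrite mule_gt0 ?lte_fin// divr_gt0.
- by rewrite (gt0_mulye (posV _ ee0)) (gt0_mulye (posV _ ea0)) gt0_muley ?leye_eq// mule_gt0 ?lte_fin ?ltry.
rewrite -!EFinM lee_fin => hS; exists (Y / ee), (X / ea); split => //.
- by rewrite !divr_gt0.
- by rewrite X0 Y0 !ltry.
Qed.

Lemma weighted_form : exists2 C : R, 0 < C & forall u g,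
  nice b u -> mfun g -> (forall x, 0 <= g x) -> nice b (fun x => g x * `|w x|) ->
  (pnorm p (EFin \o (u \* v)%R) < +oo)%E -> (pnorm q (EFin \o g) < +oo)%E ->
  (\int[leb]_x (`|Tm u x| * (g x * `|w x|))%:E <=
     C%:E * (pnorm p (EFin \o (u \* v)%R) * pnorm q (EFin \o g)))%E.
Proof.
have [CA CA0 hCA] := Phi_holder hA hB hD hABD.
have [CE CE0 hCE] := Phi_holder hE hH hJ hEHJ.
have [KB KB0 hKB] := hMB; have [KH KH0 hKH] := hMH.
have psi0 c s : 0 < s -> 0 < C1 * phi (dil c s).
  by move=> s0; rewrite mulr_gt0// phi0// mulr_gt0// ltr_pwDr// mulr_ge0.
have hbeta c s : 0 < s -> {ae leb, forall x, dil c s x ->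
    `|b x - average b (dil c s)| <= C1 * phi (dil c s)}.
  by move=> s0; apply: osc; rewrite mulr_gt0// ltr_pwDr// mulr_ge0.
have [CF CF0 hCF] := form_bound cz m mb psi0 hbeta.
(* The ratio of the sides of a dilate and of its cube; it enters [kap] twice because both Hoelder
   inequalities are used on the dilate. *)
pose W : R := 4 * N + 1.
have W0 : 0 < W by rewrite /W ltr_pwDr// mulr_ge0.
pose kap := C1 ^+ m * CA * CE * Sv * (W ^+ n.+1 * W ^+ n.+1).
have kap0 : 0 < kap by rewrite /kap !mulr_gt0// exprn_gt0.
exists (CF * kap * (2 * (KB * KH))).
  by apply: mulr_gt0; [exact: mulr_gt0|rewrite !mulr_gt0].
move=> u g nu mg g0 nG fu fg; have mu : mfun u by case: nu.
have muv : mfun (u \* v)%R by exact: mfunM.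
have [[mMB fMB] lMB] := hKB (u \* v)%R (conj (mfunE muv) fu).
have [[mMH fMH] lMH] := hKH g (conj (mfunE mg) fg).
pose Phi x := (Phi_maximal B (u \* v)%R x * Phi_maximal H g x)%E.
have G0 x : 0 <= g x * `|w x| by rewrite mulr_ge0.
have mPhi : measurable_fun [set: Rn] Phi by exact: (emeasurable_funM mMB mMH).
have Phi0 x : (0 <= Phi x)%E by rewrite mule_ge0// Phi_maximal_ge0.
apply: le_trans (hCF u _ Phi kap nu nG G0 mPhi Phi0 kap0 _) _; last first.
  have h := holder_exp pr1 mpr mMB mMH (Phi_maximal_ge0 _ _) (Phi_maximal_ge0 _ _) fMB fMH.
  have k0 : (0 <= (CF * kap)%:E)%E by rewrite lee_fin ltW// mulr_gt0.
  apply: le_trans (lee_wpmul2l k0 h) _.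
  rewrite [leRHS](_ : _ = ((CF * kap)%:E * (2%:E * ((KB%:E * pnorm p (EFin \o (u \* v)%R)) *
    (KH%:E * pnorm q (EFin \o g)))))%E); last first.
    by rewrite muleACA -EFinM (muleA 2%:E) -EFinM (muleA (CF * kap)%:E) -EFinM.
  apply: lee_wpmul2l => //; apply: lee_wpmul2l => //.
  by apply: lee_pmul => //; exact: luxemburg_ge0.
move=> c s x s0 xQ; have L0 : 0 < W * s by rewrite mulr_gt0.
have QD : hcube c s `<=` dil c s.
  move=> y hy; apply/dilP => i; have /andP[] := hy i.
  have : 0 < N * s by rewrite mulr_gt0.
  by move=> ? ? ?; apply/andP; split; lra.
have xD := QD _ xQ.
set Q := dil c s in xD *.
have [e1 [a1 [[e10 a10] ea1 [eY aY] eE aE]]] := weight_quot (c - const_mx (2 * N * s)) L0.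
(* The inequality for (A, B, D) separates v^-1 from u v, and that for (E, H, J), in [X2], separates
   w from g. The factors of v^-1 and w are those of the weight condition, the others lie below the
   maximal functions at [x]. *)
have X1 : (\int[leb]_(y in Q) `|u y|%:E <= (CA * (W * s) ^+ n.+1 * a1)%:E * Phi_maximal B (u \* v)%R x)%E.
  apply: (@le_trans _ _ (\int[leb]_(y in Q) `|(v y)^-1 * (u \* v)%R y|%:E)%E).
    rewrite (int1 Q) (int1 Q); apply: ae_le_int => [y|y|].
    - by rewrite lee_fin mulr_ge0// indicE.
    - by rewrite lee_fin mulr_ge0// indicE.
    by apply: ae_mono v0 _ => y vy; rewrite /= mulrCA mulVf ?mulr1// gt_eqF.
  apply: le_trans (hCA _ _ _ _ L0 (mfun_weightV mv v0) muv aY) _; rewrite aE.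
  rewrite muleA -EFinM; apply: lee_wpmul2l; last exact: Phi_maximal_ge.
  by rewrite lee_fin !mulr_ge0 ?exprn_ge0 ?ltW.
have X2 : (\int[leb]_(y in hcube c s) (g y * `|w y|)%:E <=
    (CE * (W * s) ^+ n.+1 * e1)%:E * Phi_maximal H g x)%E.
  apply: (@le_trans _ _ (\int[leb]_(y in Q) `|w y * g y|%:E)%E).
    apply: (@le_trans _ _ (\int[leb]_(y in Q) (g y * `|w y|)%:E)%E).
      by apply: leintS => // y _; rewrite lee_fin.
    apply: leint => y _; first by rewrite lee_fin.
    by rewrite lee_fin normrM mulrC (ger0_norm (g0 y)).
  apply: le_trans (hCE _ _ _ _ L0 mw mg eY) _; rewrite eE.
  rewrite muleA -EFinM; apply: lee_wpmul2l; last exact: Phi_maximal_ge.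
  by rewrite lee_fin !mulr_ge0 ?exprn_ge0 ?ltW.
have psm : (0 <= ((C1 * phi Q) ^+ m)%:E)%E by rewrite lee_fin exprn_ge0// ltW// psi0.
have i1 : (0 <= \int[leb]_(y in Q) `|u y|%:E)%E by apply: integral_ge0 => y _; rewrite lee_fin.
have i2 : (0 <= \int[leb]_(y in hcube c s) (g y * `|w y|)%:E)%E.
  by apply: integral_ge0 => y _; rewrite lee_fin.
apply: le_trans (lee_pmul (mule_ge0 psm i1) i2 (lee_wpmul2l psm X1) X2) _.
rewrite (muleA ((C1 * phi Q) ^+ m)%:E) -EFinM muleACA -EFinM; apply: lee_wpmul2r; first exact: Phi0.
rewrite lee_fin exprMn.
rewrite (_ : C1 ^+ m * phi Q ^+ m * (CA * (W * s) ^+ n.+1 * a1) * (CE * (W * s) ^+ n.+1 * e1) =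
  (C1 ^+ m * CA * CE * ((W * s) ^+ n.+1 * (W * s) ^+ n.+1)) * (phi Q ^+ m * e1 * a1)); last by ring.
rewrite (_ : kap * s ^+ n.+1 * s ^+ n.+1 =
  (C1 ^+ m * CA * CE * ((W * s) ^+ n.+1 * (W * s) ^+ n.+1)) * Sv); last by rewrite /kap !exprMn; ring.
apply: ler_wpM2l; last exact: ea1.
by rewrite !mulr_ge0 ?exprn_ge0 ?ltW.
Qed.

Lemma weighted_nice_bound : exists2 C : R, 0 < C & forall u, nice b u ->
  (pnorm p (EFin \o (u \* v)%R) < +oo)%E ->
  (pnorm p (EFin \o (Tm u \* w)%R) <= C%:E * pnorm p (EFin \o (u \* v)%R))%E.
Proof.
have [C C0 hC] := weighted_form; exists C => // u nu fu.
have p1 x : (1 <= p x)%E by rewrite lee_fin.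
have mT : mfun (Tm u) by exact: (comm_mfun cz mb (nice_dom mb (m := m) nu)).
have [s sE] : exists s : R, pnorm p (EFin \o (u \* v)%R) = s%:E.
  by exists (fine (pnorm p (EFin \o (u \* v)%R))); rewrite fineK// ge0_fin_numE// luxemburg_ge0.
have s0 : 0 <= s by rewrite -lee_fin -sE luxemburg_ge0.
pose F x := `|Tm u x * w x|.
have mF : mfun F by apply: mfun_norm; exact: mfunM.
(* Besides F, the sets bound [w] and [b], so that g |w| is [nice] for every bounded test function g
   supported there. *)
pose Dk k := window k `&` [set x | F x <= k%:R] `&` [set x | `|w x| <= k%:R] `&` [set x | `|b x| <= k%:R].
apply: (@le_trans _ _ (pnorm p (EFin \o F))).
  by apply: (pnorm_le p1) => x /=; rewrite /F normr_id.
rewrite sE -EFinM; apply: (dual_exp pr1 prP mpr (D := Dk)) => //.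
- by move=> x; exact: normr_ge0.
- by rewrite mulr_ge0// ltW.
- move=> k; rewrite /Dk; apply: measurableI; last by apply: le_set_nat; exact: mfun_norm.
  apply: measurableI; last by apply: le_set_nat; exact: mfun_norm.
  by apply: measurableI; [exact: measurable_hcube|exact: le_set_nat].
- move=> j k jk x [[[h1 h2] h3] h4].
  have jk' : j%:R <= k%:R :> R by rewrite ler_nat.
  by split; [split; [split|]|]; [exact: windowS h1|exact: le_trans h2 jk'|exact: le_trans h3 jk'|
    exact: le_trans h4 jk'].
- move=> x; have [k0 h0] := window_all x; have [k1 h1] := le_nat_all (normr_ge0 (Tm u x * w x)).
  have [k2 h2] := le_nat_all (normr_ge0 (w x)); have [k3 h3] := le_nat_all (normr_ge0 (b x)).
  exists (maxn (maxn k0 k1) (maxn k2 k3)).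
  by split; [split; [split|]|]; [apply: h0|apply: h1|apply: h2|apply: h3];
    rewrite !leq_max leqnn ?orbT.
- by move=> k x [[[_ h] _] _].
- move=> k; exists (- const_mx k.+1%:R), (2 * k.+1%:R); split.
    have : 1 <= k.+1%:R :> R by rewrite ler1n.
    by lra.
  by move=> x [[[h _] _] _]; exact: (windowS (leqnSn k)).
move=> k g mg g0 [M gM] gD fg.
have nG : nice b (fun x => g x * `|w x|).
  split; first by apply: mfunM => //; exact: mfun_norm.
  exists (Num.max k%:R (M * k%:R)), (- const_mx k%:R), (2 * k%:R); split => x.
  - have [Dx|nDx] := pselect (Dk k x); last by rewrite gD// mul0r normr0 le_max ler0n.
    rewrite normrM normr_id (ger0_norm (g0 x)) le_max; apply/orP; right.
    by apply: ler_pM => //; case: Dx => [[]].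
  - by move=> nx; rewrite gD ?mul0r// => -[[[h _] _] _]; apply: nx.
  - move=> hb; rewrite gD ?mul0r// => -[_ /= h].
    by move: hb; rewrite ltNge le_max h.
have := hC u g nu mg g0 nG fu fg; rewrite sE muleA -EFinM; apply: le_trans.
rewrite le_eqVlt; apply/orP; left; apply/eqP; apply: eq_integral => x _.
by rewrite /F normrM mulrAC mulrA.
Qed.

End bilinear.

Section symbol_exponent.
Context {R : realType} {n : nat}.
Local Notation Rn := (Rn R n.+1).
Local Notation leb := (@lebesgue_Rn R n.+1).
Local Notation N := (n.+1%:R : R).

Lemma exponent_inv (x : \bar R) : (1 <= x)%E -> 0 <= fine x^-1%E <= 1.
Proof.
case: x => [t|_|]; [|by rewrite invey/= lexx ler01|by []].
rewrite lee_fin => t1; have t0 : 0 < t by exact: lt_le_trans t1.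
by rewrite inver gt_eqF//= invr_ge0 ltW//= invf_le1.
Qed.

Lemma exponent_inv_le (x : \bar R) (t : R) : 0 < t -> (t%:E <= x)%E -> fine x^-1%E <= t^-1.
Proof.
case: x => [s| |] t0 ts; [|by rewrite invey/= invr_ge0 ltW|by []].
rewrite lee_fin in ts; have s0 : 0 < s by exact: lt_le_trans ts.
by rewrite inver gt_eqF//= lef_pV2.
Qed.

Lemma ae_exists (P : Rn -> Prop) (c : Rn) : {ae leb, forall x, P x} -> exists2 x, hcube c 1 x & P x.
Proof.
move=> aeP; have V := lebesgue_hcube c (@ler01 R).
have [||x [xc _ _ Px]] := @exists_good R n (hcube c 1) set0 set0 P _ (exprn_gt0 n.+1 ltr01) V _ _ aeP.
- by rewrite setI0 measure0 lee_fin divr_ge0// exprn_ge0.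
- by rewrite measure0 lee_fin divr_ge0// exprn_ge0.
by exists x.
Qed.

(** [s] tends to [si] at infinity and is at least [e0] almost everywhere, in particular at some
    point far enough out for |s x - si| to be below [e0]. *)
Lemma log_exponent_lower (s : Rn -> R) (C0 si e0 : R) : 0 < C0 -> 0 < e0 ->
  (forall x, `|s x - si| <= C0 / ln (expR 1 + enorm x)) -> {ae leb, forall x, e0 <= s x} -> 0 < si.
Proof.
move=> C00 e00 s4 ae0; rewrite ltNge; apply/negP => si0.
pose M := expR (C0 / e0).
have [x xc hx] := ae_exists (const_mx M) ae0.
have /andP[h _] := xc ord0; rewrite !mxE in h.
have Mx : M <= enorm x by apply: le_trans (enorm_ge x ord0); exact: le_trans h (ler_norm _).
have big : C0 / e0 < ln (expR 1 + enorm x).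
  rewrite -[ltLHS]expRK ltr_ln ?posrE ?expR_gt0//; last by rewrite ltr_wpDr ?expR_gt0// enorm_ge0.
  by apply: (le_lt_trans Mx); rewrite ltrDr expR_gt0.
have p0 : 0 < C0 / e0 by exact: divr_gt0.
have l0 := lt_trans p0 big.
have := le_trans (ler_norm _) (s4 x); rewrite ler_pdivlMr// => h1.
have h2 : e0 * ln (expR 1 + enorm x) <= (s x - si) * ln (expR 1 + enorm x).
  by apply: ler_wpM2r; [exact: ltW|lra].
move: big; rewrite ltr_pdivrMr// => big; lra.
Qed.

Lemma mfun_exponent_inv (r : Rn -> \bar R) : measurable_fun [set: Rn] r ->
  (forall x, (1 <= r x)%E) -> mfun (fun x => fine (r x)^-1%E).
Proof.
move=> mr r1; have mf : mfun (fun x => fine (r x)).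
  exact: (measurableT_comp (fine_measurable measurableT) mr).
have f0 x : 0 <= fine (r x) by apply: fine_ge0; exact: le_trans (r1 x).
rewrite (_ : (fun x => _) = (fun x => if r x == +oo%E then 0 else (fine (r x))^-1)).
  apply: measurable_fun_ifT; [|exact: mfun_cst|exact: mfunV].
  by apply: measurable_fun_eqe => //; exact: measurable_cst.
apply/funext => x; move: (r1 x); case: (r x) => [t|_|]; [|by rewrite invey eqxx|by []].
by rewrite lee_fin => t1; rewrite inver gt_eqF// (lt_le_trans ltr01).
Qed.

Lemma sup_real (S : set (\bar R)) : (ereal_sup S < +oo)%E ->
  exists2 M : R, 0 < M & forall y, S y -> (y <= M%:E)%E.
Proof.
move=> h; have [M M0 hM] : exists2 M : R, 0 < M & (ereal_sup S <= M%:E)%E.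
  case: (ereal_sup S) h => [t _| |_]; [|by []|by exists 1; rewrite ?leNye].
  exists (Num.max 1 t); first by rewrite lt_max ltr01.
  by rewrite lee_fin le_max lexx orbT.
by exists M => // y Sy; apply: le_trans hM; exact: ereal_sup_ubound.
Qed.

End symbol_exponent.

Section exponent_transfer.
Context {R : realType} {n : nat}.
Local Notation Rn := (Rn R n.+1).
Local Notation leb := (@lebesgue_Rn R n.+1).

Lemma pnorm_ae (p q : Rn -> \bar R) : {ae leb, forall x, p x = q x} -> pnorm p = pnorm q.
Proof.
move=> pq; apply/funext => f; congr ereal_inf; congr image; apply/seteqP.
have e (l : R) : (\int[leb]_x phi_exponent (p x) (`|f x| * l^-1%:E) =
    \int[leb]_x phi_exponent (q x) (`|f x| * l^-1%:E))%E.
  apply: ae_eq_int => [x|x|]; try exact: phi_exp_ge0.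
  by apply: ae_mono pq _ => x ->.
by split => l /=; rewrite e.
Qed.

Lemma bounded_weighted_ae (p q : Rn -> \bar R) v w dom U : {ae leb, forall x, p x = q x} ->
  bounded_weighted p v w dom U -> bounded_weighted q v w dom U.
Proof. by move=> /pnorm_ae pq; rewrite /bounded_weighted /Lp_weighted /Lp pq. Qed.

Lemma Phi_maximal_bounded_ae Psi (p q : Rn -> \bar R) : {ae leb, forall x, p x = q x} ->
  Phi_maximal_bounded Psi p -> Phi_maximal_bounded Psi q.
Proof. by move=> /pnorm_ae pq; rewrite /Phi_maximal_bounded /Lp pq. Qed.

(** The Hoelder inequality for (E, H, J) with the constant 1 as first function shows that
    [Phi_maximal H] dominates averages, which is what [conj_bound] asks of a maximal operator. *)
Lemma maximal_exponent_bound (p : Rn -> \bar R) (E H J : Rn -> R -> R) : exponent p ->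
  generalized_Phi E -> generalized_Phi H -> generalized_Phi J -> condition_F E H J ->
  Phi_maximal_bounded H (fun x => hoelder_conjugate (p x)) ->
  exists P : R, {ae leb, forall x, (p x <= P%:E)%E}.
Proof.
move=> [mp p1] hE hH hJ hF [K K0 hK].
have [C C0 hC] := Phi_holder hE hH hJ hF.
apply: (@conj_bound R n (fun x => hoelder_conjugate (p x)) (Phi_maximal H) C K) => //.
- by move=> x; exact: conj_ge1.
- by move=> f mf nf; have [] := hK f (conj (mfunE mf) nf).
move=> f a l x mf f0 l0 xQ.
have [e1 [_ [_ [_ [[e10 _ _ _] [eE _ _ _]]]]]] := cube_norms hE hH hJ hF a l0.
have oneE : (\1_(cube a l) \* (fun=> 1))%R = \1_(cube a l) :> (Rn -> R).
  by apply/funext => y /=; rewrite mulr1.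
have h := hC a l (fun=> 1) f l0 (mfun_cst 1) mf; rewrite oneE eE in h.
rewrite lte_fin e10 ltry inver gt_eqF// -EFinM mulfV ?gt_eqF// mul1e in h.
apply: (@le_trans _ _ (\int[leb]_(y in cube a l) `|1 * f y|%:E)%E).
  apply: (@le_trans _ _ (\int[leb]_(y in cube a l) (f y)%:E)%E).
    by apply: leintS => [|y _]; [exact: hcube_cube|rewrite lee_fin].
  by apply: leint => y _; rewrite lee_fin// mul1r ler_norm.
apply: (le_trans (h isT)); apply: lee_wpmul2l.
  by rewrite lee_fin mulr_ge0 ?exprn_ge0 ?ltW.
by apply: Phi_maximal_ge => //; exact: hcube_cube.
Qed.

End exponent_transfer.

Theorem theorem1p3 (R : realType) (n : nat)
  (omega : R -> R) (T : (Rn R n -> R) -> Rn R n -> R)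
  (homega : modulus_of_continuity omega) (hdini : dini omega)
  (hT : CZ_operator omega T)
  (p : Rn R n -> \bar R) (hp : exponent p) (m : nat)
  (alpha : R) (halpha0 : 0 < alpha) (halphan : alpha < n%:R)
  (r : Rn R n -> \bar R) (rinf : R) (hr : log_exponent r rinf)
  (hralpha : ((n%:R / alpha)%:E < ess_inf (@lebesgue_Rn R n) r)%E)
  (hrinf : forall x, (rinf%:E <= r x)%E)
  (delta : Rn R n -> R)
  (hdelta : forall x, delta x / n%:R = alpha / n%:R - fine (r x)^-1%E)
  (b : Rn R n -> R)
  (hb : symbol_class (fun x => (n%:R%:E / (delta x)%:E)%E) b)
  (A B D E H J : Rn R n -> R -> R)
  (hA : generalized_Phi A) (hB : generalized_Phi B) (hD : generalized_Phi D)
  (hE : generalized_Phi E) (hH : generalized_Phi H) (hJ : generalized_Phi J)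
  (hABD : condition_F A B D) (hEHJ : condition_F E H J)
  (hMB : Phi_maximal_bounded B p)
  (hMH : Phi_maximal_bounded H (fun x => hoelder_conjugate (p x)))
  (v w : Rn R n -> R) (hv : weight v) (hw : weight w) (hvloc : Lp_loc p v)
  (hvw : (ereal_sup
     [set pnorm (fun x => n%:R%:E / (delta x)%:E) (EFin \o \1_Q) ^+ m
          * (Phi_norm E (\1_Q \* w)%R / Phi_norm E \1_Q)
          * (Phi_norm A (\1_Q \* (fun x => (v x)^-1))%R / Phi_norm A \1_Q)
     | Q in @cubes R n] < +oo)%E) :
  bounded_weighted p v w (commutator_domain m b) (iter_commutator m b T).
Proof.
case: n T hT p hp r hr hralpha hrinf delta hdelta b hb A B D E H J hA hB hD hE hH hJ
  hABD hEHJ hMB hMH v w hv hw hvloc hvw halphan => [|n] T hT p hp r hr hralpha hrinf delta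
  hdelta b hb A B D E H J hA hB hD hE hH hJ hABD hEHJ hMB hMH v w hv hw hvloc hvw halphan.
  by have := lt_trans halpha0 halphan; rewrite ltxx.
set N : R := n.+1%:R in halphan hralpha hdelta hb hvw.
have N0 : 0 < N by rewrite ltr0n.
have [K cz] := CZ_operatorP homega hdini hT.
have [[mr r1] rinf0 [C0 C00 [hr3 hr4]]] := hr.
(* [s] is delta / n, the reciprocal of the exponent of the symbol class. Up to sign and a constant
   it is 1 / r, so it inherits the log-Hoelder bounds, with limit [si]. *)
pose s x := alpha / N - fine (r x)^-1%E.
pose si := alpha / N - rinf^-1.
have s3 x y : `|s x - s y| <= C0 / ln (expR 1 + (enorm (x - y))^-1).
  by apply: le_trans (hr3 x y); rewrite /s opprB addrC subrKA distrC.
have s4 x : `|s x - si| <= C0 / ln (expR 1 + enorm x).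
  by apply: le_trans (hr4 x); rewrite /s /si opprB addrC subrKA distrC.
(* The hypothesis r_inf <= r enters here: it makes the limit of [s] a lower bound. *)
have s1 x : si <= s x <= 1.
  have := exponent_inv_le rinf0 (hrinf x); have /andP[] := exponent_inv (r1 x).
  have : alpha / N <= 1 by rewrite ler_pdivrMr// mul1r ltW.
  rewrite /s /si; move: (alpha / N) rinf^-1 (fine (r x)^-1%E) => t1 t2 t3 ? ? ? ?.
  by apply/andP; split; lra.
(* The strict inequality n / alpha < r^- keeps [s] above a positive constant almost everywhere, and
   hence its limit positive. *)
have si0 : 0 < si.
  have [t ta ht] : exists2 t : R, N / alpha < t &
      {ae @lebesgue_Rn R n.+1, forall x, (t%:E <= r x)%E}.
    have hle := ess_inf_le (@lebesgue_Rn R n.+1) r.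
    case: (ess_inf _ r) hralpha hle => [t| |]//.
      by rewrite lte_fin => ta hle; exists t.
    move=> _ hle; exists (N / alpha + 1); first by rewrite ltrDl.
    by apply: ae_mono hle _ => x; exact: le_trans (leey _).
  have Na : 0 < N / alpha by rewrite divr_gt0.
  have t0 := lt_trans Na ta.
  apply: (log_exponent_lower C00 (_ : 0 < alpha / N - t^-1) s4).
    by rewrite subr_gt0 -[ltRHS]invrK invf_div ltf_pV2.
  by apply: ae_mono ht _ => x /(exponent_inv_le t0) hx; rewrite /s lerD2l lerN2.
have s0 x : 0 < s x by case/andP: (s1 x) => + _; exact: lt_le_trans.
have ms : mfun s by apply: mfunB; [exact: mfun_cst|exact: mfun_exponent_inv].
pose q (x : Rn R n.+1) := (N%:E / (delta x)%:E)%E.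
have hq x : q x = ((s x)^-1)%:E.
  have dE : delta x = N * s x by rewrite /s -hdelta mulrCA mulfV ?mulr1// gt_eqF.
  rewrite /q dE inver gt_eqF ?mulr_gt0// -EFinM invfM mulrA mulfV ?mul1r//.
  by rewrite gt_eqF.
have phiE a L (L0 : 0 < L) := pnorm_phi si0 s1 hq a L0.
have phi0 a L (L0 : 0 < L) : 0 < phi q (cube a L) by case: (phiE a L L0).
have phid := phi_decay C00 si0 s1 s3 s4 ms hq.
have [bloc hsup] := hb; have [M M0 hM] := sup_real hsup.
have bM a L : 0 < L -> (\int[@lebesgue_Rn R n.+1]_(x in cube a L)
    `|b x - average b (cube a L)|%:E <= (M * phi q (cube a L) * L ^+ n.+1)%:E)%E.
  move=> L0; have [pE p0] := phiE a L L0.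
  have := hM _ (ex_intro2 _ _ (cube a L) (cubes_cube a L0) erefl).
  rewrite [pnorm _ _]pE.
  rewrite (lebesgue_cube a (ltW L0)) -EFinM inver gt_eqF ?mulr_gt0 ?exprn_gt0//.
  by rewrite lee_pdivrMl ?mulr_gt0 ?exprn_gt0// -EFinM mulrC mulrA.
have [C1 C10 hosc] := osc_pt phi0 phid bloc (ltW M0) bM.
have [P0 hP0] := maximal_exponent_bound hp hE hH hJ hEHJ hMH.
have [mp p1] := hp.
(* Capping p at [P] changes it only on a null set and makes it real valued; the maximum with 1 keeps
   the capped exponent at least 1. *)
pose P := Num.max 1 P0.
pose pr x := fine (mine (p x) P%:E).
have prE x : (pr x)%:E = mine (p x) P%:E.
  rewrite /pr fineK//; move: (p1 x); case: (p x) => [t _|_|]; [|by rewrite min_r ?leey|by []].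
  by rewrite -EFin_min.
have pr1 x : 1 <= pr x by rewrite -lee_fin prE le_min p1 lee_fin le_max lexx.
have prP x : pr x <= P by rewrite -lee_fin prE ge_min lexx orbT.
have mpr : mfun pr.
  apply: (measurableT_comp (fine_measurable measurableT)).
  by apply: measurable_mine => //; exact: measurable_cst.
have pE : {ae @lebesgue_Rn R n.+1, forall x, p x = (pr x)%:E}.
  apply: ae_mono hP0 _ => x hx; rewrite prE min_l//; apply: (le_trans hx).
  by rewrite lee_fin le_max lexx orbT.
have qE : {ae @lebesgue_Rn R n.+1, forall x, hoelder_conjugate (p x) = hoelder_conjugate (pr x)%:E}.
  by apply: ae_mono pE _ => x ->.
have [[vloc v0] [wloc w0]] := (hv, hw).
have [Sv Sv0 hSv] := sup_real hvw.
have hvw' a L : 0 < L -> ((phi q (cube a L) ^+ m)%:E *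
     (Phi_norm E (\1_(cube a L) \* w)%R / Phi_norm E \1_(cube a L)) *
     (Phi_norm A (\1_(cube a L) \* (fun x => (v x)^-1))%R / Phi_norm A \1_(cube a L)) <= Sv%:E)%E.
  move=> L0; have [pE' _] := phiE a L L0.
  have := hSv _ (ex_intro2 _ _ (cube a L) (cubes_cube a L0) erefl).
  by rewrite -/q pE' -EFin_expe.
have mb := loc_int_mfun bloc; have mv := loc_int_mfun vloc; have mw := loc_int_mfun wloc.
have [C CC0 bnd] := weighted_nice_bound cz mb C10 phi0 hosc hA hB hD hE hH hJ hABD hEHJ mv mw v0 w0
  Sv0 hvw' pr1 prP mpr (Phi_maximal_bounded_ae pE hMB) (Phi_maximal_bounded_ae qE hMH).
apply: (bounded_weighted_ae (ae_mono pE (fun x e => esym e))).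
exact: (extend_bounded_weighted cz mb pr1 prP mpr mv mw v0 w0 CC0 bnd).
Qed.
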